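(* Let $L$ be a homogeneous Lévy basis on $\mathbb{R}^2$ with characteristic triplet $(\gamma,b,\nu)$ and seed $L'$, and let $X$ be the trawl process with trawl function $a$. Assume that $\mathbb E(|L'|)<\infty$ and that there is a strictly positive continuous function $a'\in\mathrm{RV}^\infty_\kappa$, with $2<\kappa<3$, such that $a(s)=\int_s^\infty a'(y)\,\mathrm{d}y$ for all $s\ge0$. Suppose that $b>0$, $\mathbb E(|L'|^2)<\infty$, and that, as $n\uparrow\infty$, $\Delta_n\downarrow0$ and $n\Delta_n\to\mu=+\infty$. Put $$\mathcal G^X=\sigma\Big(\bigcup_{k\ge1}\bigcap_{N\ge k}\sigma(X_0,X_{\Delta_N},\ldots,X_{k\Delta_N})\Big).$$ Then, as $n\uparrow\infty$, $$\frac{1}{n\sqrt{a(n\Delta_n)\,n\Delta_n}}\,\mathbf S^n\ \overset{\mathcal G^X\text{-}\mathcal D[0,1]}{\Longrightarrow}\ \sigma_\kappa B^H,$$ where $\sigma_\kappa^2=\dfrac{b^2}{(\kappa-2)(3-\kappa)(4-\kappa)}$ and $B^H$ is a fractional Brownian motion of index $H=2-\frac{\kappa}{2}>\frac12$.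
   Context: $(\Omega,\mathcal F,\mathbb P)$ is a complete probability space; $[\cdot]$ denotes the integer part; $\mathbb{R}^+=[0,\infty)$. A function $g:\mathbb R^+\to\mathbb R^+$ is in $\mathrm{RV}^\infty_\alpha$ (regularly varying at $\infty$ with index $\alpha$, in this sign convention) if $g(tx)/g(t)\to x^{-\alpha}$ as $t\to\infty$ for every $x>0$. Lévy basis. A homogeneous Lévy basis on $\mathbb{R}^2$ with characteristic triplet $(\gamma,b,\nu)$ ($\gamma\in\mathbb R$, $b\ge0$, $\nu$ a Lévy measure on $\mathbb R$) is a family $L=\{L(A)\}$ of real random variables, indexed by Borel sets $A\subset\mathbb{R}^2$ of finite Lebesgue measure, that is a.s. $\sigma$-additive, takes independent infinitely divisible values on disjoint sets, and satisfies $\log\mathbb{E}e^{izL(A)}=\mathrm{Leb}(A)\psi(z)$ with $\psi(z)=i\gamma z-\frac12b^2z^2+\int_{\mathbb{R}\setminus\{0\}}(e^{izx}-1-izx\mathbf 1_{|x|\le1})\nu(\mathrm{d}x)$. The seed $L'$ is a random variable with $\log\mathbb{E}e^{izL'}=\psi(z)$. Trawl process. The trawl function $a:\mathbb{R}^+\to\mathbb{R}^+$ is non-increasing, integrable and continuous on $[0,\infty)$; $A=\{(r,y):r\le0,\ 0\le y\le a(-r)\}$, $A_t=A+(t,0)$, and $X_t=L(A_t)$, $t\in\mathbb R$. Write $\mathbf S^n=(\mathbf S^n_t)_{t\ge0}$ with $\mathbf S^n_t=\sum_{k=0}^{[nt]-1}\big(X_{k\Delta_n}-\mathbb{E}(X_{k\Delta_n})\big)$.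 Stable convergence. For a sub-$\sigma$-field $\mathcal G\subseteq\mathcal F$, random vectors $\xi_n$ converge $\mathcal G$-stably in distribution to $\xi$ if, conditioned on any non-null event in $\mathcal G$, $\xi_n$ converges in distribution to $\xi$. For processes, $X^n\overset{\mathcal G\text{-}\mathcal D[0,T]}{\Longrightarrow}X$ means that $X^n$ converges to $X$ in the Skorokhod topology on $[0,T]$ and that the finite-dimensional distributions of $X^n$ converge $\mathcal G$-stably to those of $X$.
   Formalization: The fractional Brownian motion B^H is normalized with covariance s^{2H}+t^{2H}-|t-s|^{2H} (variance 2 at time 1); with the usual variance 1, the printed constant sigma_kappa^2 would be too small by a factor 2. *)

(* Defs.v *)
From HB Require Import structures.
From mathcomp Require Import all_boot all_order all_algebra.
From mathcomp Require Import all_classical all_reals all_analysis.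
From mathcomp.real_closed Require Import complex.

Set Implicit Arguments.
Unset Strict Implicit.
Unset Printing Implicit Defensive.

Import Order.TTheory GRing.Theory Num.Theory.
Import numFieldNormedType.Exports.

Local Open Scope classical_set_scope.
Local Open Scope ring_scope.

Section ComplexIntegral.
Context {R : realType}.

Definition cexp (z : R[i]) : R[i] :=
  Complex (expR (complex.Re z) * cos (complex.Im z))
          (expR (complex.Re z) * sin (complex.Im z)).

Definition cintegral d (T : measurableType d) (mu : {measure set T -> \bar R})
    (D : set T) (f : T -> R[i]) : R[i] :=
  Complex (\int[mu]_(x in D) complex.Re (f x))
          (\int[mu]_(x in D) complex.Im (f x)).

Definition char_fun d (Omega : measurableType d) (P : probability Omega R)
    (Y : Omega -> R) (z : R) : R[i] :=
  cintegral P setT (fun w => cexp (Complex 0 (z * Y w))).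

End ComplexIntegral.

Section LevyBasis.
Context {R : realType}.

Definition levy_measure (nu : {measure set (measurableTypeR R) -> \bar R}) :=
  nu [set 0] = 0%E /\ (\int[nu]_x (Num.min 1 (x ^+ 2))%:E < +oo)%E.

Definition levy_exponent (gamma b : R)
    (nu : {measure set (measurableTypeR R) -> \bar R}) (z : R) : R[i] :=
  Complex (- (b ^+ 2 * z ^+ 2) / 2) (gamma * z)
  + cintegral nu [set x | x != 0]
      (fun x => cexp (Complex 0 (z * x)) - 1
                - Complex 0 (z * x * \1_`[-1, 1]%classic x)).

(* The n-th convolution power of rho. *)
Fixpoint conv_pow (rho : probability (measurableTypeR R) R) (n : nat)
    (A : set R) : \bar R :=
  if n is m.+1 then (\int[rho]_x conv_pow rho m [set y | A (x + y)%R])%E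
  else \d_(0 : R) A.

Definition infinitely_divisible d (Omega : measurableType d)
    (P : probability Omega R) (Y : Omega -> R) :=
  forall n, (0 < n)%N -> exists rho : probability (measurableTypeR R) R,
    forall A : set (measurableTypeR R), measurable A ->
      P (Y @^-1` A) = conv_pow rho n A.

Definition independent_family d (Omega : measurableType d)
    (P : probability Omega R) (m : nat) (Y : 'I_m -> Omega -> R) :=
  forall C : 'I_m -> set (measurableTypeR R), (forall i, measurable (C i)) ->
    P (\bigcap_i (Y i @^-1` C i)) = (\prod_(i < m) P (Y i @^-1` C i))%E.

Definition leb2 : {measure set (measurableTypeR R * measurableTypeR R)
                     -> \bar R} :=
  (@lebesgue_measure R \x @lebesgue_measure R)%E.

Definition finite_borel2 (A : set (measurableTypeR R * measurableTypeR R)) :=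
  measurable A /\ (leb2 A < +oo)%E.

(* [L A] is unconstrained when [A] is not a Borel set of finite area.  In
   [lb_char] the logarithm of the characteristic function is the continuous
   one vanishing at z = 0; since the exponent is continuous in z and vanishes
   at 0, this amounts to the exponentiated identity. *)
Record levy_basis d (Omega : measurableType d) (P : probability Omega R)
    (gamma b : R) (nu : {measure set (measurableTypeR R) -> \bar R})
    (L : set (measurableTypeR R * measurableTypeR R) -> Omega -> R) : Prop := {
  lb_gauss_ge0 : 0 <= b ;
  lb_levy_measure : levy_measure nu ;
  lb_measurable : forall A, finite_borel2 A ->
    measurable_fun setT (L A : Omega -> measurableTypeR R) ;
  lb_sigma_additive :
    forall F : nat -> set (measurableTypeR R * measurableTypeR R),
    (forall n, measurable (F n)) -> trivIset setT F ->
    (leb2 (\bigcup_n F n) < +oo)%E ->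
    {ae P, forall w,
      (\sum_(0 <= k < n) L (F k) w) @[n --> \oo] --> L (\bigcup_n F n) w} ;
  lb_independent :
    forall m (F : 'I_m -> set (measurableTypeR R * measurableTypeR R)),
    (forall i, finite_borel2 (F i)) -> trivIset setT F ->
    independent_family P (fun i => L (F i)) ;
  lb_infinitely_divisible : forall A, finite_borel2 A ->
    infinitely_divisible P (L A) ;
  lb_char : forall A, finite_borel2 A -> forall z,
    char_fun P (L A) z
    = cexp (Complex (fine (leb2 A)) 0 * levy_exponent gamma b nu z) }.

Definition levy_seed d (Omega : measurableType d) (P : probability Omega R)
    (gamma b : R) (nu : {measure set (measurableTypeR R) -> \bar R})
    (L' : {RV P >-> measurableTypeR R}) :=
  forall z, char_fun P L' z = cexp (levy_exponent gamma b nu z).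

End LevyBasis.

Section Trawl.
Context {R : realType}.

Definition regularly_varying (alpha : R) (g : R -> R) :=
  forall x, 0 < x -> (g (t * x) / g t) @[t --> +oo] --> x `^ (- alpha).

(* Only the values of [a] on [0, +oo) matter. *)
Record trawl_function (a : R -> R) : Prop := {
  trawl_ge0 : forall s, 0 <= s -> 0 <= a s ;
  trawl_nonincreasing : forall s t, 0 <= s -> s <= t -> a t <= a s ;
  trawl_integrable :
    (@lebesgue_measure R).-integrable `[0, +oo[ (fun s => (a s)%:E) ;
  trawl_continuous : {within `[0, +oo[, continuous a} }.

Definition trawl_set (a : R -> R) (t : R) :
    set (measurableTypeR R * measurableTypeR R) :=
  [set (p.1 + t, p.2) | p in [set p : R * R | p.1 <= 0 /\ 0 <= p.2 <= a (- p.1)]].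

Definition trawl_process {Omega : Type}
    (L : set (measurableTypeR R * measurableTypeR R) -> Omega -> R)
    (a : R -> R) (t : R) : Omega -> R :=
  L (trawl_set a t).

Definition partial_sum d (Omega : measurableType d) (P : probability Omega R)
    (X : R -> Omega -> R) (Delta : nat -> R) (n : nat) (t : R) (w : Omega) : R :=
  \sum_(0 <= k < Num.truncn (n%:R * t))
    (X (k%:R * Delta n) w - fine 'E_P[X (k%:R * Delta n)]).

Definition sampled_sigma {Omega : Type} (X : R -> Omega -> R)
    (Delta : nat -> R) : set (set Omega) :=
  <<s \bigcup_(k in [set k | (1 <= k)%N]) \bigcap_(N in [set N | (k <= N)%N])
        g_sigma_preimage
          (fun j : 'I_k.+1 => X (j%:R * Delta N) : Omega -> measurableTypeR R) >>.

End Trawl.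

Section FractionalBrownianMotion.
Context {R : realType}.

(* [normal_prob m 0] is the uniform law on [0, 1], so the degenerate Gaussian
   laws have to be given as Dirac masses. *)
Definition gaussian d (Omega : measurableType d) (P : probability Omega R)
    (Y : Omega -> R) :=
  (exists m s : R, s != 0 /\ forall A : set (measurableTypeR R),
     measurable A -> P (Y @^-1` A) = normal_prob m s A)
  \/ (exists m : R, forall A : set (measurableTypeR R),
     measurable A -> P (Y @^-1` A) = \d_m A).

(* [fbm P H v B]: B = (B_t)_(t >= 0) is a fractional Brownian motion of
   index H with variance v at time 1, i.e. a centred Gaussian process with
   continuous paths and E[(B_t - B_s)^2] = v |t - s|^(2H).  The usual
   "standard" normalisation is v = 1; the covariance without the factor 1/2,
   s^(2H) + t^(2H) - |t - s|^(2H), is v = 2.  The latter is the one that goes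
   with the scale sigma_kappa^2 = b^2 / ((kappa-2)(3-kappa)(4-kappa)): the
   Gaussian part of X has covariance r(s) = b^2 \int_s^oo a, and
   r(T s) / (T a(T)) tends to b^2 s^(2-kappa) / (kappa-2), so that
   \int_0^1 \int_0^1 b^2 |u-v|^(2-kappa) / (kappa-2) du dv
     = 2 b^2 / ((kappa-2)(3-kappa)(4-kappa))
   is the variance of the limit at time 1. *)
Record fbm d (Omega : measurableType d) (P : probability Omega R)
    (H v : R) (B : R -> Omega -> R) : Prop := {
  fbm_measurable : forall t, 0 <= t ->
    measurable_fun setT (B t : Omega -> measurableTypeR R) ;
  fbm_gaussian : forall m (c t : 'I_m -> R), (forall i, 0 <= t i) ->
    gaussian P (fun w => \sum_(i < m) c i * B (t i) w) ;
  fbm_mean : forall t, 0 <= t -> ('E_P[B t] = 0)%E ;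
  fbm_cov : forall s t, 0 <= s -> 0 <= t ->
    ('E_P[(B s \* B t)%R]
     = (v / 2 * (s `^ (2 * H) + t `^ (2 * H) - `|t - s| `^ (2 * H)))%:E)%E ;
  fbm_continuous : forall w, {within `[0, +oo[, continuous (B ^~ w)} }.

End FractionalBrownianMotion.

Section Skorokhod.
Context {R : realType}.

(* Elements of D[0, T] are represented by functions on R of which only the
   restriction to [0, T] is relevant. *)
Definition cadlag (T : R) (x : R -> R) :=
  (forall t, 0 <= t < T -> x s @[s --> t^'+] --> x t) /\
  (forall t, 0 < t <= T -> cvg (x s @[s --> t^'-])).

Definition time_change (T : R) (lam : R -> R) :=
  [/\ lam 0 = 0, lam T = T,
      {in `[0, T] &, {homo lam : s t / s < t}} &
      {within `[0, T], continuous lam}].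

Definition skorokhod_dist (T : R) (x y : R -> R) : R :=
  inf [set e | exists2 lam, time_change T lam &
         forall t, t \in `[0, T] ->
           `|lam t - t| <= e /\ `|x t - y (lam t)| <= e].

Definition skorokhod_continuous (T : R) (f : (R -> R) -> R) :=
  forall x, cadlag T x -> forall e, 0 < e -> exists2 delta, 0 < delta &
    forall y, cadlag T y -> skorokhod_dist T x y < delta -> `|f y - f x| < e.

Context d (Omega : measurableType d) (P : probability Omega R).
Context d' (Omega' : measurableType d') (P' : probability Omega' R).

Definition skorokhod_cvg (T : R) (X : nat -> R -> Omega -> R)
    (Y : R -> Omega' -> R) :=
  forall f : (R -> R) -> R, skorokhod_continuous T f ->
    (exists M, forall x, cadlag T x -> `|f x| <= M) ->
    (\int[P]_w f (X n ^~ w)) @[n --> \oo] --> \int[P']_w f (Y ^~ w).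

(* Given any non-null event of G, the vectors [xi n] converge in distribution
   to (the law of) [eta]; the limit lives on its own probability space. *)
Definition stable_cvg (G : set (set Omega)) (m : nat)
    (xi : nat -> Omega -> 'rV[R]_m) (eta : Omega' -> 'rV[R]_m) :=
  forall B, G B -> (0 < P B)%E ->
  forall f : 'rV[R]_m -> R, continuous f -> (exists M, forall x, `|f x| <= M) ->
    ((\int[P]_(w in B) f (xi n w)) / fine (P B)) @[n --> \oo]
      --> \int[P']_w f (eta w).

Definition stable_skorokhod_cvg (G : set (set Omega)) (T : R)
    (X : nat -> R -> Omega -> R) (Y : R -> Omega' -> R) :=
  skorokhod_cvg T X Y /\
  forall m (t : 'I_m -> R), (forall i, 0 <= t i <= T) ->
    stable_cvg G (fun n w => \row_i X n (t i) w) (fun w => \row_i Y (t i) w).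

End Skorokhod.

(* Main.v *)
(* A linear combination of values of X and of rescaled partial sums is a finite
   combination of values of L on trawl sets, hence, after splitting these sets
   into atoms, a sum of independent infinitely divisible variables whose
   characteristic function is explicit.  Its Gaussian part is a quadratic form in
   the overlaps Leb(A_s \cap A_t) = r(|t - s|), where r(s) is the integral of a
   over [s, oo); by Karamata's theorem the rescaled double sums of r converge to
   the covariance of fractional Brownian motion.  The jump exponent is o(z^2) at
   infinity and only O(z^2) for bounded z, which makes its contribution vanish:
   an atom contained in few of the sampled trawl sets lies in a narrow band of the
   double sum of overlaps.  The cross overlaps with a fixed combination of values
   of X vanish as well, so X and the partial sums are asymptotically independent,
   and this is stable convergence.

   For the Skorokhod convergence, Potter bounds give
   E (S_j - S_i)^2 <= C ((j - i) / n)^g with g > 1, and a dyadic maximal inequality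
   makes the paths uniformly close, in mean, to their interpolations on a coarse
   grid.  Uniformly Lipschitz functionals of the paths thus converge.  A
   Skorokhod-continuous functional is continuous for the uniform distance (take
   the identity as time change), and is a monotone limit of uniformly Lipschitz
   ones. *)
Require Import Defs.
From mathcomp Require Import all_boot all_order all_algebra.
From mathcomp Require Import all_classical all_reals all_analysis.
From mathcomp Require Import measurable_realfun.
From mathcomp.real_closed Require Import complex.
From mathcomp Require Import ring lra zify.
Set Implicit Arguments.
Unset Strict Implicit.
Unset Printing Implicit Defensive.
Import Order.TTheory GRing.Theory Num.Theory.
Import numFieldNormedType.Exports.
Local Open Scope classical_set_scope.
Local Open Scope ring_scope.

(** * Regular variation *)

(** With [T n = n * Delta n] and [A n = a (T n) * T n], the square of the norming sequence is
    [n ^ 2 * A n], where [A n] tends to 0 while [n * A n] tends to infinity. A single weight is thus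
    of order 1 / [scaling n], yet one point of the plane may lie in a number of order [n] of the
    sampled trawl sets and collect a weight that diverges. Expanding the Levy exponent at 0 is
    therefore useless: on the atoms that matter its argument goes to infinity, and there the
    Gaussian part [b ^ 2 * z ^ 2 / 2] dominates the jumps.

    Only second moments are at hand. They suffice for tightness because [kappa < 3] makes the
    variance exponent [4 - kappa] exceed 1, and they replace the continuity theorem for
    characteristic functions: a Lipschitz function is a trigonometric polynomial up to
    [e * (1 + |x| ^ 2)], an error of small mean. Characteristic functions appear as integrals of
    [cos (Y + beta)] for every phase [beta], which carries real and imaginary parts at once and
    keeps the argument real. *)

Section RealAsymptotics.
Context {R : realType}.
Implicit Types f g df dg : R -> R.

Lemma ge0_derive_ndecr f df (c : R) :
  (forall x, c < x -> is_derive x 1 f (df x)) ->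
  (forall x, c < x -> 0 <= df x) ->
  forall x y, c < x -> x <= y -> f x <= f y.
Proof.
move=> fdf df0 x y cx xy.
have dfz z : z \in `[x, y] -> is_derive z 1 f (df z).
  by rewrite in_itv/= => /andP[xz _]; apply: fdf; exact: lt_le_trans xz.
have dfz' z : z \in `]x, y[ -> is_derive z 1 f (df z).
  by rewrite in_itv/= => /andP[xz zy]; apply: dfz; rewrite in_itv/= !ltW.
have cf : {within `[x, y], continuous f}.
  by apply: derivable_within_continuous => t /dfz [].
have [z] := MVT_segment xy dfz' cf.
rewrite in_itv/= => /andP[xz _] E.
rewrite -subr_ge0 E mulr_ge0 ?subr_ge0// df0//; exact: lt_le_trans xz.
Qed.

(** The function [u * g - f] is non-decreasing, so [f <= u * g + K] for a constant [K], and the gap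
    [(v - u) * g] eventually absorbs [K] because [g] tends to infinity. *)
Lemma lhopital_pinfty_le f df g dg (c u v : R) : u < v ->
  (forall x, c < x -> is_derive x 1 f (df x)) ->
  (forall x, c < x -> is_derive x 1 g (dg x)) ->
  (forall x, c < x -> df x <= u * dg x) ->
  g x @[x --> +oo] --> +oo ->
  \forall x \near +oo, f x <= v * g x.
Proof.
move=> uv fdf gdg dfg goo.
have mono := @ge0_derive_ndecr (u \*: g \- f) (fun x => u *: dg x - df x) c _ _ (c + 1).
have {}mono : forall y, c + 1 <= y -> f y <= u * g y + (f (c+1) - u * g (c+1)).
  move=> y cy; have := mono _ _ y _ cy.
  move=> H; suff : u * g (c + 1) - f (c + 1) <= u * g y - f y by lra.
  apply: H => [x cx|x cx|]; last by rewrite ltrDl.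
  - apply: is_deriveB; [apply: is_deriveZ; exact: gdg|exact: fdf].
  - by rewrite subr_ge0 dfg.
set K := f (c + 1) - u * g (c + 1) in mono.
near=> x.
apply: le_trans (mono _ _) _; first by near: x; apply: nbhs_pinfty_ge; exact: num_real.
rewrite -lerBrDl -mulrBl.
have -> : K = (v - u) * (K / (v - u)) by field; rewrite subr_eq0 gt_eqF.
rewrite ler_pM2l ?subr_gt0//.
by near: x; move/cvgryPge : goo; exact.
Unshelve. all: by end_near. Qed.

Lemma lhopital_pinfty f df g dg (c l : R) :
  (forall x, c < x -> is_derive x 1 f (df x)) ->
  (forall x, c < x -> is_derive x 1 g (dg x)) ->
  (forall x, c < x -> 0 < dg x) ->
  g x @[x --> +oo] --> +oo ->
  df x / dg x @[x --> +oo] --> l -> f x / g x @[x --> +oo] --> l.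
Proof.
move=> fdf gdg dg0 goo /cvgrPdist_le dfg.
apply/cvgrPdist_le => e e0.
have [N [Nr HN]] := dfg _ (divr_gt0 e0 (ltr0Sn R 1)).
pose c' := Order.max c N.
have [cc' Nc'] : c <= c' /\ N <= c' by rewrite !le_max !lexx ?orbT.
have H x : c' < x -> `|df x - l * dg x| <= e / 2 * dg x.
  move=> c'x; have dgx : 0 < dg x by apply: dg0; apply: le_lt_trans c'x.
  have := HN x (le_lt_trans Nc' c'x) => /=.
  rewrite -(ler_pM2r dgx) -{2}(gtr0_norm dgx) -normrM mulrBl divfK ?gt_eqF//.
  by rewrite distrC.
have fdf' x : c' < x -> is_derive x 1 f (df x).
  by move=> c'x; apply: fdf; apply: le_lt_trans c'x.
have gdg' x : c' < x -> is_derive x 1 g (dg x).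
  by move=> c'x; apply: gdg; apply: le_lt_trans c'x.
have U := @lhopital_pinfty_le f df g dg c' (l + e / 2) (l + e) _ fdf' gdg' _ goo.
have nfdf' x : c' < x -> is_derive x 1 (\- f) (- df x).
  by move=> c'x; apply: is_deriveN; exact: fdf'.
have L := @lhopital_pinfty_le (\- f) (fun x => - df x) g dg c' (- l + e / 2) (- l + e) _ nfdf' gdg' _ goo.
near=> x.
have gx : 0 < g x by near: x; move/cvgryPgt : goo; exact.
have fU : f x <= (l + e) * g x.
  near: x; apply: U => [|x c'x]; first by lra.
  by have := H x c'x; rewrite ler_norml; lra.
have fL : - f x <= (- l + e) * g x.
  near: x; apply: L => [|x c'x]; first by lra.
  by have := H x c'x; rewrite ler_norml; lra.
rewrite -(ler_pM2r gx) -{2}(gtr0_norm gx) -normrM mulrBl divfK ?gt_eqF//.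
rewrite ler_norml; apply/andP; split; lra.
Unshelve. all: by end_near. Qed.

(** Here [f - u * g] is non-decreasing with limit 0 at infinity, hence nonpositive. *)
Lemma lhopital_pinfty0_le f df g dg (c u : R) :
  (forall x, c < x -> is_derive x 1 f (df x)) ->
  (forall x, c < x -> is_derive x 1 g (dg x)) ->
  (forall x, c < x -> u * dg x <= df x) ->
  f x @[x --> +oo] --> (0 : R) -> g x @[x --> +oo] --> (0 : R) ->
  forall x, c < x -> f x <= u * g x.
Proof.
move=> fdf gdg dfg f0 g0 x cx.
have mono y : x <= y -> f x - u * g x <= f y - u * g y.
  move=> xy; have := @ge0_derive_ndecr (f \- u \*: g) (fun x => df x - u *: dg x) c _ _ x y cx xy.
  apply => z cz.
  - apply: is_deriveB; [exact: fdf|apply: is_deriveZ; exact: gdg].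
  - by rewrite subr_ge0 dfg.
rewrite -subr_le0.
have h0 : f y - u * g y @[y --> +oo] --> (0 : R).
  rewrite -[0](subr0) -[X in _ - X](mulr0 u); apply: cvgB => //.
  by apply: cvgM => //; exact: cvg_cst.
apply: (cvgr_to_ge h0).
by near=> y; apply: mono; near: y; apply: nbhs_pinfty_ge; exact: num_real.
Unshelve. all: by end_near. Qed.

Lemma lhopital_pinfty0 f df g dg (c l : R) :
  (forall x, c < x -> is_derive x 1 f (df x)) ->
  (forall x, c < x -> is_derive x 1 g (dg x)) ->
  (forall x, c < x -> dg x < 0) -> (forall x, c < x -> 0 < g x) ->
  f x @[x --> +oo] --> (0 : R) -> g x @[x --> +oo] --> (0 : R) ->
  df x / dg x @[x --> +oo] --> l -> f x / g x @[x --> +oo] --> l.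
Proof.
move=> fdf gdg dg0 gp f0 g0 /cvgrPdist_le dfg.
apply/cvgrPdist_le => e e0.
have [N [Nr HN]] := dfg _ e0.
pose c' := Order.max c N.
have [cc' Nc'] : c <= c' /\ N <= c' by rewrite !le_max !lexx ?orbT.
have H x : c' < x -> `|df x - l * dg x| <= e * (- dg x).
  move=> c'x; have dgx : 0 < - dg x by rewrite oppr_gt0 dg0//; apply: le_lt_trans c'x.
  have := HN x (le_lt_trans Nc' c'x) => /=.
  rewrite -(ler_pM2r dgx) -{1}(gtr0_norm dgx) -normrM mulrN normrN mulrBl divfK ?lt_eqF -?oppr_gt0//.
  by rewrite distrC.
have fdf' x : c' < x -> is_derive x 1 f (df x).
  by move=> c'x; apply: fdf; apply: le_lt_trans c'x.
have gdg' x : c' < x -> is_derive x 1 g (dg x).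
  by move=> c'x; apply: gdg; apply: le_lt_trans c'x.
have nfdf' x : c' < x -> is_derive x 1 (\- f) (- df x).
  by move=> c'x; apply: is_deriveN; exact: fdf'.
have nf0 : (\- f) x @[x --> +oo] --> (0 : R) by rewrite -oppr0; apply: cvgN.
near=> x.
have c'x : c' < x by near: x; apply: nbhs_pinfty_gt; exact: num_real.
have gx : 0 < g x by apply: gp; apply: le_lt_trans c'x.
have fU : f x <= (l + e) * g x.
  apply: (@lhopital_pinfty0_le f df g dg c' (l + e) fdf' gdg' _ f0 g0) => // y c'y.
  by have := H y c'y; rewrite ler_norml; lra.
have fL : - f x <= (- l + e) * g x.
  apply: (@lhopital_pinfty0_le (\- f) (fun x => - df x) g dg c' (- l + e) nfdf' gdg' _ nf0 g0) => // y c'y.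
  by have := H y c'y; rewrite ler_norml; lra.
rewrite -(ler_pM2r gx) -{2}(gtr0_norm gx) -normrM mulrBl divfK ?gt_eqF//.
rewrite ler_norml; apply/andP; split; lra.
Unshelve. all: by end_near. Qed.

(** The derivative of [f x * x ^ (- p)] is [x ^ (- p - 1) * (x * df x - p * f x)]. A lower bound on
    the logarithmic derivative thus becomes a comparison with a power, the source of Potter bounds;
    it is kept free of quotients. *)
Lemma log_derivative_mono f df (c p : R) :  0 <= c ->
  (forall x, c < x -> is_derive x 1 f (df x)) ->
  (forall x, c < x -> p * f x <= x * df x) ->
  forall x y, c < x -> x <= y -> f x * y `^ p <= f y * x `^ p.
Proof.
move=> c0 fdf dfp x y cx xy.
have x0 : 0 < x by apply: le_lt_trans cx.
have y0 : 0 < y by apply: lt_le_trans xy.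
have := @ge0_derive_ndecr (fun t => f t * t `^ (- p))
   (fun t => f t *: (- p * t `^ (- p - 1)) + t `^ (- p) *: df t) c _ _ x y cx xy.
move=> H; have {}H : f x * x `^ (- p) <= f y * y `^ (- p).
  apply: H => z cz; have z0 : 0 < z by apply: le_lt_trans cz.
    apply: is_deriveM; first exact: fdf.
    by apply: is_derive1_powR.
  rewrite /GRing.scale/=.
  have -> : z `^ (- p - 1) = z `^ (- p) / z.
    rewrite powRD ?powR_inv1 ?(ltW z0)//; by apply/implyP => _; rewrite gt_eqF.
  have -> : f z * (- p * (z `^ (- p) / z)) + z `^ (- p) * df z
     = z `^ (- p) / z * (z * df z - p * f z) by field; rewrite gt_eqF.
  by rewrite mulr_ge0 ?subr_ge0 ?dfp// divr_ge0 ?powR_ge0 ?ltW.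
have xp : 0 < x `^ p by rewrite powR_gt0.
have yp : 0 < y `^ p by rewrite powR_gt0.
rewrite -(ler_pM2r (mulr_gt0 xp yp)) in H.
move: H; rewrite !powRN.
have -> : f x / x `^ p * (x `^ p * y `^ p) = f x * y `^ p by field; rewrite gt_eqF.
by have -> : f y / y `^ p * (x `^ p * y `^ p) = f y * x `^ p by field; rewrite gt_eqF.
Qed.


Lemma cvg_mulry (x : R) : 0 < x -> (t * x) @[t --> +oo] --> +oo.
Proof.
move=> x0; apply/cvgryPge => A; near=> t.
by rewrite -ler_pdivrMr//; near: t; apply: nbhs_pinfty_ge; exact: num_real.
Unshelve. all: by end_near. Qed.

Lemma is_derive_dilate f df (c x t : R) : 0 < x -> 0 <= c ->
  (forall x, c < x -> is_derive x 1 f (df x)) -> c < t * x ->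
  is_derive t 1 (fun t => f (t * x)) (df (t * x) * x).
Proof.
move=> x0 c0 fdf ctx.
apply: (@is_derive1_comp _ f (fun t => t * x)); first exact: fdf.
rewrite -[X in is_derive _ _ _ X]mul1r.
have -> : (fun t => t * x) = (x \*: id) by apply/funext => u /=; rewrite /GRing.scale/= mulrC.
by rewrite mul1r -[X in is_derive _ _ _ X]mulr1; apply: is_deriveZ.
Qed.

(** Regular variation passes from a derivative to its tail integral: the quotient of [f (t * x)] and
    [f t] has the form 0 / 0, and the quotient of derivatives is [x] times that of [df]. *)
Lemma rv_lhopital0 f df (L x : R) : 0 < x ->
  (forall t : R, 0 < t -> is_derive t 1 f (- df t)) ->
  (forall t : R, 0 < t -> 0 < df t) -> (forall t : R, 0 < t -> 0 < f t) ->
  f t @[t --> +oo] --> (0 : R) ->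
  df (t * x) / df t @[t --> +oo] --> L ->
  f (t * x) / f t @[t --> +oo] --> L * x.
Proof.
move=> x0 fdf df0 f0 fc dfL.
apply: (@lhopital_pinfty0 _ (fun t => - df (t * x) * x) _ (fun t => - df t) 0).
- by move=> t t0; apply: (is_derive_dilate x0 (lexx 0) fdf); rewrite mulr_gt0.
- by move=> t t0; rewrite oppr_lt0 df0.
- exact: f0.
- by apply: (cvg_comp _ _ _ fc); exact: cvg_mulry.
- exact: fc.
- have -> : (fun t => - df (t * x) * x / - df t) = (fun t => df (t * x) / df t * x).
    by apply/funext => t; rewrite mulNr mulrAC invrN mulrN mulNr opprK mulrAC.
  by apply: cvgM => //; exact: cvg_cst.
Qed.

Lemma rv_lhopital f df (L x : R) : 0 < x ->
  (forall t : R, 0 < t -> is_derive t 1 f (df t)) ->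
  (forall t : R, 0 < t -> 0 < df t) ->
  f t @[t --> +oo] --> +oo ->
  df (t * x) / df t @[t --> +oo] --> L ->
  f (t * x) / f t @[t --> +oo] --> L * x.
Proof.
move=> x0 fdf df0 fc dfL.
apply: (@lhopital_pinfty _ (fun t => df (t * x) * x) _ df 0) => //.
- by move=> t t0; apply: (is_derive_dilate x0 (lexx 0) fdf); rewrite mulr_gt0.
- have -> : (fun t => df (t * x) * x / df t) = (fun t => df (t * x) / df t * x).
    by apply/funext => t; rewrite mulrAC.
  by apply: cvgM => //; exact: cvg_cst.
Qed.

Lemma powR_cvgy (p : R) : 0 < p -> (t `^ p) @[t --> +oo] --> +oo.
Proof.
move=> p0; apply/cvgryPge => A; near=> t.
have A1 : 0 <= Order.max A 1 by rewrite le_max ler01 orbT.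
apply: (@le_trans _ _ ((Order.max A 1 `^ p^-1) `^ p)).
  by rewrite -powRrM mulVf ?gt_eqF// powRr1// le_max lexx.
apply: ge0_ler_powR; rewrite ?nnegrE ?powR_ge0 ?ltW//.
Unshelve. all: by end_near. Qed.

(* The difference quotients of [x `^ (- rho)] on both sides of 1 squeeze the
   ratio, because [a] is monotone. *)
Lemma monotone_density (r a : R -> R) (rho : R) : 0 < rho ->
  (forall t : R, 0 < t -> 0 < r t) ->
  (forall s t : R, 0 < s -> s <= t -> a t <= a s) ->
  (forall t : R, 0 < t -> is_derive t 1 r (- a t)) ->
  (forall x, 0 < x -> r (t * x) / r t @[t --> +oo] --> x `^ (- rho)) ->
  t * a t / r t @[t --> +oo] --> rho.
Proof.
move=> rho0 r0 amono ra rRV.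
have bnd s t : 0 < s -> s <= t -> (t - s) * a t <= r s - r t <= (t - s) * a s.
  move=> s0 st.
  have ra' z : z \in `]s, t[ -> is_derive z 1 r (- a z).
    by rewrite in_itv/= => /andP[sz _]; apply: ra; exact: lt_trans sz.
  have cr : {within `[s, t], continuous r}.
    apply: derivable_within_continuous => z; rewrite in_itv/= => /andP[sz _].
    by have [] := ra z (lt_le_trans s0 sz).
  have [z] := MVT_segment st ra' cr.
  rewrite in_itv/= => /andP[sz zt] /(congr1 -%R); rewrite opprB => ->.
  rewrite mulNr opprK (mulrC (a z)).
  have ts : 0 <= t - s by rewrite subr_ge0.
  have z0 : 0 < z by apply: lt_le_trans sz.
  by rewrite !ler_wpM2l// amono.
have dpow : h^-1 *: (((h + 1) `^ (- rho)) - 1 `^ (- rho)) @[h --> (0:R)^'] --> - rho.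
  have [d1 d2] := @is_derive1_powR R (- rho) 1 ltr01.
  move: d2; rewrite powR1 mulr1 => d2; rewrite -[X in _ --> X]d2.
  have : h^-1 *: ((h *: 1 + 1) `^ (- rho) - 1 `^ (- rho)) @[h --> (0:R)^']
     --> 'D_1 ((powR (R:=R))^~ (- rho)) 1 by exact: d1.
  set F := (X in X @ _ --> _ -> _); set G := (X in _ -> X @ _ --> _).
  suff -> : F = G by [].
  by apply/funext => h; rewrite /F /G powR1 [h%:A]mulr1.
apply/cvgrPdist_le => e e0.
have e2 : 0 < e / 2 by rewrite divr_gt0.
move/cvgrPdist_le : dpow => /(_ _ e2); rewrite powR1 => -[d /= d0 Hd].
pose h := Order.min (d / 2) (1 / 2).
have h0 : 0 < h by rewrite lt_min !divr_gt0.
have hd : h < d by rewrite gt_min; apply/orP; left; lra.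
have h1 : h <= 1 / 2 by rewrite ge_min lexx orbT.
have Hp : `|- rho - h^-1 * ((h + 1) `^ (- rho) - 1)| <= e / 2.
  by apply: (Hd h); rewrite ?gt_eqF//= sub0r normrN gtr0_norm.
have Hn : `|- rho - (- h)^-1 * ((- h + 1) `^ (- rho) - 1)| <= e / 2.
  by apply: (Hd (- h)); rewrite ?oppr_eq0 ?gt_eqF//= sub0r !normrN gtr0_norm.
have hp1 : 0 < h + 1 by lra.
have hn1 : 0 < - h + 1 by lra.
(* The ratios of [r] must be known up to [h * (e / 2)], since they are divided by [h] in the end;
   [h <= 1 / 2] keeps [1 - h] positive. *)
have he : 0 < h * (e / 2) by rewrite mulr_gt0.
near=> t.
have t0 : 0 < t by near: t; apply: nbhs_pinfty_gt; exact: num_real.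
have rt := r0 t t0.
have P : `|(h + 1) `^ (- rho) - r (t * (h + 1)) / r t| <= h * (e / 2).
  by near: t; move/cvgrPdist_le : (rRV _ hp1); exact.
have N : `|(- h + 1) `^ (- rho) - r (t * (- h + 1)) / r t| <= h * (e / 2).
  by near: t; move/cvgrPdist_le : (rRV _ hn1); exact.
have th0 : 0 < t * h by rewrite mulr_gt0.
have tp : t <= t * (h + 1) by lra.
have tn : t * (- h + 1) <= t by lra.
have tn0 : 0 < t * (- h + 1) by rewrite mulr_gt0.
have /andP[_ B1] := bnd _ _ t0 tp.
have /andP[B2 _] := bnd _ _ tn0 tn.
set A := t * a t / r t.
set rp := r (t * (h + 1)) / r t in P.
set rn := r (t * (- h + 1)) / r t in N.
have C1 : 1 - rp <= h * A.
  rewrite -(ler_pM2r rt) /rp /A mulrBl mul1r divfK ?gt_eqF//.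
  have -> : h * (t * a t / r t) * r t = (t * (h + 1) - t) * a t by field; rewrite gt_eqF.
  exact: B1.
have C2 : h * A <= rn - 1.
  rewrite -(ler_pM2r rt) /rn /A mulrBl mul1r divfK ?gt_eqF//.
  have -> : h * (t * a t / r t) * r t = (t - t * (- h + 1)) * a t by field; rewrite gt_eqF.
  exact: B2.
move: Hp Hn P N; set u := (h + 1) `^ _; set v := (- h + 1) `^ _.
have Eu : - rho - h^-1 * (u - 1) = (- rho * h - (u - 1)) / h by field; rewrite gt_eqF.
have Ev : - rho - (- h)^-1 * (v - 1) = (- rho * h + (v - 1)) / h by field; rewrite gt_eqF.
rewrite Eu Ev !normrM !(gtr0_norm (_ : 0 < h^-1)) ?invr_gt0// !ler_pdivrMr//.
rewrite !ler_norml => /andP[p1 p2] /andP[n1 n2] /andP[q1 q2] /andP[m1 m2].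
apply/andP; split; rewrite -(ler_pM2l h0); nra.
Unshelve. all: by end_near. Qed.

(** Monotonicity replaces the uniform convergence theorem: [tau n] is eventually compared with fixed
    points on either side of [t], at which regular variation holds pointwise. *)
Lemma rv_cvg_seq (F : R -> R) (q : R) (T tau : R^nat) (t : R) : 0 < q ->
  (forall x, 0 <= x -> 0 <= F x) -> (forall x, 0 < x -> 0 < F x) ->
  (forall x y, 0 <= x -> x <= y -> F x <= F y) ->
  (forall x, 0 < x -> F (s * x) / F s @[s --> +oo] --> x `^ q) ->
  T n @[n --> \oo] --> +oo -> (forall n, 0 <= tau n) ->
  tau n @[n --> \oo] --> t ->
  F (T n * tau n) / F (T n) @[n --> \oo] --> t `^ q.
Proof.
move=> q0 F0 Fp Fmono FRV Too tau0 taut.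
have t0 : 0 <= t by apply: (cvgr_to_ge taut); apply: nearW.
have root y : 0 <= y -> (y `^ q^-1) `^ q = y.
  by move=> y0; rewrite -powRrM mulVf ?gt_eqF// powRr1.
have rootV y : 0 <= y -> (y `^ q) `^ q^-1 = y.
  by move=> y0; rewrite -powRrM mulfV ?gt_eqF// powRr1.
have iq0 : 0 < q^-1 by rewrite invr_gt0.
apply/cvgrPdist_le => e e0.
have e2 : 0 < e / 2 by rewrite divr_gt0.
have RV x : 0 < x -> \forall n \near \oo, `|x `^ q - F (T n * x) / F (T n)| <= e / 2.
  move=> x0; have : F (T n * x) / F (T n) @[n --> \oo] --> x `^ q.
    exact: (cvg_comp T (fun s => F (s * x) / F s) Too (FRV _ x0)).
  by move/cvgrPdist_le; exact.
have U : \forall n \near \oo, F (T n * tau n) / F (T n) <= t `^ q + e.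
  (* The comparison point has a [q]-th power exceeding [t ^ q] by [e / 2]; the other half of [e]
     pays for regular variation at [x]. *)
  pose x := (t `^ q + e / 2) `^ q^-1.
  have tx : t < x.
    rewrite -{1}(rootV t t0) /x gt0_ltr_powR ?nnegrE ?addr_ge0 ?powR_ge0 ?ltW//.
    by rewrite ltrDl.
  have x0 : 0 < x by apply: le_lt_trans tx.
  have xq : x `^ q = t `^ q + e / 2 by rewrite root// addr_ge0 ?powR_ge0 ?ltW.
  near=> n.
  have Tn : 0 < T n by near: n; move/cvgryPgt : Too; exact.
  have nx : tau n <= x by near: n; apply: (cvgr_le t taut).
  have H : `|x `^ q - F (T n * x) / F (T n)| <= e / 2 by near: n; exact: RV.
  have : F (T n * tau n) / F (T n) <= F (T n * x) / F (T n).
    rewrite ler_pM2r ?invr_gt0 ?Fp// Fmono ?mulr_ge0 ?tau0 ?ler_wpM2l ?(ltW Tn)//.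
  by move: H; rewrite xq ler_norml; lra.
have L : \forall n \near \oo, t `^ q - e <= F (T n * tau n) / F (T n).
  (* No positive comparison point need lie below [t], which may be 0; but for small [t ^ q] the
     claimed lower bound is negative and [F >= 0] suffices. *)
  have [le|lt] := leP (t `^ q) (e / 2).
    near=> n; apply: (@le_trans _ _ 0); first by lra.
    have Tn : 0 < T n by near: n; move/cvgryPgt : Too; exact.
    by rewrite divr_ge0 ?F0 ?mulr_ge0 ?tau0 ?ltW.
  pose x := (t `^ q - e / 2) `^ q^-1.
  have x0 : 0 < x by rewrite powR_gt0 // subr_gt0.
  have tx : x < t.
    rewrite -[X in _ < X](rootV t t0) /x gt0_ltr_powR ?nnegrE ?powR_ge0 ?subr_ge0 ?ltW//.
    by rewrite gtrBl.
  have xq : x `^ q = t `^ q - e / 2 by rewrite root// subr_ge0 ltW.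
  near=> n.
  have Tn : 0 < T n by near: n; move/cvgryPgt : Too; exact.
  have nx : x <= tau n by near: n; apply: (cvgr_ge t taut).
  have H : `|x `^ q - F (T n * x) / F (T n)| <= e / 2 by near: n; exact: RV.
  have : F (T n * x) / F (T n) <= F (T n * tau n) / F (T n).
    rewrite ler_pM2r ?invr_gt0 ?Fp// Fmono ?mulr_ge0 ?ler_wpM2l ?(ltW Tn) ?(ltW x0)//.
  by move: H; rewrite xq ler_norml; lra.
near=> n; rewrite ler_norml.
have : F (T n * tau n) / F (T n) <= t `^ q + e by near: n.
have : t `^ q - e <= F (T n * tau n) / F (T n) by near: n.
by lra.
Unshelve. all: by end_near. Qed.

End RealAsymptotics.

(** * Karamata's theorem along the chain [a'], [a], [r], [R1], [R2] *)

Section Karamata.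
Context {R : realType} (a a' r R1 R2 : R -> R) (k : R).
Context (k2 : 2 < k) (k3 : k < 3)
  (a'0 : forall t : R, 0 < t -> 0 < a' t) (a0 : forall t : R, 0 < t -> 0 < a t)
  (r0 : forall t : R, 0 < t -> 0 < r t)
  (da : forall t : R, 0 < t -> is_derive t 1 a (- a' t))
  (dr : forall t : R, 0 < t -> is_derive t 1 r (- a t))
  (dR1 : forall t : R, 0 < t -> is_derive t 1 R1 (r t))
  (dR2 : forall t : R, 0 < t -> is_derive t 1 R2 (R1 t))
  (amono : forall s t : R, 0 < s -> s <= t -> a t <= a s)
  (alim : a t @[t --> +oo] --> (0 : R)) (rlim : r t @[t --> +oo] --> (0 : R))
  (R1p : forall t : R, 0 < t -> 0 < R1 t) (R2p : forall t : R, 0 < t -> 0 < R2 t)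
  (a'RV : regularly_varying k a').

Let near_gt0 (c : R) : \forall t \near +oo, c < t.
Proof. by apply: nbhs_pinfty_gt; exact: num_real. Qed.

Lemma powR_mulr (x p : R) : 0 < x -> x `^ p * x = x `^ (p + 1).
Proof.
by move=> x0; rewrite powRD ?powRr1 ?ltW//; apply/implyP => _; rewrite gt_eqF.
Qed.

Lemma karamata_rv_a (x : R) : 0 < x -> a (t * x) / a t @[t --> +oo] --> x `^ (- k + 1).
Proof.
by move=> x0; rewrite -powR_mulr//; exact: (rv_lhopital0 x0 da a'0 a0 alim (a'RV x0)).
Qed.

Lemma karamata_rv_r (x : R) : 0 < x -> r (t * x) / r t @[t --> +oo] --> x `^ (- (k - 2)).
Proof.
move=> x0; have -> : - (k - 2) = - k + 1 + 1 by ring.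
by rewrite -powR_mulr//; exact: (rv_lhopital0 x0 dr a0 r0 rlim (karamata_rv_a x0)).
Qed.

Lemma karamata_ar : t * a t / r t @[t --> +oo] --> k - 2.
Proof.
by apply: monotone_density => //; [rewrite subr_gt0|exact: karamata_rv_r].
Qed.

(** The exponent [(k - 1) / 2] lies strictly between [k - 2], the limit of [t * a t / r t], and 1,
    because [k < 3]. So [r] eventually dominates a multiple of a power whose exponent is above
    -1. *)
Lemma karamata_rT_oo : t * r t @[t --> +oo] --> +oo.
Proof.
pose p := - ((k - 1) / 2).
have p1 : 0 < 1 + p by rewrite /p; move: k2 k3; lra.
have [c0 [c0r Hc0]] : \forall t \near +oo, t * a t / r t <= (k - 1) / 2.
  by apply: (cvgr_le _ karamata_ar); move: k2 k3; lra.
pose c := Order.max c0 1.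
have c0c : c0 <= c by rewrite le_max lexx.
have c1 : 1 <= c by rewrite le_max lexx orbT.
have c00 : 0 < c by apply: lt_le_trans c1.
have L := @log_derivative_mono R r (fun t => - a t) c p (ltW c00).
have {}L y : c + 1 <= y -> r (c + 1) * y `^ p <= r y * (c + 1) `^ p.
  move=> cy; apply: L => // [x cx|x cx|]; last by rewrite ltrDl.
    by apply: dr; exact: lt_trans cx.
  have x0 : 0 < x by apply: lt_trans cx.
  have := Hc0 x (le_lt_trans c0c cx); rewrite ler_pdivrMr ?r0// /p.
  by rewrite mulrN mulNr lerN2.
have C : 0 < r (c + 1) / (c + 1) `^ p by rewrite divr_gt0 ?powR_gt0 ?r0// addr_gt0.
apply/cvgryPge => A; near=> t.
have ct : c + 1 <= t by near: t; apply: nbhs_pinfty_ge; exact: num_real.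
have t0 : 0 < t by apply: lt_le_trans ct; rewrite addr_gt0.
have := L t ct; rewrite -ler_pdivrMr ?powR_gt0 ?addr_gt0// => H.
apply: (@le_trans _ _ (t * (r (c + 1) * t `^ p / (c + 1) `^ p))); last by rewrite ler_pM2l.
have -> : t * (r (c + 1) * t `^ p / (c + 1) `^ p) = r (c + 1) / (c + 1) `^ p * t `^ (1 + p).
  by rewrite [1 + p]addrC -powR_mulr//; ring.
rewrite -ler_pdivrMl//; near: t; move/cvgryPge : (powR_cvgy p1); exact.
Unshelve. all: by end_near. Qed.

(** The denominator [t * r t] has derivative [r t] times [1 - t * a t / r t], and this factor tends
    to [3 - k > 0]. *)
Lemma karamata_R1r : R1 t / (t * r t) @[t --> +oo] --> (3 - k)^-1.
Proof.
have [c [cr Hc]] : \forall t \near +oo, t * a t / r t < 1.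
  by apply: (cvgr_lt _ karamata_ar); move: k2 k3; lra.
have [c0c c00] : c <= Order.max c 0 /\ 0 <= Order.max c 0 by rewrite !le_max !lexx orbT.
have dg0 x : Order.max c 0 < x -> 0 < r x - x * a x.
  move=> cx; have x0 := le_lt_trans c00 cx.
  have := Hc x (le_lt_trans c0c cx).
  by rewrite ltr_pdivrMr ?r0// mul1r subr_gt0.
apply: (@lhopital_pinfty _ R1 r (fun t => t * r t) (fun t => r t - t * a t) (Order.max c 0)).
- by move=> x cx; apply: dR1; exact: le_lt_trans cx.
- move=> x cx; have x0 := le_lt_trans c00 cx.
  have -> : r x - x * a x = x *: (- a x) + r x *: 1 by rewrite /GRing.scale/=; ring.
  by apply: is_deriveM; exact: dr.
- exact: dg0.
- exact: karamata_rT_oo.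
- have -> : (3 - k)^-1 = (1 - (k - 2))^-1 by congr (_ ^-1); ring.
  have : (1 - t * a t / r t)^-1 @[t --> +oo] --> (1 - (k - 2))^-1.
    apply: cvgV; first by rewrite gt_eqF//; move: k2 k3; lra.
    by apply: cvgB; [exact: cvg_cst|exact: karamata_ar].
  apply: cvg_trans; apply: near_eq_cvg; near=> t.
  have t0 : 0 < t by near: t; exact: near_gt0.
  have ct : Order.max c 0 < t by near: t; exact: near_gt0.
  have rt := r0 t0.
  have := dg0 t ct => dg.
  by field; rewrite !gt_eqF//=; move: k2 k3; lra.
Unshelve. all: by end_near. Qed.

Lemma karamata_R1_oo : R1 t @[t --> +oo] --> +oo.
Proof.
apply/cvgryPge => A; near=> t.
have t0 : 0 < t by near: t; exact: near_gt0.
have k30 : 0 < (3 - k)^-1 / 2 by rewrite divr_gt0 ?invr_gt0//; move: k2 k3; lra.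
have H : (3 - k)^-1 / 2 <= R1 t / (t * r t).
  near: t; apply: (cvgr_ge _ karamata_R1r).
  by rewrite ltr_pdivrMr// ltr_pMr ?ltrDl// invr_gt0; move: k2 k3; lra.
move: H; rewrite ler_pdivlMr ?mulr_gt0 ?r0//; apply: le_trans.
rewrite -ler_pdivrMl//; near: t.
move/cvgryPge : karamata_rT_oo; exact.
Unshelve. all: by end_near. Qed.

Lemma karamata_TR1_oo : t * R1 t @[t --> +oo] --> +oo.
Proof.
apply/cvgryPge => A; near=> t.
have t0 : 1 < t by near: t; exact: near_gt0.
apply: (@le_trans _ _ (R1 t)); first by near: t; move/cvgryPge : karamata_R1_oo; exact.
by rewrite ler_peMl ?(ltW t0)// ltW// R1p// (lt_trans _ t0).
Unshelve. all: by end_near. Qed.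

(** The quotient of derivatives is [R1 / (R1 + t * r)], where [t * r / R1] tends to [3 - k]. *)
Lemma karamata_R2R1 : R2 t / (t * R1 t) @[t --> +oo] --> (4 - k)^-1.
Proof.
apply: (@lhopital_pinfty _ R2 R1 (fun t => t * R1 t) (fun t => R1 t + t * r t) 0).
- move=> x x0.
  have -> : R1 x + x * r x = x *: (r x) + R1 x *: 1 by rewrite /GRing.scale/=; ring.
  by apply: is_deriveM; exact: dR1.
- by move=> x x0; rewrite addr_gt0 ?mulr_gt0 ?R1p ?r0.
- exact: karamata_TR1_oo.
- have -> : (4 - k)^-1 = (1 + ((3 - k)^-1)^-1)^-1 by rewrite invrK; congr (_ ^-1); ring.
  have : (1 + (R1 t / (t * r t))^-1)^-1 @[t --> +oo] --> (1 + ((3 - k)^-1)^-1)^-1.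
    apply: cvgV; first by rewrite invrK gt_eqF//; move: k2 k3; lra.
    apply: cvgD; first exact: cvg_cst.
    by apply: cvgV; [rewrite invr_eq0 gt_eqF//; move: k2 k3; lra|exact: karamata_R1r].
  apply: cvg_trans; apply: near_eq_cvg; near=> t.
  have t0 : 0 < t by near: t; exact: near_gt0.
  have rt := r0 t0; have Rt := R1p t0; have trt := mulr_gt0 t0 rt.
  by field; rewrite !gt_eqF//= ?addr_gt0.
Unshelve. all: by end_near. Qed.

Lemma karamata_R2_oo : R2 t @[t --> +oo] --> +oo.
Proof.
apply/cvgryPge => A; near=> t.
have t0 : 0 < t by near: t; exact: near_gt0.
have k30 : 0 < (4 - k)^-1 / 2 by rewrite divr_gt0 ?invr_gt0//; move: k2 k3; lra.
have H : (4 - k)^-1 / 2 <= R2 t / (t * R1 t).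
  near: t; apply: (cvgr_ge _ karamata_R2R1).
  by rewrite ltr_pdivrMr// ltr_pMr ?ltrDl// invr_gt0; move: k2 k3; lra.
move: H; rewrite ler_pdivlMr ?mulr_gt0 ?R1p//; apply: le_trans.
rewrite -ler_pdivrMl//; near: t.
move/cvgryPge : karamata_TR1_oo; exact.
Unshelve. all: by end_near. Qed.

Lemma karamata_R2a :
  R2 t / (t ^+ 3 * a t) @[t --> +oo] --> ((k - 2) * (3 - k) * (4 - k))^-1.
Proof.
have -> : ((k - 2) * (3 - k) * (4 - k))^-1 = (4 - k)^-1 * (3 - k)^-1 * (k - 2)^-1.
  by rewrite !invfM; ring.
have : R2 t / (t * R1 t) * (R1 t / (t * r t)) * (t * a t / r t)^-1 @[t --> +oo]
    --> (4 - k)^-1 * (3 - k)^-1 * (k - 2)^-1.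
  apply: cvgM; first by apply: cvgM; [exact: karamata_R2R1|exact: karamata_R1r].
  by apply: cvgV; [rewrite gt_eqF//; move: k2 k3; lra|exact: karamata_ar].
apply: cvg_trans; apply: near_eq_cvg; near=> t.
have t0 : 0 < t by near: t; exact: near_gt0.
have rt := r0 t0; have Rt := R1p t0; have at0 := a0 t0.
by field; rewrite !gt_eqF.
Unshelve. all: by end_near. Qed.

Lemma karamata_rv_R2 (x : R) : 0 < x -> R2 (t * x) / R2 t @[t --> +oo] --> x `^ (4 - k).
Proof.
move=> x0; have -> : 4 - k = - (k - 2) + 1 + 1 by ring.
have R1RV : R1 (t * x) / R1 t @[t --> +oo] --> x `^ (- (k - 2) + 1).
  by rewrite -powR_mulr//; exact: (rv_lhopital x0 dR1 r0 karamata_R1_oo (karamata_rv_r x0)).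
by rewrite -powR_mulr//; exact: (rv_lhopital x0 dR2 R1p karamata_R2_oo R1RV).
Qed.

(** The logarithmic derivative [t * R1 t / R2 t] tends to [4 - k > g], hence is eventually at least
    [g]. *)
Lemma karamata_potter (g : R) : g < 4 - k -> exists2 c : R, 0 < c &
  forall x y, c < x -> x <= y -> R2 x * y `^ g <= R2 y * x `^ g.
Proof.
move=> gk.
have H : (R2 t / (t * R1 t))^-1 @[t --> +oo] --> ((4 - k)^-1)^-1.
  by apply: cvgV; [rewrite invr_eq0 gt_eqF//; move: k2 k3; lra|exact: karamata_R2R1].
have [c [cr Hc]] : \forall t \near +oo, g <= (R2 t / (t * R1 t))^-1.
  by apply: (cvgr_ge _ H); rewrite invrK.
pose c' := Order.max c 1.
have c'0 : 0 < c' by rewrite lt_max ltr01 orbT.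
exists c' => // x y cx xy.
apply: (@log_derivative_mono R R2 R1 c' g (ltW c'0)) => // z cz.
  by apply: dR2; exact: lt_trans cz.
have z0 := lt_trans c'0 cz.
have cz' : c < z by apply: le_lt_trans cz; rewrite le_max lexx.
have := Hc z cz'.
rewrite invf_div ler_pdivlMr ?R2p//.
Qed.

End Karamata.

(** * Overlaps of trawl sets and their double sums *)

Section RintegralDominated.
Context d (T : measurableType d) (R : realType) (mu : {measure set T -> \bar R}).

Lemma Rdominated_cvg (D : set T) (f_ : nat -> T -> R) (f g : T -> R) :
  measurable D -> (forall n, measurable_fun D (f_ n)) -> measurable_fun D f ->
  (forall x, D x -> f_ n x @[n --> \oo] --> f x) ->
  mu.-integrable D (EFin \o g) ->
  (forall n x, D x -> `|f_ n x| <= g x) ->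
  \int[mu]_(x in D) f_ n x @[n --> \oo] --> \int[mu]_(x in D) f x.
Proof.
move=> mD mf_ mf ff ig fg.
have [|||| fi _ H] := @dominated_convergence _ _ _ mu D mD (fun n => EFin \o f_ n) (EFin \o f) (EFin \o g) _ _ _ ig.
- by move=> n; exact/measurable_EFinP.
- exact/measurable_EFinP.
- by apply/aeW => x Dx /=; apply/fine_cvgP; split; [exact: nearW|exact: ff].
- by apply/aeW => x n Dx /=; rewrite lee_fin fg.
move: H; rewrite /= /Rintegral.
have : (\int[mu]_(x in D) (EFin \o f) x)%E \is a fin_num by exact: integrable_fin_num.
by move=> /fineK <- /fine_cvgP[].
Qed.

End RintegralDominated.

(** * Primitives and tail integrals of continuous functions on the half-line *)

Section HalfLineIntegral.
Context {R : realType}.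
Implicit Types f : R -> R.
Notation mu := (@lebesgue_measure R).

Lemma within_itvcy_sub f (x : R) : {within `[0, +oo[, continuous f} ->
  {within `[0, x], continuous f}.
Proof.
by apply: continuous_subspaceW => y; rewrite /= !in_itv/= => /andP[->].
Qed.

Lemma within_itvcy_integrable f (x : R) : {within `[0, +oo[, continuous f} ->
  mu.-integrable `[0, x] (EFin \o f).
Proof.
move=> cf; apply: continuous_compact_integrable; first exact: segment_compact.
exact: within_itvcy_sub.
Qed.

Lemma primitive_is_derive f (x : R) : {within `[0, +oo[, continuous f} -> 0 < x ->
  is_derive x 1 (fun y => \int[mu]_(t in `[0, y]) f t) (f x).
Proof.
move=> cf x0; have x1 : x < x + 1 by rewrite ltrDl.
have cfx : {for x, continuous f}.
  by have /continuous_within_itvcyP[+ _] := cf; apply; rewrite in_itv/= x0.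
have [d1 d2] := continuous_FTC1_closed x1 (within_itvcy_integrable (x + 1) cf) x0 cfx.
by split; [exact: d1|rewrite -derive1E].
Qed.

Lemma primitive_continuous f : {within `[0, +oo[, continuous f} ->
  {within `[0, +oo[, continuous (fun y => \int[mu]_(t in `[0, y]) f t)}.
Proof.
move=> cf; apply/continuous_within_itvcyP; split.
  move=> x; rewrite in_itv/= andbT => x0.
  have [+ _] := primitive_is_derive cf x0.
  by move/derivable1_diffP/differentiable_continuous.
rewrite set_itv1 Rintegral_set1.
have := parameterized_integral_cvg_left ltr01 (within_itvcy_integrable 1 cf).
by move/cvg_at_right_filter.
Qed.

Lemma primitive_gt0 f (x : R) : {within `[0, +oo[, continuous f} ->
  (forall t, 0 < t -> 0 < f t) -> 0 < x -> 0 < \int[mu]_(t in `[0, x]) f t.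
Proof.
move=> cf f0 x0.
have cP := within_itvcy_sub (x := x) (primitive_continuous cf).
have dP z : z \in `]0, x[ -> is_derive z 1 (fun y => \int[mu]_(t in `[0, y]) f t) (f z).
  by rewrite in_itv/= => /andP[z0 _]; exact: primitive_is_derive.
have [z] := MVT x0 dP cP.
rewrite in_itv/= => /andP[z0 _].
rewrite set_itv1 Rintegral_set1 !subr0 => ->.
by rewrite mulr_gt0// f0.
Qed.

Lemma primitive_ndecr f (x y : R) : {within `[0, +oo[, continuous f} ->
  (forall t, 0 <= t -> 0 <= f t) -> 0 <= x -> x <= y ->
  \int[mu]_(t in `[0, x]) f t <= \int[mu]_(t in `[0, y]) f t.
Proof.
move=> cf f0 x0 xy; rewrite -subr_ge0 Rintegral_itvB//; last exact: within_itvcy_integrable.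
apply: Rintegral_ge0 => t /=; rewrite in_itv/= => /andP[xt _].
by apply: f0; rewrite ltW// (le_lt_trans _ xt).
Qed.

Lemma primitive_bounds f (x y : R) : {within `[0, +oo[, continuous f} ->
  (forall s t, 0 <= s -> s <= t -> f t <= f s) -> 0 <= x -> x <= y ->
  (y - x) * f y <= \int[mu]_(t in `[0, y]) f t - \int[mu]_(t in `[0, x]) f t <= (y - x) * f x.
Proof.
move=> cf fdecr x0 xy.
have cP := continuous_subspaceW _ (primitive_continuous cf).
have sub : `[x, y] `<=` `[0, +oo[.
  by move=> z /=; rewrite !in_itv/= andbT => /andP[xz _]; rewrite (le_trans x0).
have dP z : z \in `]x, y[ -> is_derive z 1 (fun y => \int[mu]_(t in `[0, y]) f t) (f z).
  by rewrite in_itv/= => /andP[z0 _]; apply: primitive_is_derive => //; exact: le_lt_trans z0.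
have [z] := MVT_segment xy dP (cP _ sub).
rewrite in_itv/= => /andP[xz zy] ->.
rewrite ![_ * f _]mulrC !ler_wpM2r ?subr_ge0//; apply: fdecr => //.
exact: le_trans xz.
Qed.

Section tail.
Context (f : R -> R) (cf : {within `[0, +oo[, continuous f})
  (f0 : forall t, 0 <= t -> 0 <= f t)
  (fi : mu.-integrable `[0, +oo[ (EFin \o f)).
Let F (s : R) := \int[mu]_(t in `[s, +oo[) f t.

Lemma tail_integralE (s : R) : 0 <= s -> F s = F 0 - \int[mu]_(t in `[0, s]) f t.
Proof.
move=> s0; rewrite /F Rintegral_itvB//.
rewrite Rintegral_itv_obnd_cbnd//.
apply: integrableS fi => //; exact: subset_itvr.
Qed.


Lemma tail_integral_is_derive (s : R) : 0 < s -> is_derive s 1 F (- f s).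
Proof.
move=> s0; have D := is_deriveB (is_derive_cst (F 0) s 1) (primitive_is_derive cf s0).
rewrite -[- f s]sub0r; apply: near_eq_is_derive D.
near=> t; rewrite [RHS]tail_integralE//.
by near: t; apply: (@filterS _ _ _ (fun t => 0 < t)); [move=> t /ltW|exact: lt_nbhsr].
Unshelve. all: by end_near. Qed.

Lemma tail_integral_ge0 (s : R) : 0 <= s -> 0 <= F s.
Proof.
move=> s0; apply: Rintegral_ge0 => t /=; rewrite in_itv/= andbT => st.
by apply: f0; exact: le_trans st.
Qed.

Lemma tail_integral_nincr (s t : R) : 0 <= s -> s <= t -> F t <= F s.
Proof.
move=> s0 st; rewrite (tail_integralE s0) (tail_integralE (le_trans s0 st)).
by rewrite lerD2l lerN2; exact: primitive_ndecr.
Qed.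

Lemma tail_integral_continuous : {within `[0, +oo[, continuous F}.
Proof.
have cP := primitive_continuous cf.
apply/continuous_within_itvcyP; split.
  move=> x; rewrite in_itv/= andbT => x0.
  have [+ _] := tail_integral_is_derive x0.
  by move/derivable1_diffP/differentiable_continuous.
have /continuous_within_itvcyP[_] := cP.
rewrite set_itv1 Rintegral_set1 => H.
have : F 0 - \int[mu]_(t in `[0, x]) f t @[x --> (0:R)^'+] --> F 0 - 0.
  by apply: cvgB => //; exact: cvg_cst.
rewrite subr0; apply: cvg_trans; apply: near_eq_cvg; near=> x.
by rewrite [RHS]tail_integralE//.
Unshelve. all: by end_near. Qed.

(** Dominated convergence gives the limit along the integers, and monotonicity extends it to real
    arguments. *)
Lemma tail_integral_cvg0 : F s @[s --> +oo] --> (0 : R).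
Proof.
have H : F n%:R @[n --> \oo] --> (0 : R).
  have mc n : measurable_fun (`[0, +oo[ : set R) (\1_(`[n%:R, +oo[ : set R) : R -> R).
    exact: measurable_indic.
  have mf : measurable_fun (`[0, +oo[ : set R) f.
    by apply/measurable_EFinP; case/integrableP : fi.
  have := @Rdominated_cvg _ _ _ mu `[0, +oo[ (fun n x => f x * \1_(`[n%:R, +oo[ : set R) x) (cst 0) f.
  rewrite Rintegral_cst// mul0r.
  have -> : (fun n => \int[mu]_(x in `[0, +oo[) (f x * \1_(`[n%:R, +oo[ : set R) x)) = (fun n => F n%:R).
    apply/funext => n; rewrite /F -[in RHS](setIidr (_ : `[n%:R, +oo[ `<=` (`[0, +oo[ : set R))).
      rewrite Rintegral_mkcondr; apply: eq_Rintegral => x _.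
      by rewrite /= patchE indicE; case: ifPn => xn; rewrite ?mulr1// mulr0.
    by move=> x /=; rewrite !in_itv/= !andbT; apply: le_trans; rewrite ler0n.
  apply => //.
  - by move=> n; apply: measurable_funM.
  - move=> x _; have [N xN] : exists N, x < N%:R.
      by exists (Num.bound `|x|); apply: le_lt_trans (ler_norm x) _; exact: archi_boundP.
    apply: cvg_near_cst.
    exists N => // n /= Nn; rewrite indicE memNset ?mulr0//= in_itv/= andbT.
    by apply/negP; rewrite -ltNge (lt_le_trans xN)// ler_nat.
  - move=> n x /=; rewrite in_itv/= andbT => x0.
    rewrite normrM (ger0_norm (f0 x0)) ler_piMr ?f0// indicE.
    by case: (_ \in _); rewrite ?normr1 ?normr0.
apply/cvgrPdist_le => e e0.
have [N _ HN] : \forall n \near \oo, F n%:R <= e by exact: (cvgr_le _ H).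
near=> s.
have sN : N%:R <= s by near: s; apply: nbhs_pinfty_ge; exact: num_real.
have s0 : 0 <= s by apply: le_trans sN; rewrite ler0n.
rewrite sub0r normrN ger0_norm ?tail_integral_ge0//.
apply: le_trans (HN N (leqnn N)); apply: tail_integral_nincr => //.
Unshelve. all: by end_near. Qed.

Lemma tail_integral_gt0 (s : R) : (forall t, 0 < t -> 0 < f t) -> 0 <= s -> 0 < F s.
Proof.
move=> fp s0; have s1 : s <= s + 1 by rewrite lerDl.
have s10 : 0 <= s + 1 by exact: le_trans s1.
suff : F (s + 1) < F s by apply: le_lt_trans; exact: tail_integral_ge0.
rewrite (tail_integralE s0) (tail_integralE s10) ltrD2l ltrN2.
have cP := primitive_continuous cf.
have sub : `[s, s + 1] `<=` (`[0, +oo[ : set R).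
  by move=> z /=; rewrite !in_itv/= andbT => /andP[xz _]; rewrite (le_trans s0).
have dP z : z \in `]s, s + 1[ -> is_derive z 1 (fun y => \int[mu]_(t in `[0, y]) f t) (f z).
  by rewrite in_itv/= => /andP[z0 _]; apply: primitive_is_derive => //; exact: le_lt_trans z0.
have s1' : s < s + 1 by rewrite ltrDl.
have [z] := MVT s1' dP (continuous_subspaceW sub cP).
rewrite in_itv/= -subr_gt0 => /andP[sz _] ->; rewrite mulr_gt0 ?subr_gt0// fp//.
exact: le_lt_trans sz.
Qed.

End tail.

End HalfLineIntegral.

Section TrawlAsymptotics.
Context {R : realType} (a a' : R -> R) (k : R).
Notation mu := (@lebesgue_measure R).
Context (a_trawl : trawl_function a) (k2 : 2 < k) (k3 : k < 3)
  (a'0 : forall y, 0 <= y -> 0 < a' y) (a'c : {within `[0, +oo[, continuous a'})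
  (a'RV : regularly_varying k a')
  (aE : forall s, 0 <= s -> (a s)%:E = (\int[mu]_(y in `[s, +oo[) (a' y)%:E)%E).

(** This is the area common to two trawl sets at time distance [s]. Twice its double primitive
    [overlap2 x] is the integral of [overlap |u - v|] over the square of side [x], which is the
    variance of the integrated Gaussian part up to the factor [b ^ 2]. *)
Definition overlap (s : R) : R := \int[mu]_(y in `[s, +oo[) a y.
Definition overlap1 (x : R) : R := \int[mu]_(y in `[0, x]) overlap y.
Definition overlap2 (x : R) : R := \int[mu]_(y in `[0, x]) overlap1 y.
Notation r := overlap.
Notation R1 := overlap1.
Notation R2 := overlap2.

Let a_tailE s : 0 <= s -> a s = \int[mu]_(y in `[s, +oo[) a' y.
Proof. by move=> s0; rewrite /Rintegral -aE. Qed.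

Let a'i : mu.-integrable `[0, +oo[ (EFin \o a').
Proof.
apply/integrableP; split.
  apply/measurable_EFinP; exact: subspace_continuous_measurable_fun.
under eq_integral => x.
  rewrite inE/= in_itv/= andbT => x0.
  rewrite gtr0_norm ?a'0//; over.
by rewrite -aE// ltry.
Qed.

Let a'ge0 y : 0 <= y -> 0 <= a' y. Proof. by move=> /a'0/ltW. Qed.

Let ac : {within `[0, +oo[, continuous a} := trawl_continuous a_trawl.
Let a_ge0 s : 0 <= s -> 0 <= a s. Proof. exact: trawl_ge0. Qed.
Let ai : mu.-integrable `[0, +oo[ (EFin \o a) := trawl_integrable a_trawl.

Lemma trawl_gt0 s : 0 <= s -> 0 < a s.
Proof.
move=> s0; rewrite a_tailE//.
by apply: (tail_integral_gt0 a'c a'ge0 a'i) => // t t0; exact: a'0 (ltW t0).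
Qed.

Lemma trawl_is_derive (s : R) : 0 < s -> is_derive s 1 a (- a' s).
Proof.
move=> s0; apply: near_eq_is_derive (tail_integral_is_derive a'c a'i s0).
near=> t; rewrite a_tailE//.
by near: t; apply: (@filterS _ _ _ (fun t => 0 < t)); [move=> t /ltW|exact: lt_nbhsr].
Unshelve. all: by end_near. Qed.

Lemma trawl_cvg0 : a s @[s --> +oo] --> (0 : R).
Proof.
apply: cvg_trans (tail_integral_cvg0 a'c a'ge0 a'i).
apply: near_eq_cvg; near=> s; rewrite a_tailE//.
Unshelve. all: by end_near. Qed.

Lemma overlap_is_derive (s : R) : 0 < s -> is_derive s 1 r (- a s).
Proof. exact: tail_integral_is_derive. Qed.

Lemma overlap_gt0 s : 0 <= s -> 0 < r s.
Proof.
by apply: (tail_integral_gt0 ac a_ge0 ai) => t t0; apply: trawl_gt0; exact: ltW.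
Qed.

Lemma overlap_ge0 s : 0 <= s -> 0 <= r s.
Proof. by move=> /overlap_gt0/ltW. Qed.

Lemma overlap_nincr s t : 0 <= s -> s <= t -> r t <= r s.
Proof. exact: (tail_integral_nincr ac a_ge0 ai). Qed.

Lemma overlap_cvg0 : r s @[s --> +oo] --> (0 : R).
Proof. exact: tail_integral_cvg0. Qed.

Lemma overlap_continuous : {within `[0, +oo[, continuous r}.
Proof. exact: tail_integral_continuous. Qed.

Lemma overlap1_gt0 t : 0 < t -> 0 < R1 t.
Proof. by apply: primitive_gt0; [exact: overlap_continuous|move=> s /ltW/overlap_gt0]. Qed.

Lemma overlap1_0 : R1 0 = 0.
Proof. by rewrite /R1 set_itv1 Rintegral_set1. Qed.

Lemma overlap2_0 : R2 0 = 0.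
Proof. by rewrite /R2 set_itv1 Rintegral_set1. Qed.

Lemma overlap1_ge0 t : 0 <= t -> 0 <= R1 t.
Proof.
by rewrite le_eqVlt => /predU1P[<-|/overlap1_gt0/ltW//]; rewrite overlap1_0.
Qed.

Lemma overlap1_continuous : {within `[0, +oo[, continuous R1}.
Proof. by apply: primitive_continuous; exact: overlap_continuous. Qed.

Lemma overlap1_is_derive (s : R) : 0 < s -> is_derive s 1 R1 (r s).
Proof. by apply: primitive_is_derive; exact: overlap_continuous. Qed.

Lemma overlap2_is_derive (s : R) : 0 < s -> is_derive s 1 R2 (R1 s).
Proof. by apply: primitive_is_derive; exact: overlap1_continuous. Qed.

Lemma overlap2_gt0 t : 0 < t -> 0 < R2 t.
Proof. by apply: primitive_gt0; [exact: overlap1_continuous|exact: overlap1_gt0]. Qed.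

Lemma overlap2_ge0 t : 0 <= t -> 0 <= R2 t.
Proof.
by rewrite le_eqVlt => /predU1P[<-|/overlap2_gt0/ltW//]; rewrite overlap2_0.
Qed.

Lemma overlap1_ndecr s t : 0 <= s -> s <= t -> R1 s <= R1 t.
Proof. by apply: primitive_ndecr; [exact: overlap_continuous|exact: overlap_ge0]. Qed.

Lemma overlap2_ndecr s t : 0 <= s -> s <= t -> R2 s <= R2 t.
Proof. by apply: primitive_ndecr; [exact: overlap1_continuous|exact: overlap1_ge0]. Qed.

Lemma overlap1_bounds s t : 0 <= s -> s <= t ->
  (t - s) * r t <= R1 t - R1 s <= (t - s) * r s.
Proof. by apply: primitive_bounds; [exact: overlap_continuous|exact: overlap_nincr]. Qed.

Lemma overlap2_bounds s t : 0 <= s -> s <= t ->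
  (t - s) * R1 s <= R2 t - R2 s <= (t - s) * R1 t.
Proof.
move=> s0 st.
have sub : `[s, t] `<=` (`[0, +oo[ : set R).
  by move=> z /=; rewrite !in_itv/= andbT => /andP[xz _]; rewrite (le_trans s0).
have dP z : z \in `]s, t[ -> is_derive z 1 R2 (R1 z).
  by rewrite in_itv/= => /andP[z0 _]; apply: overlap2_is_derive; exact: le_lt_trans z0.
have cR2 : {within `[0, +oo[, continuous R2} by exact: (primitive_continuous overlap1_continuous).
have [z] := MVT_segment st dP (continuous_subspaceW sub cR2).
rewrite in_itv/= => /andP[sz zt] ->.
rewrite ![_ * R1 _]mulrC !ler_wpM2r ?subr_ge0//; apply: overlap1_ndecr => //.
exact: le_trans sz.
Qed.

(** [R2] grows by at least [x * R1 x] on [[x, 2 * x]], since [R1] is non-decreasing. The asymptotics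
    of [R2] thus bound [R1] as well. *)
Lemma overlap2_doubling x : 0 <= x -> x * R1 x <= R2 (2 * x).
Proof.
move=> x0; have x2 : x <= 2 * x by lra.
have /andP[+ _] := overlap2_bounds x0 x2.
have -> : 2 * x - x = x by ring.
by move/le_trans; apply; rewrite gerBl overlap2_ge0.
Qed.

Let a'p (t : R) : 0 < t -> 0 < a' t. Proof. by move=> /ltW/a'0. Qed.
Let ap (t : R) : 0 < t -> 0 < a t. Proof. by move=> /ltW/trawl_gt0. Qed.
Let rp (t : R) : 0 < t -> 0 < r t. Proof. by move=> /ltW/overlap_gt0. Qed.
Let amono (s t : R) : 0 < s -> s <= t -> a t <= a s.
Proof. by move=> /ltW; exact: trawl_nonincreasing. Qed.

Definition limit_const : R := ((k - 2) * (3 - k) * (4 - k))^-1.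

Lemma limit_const_gt0 : 0 < limit_const.
Proof. by rewrite invr_gt0 !mulr_gt0 ?subr_gt0//; move: k2 k3; lra. Qed.

Lemma overlap2_cvg : R2 t / (t ^+ 3 * a t) @[t --> +oo] --> limit_const.
Proof.
exact: (karamata_R2a k2 k3 a'p ap rp trawl_is_derive overlap_is_derive
  overlap1_is_derive overlap2_is_derive amono trawl_cvg0 overlap_cvg0 overlap1_gt0 a'RV).
Qed.

Lemma overlap2_cvg_seq (T tau : R^nat) (t : R) :
  T n @[n --> \oo] --> +oo -> (forall n, 0 <= tau n) -> tau n @[n --> \oo] --> t ->
  R2 (T n * tau n) / (T n ^+ 3 * a (T n)) @[n --> \oo] --> t `^ (4 - k) * limit_const.
Proof.
move=> Too tau0 taut.
have RV x : 0 < x -> R2 (s * x) / R2 s @[s --> +oo] --> x `^ (4 - k).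
  exact: (karamata_rv_R2 k2 k3 a'p ap rp trawl_is_derive overlap_is_derive
    overlap1_is_derive overlap2_is_derive amono trawl_cvg0 overlap_cvg0 overlap1_gt0 a'RV).
have k4 : 0 < 4 - k by move: k3; lra.
have H1 := rv_cvg_seq k4 overlap2_ge0 overlap2_gt0 overlap2_ndecr RV Too tau0 taut.
have H2 : R2 (T n) / (T n ^+ 3 * a (T n)) @[n --> \oo] --> limit_const.
  exact: (cvg_comp T (fun t => R2 t / (t ^+ 3 * a t)) Too overlap2_cvg).
apply: cvg_trans (cvgM H1 H2); apply: near_eq_cvg; near=> n.
have Tn : 0 < T n by near: n; move/cvgryPgt : Too; exact.
have /= RT := overlap2_gt0 Tn; have aT := ap Tn.
by rewrite /=; field; rewrite !gt_eqF.
Unshelve. all: by end_near. Qed.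

Lemma overlap2_potter : exists g C T0 c : R, [/\ 1 < g < 2, 0 < C, 0 < T0, 0 < c &
  forall T, T0 <= T -> c * T `^ g <= T ^+ 3 * a T /\
    forall x, 0 <= x -> x <= T -> R2 x <= C * (T ^+ 3 * a T) * (x / T) `^ g].
Proof.
(* The midpoint of 1 and [4 - k]: above 1 because [k < 3], and below the index of [R2], as Potter's
   bound requires. *)
pose g := (5 - k) / 2.
have g12 : 1 < g < 2 by rewrite /g; move: k2 k3; lra.
have /andP[g1 g2] := g12.
have g0 : 0 < g by lra.
have gk : g < 4 - k by rewrite /g; move: k2 k3; lra.
have [c c0 Hc] := karamata_potter k2 k3 a'p ap rp trawl_is_derive overlap_is_derive
  overlap1_is_derive overlap2_is_derive amono trawl_cvg0 overlap_cvg0 overlap1_gt0 overlap2_gt0 a'RV gk.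
have K0 := limit_const_gt0.
have [N [Nr HN]] : \forall t \near +oo, `|limit_const - R2 t / (t ^+ 3 * a t)| <= limit_const / 2.
  by move/cvgrPdist_le : overlap2_cvg; apply; rewrite divr_gt0.
pose T0 := Order.max (c + 1) (N + 1).
have cT0 : c + 1 <= T0 by rewrite le_max lexx.
have NT0 : N + 1 <= T0 by rewrite le_max lexx orbT.
have T00 : 0 < T0 by apply: lt_le_trans cT0; rewrite addr_gt0.
pose c1 := R2 (c + 1) / (c + 1) `^ g.
have c10 : 0 < c1 by rewrite divr_gt0 ?powR_gt0 ?overlap2_gt0 ?addr_gt0.
(* The summand 1 serves [x > c], where Potter's bound applies; the other one serves [x <= c], where
   [R2 x <= r 0 * x ^ 2] and [R2 T >= c1 * T ^ g]. *)
pose C1 := 1 + r 0 * c `^ (2 - g) / c1.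
have C10 : 0 < C1.
  by rewrite addr_gt0// divr_gt0// mulr_gt0 ?powR_gt0 ?overlap_gt0.
pose K2 := 3 / 2 * limit_const.
have K20 : 0 < K2 by rewrite mulr_gt0.
exists g, (C1 * K2), T0, (c1 / K2); split => //; [by rewrite mulr_gt0|by rewrite divr_gt0|].
move=> T TT0.
have Tp : 0 < T by apply: lt_le_trans TT0.
have cT : c + 1 <= T by apply: le_trans TT0.
have aT := ap Tp.
have T3a : 0 < T ^+ 3 * a T by rewrite mulr_gt0 ?exprn_gt0.
have R2K : R2 T <= K2 * (T ^+ 3 * a T).
  have NT : N < T by apply: lt_le_trans (le_trans NT0 TT0); rewrite ltrDl.
  have := HN T NT; rewrite ler_norml => /andP[+ _].
  rewrite -ler_pdivrMr// /K2.
  set u := R2 T / _; set v := limit_const; lra.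
have R2c : c1 * T `^ g <= R2 T.
  rewrite /c1 mulrAC ler_pdivrMr ?powR_gt0 ?addr_gt0//.
  by apply: Hc => //; rewrite ltrDl.
split.
  by rewrite mulrAC ler_pdivrMr// (mulrC _ K2); exact: le_trans R2K.
move=> x; rewrite le_eqVlt => /predU1P[<- _|x0 xT].
  by rewrite overlap2_0 !mulr_ge0 ?powR_ge0 ?ltW.
have Tg : 0 < T `^ g by rewrite powR_gt0.
have xg : 0 < x `^ g by rewrite powR_gt0.
suff H : R2 x * T `^ g <= C1 * R2 T * x `^ g.
  rewrite powRM ?invr_ge0 ?(ltW x0) ?(ltW Tp)// -powR_inv1 ?(ltW Tp)// -powRrM mulN1r powRN.
  rewrite mulrA ler_pdivlMr//; apply: le_trans H _.
  by rewrite ler_wpM2r ?(ltW xg)// -[leRHS]mulrA ler_wpM2l// ltW.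
have [xc|cx] := leP x c; last first.
  have := Hc x T cx xT; move/le_trans; apply.
  rewrite ler_wpM2r ?(ltW xg)// ler_peMl ?(ltW (overlap2_gt0 Tp))// lerDl.
  apply: divr_ge0; last exact: ltW.
  by apply: mulr_ge0; [exact: overlap_ge0|exact: powR_ge0].
have R2x : R2 x <= r 0 * x `^ 2.
  have /andP[_] := overlap2_bounds (lexx 0) (ltW x0).
  rewrite overlap2_0 !subr0 => /le_trans; apply.
  have /andP[_] := overlap1_bounds (lexx 0) (ltW x0).
  rewrite overlap1_0 !subr0 => H.
  have -> : r 0 * x `^ 2 = x * (x * r 0) by rewrite powR_mulrn ?(ltW x0)//; ring.
  by rewrite ler_wpM2l// ltW.
apply: le_trans (ler_wpM2r (ltW Tg) R2x) _.
have -> : x `^ 2 = x `^ (2 - g) * x `^ g.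
  by rewrite -powRD ?subrK//; apply/implyP => _; rewrite gt_eqF.
have xc2 : x `^ (2 - g) <= c `^ (2 - g).
  by rewrite ge0_ler_powR ?nnegrE ?subr_ge0 ?(ltW x0) ?(ltW c0) ?(ltW g2).
apply: (@le_trans _ _ (r 0 * (c `^ (2 - g) * x `^ g) * T `^ g)).
  by rewrite ler_wpM2r ?(ltW Tg)// ler_wpM2l ?overlap_ge0// ler_wpM2r ?(ltW xg).
have -> : r 0 * (c `^ (2 - g) * x `^ g) * T `^ g =
    r 0 * c `^ (2 - g) / c1 * (c1 * T `^ g) * x `^ g by field; rewrite gt_eqF.
rewrite ler_wpM2r ?(ltW xg)// /C1 mulrDl mul1r.
apply: (@le_trans _ _ (r 0 * c `^ (2 - g) / c1 * R2 T)).
  apply: ler_wpM2l R2c; apply: divr_ge0; last exact: ltW.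
  by apply: mulr_ge0; [exact: overlap_ge0|exact: powR_ge0].
by rewrite lerDr overlap2_ge0// ltW.
Qed.

Lemma trawl_scale_cvg0 : t * a t @[t --> +oo] --> (0 : R).
Proof.
have H := karamata_ar k2 a'p ap rp trawl_is_derive overlap_is_derive amono trawl_cvg0 overlap_cvg0 a'RV.
have : t * a t / r t * r t @[t --> +oo] --> (k - 2) * 0.
  by apply: cvgM => //; exact: overlap_cvg0.
rewrite mulr0; apply: cvg_trans; apply: near_eq_cvg; near=> t.
have t0 : 0 < t by near: t; apply: nbhs_pinfty_gt; exact: num_real.
by rewrite /= divfK// gt_eqF// rp.
Unshelve. all: by end_near. Qed.


(** * Sums of overlaps on an equidistant grid *)

Section DiscreteSums.
Context (D : R) (D0 : 0 < D).

Definition overlap_sum (N : nat) : R := \sum_(j < N) r (j.+1%:R * D).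

(** A right-endpoint Riemann sum of a non-increasing function is a lower sum, and its error
    telescopes. *)
Lemma overlap_sum_bounds N :
  D * overlap_sum N <= R1 (N%:R * D) <= D * overlap_sum N + D * (r 0 - r (N%:R * D)).
Proof.
elim: N => [|N /andP[IH1 IH2]].
  by rewrite /overlap_sum big_ord0 mulr0 mul0r overlap1_0 subrr mulr0 addr0 lexx.
have N0 : 0 <= N%:R * D by rewrite mulr_ge0// ltW.
have N1 : N%:R * D <= N.+1%:R * D by rewrite ler_pM2r// ler_nat.
have := overlap1_bounds N0 N1.
have -> : N.+1%:R * D - N%:R * D = D by rewrite -natr1; ring.
rewrite /overlap_sum big_ord_recr/= -/(overlap_sum N) !mulrDr => /andP[B1 B2].
by apply/andP; split; lra.
Qed.

Definition overlap_double_sum (N : nat) : R :=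
  \sum_(i < N) \sum_(j < N) r `|i%:R * D - j%:R * D|.

Lemma overlap_double_sumS N :
  overlap_double_sum N.+1 = overlap_double_sum N + 2 * overlap_sum N + r 0.
Proof.
rewrite /overlap_double_sum big_ord_recr/= big_ord_recr/= subrr normr0.
under eq_bigr do rewrite big_ord_recr/=.
rewrite big_split/= -!addrA; congr (_ + _).
have E : \sum_(i < N) r `|i%:R * D - N%:R * D| = overlap_sum N.
  rewrite /overlap_sum (reindex_inj rev_ord_inj)/=; apply: eq_bigr => i _.
  congr (r _); rewrite -mulrBl normrM (gtr0_norm D0) natrB ?ltn_ord//; congr (_ * _).
  by rewrite opprB addrAC subrr add0r normr_nat || rewrite distrC opprB addrC subrK normr_nat.
rewrite E.
under eq_bigr do rewrite distrC.
by rewrite E; ring.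
Qed.

(** The constant 5 is the error of one induction step: 2 from comparing [overlap_sum] with [R1 / D],
    2 from comparing the increment of [R2 / D ^ 2] with [R1 / D], and 1 from the new diagonal term
    [r 0]. *)
Lemma overlap_double_sum_approx N :
  `|overlap_double_sum N - 2 * R2 (N%:R * D) / D ^+ 2| <= 5 * r 0 * N%:R.
Proof.
elim: N => [|N IH].
  by rewrite /overlap_double_sum big_ord0 mul0r overlap2_0 mulr0 mul0r subr0 normr0 mulr0.
have N0 : 0 <= N%:R * D by rewrite mulr_ge0// ltW.
have N1 : N%:R * D <= N.+1%:R * D by rewrite ler_pM2r// ler_nat.
have := overlap2_bounds N0 N1; have := overlap1_bounds N0 N1.
have -> : N.+1%:R * D - N%:R * D = D by rewrite -natr1; ring.
move=> /andP[_ B1] /andP[B2 B3].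
have /andP[S1 S2] := overlap_sum_bounds N.
rewrite overlap_double_sumS -[X in _ <= _ * X]natr1.
have rN0 : 0 <= r (N%:R * D) by exact: overlap_ge0.
have rN : r (N%:R * D) <= r 0 by exact: overlap_nincr.
have r00 : 0 <= r 0 by exact: overlap_ge0.
set G := overlap_double_sum N in IH *; set s := overlap_sum N in S1 S2 *.
set P := R2 (N%:R * D) in IH B2 B3 *.
set Q := R2 (N.+1%:R * D) in B2 B3 *.
set u := R1 (N%:R * D) in S1 S2 B1 B2 *.
set v := R1 (N.+1%:R * D) in B1 B3.
have Dr : 0 <= D * r 0 by rewrite mulr_ge0// ltW.
have DrN : 0 <= D * r (N%:R * D) by rewrite mulr_ge0// ltW.
have DrNN : D * r (N%:R * D) <= D * r 0 by rewrite ler_pM2l.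
have H1 : `|s - u / D| <= r 0.
  rewrite -(ler_pM2l D0) -{1}(gtr0_norm D0) -normrM mulrBr [D * (u / D)]mulrC divfK ?gt_eqF//.
  by rewrite ler_norml; apply/andP; split; lra.
have H2 : `|Q - P - D * u| <= D * (D * r 0).
  have E : D * (v - u) <= D * (D * r 0) by rewrite ler_pM2l//; lra.
  rewrite ler_norml; apply/andP; split; [|lra].
  have : 0 <= D * (D * r 0) by rewrite mulr_ge0// ltW.
  lra.
have H3 : `|(Q - P) / D ^+ 2 - u / D| <= r 0.
  have -> : (Q - P) / D ^+ 2 - u / D = (Q - P - D * u) / (D * D) by field; rewrite gt_eqF.
  rewrite normrM normfV (gtr0_norm (mulr_gt0 D0 D0)) ler_pdivrMr ?mulr_gt0//.
  by rewrite mulrC mulrA in H2 *; lra.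
have -> : G + 2 * s + r 0 - 2 * Q / D ^+ 2 =
  (G - 2 * P / D ^+ 2) + 2 * (s - u / D) - 2 * ((Q - P) / D ^+ 2 - u / D) + r 0.
  by rewrite !mulrBl; ring.
have -> : 5 * r 0 * (N%:R + 1) = 5 * r 0 * N%:R + 5 * r 0 by ring.
move: IH H1 H3; rewrite !ler_norml.
set w := G - _; set x := s - _; set y := _ / _ - _ / _; set z := 5 * _ * _.
by move=> /andP[? ?] /andP[? ?] /andP[? ?]; apply/andP; split; lra.
Qed.

(** The at most [s / D + 1] grid points up to [s] contribute at most [r 0] each; beyond [s] the sum
    is compared with a grid started at 0. *)
Lemma overlap_point_sum (s : R) N : 0 <= s ->
  \sum_(j < N) r `|j%:R * D - s| <= (s / D + 2) * r 0 + R1 (N%:R * D) / D.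
Proof.
move=> s0.
pose p := (Num.truncn (s / D)).+1.
have sD0 : 0 <= s / D by rewrite divr_ge0// ltW.
have ps : s < p%:R * D by rewrite -ltr_pdivrMr// /p; have /andP[] := truncn_itv sD0.
have pl : p%:R <= s / D + 1.
  by rewrite /p -natr1 lerD2r; have /andP[] := truncn_itv sD0.
have r00 : 0 <= r 0 by exact: overlap_ge0.
have /andP[S1 _] := overlap_sum_bounds N.
apply: (@le_trans _ _ (p%:R * r 0 + (r 0 + overlap_sum N))); last first.
  rewrite -(ler_pdivlMl) in S1 => //.
  rewrite (mulrC D^-1) in S1.
  have : p%:R * r 0 <= (s / D + 1) * r 0 by rewrite ler_wpM2r.
  by move: S1; lra.

have step M : \sum_(j < M) r `|j%:R * D - s| <= (minn M p)%:R * r 0 + \sum_(i < M - p) r (i%:R * D).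
  elim: M => [|M IH]; first by rewrite !big_ord0 min0n mul0r add0r.
  rewrite big_ord_recr/=; have [Mp|pM] := ltnP M p.
    have -> : (M.+1 - p = 0)%N by apply/eqP; rewrite subn_eq0.
    move: IH; have -> : (M - p = 0)%N by apply/eqP; rewrite subn_eq0 ltnW.
    rewrite !big_ord0 !addr0 (minn_idPl (ltnW Mp)) => IH.
    by rewrite (minn_idPl Mp) -natr1 mulrDl mul1r lerD// overlap_nincr.
  rewrite subSn// big_ord_recr/= (minn_idPr (leqW pM)).
  move: IH; rewrite (minn_idPr pM) => IH.
  rewrite addrA lerD//; apply: overlap_nincr; first by rewrite mulr_ge0// ltW.
  by rewrite natrB// mulrBl; apply: le_trans (ler_norm _); rewrite lerD2l lerN2 ltW.
apply: le_trans (step N) _; rewrite lerD//.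
  by rewrite ler_wpM2r// ler_nat geq_minr.
have : (N - p <= N)%N by rewrite leq_subr.
case: (N - p)%N => [_|M MN].
  by rewrite big_ord0 addr_ge0// sumr_ge0// => i _; rewrite overlap_ge0// mulr_ge0// ltW.
rewrite big_ord_recl/= mul0r lerD2l /overlap_sum.
rewrite -(big_mkord xpredT (fun i => r (i.+1%:R * D))).
rewrite -[leRHS](big_mkord xpredT (fun i => r (i.+1%:R * D))).
rewrite [leRHS](big_cat_nat (n := M))//=; last exact: ltnW.
by rewrite lerDl sumr_ge0// => i _; rewrite overlap_ge0// mulr_ge0// ltW.
Qed.

End DiscreteSums.

(** * Asymptotics of the norming sequence *)

Section Normalization.
Context (Delta : nat -> R) (Delta_gt0 : forall n, (0 < n)%N -> 0 < Delta n)
  (Delta_cvg0 : Delta n @[n --> \oo] --> 0) (horizon_cvgy : (n%:R * Delta n) @[n --> \oo] --> +oo).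

Let powRS (x p : R) : 0 < x -> x `^ (p + 1) = x `^ p * x.
Proof. by move=> x0; rewrite powRD ?powRr1 ?ltW//; apply/implyP => _; rewrite gt_eqF. Qed.

Definition scaling (n : nat) : R := n%:R * Num.sqrt (a (n%:R * Delta n) * (n%:R * Delta n)).

Let T (n : nat) : R := n%:R * Delta n.
Let A (n : nat) : R := a (T n) * T n.

Let T_gt0 n : (0 < n)%N -> 0 < T n.
Proof. by move=> n0; rewrite mulr_gt0 ?ltr0n// Delta_gt0. Qed.

Let A_gt0 n : (0 < n)%N -> 0 < A n.
Proof. by move=> n0; rewrite mulr_gt0 ?T_gt0// trawl_gt0// ltW// T_gt0. Qed.

Lemma scaling_gt0 n : (0 < n)%N -> 0 < scaling n.
Proof. by move=> n0; rewrite mulr_gt0 ?ltr0n// sqrtr_gt0 A_gt0. Qed.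

Lemma scaling_sqr n : (0 < n)%N -> scaling n ^+ 2 = n%:R ^+ 2 * A n.
Proof. by move=> n0; rewrite exprMn sqr_sqrtr// ltW// A_gt0. Qed.

Let A_cvg0 : A n @[n --> \oo] --> (0 : R).
Proof.
have := cvg_comp _ _ horizon_cvgy trawl_scale_cvg0.
by apply: cvg_trans; apply: near_eq_cvg; near=> n; rewrite /= /A mulrC.
Unshelve. all: by end_near. Qed.

Let TA n : T n ^+ 3 * a (T n) = T n ^+ 2 * A n. Proof. by rewrite /A; ring. Qed.

Let near_pos : \forall n \near \oo, (0 < n)%N.
Proof. exact: nbhs_infty_gt. Qed.

Let near_Delta1 : \forall n \near \oo, Delta n <= 1.
Proof. by have /cvgr_le := Delta_cvg0; apply; exact: ltr01. Qed.

(** [T ^ 2 * A] equals [T ^ 3 * a T], which is at least a multiple of [T ^ g]; so [T * A] is at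
    least of order [T ^ (g - 1)] with [g > 1]. *)
Let TA_cvgy : (T n * A n) @[n --> \oo] --> +oo.
Proof.
have [g [C [T0 [c [/andP[g1 g2] C0 T00 c0 H]]]]] := overlap2_potter.
have g10 : 0 < g - 1 by lra.
have P := cvg_comp _ _ horizon_cvgy (powR_cvgy g10).
apply/cvgryPge => M; near=> n.
have n0 : (0 < n)%N by near: n; exact: near_pos.
have T1 : T0 <= T n by near: n; move/cvgryPge : horizon_cvgy; exact.
have [H1 _] := H _ T1.
have Tn := T_gt0 n0.
have MP : M / c <= T n `^ (g - 1) by near: n; move/cvgryPge : P; exact.
rewrite -(ler_pM2r Tn); apply: (@le_trans _ _ (c * T n `^ g)).
  rewrite ler_pdivrMr// in MP.
  have -> : T n `^ g = T n `^ (g - 1) * T n.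
    by rewrite -powRS// subrK.
  by rewrite mulrA ler_pM2r// mulrC.
by apply: le_trans H1 _; rewrite TA le_eqVlt; apply/orP; left; apply/eqP; ring.
Unshelve. all: by end_near. Qed.

(** Discretisation errors will be of relative order [1 / (n * A n)]. Since [Delta n <= 1]
    eventually, [n] is at least [T n]. *)
Let nA_cvgy : (n%:R * A n) @[n --> \oo] --> +oo.
Proof.
apply/cvgryPge => M; near=> n.
have n0 : (0 < n)%N by near: n; exact: near_pos.
have D1 : Delta n <= 1 by near: n; exact: near_Delta1.
apply: (@le_trans _ _ (T n * A n)).
  by near: n; move/cvgryPge : TA_cvgy; exact.
by rewrite ler_pM2r ?A_gt0// ler_piMr.
Unshelve. all: by end_near. Qed.

Let inv_cvg0 (u : R^nat) : u n @[n --> \oo] --> +oo -> (u n)^-1 @[n --> \oo] --> (0 : R).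
Proof.
move=> uoo; apply/cvgrPdist_le => e e0; near=> n.
have un : e^-1 <= u n by near: n; move/cvgryPge : uoo; exact.
have e1 : 0 < e^-1 by rewrite invr_gt0.
have u0 : 0 < u n by exact: lt_le_trans un.
by rewrite sub0r normrN gtr0_norm ?invr_gt0// -[leRHS]invrK lef_pV2.
Unshelve. all: by end_near. Qed.

Lemma overlap_double_sum_cvg (N : nat -> nat) (t : R) :
  (N n)%:R / n%:R @[n --> \oo] --> t ->
  overlap_double_sum (Delta n) (N n) / scaling n ^+ 2 @[n --> \oo] --> 2 * (t `^ (4 - k) * limit_const).
Proof.
move=> Nt; pose tau n : R := (N n)%:R / n%:R.
have tau0 n : 0 <= tau n by rewrite divr_ge0.
have L := overlap2_cvg_seq horizon_cvgy tau0 Nt.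
have E : 5 * r 0 * (tau n * (n%:R * A n)^-1) @[n --> \oo] --> 5 * r 0 * (t * 0).
  by apply: cvgM; [exact: cvg_cst|apply: cvgM => //; exact: inv_cvg0].
rewrite !mulr0 in E.
have L2 : 2 * (R2 (T n * tau n) / (T n ^+ 3 * a (T n))) @[n --> \oo] --> 2 * (t `^ (4 - k) * limit_const).
  by apply: cvgM; [exact: cvg_cst|exact: L].
have Z : overlap_double_sum (Delta n) (N n) / scaling n ^+ 2 - 2 * (R2 (T n * tau n) / (T n ^+ 3 * a (T n)))
    @[n --> \oo] --> (0 : R).
  apply/cvgrPdist_le => e e0; have /cvgr_le/(_ e e0) E' := E; near=> n.
  have n0 : (0 < n)%N by near: n; exact: near_pos.
  have nn : 0 < n%:R :> R by rewrite ltr0n.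
  have D0 := Delta_gt0 n0; have An := A_gt0 n0.
  rewrite sub0r normrN scaling_sqr// TA.
  have -> : T n * tau n = (N n)%:R * Delta n by rewrite /T /tau; field; rewrite gt_eqF.
  set G := overlap_double_sum _ _; set r2 := R2 _.
  have -> : G / (n%:R ^+ 2 * A n) - 2 * (r2 / (T n ^+ 2 * A n)) =
    (G - 2 * r2 / Delta n ^+ 2) / (n%:R ^+ 2 * A n).
    by rewrite /T; field; rewrite !gt_eqF.
  rewrite normrM [X in _ * X]gtr0_norm; last by rewrite invr_gt0 mulr_gt0// exprn_gt0.
  apply: (@le_trans _ _ (5 * r 0 * (N n)%:R / (n%:R ^+ 2 * A n))).
    apply: ler_wpM2r; last exact: overlap_double_sum_approx.
    by rewrite invr_ge0 mulr_ge0 ?sqr_ge0// ltW.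
  have -> : 5 * r 0 * (N n)%:R / (n%:R ^+ 2 * A n) = 5 * r 0 * (tau n * (n%:R * A n)^-1).
    by rewrite /tau; field; rewrite !gt_eqF.
  by near: n.
have D : overlap_double_sum (Delta n) (N n) / scaling n ^+ 2 - 2 * (R2 (T n * tau n) / (T n ^+ 3 * a (T n))) +
    2 * (R2 (T n * tau n) / (T n ^+ 3 * a (T n))) @[n --> \oo] --> 0 + 2 * (t `^ (4 - k) * limit_const).
  exact: cvgD.
by move: D; under eq_fun do rewrite subrK; rewrite add0r.
Unshelve. all: by end_near. Qed.

Let R1_bound (n : nat) (x : R) : (0 < n)%N -> 0 < x ->
  R1 (x * T n) / (T n * A n) <= x^-1 * (R2 (T n * (2 * x)) / (T n ^+ 3 * a (T n))).
Proof.
move=> n0 x0; have Tn := T_gt0 n0; have An := A_gt0 n0.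
rewrite TA.
have -> : x^-1 * (R2 (T n * (2 * x)) / (T n ^+ 2 * A n)) =
    (x * T n)^-1 * R2 (2 * (x * T n)) / (T n * A n).
  rewrite (_ : T n * (2 * x) = 2 * (x * T n)); last by ring.
  by field; rewrite !gt_eqF.
rewrite ler_pM2r; last by rewrite invr_gt0 mulr_gt0.
have xT : 0 < x * T n by exact: mulr_gt0.
rewrite ler_pdivlMl//.
exact: (overlap2_doubling (ltW xT)).
Qed.

Let R1_scaled (x : R) : 0 < x ->
  x^-1 * (R2 (T n * (2 * x)) / (T n ^+ 3 * a (T n))) @[n --> \oo] -->
    x^-1 * ((2 * x) `^ (4 - k) * limit_const).
Proof.
move=> x0; apply: cvgM; first exact: cvg_cst.
apply: (overlap2_cvg_seq (tau := fun=> 2 * x) horizon_cvgy); last exact: cvg_cst.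
by move=> _; rewrite mulr_ge0// ltW.
Qed.

(** The first summand becomes of order [1 / (T * sqrt A)], where [T ^ 2 * A] diverges; the second is
    [sqrt A] times [R1 T / (T * A)], which stays bounded, while [A] tends to 0. *)
Lemma overlap_cross_cvg0 (s : R) : 0 <= s ->
  (scaling n)^-1 * ((s / Delta n + 2) * r 0 + R1 (T n) / Delta n) @[n --> \oo] --> (0 : R).
Proof.
move=> s0.
have T2A : (T n ^+ 2 * A n)^-1 @[n --> \oo] --> (0 : R).
  apply: inv_cvg0; apply/cvgryPge => M; near=> n.
  have M' : `|M| <= T n * A n by near: n; move/cvgryPge : TA_cvgy; exact.
  have T1 : 1 <= T n by near: n; move/cvgryPge : horizon_cvgy; exact.
  apply: le_trans (ler_norm M) _; apply: le_trans (M') _.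
  by rewrite expr2 -mulrA ler_peMl// (le_trans _ M').
have T2As : Num.sqrt (T n ^+ 2 * A n)^-1 @[n --> \oo] --> (0 : R).
  by rewrite -sqrtr0; apply: (cvg_comp _ _ T2A); exact: sqrt_continuous.
have As : Num.sqrt (A n) @[n --> \oo] --> (0 : R).
  by rewrite -[X in _ --> X]sqrtr0; apply: (cvg_comp _ _ A_cvg0); exact: sqrt_continuous.
have L : (s + 2) * r 0 * Num.sqrt (T n ^+ 2 * A n)^-1 +
    (1^-1 * (R2 (T n * (2 * 1)) / (T n ^+ 3 * a (T n)))) * Num.sqrt (A n) @[n --> \oo] -->
    (s + 2) * r 0 * 0 + (1^-1 * ((2 * 1) `^ (4 - k) * limit_const)) * 0.
  by apply: cvgD; apply: cvgM => //; [exact: cvg_cst|exact: R1_scaled].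
rewrite !mulr0 addr0 in L.
apply: (squeeze_cvgr _ (cvg_cst 0) L); near=> n.
have n0 : (0 < n)%N by near: n; exact: near_pos.
have D1 : Delta n <= 1 by near: n; exact: near_Delta1.
have D0 := Delta_gt0 n0; have An := A_gt0 n0; have Tn := T_gt0 n0.
have nn : 0 < n%:R :> R by rewrite ltr0n.
have r00 : 0 <= r 0 by exact: overlap_ge0.
have R10 : 0 <= R1 (T n) by apply: overlap1_ge0; exact: ltW.
have sA : 0 < Num.sqrt (A n) by rewrite sqrtr_gt0.
have sD : 0 <= s / Delta n by rewrite divr_ge0// ltW.
apply/andP; split.
  apply: mulr_ge0; first by rewrite invr_ge0 ltW// scaling_gt0.
  by apply: addr_ge0; [rewrite mulr_ge0// addr_ge0|rewrite divr_ge0// ltW].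
rewrite mulrDr; apply: lerD.
  rewrite sqrtrV; last by rewrite mulr_ge0 ?sqr_ge0// ltW.
  rewrite sqrtrM ?sqr_ge0// sqrtr_sqr gtr0_norm//.
  rewrite /scaling -/(T n) -/(A n).
  have -> : (n%:R * Num.sqrt (A n))^-1 * ((s / Delta n + 2) * r 0) =
      (s + 2 * Delta n) * r 0 * (T n * Num.sqrt (A n))^-1.
    by rewrite /T; field; rewrite !gt_eqF.
  apply: ler_wpM2r; first by rewrite invr_ge0 mulr_ge0// ltW.
  by apply: ler_wpM2r => //; rewrite lerD2l; lra.
have E : (scaling n)^-1 * (R1 (T n) / Delta n) = R1 (1 * T n) / (T n * A n) * Num.sqrt (A n).
  have A2 : A n = Num.sqrt (A n) ^+ 2 by rewrite sqr_sqrtr// ltW.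
  rewrite mul1r [X in _ / (_ * X)]A2 /scaling -/(T n) -/(A n) /T; field.
  by rewrite !gt_eqF.
by rewrite E; apply: ler_wpM2r; [exact: ltW|exact: R1_bound].
Unshelve. all: by end_near. Qed.

(** Since [scaling n / n = sqrt (A n)] tends to 0, the width [M] covers a vanishing fraction of the
    horizon. Hence [R1 (M * Delta n) <= R1 (x * T n)] eventually for any fixed [x > 0], and relative
    to [T * A] the latter is of order [x ^ (3 - k)], small with [x]. *)
Lemma overlap_band_small (Z e : R) : 0 < Z -> 0 < e -> \forall n \near \oo,
  forall M : nat, M%:R <= Z * scaling n + 1 ->
  n%:R * (2 * (r 0 + overlap_sum (Delta n) M)) / scaling n ^+ 2 <= e.
Proof.
move=> Z0 e0.
have k3' : 0 < 3 - k by rewrite subr_gt0.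
pose B := 2 `^ (4 - k) * limit_const.
have B0 : 0 < B by rewrite mulr_gt0 ?powR_gt0// limit_const_gt0.
(* Chosen so that the limit [x^-1 * (2 * x) ^ (4 - k) * limit_const] of the bound equals [e / 8]. *)
pose x := (e / (8 * B)) `^ (3 - k)^-1.
have eB : 0 < e / (8 * B) by rewrite divr_gt0// mulr_gt0.
have x0 : 0 < x by rewrite powR_gt0.
have xE : x^-1 * ((2 * x) `^ (4 - k) * limit_const) = e / 8.
  rewrite powRM ?ltW//.
  have -> : x `^ (4 - k) = x `^ (3 - k) * x.
    by rewrite -powRS//; congr (_ `^ _); ring.
  have -> : x `^ (3 - k) = e / (8 * B) by rewrite /x -powRrM mulVf ?gt_eqF// powRr1// ltW.
  by rewrite /B; field; rewrite !gt_eqF ?powR_gt0 ?limit_const_gt0.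
have L := R1_scaled x0; rewrite xE in L.
have e8 : e / 8 < e / 4 by lra.
have nAi := inv_cvg0 nA_cvgy.
have r00 : 0 < r 0 by exact: overlap_gt0.
have e1 : 0 < e / (4 * r 0) by rewrite divr_gt0// mulr_gt0.
have As : Num.sqrt (A n) @[n --> \oo] --> (0 : R).
  by rewrite -[X in _ --> X]sqrtr0; apply: (cvg_comp _ _ A_cvg0); exact: sqrt_continuous.
have ni : n%:R^-1 @[n --> \oo] --> (0 : R) by apply: inv_cvg0; exact: cvgr_idn.
have H1 : Z * Num.sqrt (A n) + n%:R^-1 @[n --> \oo] --> Z * 0 + 0.
  by apply: cvgD => //; apply: cvgM => //; exact: cvg_cst.
rewrite mulr0 addr0 in H1.
near=> n => M MZ.
have n0 : (0 < n)%N by near: n; exact: near_pos.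
have D0 := Delta_gt0 n0; have An := A_gt0 n0; have Tn := T_gt0 n0.
have nn : 0 < n%:R :> R by rewrite ltr0n.
have Mx : M%:R * Delta n <= x * T n.
  have H : Z * Num.sqrt (A n) + n%:R^-1 <= x by near: n; move/cvgr_le : H1; apply.
  rewrite /T mulrA ler_pM2r//; apply: le_trans MZ _.
  rewrite /scaling -/(T n) -/(A n).
  have -> : Z * (n%:R * Num.sqrt (A n)) + 1 = (Z * Num.sqrt (A n) + n%:R^-1) * n%:R.
    by field; rewrite gt_eqF.
  by rewrite ler_pM2r.
have S : overlap_sum (Delta n) M <= R1 (x * T n) / Delta n.
  rewrite ler_pdivlMr// mulrC; have /andP[S1 _] := overlap_sum_bounds D0 M.
  apply: le_trans S1 _; apply: overlap1_ndecr => //.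
  by rewrite mulr_ge0// ltW.
have S2 := R1_bound n0 x0.
have S3 : x^-1 * (R2 (T n * (2 * x)) / (T n ^+ 3 * a (T n))) <= e / 4.
  by near: n; move/cvgr_le : L; apply.
have S4 : (n%:R * A n)^-1 <= e / (4 * r 0) by near: n; move/cvgr_le : nAi; apply.
rewrite scaling_sqr//.
have -> : n%:R * (2 * (r 0 + overlap_sum (Delta n) M)) / (n%:R ^+ 2 * A n) =
   2 * (r 0 * (n%:R * A n)^-1) + 2 * (overlap_sum (Delta n) M / (n%:R * A n)).
  by field; rewrite !gt_eqF.
have S5 : r 0 * (n%:R * A n)^-1 <= e / 4.
  rewrite (_ : e / 4 = r 0 * (e / (4 * r 0))); last by field; rewrite gt_eqF.
  by rewrite ler_pM2l.
have S6 : overlap_sum (Delta n) M / (n%:R * A n) <= e / 4.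
  apply: le_trans S3; apply: le_trans S2.
  have -> : R1 (x * T n) / (T n * A n) = R1 (x * T n) / Delta n / (n%:R * A n).
    by rewrite /T; field; rewrite !gt_eqF.
  by rewrite ler_pM2r// invr_gt0 mulr_gt0.
lra.
Unshelve. all: by end_near. Qed.

(** The main term obeys Potter's bound. The discretisation error, linear in [N], is absorbed because
    [N <= n ^ g * (N / n) ^ g] and [n ^ g] is at most a multiple of [scaling n ^ 2]. *)
Lemma overlap_double_sum_holder : exists g C : R, [/\ 1 < g < 2, 0 < C &
  \forall n \near \oo, forall N, (N <= n)%N ->
    overlap_double_sum (Delta n) N <= C * scaling n ^+ 2 * (N%:R / n%:R) `^ g].
Proof.
have [g [C [T0 [c [g12 C0 T00 c0 H]]]]] := overlap2_potter.
have /andP[g1 g2] := g12.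
exists g, (2 * C + 5 * r 0 / c).
have r00 : 0 < r 0 by exact: overlap_gt0.
split => //; first by rewrite addr_gt0 ?mulr_gt0 ?invr_gt0.
near=> n => N Nn.
have n0 : (0 < n)%N by near: n; exact: near_pos.
have D1 : Delta n <= 1 by near: n; exact: near_Delta1.
have D0 := Delta_gt0 n0; have An := A_gt0 n0; have Tn := T_gt0 n0.
have nn : 0 < n%:R :> R by rewrite ltr0n.
have [->|N0] := posnP N.
  rewrite /overlap_double_sum big_ord0 mulr_ge0 ?powR_ge0// mulr_ge0 ?sqr_ge0//.
  by rewrite addr_ge0 ?mulr_ge0 ?invr_ge0 ?ltW.
have NN : 0 < N%:R :> R by rewrite ltr0n.
have T1 : T0 <= T n by near: n; move/cvgryPge : horizon_cvgy; exact.
have [H1 /(_ (N%:R * Delta n)) H2] := H _ T1.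
have G := overlap_double_sum_approx D0 N.
have xE : N%:R * Delta n / T n = N%:R / n%:R by rewrite /T; field; rewrite !gt_eqF.
set y := (N%:R / n%:R) `^ g in xE *.
have y0 : 0 <= y by exact: powR_ge0.
have G2 : R2 (N%:R * Delta n) <= C * (T n ^+ 2 * A n) * y.
  rewrite -TA /y -xE; apply: H2; first by rewrite mulr_ge0// ltW.
  by rewrite /T ler_pM2r// ler_nat.
have E1 : N%:R <= n%:R `^ g * y.
  rewrite mulrC -powRM ?divr_ge0// divfK ?gt_eqF// -[leLHS]powRr1//.
  by apply: ler_powR; [rewrite ler1n|exact: ltW].
have E2 : n%:R `^ g <= c^-1 * scaling n ^+ 2.
  rewrite ler_pdivlMl// scaling_sqr//; apply: (@le_trans _ _ (Delta n ^- 2 * (c * T n `^ g))).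
    (* As [Delta n <= 1] and [g < 2], the factor [Delta n ^ (g - 2)] is at least 1. *)
    have Dp : 1 <= Delta n ^- 2 * Delta n `^ g.
      rewrite ler_pdivlMl ?exprn_gt0// mulr1 -powR_mulrn; last exact: ltW.
      by apply: ger_powR; [rewrite D0|exact: ltW].
    rewrite /T powRM//; last exact: ltW.
    have -> : Delta n ^- 2 * (c * (n%:R `^ g * Delta n `^ g)) =
      c * n%:R `^ g * (Delta n ^- 2 * Delta n `^ g) by ring.
    by rewrite ler_peMr// mulr_ge0 ?powR_ge0// ltW.
  rewrite ler_pdivrMl ?exprn_gt0//; apply: le_trans H1 _; rewrite TA /T.
  by rewrite le_eqVlt; apply/orP; left; apply/eqP; ring.
have E3 : R2 (N%:R * Delta n) / Delta n ^+ 2 <= C * scaling n ^+ 2 * y.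
  rewrite ler_pdivrMr ?exprn_gt0//; apply: le_trans G2 _; rewrite scaling_sqr// /T.
  by rewrite le_eqVlt; apply/orP; left; apply/eqP; ring.
have E4 : 5 * r 0 * N%:R <= 5 * r 0 / c * scaling n ^+ 2 * y.
  have -> : 5 * r 0 / c * scaling n ^+ 2 * y = 5 * r 0 * (c^-1 * scaling n ^+ 2 * y) by ring.
  rewrite ler_pM2l ?mulr_gt0//; apply: le_trans E1 _.
  by rewrite ler_wpM2r.
move: G; rewrite ler_norml => /andP[_ G].
have -> : (2 * C + 5 * r 0 / c) * scaling n ^+ 2 * y =
  2 * (C * scaling n ^+ 2 * y) + 5 * r 0 / c * scaling n ^+ 2 * y by ring.
rewrite -mulrA in G; lra.
Unshelve. all: by end_near. Qed.

End Normalization.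

End TrawlAsymptotics.

(** * Approximation by trigonometric polynomials *)

Section TrigBounds.
Context {R : realType}.
Implicit Types x y u : R.

Lemma MVT_lipschitz (f df : R -> R) (M x y : R) :
  (forall z : R, is_derive z 1 f (df z)) -> (forall z : R, `|df z| <= M) ->
  `|f x - f y| <= M * `|x - y|.
Proof.
move=> fdf dfM.
wlog xy : x y / y <= x.
  by move=> H; have [xy|/ltW yx] := leP y x; [|rewrite distrC (distrC x)]; exact: H.
have cf : {within `[y, x], continuous f}.
  by apply: derivable_within_continuous => z _; have [] := fdf z.
have [z _ ->] := MVT_segment xy (fun z _ => fdf z) cf.
by rewrite normrM ler_wpM2r.
Qed.

Lemma cos_lipschitz x y : `|cos x - cos y| <= `|x - y|.
Proof.
rewrite -[leRHS]mul1r; apply: (@MVT_lipschitz cos (fun z => - sin z)) => z.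
by rewrite normrN ler_norml sin_geN1 sin_le1.
Qed.

Lemma sin_lipschitz x y : `|sin x - sin y| <= `|x - y|.
Proof.
rewrite -[leRHS]mul1r; apply: (@MVT_lipschitz sin cos) => z.
by rewrite ler_norml cos_geN1 cos_le1.
Qed.

Lemma ler_norm_sin x : `|sin x| <= `|x|.
Proof. by have := sin_lipschitz x 0; rewrite sin0 !subr0. Qed.

Lemma ler_norm_1Bcos x : `|1 - cos x| <= `|x|.
Proof. by have := cos_lipschitz 0 x; rewrite cos0 sub0r normrN. Qed.

Lemma norm_subr_sin_le u : `|u - sin u| <= u ^+ 2.
Proof.
wlog u0 : u / 0 <= u.
  move=> H; have [|/ltW u0] := leP 0 u; first exact: H.
  have := H (- u); rewrite oppr_ge0 sinN sqrrN => /(_ u0).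
  by rewrite -opprD normrN.
have dg (z : R) : is_derive z 1 (fun u => u - sin u) (1 - cos z) by exact: is_deriveB.
have cg : {within `[0, u], continuous (fun u => u - sin u)}.
  by apply: derivable_within_continuous => z _; have [] := dg z.
have [z] := MVT_segment u0 (fun z _ => dg z) cg.
rewrite in_itv/= sin0 !subr0 => /andP[z0 zu] ->.
rewrite normrM (ger0_norm u0) expr2 ler_wpM2r//.
by apply: le_trans (ler_norm_1Bcos z) _; rewrite ger0_norm.
Qed.

End TrigBounds.

Section BernsteinOperator.
Context {R : realType}.

(* Expectation of [g S] when [S] is binomial with parameters [N] and [y]. *)
Fixpoint bernstein (N : nat) (g : nat -> R) (y : R) : R :=
  if N is n.+1 then (1 - y) * bernstein n g y + y * bernstein n (g \o S) y
  else g 0%N.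

Lemma bernstein_le N g h y : 0 <= y <= 1 -> (forall k, g k <= h k) ->
  bernstein N g y <= bernstein N h y.
Proof.
move=> /andP[y0 y1]; elim: N g h => [|N IH] g h gh //=.
by rewrite lerD// ler_wpM2l ?subr_ge0// IH//= => k; exact: gh.
Qed.

Lemma bernstein_lin N g h (c e y : R) :
  bernstein N (fun k => c * g k + h k + e) y = c * bernstein N g y + bernstein N h y + e.
Proof.
elim: N g h => [|N IH] g h //=.
by rewrite IH (IH (g \o S) (h \o S)); ring.
Qed.

Lemma bernstein_cst N (c y : R) : bernstein N (fun=> c) y = c.
Proof. by elim: N => //= N IH; rewrite (_ : _ \o S = fun=> c)// IH; ring. Qed.

(** Squared bias plus variance. The centre [c] is general because the recursion replaces it by
    [c - 1]. *)
Lemma bernstein_sqr N (c y : R) :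
  bernstein N (fun k => (k%:R - c) ^+ 2) y = (N%:R * y - c) ^+ 2 + N%:R * (y * (1 - y)).
Proof.
elim: N c => [|N IH] c /=; first by rewrite !mul0r addr0.
rewrite IH (_ : _ \o S = fun k => (k%:R - (c - 1)) ^+ 2); last first.
  by apply/funext => k /=; rewrite -natr1; congr (_ ^+ 2); ring.
by rewrite IH -[N.+1%:R]natr1; ring.
Qed.

(** The inequality [|d| <= d ^ 2 / (2 * t * N) + t * N / 2] reduces the first absolute moment to the
    variance; [t] is the relative precision. *)
Lemma bernstein_norm N (y t : R) : 0 <= y <= 1 -> 0 < t -> (0 < N)%N ->
  1 <= t ^+ 2 * N%:R ->
  bernstein N (fun k => `|k%:R - N%:R * y|) y <= t * N%:R.
Proof.
move=> y01 t0 N0 tN; have N0' : 0 < N%:R :> R by rewrite ltr0n.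
have /andP[y0 y1] := y01.
apply: (@le_trans _ _ (bernstein N (fun k => (2 * t * N%:R)^-1 * (k%:R - N%:R * y) ^+ 2 + 0 + t * N%:R / 2) y)).
  apply: bernstein_le => // k; set d := k%:R - _.
  have -> : (2 * t * N%:R)^-1 * d ^+ 2 + 0 + t * N%:R / 2 = `|d| + (`|d| - t * N%:R) ^+ 2 / (2 * t * N%:R).
    by rewrite -[d ^+ 2]real_normK ?num_real//; field; rewrite !gt_eqF.
  by rewrite lerDl divr_ge0 ?sqr_ge0 ?mulr_ge0 ?ltW.
rewrite (@bernstein_lin N (fun k => (k%:R - N%:R * y) ^+ 2) (fun=> 0)) bernstein_cst bernstein_sqr subrr expr0n/= add0r addr0.
have y4 : y * (1 - y) <= 1 by nra.
rewrite [leRHS](_ : _ = t * N%:R / 2 + t * N%:R / 2); last by field.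
rewrite lerD2r mulrC ler_pdivrMr ?mulr_gt0//.
have -> : t * N%:R / 2 * (2 * t * N%:R) = N%:R * (t ^+ 2 * N%:R) by field.
by rewrite ler_pM2l//; apply: le_trans tN.
Qed.

End BernsteinOperator.

Section TrigPolynomials.
Context {R : realType} (m : nat).

(** The phase [b] provides sines and constants, so one kind of term suffices. *)
Inductive trigpoly : ('rV[R]_m -> R) -> Prop :=
| trigpoly_cos (c : R) (u : 'rV[R]_m) (b : R) :
    trigpoly (fun x => c * cos (\sum_j u 0 j * x 0 j + b))
| trigpoly_add p q : trigpoly p -> trigpoly q -> trigpoly (fun x => p x + q x).

Lemma trigpoly_eq p q : trigpoly p -> p =1 q -> trigpoly q.
Proof. by move=> + /funext pq; rewrite pq. Qed.

Lemma trigpoly_cst (c : R) : trigpoly (fun=> c).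
Proof.
apply: (trigpoly_eq (trigpoly_cos c 0 0)) => x; rewrite big1 ?addr0 ?cos0 ?mulr1// => j _.
by rewrite mxE mul0r.
Qed.

Lemma trigpolyZ (c : R) p : trigpoly p -> trigpoly (fun x => c * p x).
Proof.
elim=> [c' u b|q r _ IHq _ IHr].
  by apply: (trigpoly_eq (trigpoly_cos (c * c') u b)) => x; rewrite mulrA.
by apply: (trigpoly_eq (trigpoly_add IHq IHr)) => x; rewrite mulrDr.
Qed.

(** Products turn into sums by the addition formulas, a sine being a cosine shifted by [pi / 2]. The
    Bernstein recursion asks for no other product. *)
Lemma trigpoly_mul_sin (j : 'I_m) (s : R) p : trigpoly p ->
  trigpoly (fun x => p x * sin (s * x 0 j)).
Proof.
elim=> [c u b|q r _ IHq _ IHr].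
  pose e := s *: delta_mx 0 j : 'rV[R]_m.
  have eE (x : 'rV[R]_m) : \sum_i e 0 i * x 0 i = s * x 0 j.
    rewrite (bigD1 j)//= big1 ?addr0 => [|i ij]; first by rewrite !mxE !eqxx mulr1.
    by rewrite !mxE (negbTE ij) andbF mulr0 mul0r.
  have DE (x : 'rV[R]_m) (t : R) : \sum_i (u + t *: e) 0 i * x 0 i = \sum_i u 0 i * x 0 i + t * (s * x 0 j).
    rewrite -eE mulr_sumr -big_split/=; apply: eq_bigr => i _.
    by rewrite mxE [in X in (_ + X) * _]mxE; ring.
  apply: (trigpoly_eq (trigpoly_add (trigpoly_cos (c / 2) (u + 1 *: e) (b - pi / 2))
    (trigpoly_cos (- (c / 2)) (u + (- 1) *: e) (b - pi / 2)))) => x; rewrite !DE mul1r mulN1r.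
  set A := \sum_i _; set t := s * _.
  have -> : A + t + (b - pi / 2) = (A + b) + (t - pi / 2) by ring.
  have -> : A - t + (b - pi / 2) = (A + b) - (t + pi / 2) by ring.
  have c1 : cos (t - pi / 2) = sin t by rewrite cosB cos_pihalf sin_pihalf; ring.
  have c2 : cos (t + pi / 2) = - sin t by rewrite cosD cos_pihalf sin_pihalf; ring.
  have s1 : sin (t - pi / 2) = - cos t by rewrite sinB cos_pihalf sin_pihalf; ring.
  have s2 : sin (t + pi / 2) = cos t by rewrite sinD cos_pihalf sin_pihalf; ring.
  by rewrite (cosD (A + b) (t - _)) (cosB (A + b)) c1 c2 s1 s2; field.
by apply: (trigpoly_eq (trigpoly_add IHq IHr)) => x; rewrite mulrDl.
Qed.

Context (N : nat) (M : R).

Let y (j : 'I_m) (x : 'rV[R]_m) : R := (1 + sin (M^-1 * x 0 j)) / 2.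

Lemma trigpoly_bernstein j n (g : nat -> 'rV[R]_m -> R) :
  (forall k, trigpoly (g k)) -> trigpoly (fun x => bernstein n (g ^~ x) (y j x)).
Proof.
elim: n g => [|n IH] g Hg /=; first exact: Hg.
have H1 := IH g Hg; have H2 := IH (g \o S) (fun k => Hg k.+1).
set A := (fun x => bernstein n (g ^~ x) (y j x)) in H1.
set B := (fun x => bernstein n ((g \o S) ^~ x) (y j x)) in H2.
rewrite (_ : (fun x => _) = fun x => (2^-1 * A x + 2^-1 * B x)
   + (- (2^-1) * (A x * sin (M^-1 * x 0 j)) + 2^-1 * (B x * sin (M^-1 * x 0 j)))); last first.
  by apply/funext => x; rewrite /A /B /y (_ : (g^~ x) \o S = (g \o S)^~ x)//; field.
by do 2! apply: trigpoly_add; apply: trigpolyZ => //; exact: trigpoly_mul_sin.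
Qed.

Let upd (k : 'I_m -> nat) j l := fun i => if i == j then l else k i.

(** Expectation of [G] over independent binomial counts, one for each coordinate listed in [s]; the
    other coordinates count 0. *)
Fixpoint multi_bernstein (s : seq 'I_m) (G : ('I_m -> nat) -> R) (x : 'rV[R]_m) : R :=
  if s is j :: s' then
    bernstein N (fun l => multi_bernstein s' (fun k => G (upd k j l)) x) (y j x)
  else G (fun=> 0%N).

Lemma trigpoly_multi_bernstein s G : trigpoly (multi_bernstein s G).
Proof.
elim: s G => [|j s IH] G /=; first exact: trigpoly_cst.
exact: (@trigpoly_bernstein j N (fun l => multi_bernstein s (fun k => G (upd k j l)))).
Qed.

Let y01 j x : 0 <= y j x <= 1.
Proof.
rewrite /y; have := sin_geN1 (M^-1 * x 0 j); have := sin_le1 (M^-1 * x 0 j); lra.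
Qed.

(** Induction on the coordinates. The offset [e] is general since it carries the deviation of the
    coordinate already fixed while the remaining ones are averaged. *)
Lemma multi_bernstein_approx (t K c e : R) s G x : 0 < t -> (0 < N)%N ->
  1 <= t ^+ 2 * N%:R -> 0 <= K -> uniq s ->
  (forall k, `|G k - c| <= e + K * \sum_(j <- s) `|(k j)%:R - N%:R * y j x|) ->
  `|multi_bernstein s G x - c| <= e + K * (size s)%:R * (t * N%:R).
Proof.
move=> t0 N0 tN K0; elim: s G e => [|j s IH] G e.
  by move=> _ /(_ (fun=> 0%N)); rewrite /= big_nil !mulr0 mul0r.
move=> /=/andP[js us] H.
set h := fun l => multi_bernstein s (fun k => G (upd k j l)) x.
have hl l : `|h l - c| <= (e + K * `|l%:R - N%:R * y j x|) + K * (size s)%:R * (t * N%:R).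
  apply: IH => // k; apply: le_trans (H _) _.
  rewrite big_cons mulrDr addrA /upd eqxx lerD2l ler_wpM2l// !big_seq.
  apply: ler_sum => i si; case: eqP => // ij; by rewrite -ij si in js.
have yj := y01 j x.
have B := bernstein_norm yj t0 N0 tN.
set E := K * (size s)%:R * (t * N%:R) in hl *.
have -> : e + K * (size s).+1%:R * (t * N%:R) = K * (t * N%:R) + 0 + (e + E).
  by rewrite /E -[(size s).+1%:R]natr1; ring.
have KB : K * bernstein N (fun k => `|k%:R - N%:R * y j x|) (y j x) <= K * (t * N%:R).
  by rewrite ler_wpM2l.
rewrite ler_norml; apply/andP; split.
  rewrite lerBrDr; apply: le_trans (_ : bernstein N (fun l => (- K) * `|l%:R - N%:R * y j x| + 0 + (c - (e + E))) (y j x) <= _).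
    by rewrite (@bernstein_lin _ N _ (fun=> 0)) bernstein_cst mulNr; lra.
  by apply: bernstein_le => // l; have := hl l; rewrite ler_norml; lra.
rewrite lerBlDr; apply: (@le_trans _ _ (bernstein N (fun l => K * `|l%:R - N%:R * y j x| + 0 + (c + (e + E))) (y j x))).
  by apply: bernstein_le => // l; have := hl l; rewrite ler_norml; lra.
by rewrite (@bernstein_lin _ N _ (fun=> 0)) bernstein_cst; lra.
Qed.

End TrigPolynomials.

Section TrigApproximation.
Context {R : realType} (m : nat).

(* [F] is first composed with the bounded map [x |-> M sin (x / M)]; Bernstein
   polynomials in [(1 + sin (x / M)) / 2] are then trigonometric polynomials. *)
Lemma trigpoly_approx (F : 'rV[R]_m -> R) (K e : R) : 0 <= K -> 0 < e ->
  (forall x y, `|F x - F y| <= K * \sum_j `|x 0 j - y 0 j|) ->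
  exists2 p, trigpoly p & forall x, `|F x - p x| <= e * (1 + \sum_j x 0 j ^+ 2).
Proof.
move=> K0 e0 FK.
(* The map [x |-> M * sin (x / M)] moves a coordinate by at most [x ^ 2 / M], and this choice gives
   [K / M <= e]. *)
pose M := (K + 1) / e.
have K1 : 0 < K + 1 by rewrite ltr_wpDl.
have M0 : 0 < M by rewrite divr_gt0.
(* Makes the Bernstein error [2 * M * K * m * t] at most [e]; the summand 1 avoids a zero
   denominator. *)
pose t := e / (2 * M * K * m%:R + 1).
have t1 : 0 < 2 * M * K * m%:R + 1 by apply: ltr_wpDl => //; do 3! apply: mulr_ge0 => //; exact: ltW.
have t0 : 0 < t by rewrite divr_gt0.
pose N := (Num.truncn (t ^+ 2)^-1).+1.
have tN : 1 <= t ^+ 2 * N%:R.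
  rewrite -ler_pdivrMl ?exprn_gt0// mulr1.
  have t20 : 0 <= (t ^+ 2)^-1 by rewrite invr_ge0 sqr_ge0.
  by have /andP[_ /ltW] := truncn_itv t20.
have N0 : 0 < N%:R :> R by rewrite ltr0n.
(* A count equal to [N * (1 + sin) / 2] stands for the value [M * sin], whence the affine expression
   in [k]. *)
pose G (k : 'I_m -> nat) := F (\row_j (M * (2 * (k j)%:R / N%:R - 1))).
exists (multi_bernstein N M (enum 'I_m) G); first exact: trigpoly_multi_bernstein.
move=> x.
pose z := \row_j (M * sin (M^-1 * x 0 j)) : 'rV[R]_m.
have xz : `|F x - F z| <= e * \sum_j x 0 j ^+ 2.
  apply: le_trans (FK _ _) _.
  apply: (@le_trans _ _ (K * (M^-1 * \sum_j x 0 j ^+ 2))).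
    rewrite ler_wpM2l// mulr_sumr ler_sum// => j _; rewrite mxE.
    have -> : x 0 j - M * sin (M^-1 * x 0 j) = M * (M^-1 * x 0 j - sin (M^-1 * x 0 j)).
      by rewrite mulrBr mulrA mulfV ?gt_eqF// mul1r.
    rewrite normrM gtr0_norm// -ler_pdivlMl//; apply: le_trans (norm_subr_sin_le _) _.
    by rewrite le_eqVlt; apply/orP; left; apply/eqP; ring.
  rewrite mulrA ler_wpM2r ?sumr_ge0//; first by move=> j _; exact: sqr_ge0.
  by rewrite /M invf_div mulrA ler_pdivrMr// mulrC ler_pM2l// lerDl.
have zp : `|multi_bernstein N M (enum 'I_m) G x - F z| <= e.
  have H := @multi_bernstein_approx R m N M t (2 * M * K / N%:R) (F z) 0 (enum 'I_m) G x t0 (ltn0Sn _) tN.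
  apply: le_trans (H _ (enum_uniq _) _) _.
  - by apply: divr_ge0 => //; do 2! apply: mulr_ge0 => //; exact: ltW.
  - move=> k; rewrite add0r; apply: le_trans (FK _ _) _.
    rewrite big_enum/= !mulr_sumr; apply: ler_sum => j _; rewrite !mxE.
    set u := (k j)%:R; set s := sin _.
    have -> : M * (2 * u / N%:R - 1) - M * s = 2 * M / N%:R * (u - N%:R * ((1 + s) / 2)).
      by field; rewrite gt_eqF.
    rewrite normrM ger0_norm; last by apply: divr_ge0 => //; apply: mulr_ge0 => //; exact: ltW.
    by rewrite le_eqVlt; apply/orP; left; apply/eqP; ring.
  - rewrite add0r size_enum_ord.
    have -> : 2 * M * K / N%:R * m%:R * (t * N%:R) = 2 * M * K * m%:R * t by field; rewrite gt_eqF.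
    rewrite /t mulrA ler_pdivrMr// mulrC ler_pM2l// lerDl//.
have -> : F x - multi_bernstein N M (enum 'I_m) G x = (F x - F z) - (multi_bernstein N M (enum 'I_m) G x - F z) by ring.
apply: le_trans (ler_normB _ _) _.
by rewrite mulrDr mulr1 addrC lerD.
Qed.

End TrigApproximation.

(** * Weak convergence from Lipschitz functionals *)

Section BoundedIntegrals.
Context d (T : measurableType d) (R : realType) (P : probability T R).
Implicit Types (f g : T -> R) (B : set T).

Lemma bounded_integrable B f (M : R) : measurable B -> measurable_fun B f ->
  (forall x, B x -> `|f x| <= M) -> P.-integrable B (EFin \o f).
Proof.
move=> mB mf fM; apply: measurable_bounded_integrable => //.
  by apply: le_lt_trans (probability_le1 P mB) _; rewrite ltry.
exists M; split; first exact: num_real.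
by move=> x Mx y By; apply: le_trans (fM y By) _; exact: ltW.
Qed.

Lemma measurable_fun_lim (f_ : nat -> T -> R) f :
  (forall n, measurable_fun setT (f_ n)) ->
  (forall x, f_ n x @[n --> \oo] --> f x) -> measurable_fun setT f.
Proof.
by move=> mf_ ff; apply: (@measurable_fun_cvg _ _ _ _ f_) => // x _; exact: ff.
Qed.

Lemma Rintegral_le_norm f g : measurable_fun setT f -> P.-integrable setT (EFin \o g) ->
  (forall x, `|f x| <= g x) -> `|\int[P]_x f x| <= \int[P]_x g x.
Proof.
move=> mf ig fg.
have fi : P.-integrable setT (EFin \o f).
  apply: le_integrable ig => //; first exact/measurable_EFinP.
  by move=> x _ /=; rewrite lee_fin (le_trans (fg x))// ler_norm.
apply: le_trans (le_normr_Rintegral measurableT fi) _.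
apply: le_Rintegral => //.
have -> : EFin \o (fun x => `|f x|) = (fun x => `|(EFin \o f) x|)%E by [].
exact: integrable_abse.
Qed.

End BoundedIntegrals.

(** * Lipschitz regularisation and a weighted portmanteau theorem *)

Section LipschitzRegularization.
Context {R : realType} (T : Type) (D : set T) (close : R -> T -> T -> Prop).
Context (close_refl : forall x, D x -> close 0 x x)
  (close_sym : forall e x y, close e x y -> close e y x)
  (close_tri : forall e1 e2 x y z, close e1 x y -> close e2 y z -> close (e1 + e2) x z).
Context (f : T -> R) (M : R) (fM : forall x, D x -> `|f x| <= M).

(** The infimal convolution of [f] with [k] times a distance (the Pasch-Hausdorff envelope). The
    distance is given only through the relation [close e x y], to be read as: at most [e]. *)
Definition lip_reg (k : R) (x : T) : R :=
  inf [set v | exists y e, [/\ D y, 0 <= e, close e x y & v = f y + k * e]].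

Let lip_set (k : R) (x : T) := [set v | exists y e, [/\ D y, 0 <= e, close e x y & v = f y + k * e]].

Let lip_set_lb k x : 0 <= k -> lbound (lip_set k x) (- M).
Proof.
move=> k0 v [y [e [Dy e0 _ ->]]]; rewrite -[leLHS]addr0 lerD ?mulr_ge0//.
by have := fM Dy; rewrite ler_norml => /andP[].
Qed.

Let lip_set_inf k x : 0 <= k -> D x -> has_inf (lip_set k x).
Proof.
move=> k0 Dx; split; last by exists (- M); exact: lip_set_lb.
by exists (f x + k * 0), x, 0; split=> //; exact: close_refl.
Qed.

Lemma lip_reg_le k x : 0 <= k -> D x -> lip_reg k x <= f x.
Proof.
move=> k0 Dx; rewrite -[leRHS]addr0 -(mulr0 k).
apply: ge_inf; first by have [] := lip_set_inf k0 Dx.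
by exists x, 0; split => //; exact: close_refl.
Qed.

Lemma lip_reg_ge k x : 0 <= k -> D x -> - M <= lip_reg k x.
Proof. by move=> k0 Dx; apply: lb_le_inf; [have [] := lip_set_inf k0 Dx|exact: lip_set_lb]. Qed.

Lemma lip_reg_bounded k x : 0 <= k -> D x -> `|lip_reg k x| <= M.
Proof.
move=> k0 Dx; rewrite ler_norml lip_reg_ge//=.
apply: le_trans (lip_reg_le k0 Dx) _.
by have := fM Dx; rewrite ler_norml => /andP[].
Qed.

Lemma lip_reg_lipschitz k e x y : 0 <= k -> 0 <= e -> D x -> D y -> close e x y ->
  `|lip_reg k x - lip_reg k y| <= k * e.
Proof.
move=> k0 e0 Dx Dy exy.
have H u v : D u -> D v -> close e u v -> lip_reg k v - k * e <= lip_reg k u.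
  move=> Du Dv euv; apply: lb_le_inf; first by have [] := lip_set_inf k0 Du.
  move=> _ [z [e' [Dz e'0 euz ->]]]; rewrite lerBlDr -addrA -mulrDr.
  apply: ge_inf; first by have [] := lip_set_inf k0 Dv.
  exists z, (e' + e); split => //; first by rewrite addr_ge0.
  by rewrite addrC; apply: close_tri euz; exact: close_sym.
have H1 := H _ _ Dx Dy exy; have H2 := H _ _ Dy Dx (close_sym exy).
by rewrite ler_norml; apply/andP; split; lra.
Qed.

Lemma lip_reg_cvg x : D x ->
  (forall e : R, 0 < e -> exists2 del : R, 0 < del & forall y (e' : R), D y -> 0 <= e' -> e' < del ->
     close e' x y -> `|f y - f x| <= e) ->
  lip_reg n%:R x @[n --> \oo] --> f x.
Proof.
move=> Dx cf; apply/cvgrPdist_le => e e0.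
have [del del0 Hdel] := cf e e0.
(* From this rank on, points at distance at least [del] pay a penalty of at least [2 * M], more than
   [f] can gain there. *)
exists (Num.bound (2 * M / del)) => // n /= Hn.
have nM : 2 * M / del <= n%:R.
  have M0 : 0 <= 2 * M / del.
    by rewrite divr_ge0 ?(ltW del0)// mulr_ge0// (le_trans _ (fM Dx)).
  by apply: le_trans (ltW (archi_boundP M0)) _; rewrite ler_nat.
have fx := fM Dx.
rewrite ger0_norm ?subr_ge0 ?lip_reg_le// lerBlDl -lerBlDr.
apply: lb_le_inf; first by have [] := lip_set_inf (ler0n _ n) Dx.
move=> _ [y [e' [Dy e'0 exy ->]]].
have [e'd|de'] := ltP e' del.
  have := Hdel y e' Dy e'0 e'd exy; rewrite ler_norml => /andP[H _].
  have : 0 <= n%:R * e' by rewrite mulr_ge0.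
  lra.
have : n%:R * del <= n%:R * e' by rewrite ler_wpM2l.
have := fM Dy; move: fx nM; rewrite ler_pdivrMr// !ler_norml.
move=> /andP[? ?] ? /andP[? ?]; lra.
Qed.

End LipschitzRegularization.

Section Portmanteau.
Context {R : realType} d (Omega : measurableType d) (P : probability Omega R)
  d' (Omega' : measurableType d') (P' : probability Omega' R).
Context (T : Type) (D : set T) (close : R -> T -> T -> Prop).
Context (close_refl : forall x, D x -> close 0 x x)
  (close_sym : forall e x y, close e x y -> close e y x)
  (close_tri : forall e1 e2 x y z, close e1 x y -> close e2 y z -> close (e1 + e2) x z).
Context (xi : nat -> Omega -> T) (eta : Omega' -> T) (om : Omega -> R) (c : R).
Context (Dxi : forall n w, D (xi n w)) (Deta : forall w, D (eta w))
  (om0 : forall w, 0 <= om w <= 1) (mom : measurable_fun setT om) (c0 : 0 <= c).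

Definition close_lipschitz (F : T -> R) (K : R) := forall (e : R) x y, 0 <= e -> D x -> D y ->
  close e x y -> `|F x - F y| <= K * e.

Context (Hlip : forall F (M K : R), 0 <= K -> (forall x, D x -> `|F x| <= M) -> close_lipschitz F K ->
  [/\ forall n, measurable_fun setT (F \o xi n), measurable_fun setT (F \o eta) &
   \int[P]_w (F (xi n w) * om w) @[n --> \oo] --> c * \int[P']_w F (eta w)]).

Definition close_continuous (f : T -> R) := forall x, D x ->
  forall e : R, 0 < e -> exists2 del : R, 0 < del & forall y (e' : R), D y -> 0 <= e' -> e' < del ->
     close e' x y -> `|f y - f x| <= e.

(** The envelopes lie below [f], so a lower bound passes from them to [f]. Measurability along [xi]
    and [eta] is part of the conclusion and comes from pointwise limits, as [T] carries no
    sigma-algebra. *)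
Lemma portmanteau_ge (f : T -> R) (M : R) : (forall x, D x -> `|f x| <= M) ->
  close_continuous f ->
  [/\ forall n, measurable_fun setT (f \o xi n), measurable_fun setT (f \o eta) &
   forall e : R, 0 < e -> \forall n \near \oo,
     c * \int[P']_w f (eta w) - e <= \int[P]_w (f (xi n w) * om w)].
Proof.
move=> fM cf.
pose F (k : nat) := lip_reg D close f k%:R.
have FM k x : D x -> `|F k x| <= M by move=> Dx; exact: lip_reg_bounded.
have FL k : close_lipschitz (F k) k%:R by move=> e x y e0 Dx Dy; exact: (lip_reg_lipschitz close_refl close_sym close_tri fM).
have HF k := Hlip (ler0n _ k) (FM k) (FL k).
have Fcvg x : D x -> F k x @[k --> \oo] --> f x.
  by move=> Dx; exact: (lip_reg_cvg close_refl fM Dx (cf _ Dx)).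
have mfxi n : measurable_fun setT (f \o xi n).
  apply: (@measurable_fun_lim _ _ _ (fun k => F k \o xi n)) => [k|w]; last exact: Fcvg.
  by have [] := HF k.
have mfeta : measurable_fun setT (f \o eta).
  apply: (@measurable_fun_lim _ _ _ (fun k => F k \o eta)) => [k|w]; last exact: Fcvg.
  by have [] := HF k.
split => // e e0.
have Icvg : \int[P']_w F k (eta w) @[k --> \oo] --> \int[P']_w f (eta w).
  apply: (@Rdominated_cvg _ _ _ P' setT (fun k w => F k (eta w)) (f \o eta) (fun=> M)) => //.
  - by move=> k; have [] := HF k.
  - by move=> w _; exact: Fcvg.
  - apply: (@bounded_integrable _ _ _ P' _ _ `|M|) => // x _.
  - by move=> k w _; exact: FM.
have /cvgrPdist_le/(_ (e / 2)) : c * \int[P']_w F k (eta w) @[k --> \oo] --> c * \int[P']_w f (eta w).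
  by apply: cvgM => //; exact: cvg_cst.
rewrite divr_gt0// => /(_ isT)[k _ /(_ k (leqnn k))/= Hk].
have [_ _ /cvgrPdist_le/(_ (e / 2))] := HF k.
rewrite divr_gt0// => /(_ isT); apply: filterS => n Hn.
have : \int[P]_w (F k (xi n w) * om w) <= \int[P]_w (f (xi n w) * om w).
  have bd (h : Omega -> R) : measurable_fun setT h -> (forall w, `|h w| <= M) ->
      P.-integrable setT (EFin \o (fun w => h w * om w)).
    move=> mh hM; apply: (@bounded_integrable _ _ _ P _ _ M) => //; first exact: measurable_funM.
    move=> w _; rewrite normrM -[leRHS]mulr1 ler_pM//.
    by have /andP[q0 q1] := om0 w; rewrite ger0_norm.
  apply: le_Rintegral => //.
  - by apply: (bd (F k \o xi n)) => [|w]; [have [] := HF k|exact: FM].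
  - by apply: (bd (f \o xi n)) => // w; exact: fM.
  - move=> w _; have /andP[q0 q1] := om0 w; rewrite ler_wpM2r//.
    exact: (lip_reg_le close_refl fM).
by move: Hk Hn; rewrite !ler_norml => /andP[? ?] /andP[? ?]; lra.
Qed.

Lemma portmanteau (f : T -> R) (M : R) : (forall x, D x -> `|f x| <= M) ->
  close_continuous f ->
  \int[P]_w (f (xi n w) * om w) @[n --> \oo] --> c * \int[P']_w f (eta w).
Proof.
move=> fM cf.
have [mxi meta L] := portmanteau_ge fM cf.
have nfM x : D x -> `|- f x| <= M by rewrite normrN; exact: fM.
have ncf : close_continuous (fun x => - f x).
  move=> x Dx e e0; have [del d0 H] := cf x Dx e e0; exists del => // y e' Dy e'0 e'd exy.
  by rewrite -opprD normrN; exact: (H y e').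
have [_ _ U] := portmanteau_ge nfM ncf.
have bd (h : Omega -> R) : measurable_fun setT h -> (forall w, `|h w| <= M) ->
    P.-integrable setT (EFin \o (fun w => h w * om w)).
  move=> mh hM; apply: (@bounded_integrable _ _ _ P _ _ M) => //; first exact: measurable_funM.
  move=> w _; rewrite normrM -[leRHS]mulr1 ler_pM//.
  by have /andP[q0 q1] := om0 w; rewrite ger0_norm.
apply/cvgrPdist_le => e e0; near=> n.
have H1 : c * \int[P']_w f (eta w) - e <= \int[P]_w (f (xi n w) * om w) by near: n; exact: L.
have : c * \int[P']_w - f (eta w) - e <= \int[P]_w (- f (xi n w) * om w) by near: n; exact: U.
rewrite (_ : (fun w => - f (xi n w) * om w) = fun w => -1 * (f (xi n w) * om w)); last first.
  by apply/funext => w; rewrite mulN1r mulNr.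
rewrite (_ : (fun w => - f (eta w)) = fun w => -1 * f (eta w)); last first.
  by apply/funext => w; rewrite mulN1r.
rewrite !RintegralZl//; last 2 first.
  by apply: (bd (f \o xi n)) => // w; exact: fM.
  by apply: (@bounded_integrable _ _ _ P' _ _ M) => // w _; exact: fM.
by move=> H2; rewrite ler_norml; apply/andP; split; lra.
Unshelve. all: by end_near. Qed.

End Portmanteau.

Section TrigWeakConvergence.
Context {R : realType} (m : nat).

Lemma trigpoly_bounded (p : 'rV[R]_m -> R) : trigpoly p -> exists M, forall x, `|p x| <= M.
Proof.
elim=> [c u b|q r _ [Mq Hq] _ [Mr Hr]].
  exists `|c| => x; rewrite normrM -[leRHS]mulr1 ler_wpM2l//.
  by rewrite ler_norml cos_geN1 cos_le1.
by exists (Mq + Mr) => x; apply: le_trans (ler_normD _ _) _; exact: lerD.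
Qed.

Section coordinates.
Context d (Omega : measurableType d) (z : Omega -> 'rV[R]_m)
  (mz : forall j, measurable_fun setT (fun w => z w 0 j)).

Lemma trigpoly_measurable (p : 'rV[R]_m -> R) : trigpoly p ->
  measurable_fun setT (fun w => p (z w)).
Proof.
elim=> [c u b|q r _ mq _ mr]; last exact: measurable_funD.
apply: measurable_funM => //; apply: (@measurableT_comp _ _ _ _ _ _ (@cos R)).
  by apply: continuous_measurable_fun; exact: continuous_cos.
apply: measurable_funD => //; apply: measurable_sum => j.
by apply: measurable_funM => //; exact: mz.
Qed.

(** Trigonometric polynomials of measurable coordinates are measurable and converge pointwise to
    [F], so no sigma-algebra on row vectors is involved. *)
Lemma lipschitz_measurable (F : 'rV[R]_m -> R) (K : R) : 0 <= K ->
  (forall x y, `|F x - F y| <= K * \sum_j `|x 0 j - y 0 j|) ->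
  measurable_fun setT (fun w => F (z w)).
Proof.
move=> K0 FK.
have H n : {p | trigpoly p & forall x, `|F x - p x| <= n.+1%:R^-1 * (1 + \sum_j x 0 j ^+ 2)}.
  by apply: cid2; apply: trigpoly_approx K0 _ FK; rewrite invr_gt0.
pose p n := s2val (H n).
have Hp n x : `|F x - p n x| <= n.+1%:R^-1 * (1 + \sum_j x 0 j ^+ 2) by exact: (s2valP' (H n)).
apply: (@measurable_fun_lim _ _ _ (fun n w => p n (z w))) => [n|w].
  by apply: trigpoly_measurable; exact: (s2valP (H n)).
apply/cvgrPdist_le => e e0.
have S0 : 0 <= 1 + \sum_j z w 0 j ^+ 2.
  by rewrite addr_ge0// sumr_ge0// => j _; exact: sqr_ge0.
have : n.+1%:R^-1 * (1 + \sum_j z w 0 j ^+ 2) @[n --> \oo] --> 0 * (1 + \sum_j z w 0 j ^+ 2).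
  by apply: cvgM; [exact: cvg_harmonic|exact: cvg_cst].
rewrite mul0r => /cvgr_le/(_ e e0); apply: filterS => n.
by apply: le_trans; exact: Hp.
Qed.

Context (P : probability Omega R) (C : R)
  (zC : forall j, (\int[P]_w ((z w 0 j) ^+ 2)%:E <= C%:E)%E).

Lemma sqr_norm_integral_le : P.-integrable setT (EFin \o (fun w => 1 + \sum_j z w 0 j ^+ 2)) /\
  \int[P]_w (1 + \sum_j z w 0 j ^+ 2) <= 1 + m%:R * C.
Proof.
have mz2 j : measurable_fun setT (fun w => (z w 0 j) ^+ 2) by apply: measurable_funX; exact: mz.
have mS : measurable_fun setT (fun w => 1 + \sum_j z w 0 j ^+ 2).
  by apply: measurable_funD => //; apply: measurable_sum.
have S0 w : 0 <= 1 + \sum_j z w 0 j ^+ 2.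
  by rewrite addr_ge0// sumr_ge0// => j _; exact: sqr_ge0.
have I : (\int[P]_w (1 + \sum_j z w 0 j ^+ 2)%:E <= (1 + m%:R * C)%:E)%E.
  under eq_integral do rewrite EFinD -sumEFin.
  rewrite ge0_integralD//; last 2 first.
    by move=> w _; apply: sume_ge0 => j _; rewrite lee_fin sqr_ge0.
    by apply: emeasurable_sum => j; exact/measurable_EFinP.
  have -> : (\int[P]_(x in setT) 1 = 1)%E by rewrite integral_cst// mul1e; exact: probability_setT.
  rewrite EFinD leeD2l//.
  rewrite ge0_integral_sum//; last 2 first.
    by move=> j; exact/measurable_EFinP.
    by move=> j w _; rewrite lee_fin sqr_ge0.
  apply: (@le_trans _ _ (\sum_(j < m) C%:E)%E); first by apply: lee_sum => j _; exact: zC.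
  by rewrite sumEFin sumr_const card_ord lee_fin mulr_natl.
have fin : (\int[P]_w (1 + \sum_j z w 0 j ^+ 2)%:E)%E \is a fin_num.
  by rewrite ge0_fin_numE ?(le_lt_trans I) ?ltry//; apply: integral_ge0 => w _; rewrite lee_fin.
split; last by rewrite -lee_fin /Rintegral fineK.
apply/integrableP; split; first exact/measurable_EFinP.
under eq_integral do rewrite /= ger0_norm//.
by rewrite (le_lt_trans I) ?ltry.
Qed.

End coordinates.

Context d (Omega : measurableType d) (P : probability Omega R)
  d' (Omega' : measurableType d') (P' : probability Omega' R).
Context (zeta : nat -> Omega -> 'rV[R]_m) (om : nat -> Omega -> R)
  (eta : Omega' -> 'rV[R]_m) (c W C : R).
Context (mzeta : forall n j, measurable_fun setT (fun w => zeta n w 0 j))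
  (meta : forall j, measurable_fun setT (fun w => eta w 0 j))
  (mom : forall n, measurable_fun setT (om n)) (omW : forall n w, `|om n w| <= W)
  (zetaC : forall n j, (\int[P]_w ((zeta n w 0 j) ^+ 2)%:E <= C%:E)%E)
  (etaC : forall j, (\int[P']_w ((eta w 0 j) ^+ 2)%:E <= C%:E)%E).
Context (Hcos : forall (u : 'rV[R]_m) (b : R),
  \int[P]_w (cos (\sum_j u 0 j * zeta n w 0 j + b) * om n w) @[n --> \oo]
   --> c * \int[P']_w cos (\sum_j u 0 j * eta w 0 j + b)).

(** A probability space has a point, and the bound on [om] is read there. *)
Let W0 : 0 <= W.
Proof.
have [w _] : exists w : Omega, True.
  apply: contrapT => H; have : P setT = P set0.
    by congr (P _); apply/seteqP; split => // w _; apply: H; exists w.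
  by rewrite measure0 probability_setT => /eqP; rewrite onee_eq0.
exact: le_trans (omW 0%N w).
Qed.

Let integrable_om (f : Omega -> R) n (M : R) : measurable_fun setT f -> (forall w, `|f w| <= M) ->
  P.-integrable setT (EFin \o (fun w => f w * om n w)).
Proof.
move=> mf fM; apply: (@bounded_integrable _ _ _ P _ _ (M * W)) => //.
  exact: measurable_funM.
by move=> w _; rewrite normrM ler_pM.
Qed.

Lemma trigpoly_cvg (p : 'rV[R]_m -> R) : trigpoly p ->
  \int[P]_w (p (zeta n w) * om n w) @[n --> \oo] --> c * \int[P']_w p (eta w).
Proof.
elim=> [a u b|q r tq IHq tr IHr].
  have mc1 n : measurable_fun setT (fun w => cos (\sum_j u 0 j * zeta n w 0 j + b)).
    have := trigpoly_measurable (mzeta n) (trigpoly_cos 1 u b).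
    by apply: eq_measurable_fun => w _; rewrite mul1r.
  have mc2 : measurable_fun setT (fun w => cos (\sum_j u 0 j * eta w 0 j + b)).
    have := trigpoly_measurable meta (trigpoly_cos 1 u b).
    by apply: eq_measurable_fun => w _; rewrite mul1r.
  have cb (t : R) : `|cos t| <= 1 by rewrite ler_norml cos_geN1 cos_le1.
  rewrite RintegralZl//; last exact: (@bounded_integrable _ _ _ P' _ _ 1).
  rewrite mulrCA.
  under eq_fun => n do (under eq_Rintegral do rewrite -mulrA;
    rewrite RintegralZl; [|by []|by apply: (@integrable_om _ _ 1)]).
  by apply: cvgM; [exact: cvg_cst|exact: Hcos].
have [Mq Hq] := trigpoly_bounded tq; have [Mr Hr] := trigpoly_bounded tr.
rewrite RintegralD//; last 2 first.
- by apply: (@bounded_integrable _ _ _ P' _ _ Mq) => //; exact: trigpoly_measurable.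
- by apply: (@bounded_integrable _ _ _ P' _ _ Mr) => //; exact: trigpoly_measurable.
rewrite mulrDr.
under eq_fun => n do (under eq_Rintegral do rewrite mulrDl;
  rewrite RintegralD; [|by []|by apply: (@integrable_om _ _ Mq) => //; exact: trigpoly_measurable
    |by apply: (@integrable_om _ _ Mr) => //; exact: trigpoly_measurable]).
exact: cvgD.
Qed.

(** The approximation error [e * (1 + |x| ^ 2)] has a mean bounded uniformly in [n] by the second
    moments; this takes the place of tightness. *)
Lemma lipschitz_cvg (F : 'rV[R]_m -> R) (K M : R) : 0 <= K ->
  (forall x, `|F x| <= M) ->
  (forall x y, `|F x - F y| <= K * \sum_j `|x 0 j - y 0 j|) ->
  \int[P]_w (F (zeta n w) * om n w) @[n --> \oo] --> c * \int[P']_w F (eta w).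
Proof.
move=> K0 FM FK; apply/cvgrPdist_le => e e0.
have C0 : 0 <= m%:R * `|C| by rewrite mulr_ge0.
(* With precision [e / (2 * A)], the approximation errors of both integrals together stay below
   [e / 2]. *)
pose A := (W + `|c|) * (1 + m%:R * `|C|) + 1.
have A0 : 0 < A by rewrite ltr_wpDl// mulr_ge0 ?addr_ge0.
have e'0 : 0 < e / (2 * A) by rewrite divr_gt0 ?mulr_gt0.
have [p tp pF] := trigpoly_approx K0 e'0 FK.
have [Mp Hp] := trigpoly_bounded tp.
have mF n := lipschitz_measurable (mzeta n) K0 FK.
have mp n := trigpoly_measurable (mzeta n) tp.
have mF' := lipschitz_measurable meta K0 FK.
have mp' := trigpoly_measurable meta tp.
have [i' I'] := sqr_norm_integral_le meta etaC.
have CC : 1 + m%:R * C <= 1 + m%:R * `|C| by rewrite lerD2l ler_wpM2l// ler_norm.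
have B1 n : `|\int[P]_w (F (zeta n w) * om n w) - \int[P]_w (p (zeta n w) * om n w)|
    <= e / (2 * A) * W * (1 + m%:R * `|C|).
  rewrite -RintegralB//; last 2 first.
  - exact: integrable_om.
  - exact: (integrable_om _ (mp n)).
  have [i I] := sqr_norm_integral_le (mzeta n) (zetaC n).
  apply: (@le_trans _ _ (\int[P]_w (e / (2 * A) * W * (1 + \sum_j zeta n w 0 j ^+ 2)))).
    apply: Rintegral_le_norm.
    - by apply: measurable_funB; apply: measurable_funM.
    - by have := integrableZl measurableT (e / (2 * A) * W) i.
    - move=> w; rewrite -mulrBl normrM mulrAC ler_pM//.
  rewrite RintegralZl//; apply: ler_wpM2l; first exact: mulr_ge0 (ltW e'0) W0.
  exact: le_trans CC.
have B2 : `|\int[P']_w F (eta w) - \int[P']_w p (eta w)| <= e / (2 * A) * (1 + m%:R * `|C|).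
  rewrite -RintegralB//; last 2 first.
  - exact: (@bounded_integrable _ _ _ P' _ _ M).
  - exact: (@bounded_integrable _ _ _ P' _ _ Mp).
  apply: (@le_trans _ _ (\int[P']_w (e / (2 * A) * (1 + \sum_j eta w 0 j ^+ 2)))).
    apply: Rintegral_le_norm => //.
    - exact: measurable_funB.
    - by have := integrableZl measurableT (e / (2 * A)) i'.
  rewrite RintegralZl//; apply: ler_wpM2l; first exact: ltW.
  exact: le_trans CC.
have /cvgrPdist_le/(_ (e / 2)) := trigpoly_cvg tp.
rewrite divr_gt0// => /(_ isT); apply: filterS => n Hn.
have cB2 : `|c * \int[P']_w F (eta w) - c * \int[P']_w p (eta w)| <= e / (2 * A) * `|c| * (1 + m%:R * `|C|).
  by rewrite -mulrBr normrM [e / _ * _]mulrC -mulrA ler_wpM2l.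
have S : e / (2 * A) * W * (1 + m%:R * `|C|) + e / (2 * A) * `|c| * (1 + m%:R * `|C|) <= e / 2.
  have -> : e / (2 * A) * W * (1 + m%:R * `|C|) + e / (2 * A) * `|c| * (1 + m%:R * `|C|)
    = e / 2 * ((W + `|c|) * (1 + m%:R * `|C|) / A) by field; rewrite gt_eqF.
  by rewrite ler_piMr ?divr_ge0 ?(ltW e0)// ler_pdivrMr// mul1r lerDl.
have := B1 n; move: cB2 Hn S; rewrite !ler_norml.
set x1 := c * _; set x2 := c * _; set x3 := \int[P]_w _; set x4 := \int[P]_w _.
by move=> /andP[? ?] /andP[? ?] ? /andP[? ?]; apply/andP; split; lra.
Qed.

End TrigWeakConvergence.

(** * Characteristic functions *)

Section IntegralTransfer.
Context {R : realType}.

Lemma Rintegral_sum d (T : measurableType d) (mu : {measure set T -> \bar R})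
    (I : Type) (s : seq I) (f : I -> T -> R) :
  (forall i, mu.-integrable setT (EFin \o f i)) ->
  mu.-integrable setT (EFin \o (fun x => \sum_(i <- s) f i x)) /\
  \int[mu]_x (\sum_(i <- s) f i x) = \sum_(i <- s) \int[mu]_x f i x.
Proof.
move=> fi; elim: s => [|i s [IH1 IH2]].
  split; first by under eq_fun do rewrite /= big_nil; exact: integrable0.
  rewrite big_nil; under eq_Rintegral do rewrite big_nil.
  by rewrite Rintegral_cst// mul0r.
split.
  have := integrableD measurableT (fi i) IH1.
  by apply: eq_integrable => // x _; rewrite /= big_cons EFinD.
rewrite big_cons -IH2 -RintegralD//.
by apply: eq_Rintegral => x _; rewrite big_cons.
Qed.

Lemma integrable_mul_bounded d (T : measurableType d) (mu : {measure set T -> \bar R})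
    (Z h : T -> R) (M : R) : mu.-integrable setT (EFin \o Z) ->
  measurable_fun setT h -> (forall x, `|h x| <= M) ->
  mu.-integrable setT (EFin \o (fun x => Z x * h x)).
Proof.
move=> Zi mh hM; have /integrableP[/measurable_EFinP mZ _] := Zi.
have M0 (x : T) : 0 <= M by exact: le_trans (normr_ge0 (h x)) (hM x).
have := integrableZl measurableT M (integrable_abse Zi).
apply: le_integrable => //; first by apply/measurable_EFinP; exact: measurable_funM.
move=> x _ /=; rewrite lee_fin normrM [leRHS]ger0_norm ?mulr_ge0 ?(M0 x)//.
by rewrite mulrC ler_pM.
Qed.

Context d1 (T1 : measurableType d1) (mu1 : {measure set T1 -> \bar R})
  d2 (T2 : measurableType d2) (mu2 : {measure set T2 -> \bar R}).
Context (Y1 Z1 : T1 -> R) (Y2 Z2 : T2 -> R).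
Context (mY1 : measurable_fun setT (Y1 : T1 -> measurableTypeR R))
  (mY2 : measurable_fun setT (Y2 : T2 -> measurableTypeR R))
  (iZ1 : mu1.-integrable setT (EFin \o Z1)) (iZ2 : mu2.-integrable setT (EFin \o Z2)).
Context (H : forall C : set (measurableTypeR R), measurable C ->
  \int[mu1]_x (Z1 x * \1_C (Y1 x)) = \int[mu2]_x (Z2 x * \1_C (Y2 x))).

Let level (h : R -> R) (N k : nat) : set R := h @^-1` `[k%:R / N.+1%:R, k.+1%:R / N.+1%:R[.
(** The levels run up to [N.+1], since [h x = 1] falls into that last one. *)
Let step (h : R -> R) (N : nat) (x : R) : R :=
  \sum_(k <- iota 0 N.+2) (k%:R / N.+1%:R * \1_(level h N k) x).

Let step_close h N x : 0 <= h x <= 1 -> `|h x - step h N x| <= N.+1%:R^-1.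
Proof.
move=> /andP[h0 h1].
have N0 : 0 < N.+1%:R :> R by rewrite ltr0n.
have hN0 : 0 <= h x * N.+1%:R by rewrite mulr_ge0.
have /andP[k1 k2] := truncn_itv hN0.
set k0 := Num.truncn _ in k1 k2.
have k0N : (k0 < N.+2)%N.
  rewrite ltnS -(ler_nat R); apply: le_trans k1 _.
  by rewrite ler_piMl.
have lev k : \1_(level h N k) x = (k == k0)%:R :> R.
  rewrite indicE; congr (_%:R); congr nat_of_bool; apply/idP/eqP => [|->].
    rewrite inE /level/= in_itv/= ler_pdivrMr// ltr_pdivlMr// => /andP[q1 q2].
    apply/eqP; rewrite eqn_leq; apply/andP; split.
      by rewrite -ltnS -(ltr_nat R); exact: le_lt_trans k2.
    by rewrite -ltnS -(ltr_nat R); exact: le_lt_trans q2.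
  by rewrite inE /level/= in_itv/= ler_pdivrMr// ltr_pdivlMr// k1.
have -> : step h N x = k0%:R / N.+1%:R.
  rewrite /step (bigD1_seq k0) ?iota_uniq ?mem_iota//= lev eqxx mulr1 big1 ?addr0// => k kk.
  by rewrite lev (negbTE kk) mulr0.
rewrite -(ler_pM2r N0) mulVf ?gt_eqF// -[X in _ * X <= _](gtr0_norm N0) -normrM mulrBl divfK ?gt_eqF//.
by rewrite ger0_norm ?subr_ge0// lerBlDr addrC natr1 ltW.
Qed.

(** Both sides integrate [h] against weighted image measures that agree on indicators. As [Z1] and
    [Z2] may change sign, [h] is approximated uniformly by staircases and dominated convergence
    concludes. *)
Lemma integral_transfer01 (h : R -> R) :
  measurable_fun setT (h : measurableTypeR R -> measurableTypeR R) ->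
  (forall x, 0 <= h x <= 1) ->
  \int[mu1]_x (Z1 x * h (Y1 x)) = \int[mu2]_x (Z2 x * h (Y2 x)).
Proof.
move=> mh h01.
have mlev N k : measurable (level h N k : set (measurableTypeR R)).
  by rewrite -[level _ _ _]setTI; apply: mh.
have mstep N : measurable_fun setT (step h N : measurableTypeR R -> R).
  apply: measurable_sum => k; apply: measurable_funM => //; exact: measurable_indic.
have term d (T : measurableType d) (mu : {measure set T -> \bar R}) (Z Y : T -> R) :
    measurable_fun setT (Y : T -> measurableTypeR R) -> mu.-integrable setT (EFin \o Z) -> forall N,
    \int[mu]_x (Z x * step h N (Y x)) = \sum_(k <- iota 0 N.+2) (k%:R / N.+1%:R * \int[mu]_x (Z x * \1_(level h N k) (Y x))).
  move=> mY iZ N.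
  have i1 k : mu.-integrable setT (EFin \o (fun x => Z x * \1_(level h N k) (Y x))).
    apply: (integrable_mul_bounded (M := 1) iZ).
      by apply: (measurableT_comp _ mY); exact: measurable_indic.
    by move=> x; rewrite indicE; case: (_ \in _); rewrite ?normr1 ?normr0.
  have [] := @Rintegral_sum _ _ mu _ (iota 0 N.+2) (fun k x => k%:R / N.+1%:R * (Z x * \1_(level h N k) (Y x))).
    by move=> k; have := integrableZl measurableT (k%:R / N.+1%:R) (i1 k).
  move=> _ E; transitivity (\int[mu]_x (\sum_(k <- iota 0 N.+2) (k%:R / N.+1%:R * (Z x * \1_(level h N k) (Y x))))).
    by apply: eq_Rintegral => x _; rewrite /step mulr_sumr; apply: eq_bigr => k _; rewrite mulrCA.
  by rewrite E; apply: eq_bigr => k _; rewrite RintegralZl.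
have stepE N : \int[mu1]_x (Z1 x * step h N (Y1 x)) = \int[mu2]_x (Z2 x * step h N (Y2 x)).
  by rewrite !term//; apply: eq_bigr => k _; rewrite H.
have lim d (T : measurableType d) (mu : {measure set T -> \bar R}) (Z Y : T -> R) :
    measurable_fun setT (Y : T -> measurableTypeR R) -> mu.-integrable setT (EFin \o Z) ->
    \int[mu]_x (Z x * step h N (Y x)) @[N --> \oo] --> \int[mu]_x (Z x * h (Y x)).
  move=> mY iZ; have /integrableP[/measurable_EFinP mZ _] := iZ.
  have iZ2' := integrableZl measurableT 2 (integrable_abse iZ).
  apply: (@Rdominated_cvg _ _ _ mu setT (fun N x => Z x * step h N (Y x)) _ (fun x => 2 * `|Z x|)) => //.
  - move=> N; apply: measurable_funM => //; exact: (measurableT_comp (mstep N) mY).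
  - by apply: measurable_funM => //; exact: (measurableT_comp mh mY).
  - move=> x _; apply: cvgM; first exact: cvg_cst.
    apply/cvgrPdist_le => e e0; have := @cvg_harmonic R.
    move=> /cvgr_le/(_ e e0); apply: filterS => N; apply: le_trans.
    exact: step_close.
  - move=> N x _; rewrite normrM mulrC ler_wpM2r//.
    have := step_close N (h01 (Y x)); have /andP[q0 q1] := h01 (Y x).
    have : N.+1%:R^-1 <= 1 :> R by rewrite invf_le1 ?ler1n// ltr0n.
    move: q0 q1; rewrite !ler_norml; move: (h (Y x)) (step h N (Y x)) (N.+1%:R^-1) => u v r.
    by move=> ? ? ? /andP[? ?]; apply/andP; split; lra.
have := lim _ _ mu1 _ _ mY1 iZ1; under eq_fun do rewrite stepE.
move=> L1; have L2 := lim _ _ mu2 _ _ mY2 iZ2.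
exact: (cvg_unique _ L1 L2).
Qed.

Lemma integral_transfer (h : R -> R) :
  measurable_fun setT (h : measurableTypeR R -> measurableTypeR R) ->
  (forall x, `|h x| <= 1) ->
  \int[mu1]_x (Z1 x * h (Y1 x)) = \int[mu2]_x (Z2 x * h (Y2 x)).
Proof.
move=> mh h1.
pose g x := (h x + 1) / 2.
have mg : measurable_fun setT (g : measurableTypeR R -> measurableTypeR R).
  by apply: measurable_funM => //; exact: measurable_funD.
have g01 x : 0 <= g x <= 1 by rewrite /g; have := h1 x; rewrite ler_norml; lra.
have E d (T : measurableType d) (mu : {measure set T -> \bar R}) (Z Y : T -> R) :
    measurable_fun setT (Y : T -> measurableTypeR R) -> mu.-integrable setT (EFin \o Z) ->
    \int[mu]_x (Z x * h (Y x)) = 2 * \int[mu]_x (Z x * g (Y x)) - \int[mu]_x (Z x * 1).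
  move=> mY iZ.
  have i1 : mu.-integrable setT (EFin \o (fun x => Z x * g (Y x))).
    apply: (integrable_mul_bounded (M := 1) iZ); first exact: (measurableT_comp mg mY).
    by move=> x; have := g01 (Y x); rewrite ler_norml; lra.
  have i2 : mu.-integrable setT (EFin \o (fun x => Z x * 1)).
    by apply: (integrable_mul_bounded (M := 1) iZ) => // x; rewrite normr1.
  rewrite -RintegralZl// -RintegralB//; last by have := integrableZl measurableT 2 i1.
  by apply: eq_Rintegral => x _; rewrite /g; field.
rewrite !E// (integral_transfer01 mg g01); congr (_ - _).
have := H measurableT; under eq_Rintegral do rewrite indicE in_setT.
by move=> ->; apply: eq_Rintegral => x _; rewrite indicE in_setT.
Qed.

End IntegralTransfer.

(** * Characteristic function of the normal law *)

Section GaussianCharacteristic.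
Context {R : realType} (m s : R) (s0 : s != 0).
Notation mu := (@lebesgue_measure R).
Notation p := (normal_pdf m s).

Let pE x : p x = normal_peak s * expR (- (x - m) ^+ 2 / (s ^+ 2 *+ 2)).
Proof. by rewrite normal_pdfE. Qed.

Let twice (x : R) : x *+ 2 = 2 * x. Proof. by rewrite mulr_natl. Qed.

Let s2 : 0 < s ^+ 2. Proof. by rewrite exprn_even_gt0. Qed.


Let p_is_derive (x : R) : is_derive x 1 p (- (x - m) / s ^+ 2 * p x).
Proof.
have D : is_derive x 1 (fun x : R => x - m) 1.
  by rewrite -[X in is_derive _ _ _ X]subr0; exact: is_deriveB.
have D2 : is_derive x 1 (fun x : R => (x - m) ^+ 2) ((x - m) *+ 2).
  have := is_deriveX 2 D; rewrite /GRing.scale/= mulr1 expr1.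
  by rewrite mulr_natl.
have D3 := is_deriveZ (normal_peak s) (is_derive1_comp (is_derive_expR _)
   (is_deriveZ (- (s ^+ 2 *+ 2)^-1) D2)).
rewrite pE.
have -> : - (x - m) / s ^+ 2 * (normal_peak s * expR (- (x - m) ^+ 2 / (s ^+ 2 *+ 2))) =
    normal_peak s *: (expR ((- (s ^+ 2 *+ 2)^-1 \*: (fun x => (x - m) ^+ 2)) x) *
      (- (s ^+ 2 *+ 2)^-1 *: ((x - m) *+ 2))).
  have -> : expR ((- (s ^+ 2 *+ 2)^-1 \*: (fun x => (x - m) ^+ 2)) x) =
      expR (- (x - m) ^+ 2 / (s ^+ 2 *+ 2)).
    by rewrite /= /GRing.scale/=; congr expR; rewrite mulrC mulrN mulNr.
  move: (expR _) => E; rewrite /GRing.scale/= (twice (s ^+ 2)) (twice (x - m)); field.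
  by rewrite s0.
rewrite (_ : p = normal_peak s \*: (expR \o (- (s ^+ 2 *+ 2)^-1 \*: (fun x => (x - m) ^+ 2)))).
  exact: D3.
apply/funext => y; rewrite pE /= /GRing.scale/=; congr (_ * expR _).
by rewrite mulrC mulNr mulrN.
Qed.

Let C := 2 * `|s| * normal_peak s / normal_peak (Num.sqrt 2 * s).
Let q := normal_pdf m (Num.sqrt 2 * s).

(** Half of the Gaussian exponent absorbs the linear factor: with [t = (x - m) ^ 2 / (4 * s ^ 2)]
    one has [|x - m| <= 2 * |s| * (1 + t) <= 2 * |s| * exp t]. The density [q] has twice the
    variance, and [C] adjusts the peaks. *)
Let moment_bound (x : R) : `|x - m| * p x <= C * q x.
Proof.
have r2 : Num.sqrt 2 != 0 :> R by rewrite gt_eqF// sqrtr_gt0.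
have r2s : Num.sqrt 2 * s != 0 by rewrite mulf_neq0.
have pk : 0 < normal_peak (Num.sqrt 2 * s) by exact: normal_peak_gt0.
rewrite /C /q (normal_pdfE _ r2s) pE /normal_fun.
set E1 := expR _; set k1 := normal_peak s; set k2 := normal_peak (_ * _) in pk *.
set E2 := expR _.
have -> : 2 * `|s| * k1 / k2 * (k2 * E2) = k1 * (2 * `|s| * E2) by field; rewrite gt_eqF.
have -> : `|x - m| * (k1 * E1) = k1 * (`|x - m| * E1) by ring.
apply: ler_wpM2l; first exact: normal_peak_ge0.
have s1 : 0 < `|s| by rewrite normr_gt0.
pose t := (x - m) ^+ 2 / (4 * s ^+ 2).
have t0 : 0 <= t by rewrite divr_ge0 ?sqr_ge0// mulr_ge0// ltW.
have -> : E1 = expR (- t) * expR (- t).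
  by rewrite /E1 -expRD; congr expR; rewrite /t twice; field.
have -> : E2 = expR (- t).
  by rewrite /E2 exprMn sqr_sqrtr//; congr expR; rewrite /t twice; field.
rewrite mulrA ler_wpM2r ?expR_ge0// expRN ler_pdivrMr ?expR_gt0//.
apply: (@le_trans _ _ (2 * `|s| * (1 + t))); last first.
  by rewrite ler_wpM2l ?mulr_ge0// expR_ge1Dx.
rewrite -(ler_pM2r s1).
have -> : 2 * `|s| * (1 + t) * `|s| = 2 * `|s| ^+ 2 + `|x - m| ^+ 2 / 2.
  have -> : 2 * `|s| * (1 + t) * `|s| = 2 * `|s| ^+ 2 * (1 + t) by ring.
  by rewrite !real_normK ?num_real// /t; field.
have := sqr_ge0 (2 * `|s| - `|x - m|).
have -> : (2 * `|s| - `|x - m|) ^+ 2 = 4 * `|s| ^+ 2 - 4 * (`|x - m| * `|s|) + `|x - m| ^+ 2 by ring.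
have := sqr_ge0 `|x - m|; have := sqr_ge0 `|s|.
lra.
Qed.

Let ip : mu.-integrable setT (EFin \o p). Proof. exact: integrable_normal_pdf. Qed.

Let ixp : mu.-integrable setT (EFin \o (fun x => `|x - m| * p x)).
Proof.
have iq : mu.-integrable setT (EFin \o q) by exact: integrable_normal_pdf.
have := integrableZl measurableT C iq; apply: le_integrable => //.
  apply/measurable_EFinP; apply: measurable_funM; last exact: measurable_normal_pdf.
  by apply: measurableT_comp => //; exact: measurable_funB.
move=> x _ /=; rewrite lee_fin ger0_norm ?mulr_ge0 ?normal_pdf_ge0//.
by apply: le_trans (moment_bound x) _; exact: ler_norm.
Qed.

Let mcos (z b : R) : measurable_fun setT (fun x : measurableTypeR R => cos (z * (x - m) + b)).
Proof.
apply: (measurableT_comp (f := @cos R)); first exact: (continuous_measurable_fun (@continuous_cos R)).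
by apply: measurable_funD => //; apply: measurable_funM => //; exact: measurable_funB.
Qed.

Let msin (z b : R) : measurable_fun setT (fun x : measurableTypeR R => sin (z * (x - m) + b)).
Proof.
apply: (measurableT_comp (f := @sin R)); first exact: (continuous_measurable_fun (@continuous_sin R)).
by apply: measurable_funD => //; apply: measurable_funM => //; exact: measurable_funB.
Qed.

Let I (b z : R) := \int[mu]_x (p x * cos (z * (x - m) + b)).

Let ipcos b z : mu.-integrable setT (EFin \o (fun x => p x * cos (z * (x - m) + b))).
Proof.
apply: (integrable_mul_bounded (M := 1) ip); first exact: mcos.
by move=> x; rewrite ler_norml cos_geN1 cos_le1.
Qed.

Let ixpsin b z : mu.-integrable setT (EFin \o (fun x => (x - m) * p x * sin (z * (x - m) + b))).
Proof.
have := ixp; apply: le_integrable => //.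
  apply/measurable_EFinP; apply: measurable_funM; last exact: msin.
  by apply: measurable_funM; [exact: measurable_funB|exact: measurable_normal_pdf].
move=> x _ /=; rewrite lee_fin !normrM normr_id -[leRHS]mulr1 ler_wpM2l ?mulr_ge0//.
by rewrite ler_norml sin_geN1 sin_le1.
Qed.

Let affine_is_derive (z b x : R) : is_derive x 1 (fun x : R => z * (x - m) + b) z.
Proof.
have D : is_derive x 1 (fun x : R => x - m) 1.
  by rewrite -[X in is_derive _ _ _ X]subr0; exact: is_deriveB.
have := is_deriveD (is_deriveZ z D) (is_derive_cst b x 1).
by rewrite addr0 /GRing.scale/= mulr1.
Qed.


Let p_decay (x : R) : x != m -> p x <= C * normal_peak (Num.sqrt 2 * s) / `|x - m|.
Proof.
move=> xm; have xm0 : 0 < `|x - m| by rewrite normr_gt0 subr_eq0.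
rewrite ler_pdivlMr// mulrC; apply: le_trans (moment_bound x) _.
apply: ler_wpM2l.
  by rewrite /C divr_ge0 ?normal_peak_ge0// !mulr_ge0 ?normal_peak_ge0.
by apply: normal_pdf_ub; rewrite mulf_neq0// gt_eqF// sqrtr_gt0.
Qed.

Let p_cvg0 (e : R) : (e == 1) || (e == -1) -> p (e * n%:R) @[n --> \oo] --> (0 : R).
Proof.
move=> e1; have en : `|e| = 1 by case/orP : e1 => /eqP ->; rewrite ?normrN normr1.
pose K := C * normal_peak (Num.sqrt 2 * s).
have K0 : 0 <= K by rewrite /K /C !mulr_ge0 ?invr_ge0 ?normal_peak_ge0.
apply/cvgrPdist_le => d d0; near=> n.
have nm : `|m| + K / d + 1 <= n%:R by near: n; exact: nbhs_infty_ger.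
have Kd : 0 <= K / d by rewrite divr_ge0// ltW.
have B : K / d < `|e * n%:R - m|.
  have := ler_normB (e * n%:R - m) (- m); rewrite opprK subrK normrM en mul1r normrN normr_nat.
  by lra.
have em : e * n%:R != m by rewrite -subr_eq0 -normr_gt0 (le_lt_trans Kd).
rewrite sub0r normrN ger0_norm ?normal_pdf_ge0//; apply: le_trans (p_decay em) _.
rewrite -/K ler_pdivrMr; last by rewrite (le_lt_trans Kd).
by rewrite mulrC -ler_pdivrMr// ltW.
Unshelve. all: by end_near. Qed.

Let derive_continuous (f : R -> R) (df : R -> R) : (forall x : R, is_derive x 1 f (df x)) -> continuous f.
Proof. by move=> fdf x; have [/derivable1_diffP/differentiable_continuous] := fdf x. Qed.

(* The integral over R of the derivative of [sin (z (x - m) + b) p x] is 0. *)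
Let stein b z : z * I b z = (s ^+ 2)^-1 * \int[mu]_x ((x - m) * p x * sin (z * (x - m) + b)).
Proof.
pose F x := sin (z * (x - m) + b) * p x.
pose G x := z * (p x * cos (z * (x - m) + b)) - (s ^+ 2)^-1 * ((x - m) * p x * sin (z * (x - m) + b)).
have dF (x : R) : is_derive x 1 F (G x).
  have E : sin (z * (x - m) + b) *: (- (x - m) / s ^+ 2 * p x) + p x *: (cos (z * (x - m) + b) * z) = G x.
    by rewrite /G /GRing.scale/=; field; rewrite s0.
  rewrite -E.
  exact: (is_deriveM (is_derive1_comp (is_derive_sin _) (affine_is_derive z b x)) (p_is_derive x)).
have cp := @continuous_normal_pdf R m s s0.
have caff := derive_continuous (affine_is_derive z b).
have cG : continuous G.
  move=> x; apply: cvgB.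
    apply: cvgM; first exact: cvg_cst.
    apply: cvgM; first exact: cp.
    by apply: continuous_comp; [exact: caff|exact: continuous_cos].
  apply: cvgM; first exact: cvg_cst.
  apply: cvgM; last by apply: continuous_comp; [exact: caff|exact: continuous_sin].
  apply: cvgM; last exact: cp.
  by apply: cvgB; [exact: cvg_id|exact: cvg_cst].
have i1 := integrableZl measurableT z (ipcos b z).
have i2 := integrableZl measurableT ((s ^+ 2)^-1) (ixpsin b z).
have iG : mu.-integrable setT (EFin \o G).
  have := integrableB measurableT i1 i2.
  by apply: eq_integrable.
have cF := derive_continuous dF.
have FTC n : \int[mu]_x (G x * \1_(`[- n.+1%:R, n.+1%:R] : set R) x) = F n.+1%:R - F (- n.+1%:R).
  have n0 : 0 < n.+1%:R :> R by rewrite ltr0n.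
  have nn : - n.+1%:R < n.+1%:R :> R by lra.
  have := @continuous_FTC2 R G F _ _ nn.
  rewrite -EFinB => /(_ _ _ _)/(congr1 fine) /= <-; last first.
  - by move=> x _; rewrite derive1E; have [_ ->] := dF x.
  - split; first by move=> x _; have [] := dF x.
      by apply: cvg_at_right_filter; exact: cF.
    by apply: cvg_at_left_filter; exact: cF.
  - exact: continuous_subspaceT.
  rewrite -[RHS]/(Rintegral _ _ _) Rintegral_mkcond; apply: eq_Rintegral => x _.
  by rewrite patchE indicE; case: ifPn; rewrite ?mulr1 ?mulr0.
have L1 : \int[mu]_x (G x * \1_(`[- n.+1%:R, n.+1%:R] : set R) x) @[n --> \oo] --> \int[mu]_x G x.
  apply: (@Rdominated_cvg _ _ _ mu setT _ G (fun x => `|G x|)) => //.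
  - by move=> n; apply: measurable_funM => //; exact: continuous_measurable_fun.
  - exact: continuous_measurable_fun.
  - move=> x _; apply: cvg_near_cst; near=> n; rewrite indicE mem_set ?mulr1//=.
    rewrite in_itv/= -ler_norml; near: n.
    exists (Num.bound `|x|) => // n /= Hn; apply: le_trans (ltW (archi_boundP (normr_ge0 x))) _.
    by rewrite ler_nat leqW.
  - have -> : EFin \o (fun x => `|G x|) = (fun x => `|(EFin \o G) x|)%E by [].
    exact: integrable_abse.
  - move=> n x _; rewrite normrM ler_piMr// indicE.
    by case: (_ \in _); rewrite ?normr1 ?normr0.
have L2 : F n.+1%:R - F (- n.+1%:R) @[n --> \oo] --> (0 : R).
  have H (e : R) : (e == 1) || (e == -1) -> F (e * n.+1%:R) @[n --> \oo] --> (0 : R).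
    move=> /p_cvg0 pe; have {}pe : p (e * n.+1%:R) @[n --> \oo] --> (0 : R).
      by rewrite (cvg_shiftS (fun n => p (e * n%:R))).
    apply/cvgrPdist_le => d d0; move/cvgrPdist_le : pe => /(_ d d0); apply: filterS => n.
    rewrite !sub0r !normrN; apply: le_trans.
    by rewrite /F normrM ler_piMl// ler_norml sin_geN1 sin_le1.
  have H1 := H 1; have H2 := H (-1).
  rewrite !eqxx orbT in H1 H2.
  have : F (1 * n.+1%:R) - F (-1 * n.+1%:R) @[n --> \oo] --> (0 : R) - 0.
    by apply: cvgB; [exact: H1|exact: H2].
  by rewrite subr0; under eq_fun do rewrite mul1r mulN1r.
move: L1; under eq_fun do rewrite FTC; move=> L1.
have : \int[mu]_x G x = 0 by exact: (cvg_unique _ L1 L2).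
rewrite /G RintegralB// RintegralZl// RintegralZl//.
by move/subr0_eq.
Unshelve. all: by end_near. Qed.

(** Differentiation under the integral produces a sine moment, which [stein] turns back into a
    multiple of [I b z]. *)
Let I_is_derive (b z : R) : is_derive z 1 (I b) (- (s ^+ 2 * z) * I b z).
Proof.
pose f (z x : R) := p x * cos (z * (x - m) + b).
have df (t x : R) : is_derive t 1 (f ^~ x) (- ((x - m) * p x * sin (t * (x - m) + b))).
  have D : is_derive t 1 (fun t : R => t * (x - m) + b) (x - m).
    have := is_deriveD (is_deriveM (is_derive_id t 1) (is_derive_cst (x - m) t 1)) (is_derive_cst b t 1).
    by rewrite addr0 scaler0 add0r /GRing.scale/= mulr1.
  have := is_deriveZ (p x) (is_derive1_comp (is_derive_cos _) D).
  by rewrite /GRing.scale/= (_ : p x * _ = - ((x - m) * p x * sin (t * (x - m) + b)))//; ring.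
have zin : (`]z - 1, z + 1[%classic : set R) z by rewrite /= in_itv/= gtrBl ltrDl ltr01.
have d1E x y : partial1of2 f x y = - ((y - m) * p y * sin (x * (y - m) + b)).
  by rewrite /partial1of2 derive1E; have [_ ->] := df x y.
have G0 (y : R) : 0 <= `|y - m| * p y by rewrite mulr_ge0 ?normal_pdf_ge0.
have H1 := @derivable_under_integral R _ _ mu f setT measurableT z (z - 1) (z + 1) zin
  (fun x _ => ipcos b x) (fun x y _ _ => @ex_derive _ _ _ _ _ _ _ (df x y)) (fun y => `|y - m| * p y) G0 ixp.
have H2 := @differentiation_under_integral R _ _ mu f setT measurableT z (z - 1) (z + 1) zin
  (fun x _ => ipcos b x) (fun x y _ _ => @ex_derive _ _ _ _ _ _ _ (df x y)) (fun y => `|y - m| * p y) G0 ixp.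
have Gub (x y : R) : (`]z - 1, z + 1[%classic : set R) x -> [set: R] y -> `|partial1of2 f x y| <= `|y - m| * p y.
  move=> _ _; rewrite d1E normrN !normrM -[leRHS]mulr1 ler_pM//.
    by rewrite (ger0_norm (normal_pdf_ge0 _ _ _)).
  by rewrite ler_norml sin_geN1 sin_le1.
split; first exact: H1.
rewrite -derive1E; rewrite [LHS]H2//.
under eq_Rintegral do rewrite d1E -mulN1r.
rewrite RintegralZl//.
have := stein b z => /(congr1 (fun t => s ^+ 2 * t)).
rewrite [X in _ = X -> _]mulrA mulfV ?gt_eqF// mul1r => <-; ring.
Qed.

(** The equation [I' = - s ^ 2 * z * I] makes [I z * exp (s ^ 2 * z ^ 2 / 2)] constant, after the
    phase is recentred at [m]. *)
Lemma normal_pdf_cos (z b : R) :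
  \int[mu]_x (p x * cos (z * x + b)) = expR (- (s ^+ 2 * z ^+ 2) / 2) * cos (z * m + b).
Proof.
transitivity (I (z * m + b) z).
  by apply: eq_Rintegral => x _; congr (_ * cos _); ring.
set c := z * m + b.
pose J t := I c t * expR (s ^+ 2 / 2 * t ^+ 2).
have dJ (t : R) : is_derive t 1 J 0.
  have D2 : is_derive t 1 (fun t : R => s ^+ 2 / 2 * t ^+ 2) (s ^+ 2 * t).
    have := is_deriveZ (s ^+ 2 / 2) (is_deriveX 2 (is_derive_id t 1)).
    rewrite /GRing.scale/= mulr1 expr1 (_ : s ^+ 2 / 2 * (2 * t) = s ^+ 2 * t); last by field.
    by rewrite (_ : (_ \*: _) = (fun t => s ^+ 2 / 2 * t ^+ 2)).
  have := is_deriveM (I_is_derive c t) (is_derive1_comp (is_derive_expR _) D2).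
  rewrite /GRing.scale/= (_ : _ + _ = 0)//; ring.
have J0 : J z = J 0.
  have : `|J z - J 0| <= 0 * `|z - 0|.
    by apply: (@MVT_lipschitz R J (fun=> 0)) => // t; rewrite normr0.
  by rewrite mul0r normr_le0 subr_eq0 => /eqP.
have : I c 0 = cos c.
  rewrite /I; under eq_Rintegral do rewrite mul0r add0r.
  rewrite RintegralZr//.
  by rewrite /Rintegral integral_normal_pdf mul1r.
move=> I0; move: J0; rewrite /J I0 expr0n/= mulr0 expR0 mulr1 => <-.
have E : - (s ^+ 2 * z ^+ 2) / 2 + s ^+ 2 / 2 * z ^+ 2 = 0 by field.
by rewrite mulrCA -expRD E expR0 mulr1.
Qed.

End GaussianCharacteristic.

Section CharacteristicFunctions.
Context {R : realType} d (Omega : measurableType d) (P : probability Omega R).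
Implicit Types Y : Omega -> R.

(* [Y] has characteristic function [exp (rho + i theta)] at 1. *)
Definition has_cf Y (rho theta : R) := forall beta,
  \int[P]_w cos (Y w + beta) = expR rho * cos (theta + beta).

Lemma measurable_cos_shift Y (beta : R) : measurable_fun setT Y ->
  measurable_fun setT (fun w => cos (Y w + beta)).
Proof.
move=> mY; apply: (measurableT_comp (f := @cos R)).
  exact: (continuous_measurable_fun (@continuous_cos R)).
exact: measurable_funD.
Qed.

Lemma norm_cos_le1 (x : R) : `|cos x| <= 1.
Proof. by rewrite ler_norml cos_geN1 cos_le1. Qed.

Lemma norm_sin_le1 (x : R) : `|sin x| <= 1.
Proof. by rewrite ler_norml sin_geN1 sin_le1. Qed.

Lemma integrable_cos_shift Y (beta : R) : measurable_fun setT Y ->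
  P.-integrable setT (EFin \o (fun w => cos (Y w + beta))).
Proof.
move=> mY; apply: (@bounded_integrable _ _ _ P _ _ 1) => //.
  exact: measurable_cos_shift.
by move=> w _; exact: norm_cos_le1.
Qed.

Lemma has_cfP Y rho theta : measurable_fun setT Y ->
  \int[P]_w cos (Y w) = expR rho * cos theta ->
  \int[P]_w sin (Y w) = expR rho * sin theta -> has_cf Y rho theta.
Proof.
move=> mY hc hs beta.
have mc : measurable_fun setT (fun w => cos (Y w)).
  by have := measurable_cos_shift 0 mY; under eq_fun do rewrite addr0.
have ms : measurable_fun setT (fun w => sin (Y w)).
  apply: (measurableT_comp (f := @sin R)) => //.
  exact: (continuous_measurable_fun (@continuous_sin R)).
have ic : P.-integrable setT (EFin \o (fun w => cos (Y w))).
  by apply: (@bounded_integrable _ _ _ P _ _ 1) => // w _; exact: norm_cos_le1.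
have is' : P.-integrable setT (EFin \o (fun w => sin (Y w))).
  by apply: (@bounded_integrable _ _ _ P _ _ 1) => // w _; exact: norm_sin_le1.
transitivity (\int[P]_w (cos beta * cos (Y w) - sin beta * sin (Y w))).
  by apply: eq_Rintegral => w _; rewrite cosD mulrC [sin (Y w) * _]mulrC.
rewrite RintegralB//; last 2 first.
- by have := integrableZl measurableT (cos beta) ic.
- by have := integrableZl measurableT (sin beta) is'.
by rewrite !RintegralZl// hc hs cosD; ring.
Qed.

Lemma Rintegral_probability_cst (c : R) : \int[P]_w c = c.
Proof. transitivity (c * fine 1%E); last by rewrite mulr1.
by rewrite Rintegral_cst//; congr (_ * fine _); exact: probability_setT. Qed.

Lemma has_cf_cst (c : R) : has_cf (fun=> c) 0 c.
Proof. by move=> b; rewrite Rintegral_probability_cst expR0 mul1r. Qed.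

Lemma has_cf_shift Y rho theta (c : R) : has_cf Y rho theta ->
  has_cf (fun w => Y w + c) rho (theta + c).
Proof. by move=> H b; under eq_Rintegral do rewrite -addrA; rewrite H addrA. Qed.

Lemma ae_has_cf Y Y' rho theta : measurable_fun setT Y -> measurable_fun setT Y' ->
  {ae P, forall w, Y w = Y' w} -> has_cf Y rho theta -> has_cf Y' rho theta.
Proof.
move=> mY mY' YY' H b; rewrite -H /Rintegral; congr fine.
apply: ae_eq_integral => //.
- by apply/measurable_EFinP; exact: measurable_cos_shift.
- by apply/measurable_EFinP; exact: measurable_cos_shift.
- by apply: filterS YY' => w E _; rewrite /= E.
Qed.

(** Half-angle formula: [2 * (1 - cos u) = (2 * sin (u / 2)) ^ 2]. These quotients recover a second
    moment from the characteristic function near 0. *)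
Lemma cos_quotient_cvg (y : R) :
  2 * n.+1%:R ^+ 2 * (1 - cos (n.+1%:R^-1 * y)) @[n --> \oo] --> y ^+ 2.
Proof.
have H : 2 * n.+1%:R * sin (n.+1%:R^-1 * y / 2) @[n --> \oo] --> y.
  apply/cvgrPdist_le => e e0.
  have : y ^+ 2 / 2 * n.+1%:R^-1 @[n --> \oo] --> y ^+ 2 / 2 * 0.
    by apply: cvgM; [exact: cvg_cst|exact: cvg_harmonic].
  rewrite mulr0 => /cvgr_le/(_ e e0); apply: filterS => n; apply: le_trans.
  have n0 : n.+1%:R != 0 :> R by rewrite pnatr_eq0.
  set v := n.+1%:R^-1 * y / 2.
  have -> : y - 2 * n.+1%:R * sin v = 2 * n.+1%:R * (v - sin v) by rewrite /v; field.
  rewrite normrM ger0_norm ?mulr_ge0//.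
  apply: (@le_trans _ _ (2 * n.+1%:R * v ^+ 2)).
    by rewrite ler_wpM2l ?mulr_ge0// norm_subr_sin_le.
  by rewrite le_eqVlt; apply/orP; left; apply/eqP; rewrite /v; field.
have : (2 * n.+1%:R * sin (n.+1%:R^-1 * y / 2)) * (2 * n.+1%:R * sin (n.+1%:R^-1 * y / 2))
    @[n --> \oo] --> y * y by exact: cvgM.
rewrite -expr2; apply: cvg_trans; apply: near_eq_cvg; near=> n.
rewrite [in RHS](splitr (n.+1%:R^-1 * y)).
by rewrite cosD -!expr2 cos2sin2; ring.
Unshelve. all: by end_near. Qed.

Lemma one_sub_cos_le (u : R) : 0 <= 1 - cos u <= u ^+ 2 / 2.
Proof.
rewrite subr_ge0 cos_le1/=.
have -> : cos u = 1 - 2 * sin (u / 2) ^+ 2.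
  rewrite {1}(_ : u = u / 2 + u / 2); last by field.
  by rewrite cosD -!expr2 cos2sin2; ring.
have : sin (u / 2) ^+ 2 <= (u / 2) ^+ 2.
  by rewrite -[leLHS]real_normK ?num_real// -[leRHS]real_normK ?num_real// ler_sqr ?nnegrE// ler_norm_sin.
have -> : (u / 2) ^+ 2 = u ^+ 2 / 4 by field.
lra.
Qed.

Lemma sin_quotient_cvg (y : R) : n.+1%:R * sin (n.+1%:R^-1 * y) @[n --> \oo] --> y.
Proof.
apply/cvgrPdist_le => e e0.
have : y ^+ 2 * n.+1%:R^-1 @[n --> \oo] --> y ^+ 2 * 0.
  by apply: cvgM; [exact: cvg_cst|exact: cvg_harmonic].
rewrite mulr0 => /cvgr_le/(_ e e0); apply: filterS => n; apply: le_trans.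
have n0 : n.+1%:R != 0 :> R by rewrite pnatr_eq0.
set v := n.+1%:R^-1 * y.
have -> : y - n.+1%:R * sin v = n.+1%:R * (v - sin v) by rewrite /v; field.
rewrite normrM ger0_norm//.
apply: (@le_trans _ _ (n.+1%:R * v ^+ 2)); first by rewrite ler_wpM2l// norm_subr_sin_le.
by rewrite le_eqVlt; apply/orP; left; apply/eqP; rewrite /v; field.
Qed.

End CharacteristicFunctions.

Section FatouCos.
Context {R : realType} d (T : measurableType d) (mu : {measure set T -> \bar R}) (D : set T) (mD : measurable D).

(** Fatou's lemma along [cos_quotient_cvg]; no moment of [Y] is assumed, and square integrability is
    a consequence. *)
Lemma sqr_integral_le (Y : T -> R) (C : R) : measurable_fun D Y ->
  (forall n : nat, (\int[mu]_(x in D) (2 * n.+1%:R ^+ 2 * (1 - cos (n.+1%:R^-1 * Y x)))%:E <= C%:E)%E) ->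
  (\int[mu]_(x in D) (Y x ^+ 2)%:E <= C%:E)%E.
Proof.
move=> mY H.
pose f n x : \bar R := (2 * n.+1%:R ^+ 2 * (1 - cos (n.+1%:R^-1 * Y x)))%:E.
have mf n : measurable_fun D (f n).
  apply/measurable_EFinP; apply: measurable_funM => //; apply: measurable_funB => //.
  apply: (@measurableT_comp _ _ _ _ _ _ (@cos R)).
    exact: (continuous_measurable_fun (@continuous_cos R)).
  exact: measurable_funM.
have f0 n x : D x -> (0 <= f n x)%E.
  move=> _; rewrite lee_fin; apply: mulr_ge0; first by rewrite mulr_ge0 ?sqr_ge0.
  by have /andP[] := one_sub_cos_le (n.+1%:R^-1 * Y x).
have := fatou mu mD mf f0.
rewrite (_ : (fun x => limn_einf (f ^~ x)) = (fun x => (Y x ^+ 2)%:E)); last first.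
  apply/funext => x; have : f n x @[n --> \oo] --> (Y x ^+ 2)%:E.
    apply/fine_cvgP; split; first exact: nearW.
    rewrite (_ : fine \o f^~ x = fun n => 2 * n.+1%:R ^+ 2 * (1 - cos (n.+1%:R^-1 * Y x)))//.
    apply: cos_quotient_cvg.
  by move=> /cvg_limn_einf_sup[].
move=> /le_trans; apply.
rewrite limn_einf_lim; apply: lime_le; first exact: is_cvg_einfs.
apply: nearW => n; apply: le_trans (H n).
by apply: ereal_inf_lbound; exists n => /=.
Qed.

End FatouCos.

Section MomentsFromCf.
Context {R : realType} d (Omega : measurableType d) (P : probability Omega R).

Lemma norm_cos_cf_le (rho theta : R) : rho <= 0 ->
  0 <= 1 - expR rho * cos theta <= - rho + `|theta|.
Proof.
move=> r0; have e1 : expR rho <= 1 by rewrite -expR0 ler_expR.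
have e0 : 0 <= expR rho by exact: expR_ge0.
have c1 := cos_le1 theta; have c2 := cos_geN1 theta.
have := ler_norm_1Bcos theta; rewrite ger0_norm ?subr_ge0// => ct.
have er := expR_ge1Dx rho.
apply/andP; split; first by nra.
have H : 1 - expR rho * cos theta = (1 - expR rho) + expR rho * (1 - cos theta) by ring.
have : expR rho * (1 - cos theta) <= 1 * (1 - cos theta) by rewrite ler_wpM2r// subr_ge0.
by rewrite H; lra.
Qed.

Lemma integral_sin_quotient_cvg (Y : Omega -> R) : P.-integrable setT (EFin \o Y) ->
  \int[P]_w (n.+1%:R * sin (n.+1%:R^-1 * Y w)) @[n --> \oo] --> \int[P]_w Y w.
Proof.
move=> iY; have /integrableP[/measurable_EFinP mY _] := iY.
have ms n : measurable_fun setT (fun w => n.+1%:R * sin (n.+1%:R^-1 * Y w)).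
  apply: measurable_funM => //; apply: (measurableT_comp (f := @sin R)) => //.
    exact: (continuous_measurable_fun (@continuous_sin R)).
  exact: measurable_funM.
apply: (@Rdominated_cvg _ _ _ P setT _ Y (fun w => `|Y w|)) => //.
- by move=> w _; exact: sin_quotient_cvg.
- have -> : EFin \o (fun x => `|Y x|) = (fun x => `|(EFin \o Y) x|)%E by [].
  exact: integrable_abse.
- move=> n w _; rewrite normrM ger0_norm//.
  rewrite -ler_pdivlMl ?ltr0n//; apply: le_trans (ler_norm_sin _) _.
  by rewrite normrM ger0_norm.
Qed.

Lemma integral_cos_quotient_cvg (Y : Omega -> R) : measurable_fun setT Y ->
  P.-integrable setT (EFin \o (fun w => Y w ^+ 2)) ->
  \int[P]_w (2 * n.+1%:R ^+ 2 * (1 - cos (n.+1%:R^-1 * Y w))) @[n --> \oo] --> \int[P]_w (Y w ^+ 2).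
Proof.
move=> mY iY.
have ms n : measurable_fun setT (fun w => 2 * n.+1%:R ^+ 2 * (1 - cos (n.+1%:R^-1 * Y w))).
  apply: measurable_funM => //; apply: measurable_funB => //.
  apply: (measurableT_comp (f := @cos R)); last exact: measurable_funM.
  exact: (continuous_measurable_fun (@continuous_cos R)).
apply: (@Rdominated_cvg _ _ _ P setT _ _ (fun w => Y w ^+ 2)) => //.
- exact: measurable_funX.
- by move=> w _; exact: cos_quotient_cvg.
- move=> n w _; have /andP[q0 q1] := one_sub_cos_le (n.+1%:R^-1 * Y w).
  have c0 : 0 <= 2 * n.+1%:R ^+ 2 :> R by apply: mulr_ge0.
  rewrite ger0_norm ?mulr_ge0//.
  apply: le_trans (ler_wpM2l c0 q1) _.
  by rewrite le_eqVlt; apply/orP; left; apply/eqP; field.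
Qed.

(** At [z = 1 / n] the real part differs from 1 by at most [- rho z + |theta z| <= 2 * A * z ^ 2],
    whence the factor 4. The mean vanishes because the angle is quadratic in [z], so that
    [n * sin (theta (1 / n))] tends to 0. *)
Lemma cf_moments (Y : Omega -> R) (A : R) (rho theta : R -> R) :
  measurable_fun setT Y ->
  (forall z, has_cf P (fun w => z * Y w) (rho z) (theta z)) ->
  (forall z, rho z <= 0 /\ - rho z <= A * z ^+ 2 /\ `|theta z| <= A * z ^+ 2) ->
  [/\ (\int[P]_w (Y w ^+ 2)%:E <= (4 * A)%:E)%E, P.-integrable setT (EFin \o Y) & \int[P]_w Y w = 0].
Proof.
move=> mY cf B.
have mzY z : measurable_fun setT (fun w => z * Y w) by exact: measurable_funM.
have I2 : (\int[P]_w (Y w ^+ 2)%:E <= (4 * A)%:E)%E.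
  apply: sqr_integral_le => // n.
  have n0 : 0 < n.+1%:R :> R by rewrite ltr0n.
  set z := n.+1%:R^-1.
  have [r0 [r1 t1]] := B z.
  have ic : P.-integrable setT (EFin \o (fun w => cos (z * Y w))).
    by have := integrable_cos_shift P 0 (mzY z); under eq_fun do rewrite /= addr0.
  have i1 : P.-integrable setT (EFin \o (fun w => 1 - cos (z * Y w))).
    have := integrableB measurableT (@bounded_integrable _ _ _ P setT (fun=> 1) 1 measurableT _ _) ic.
    by apply => // w _; rewrite normr1.
  have i2 : P.-integrable setT (EFin \o (fun w => 2 * n.+1%:R ^+ 2 * (1 - cos (z * Y w)))).
    by have := integrableZl measurableT (2 * n.+1%:R ^+ 2) i1.
  rewrite -[leLHS]fineK; last exact: integrable_fin_num.
  rewrite lee_fin -/(Rintegral P setT (fun w => 2 * n.+1%:R ^+ 2 * (1 - cos (z * Y w)))).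
  rewrite RintegralZl// RintegralB//; last first.
    by apply: (@bounded_integrable _ _ _ P _ _ 1) => // w _; rewrite normr1.
  rewrite Rintegral_probability_cst.
  have := cf z 0; under eq_Rintegral do rewrite addr0.
  rewrite addr0 => ->.
  have /andP[_ c1] := norm_cos_cf_le (theta z) r0.
  apply: (@le_trans _ _ (2 * n.+1%:R ^+ 2 * (2 * A * z ^+ 2))).
    by rewrite ler_wpM2l ?mulr_ge0 ?sqr_ge0//; lra.
  by rewrite le_eqVlt; apply/orP; left; apply/eqP; rewrite /z; field; rewrite gt_eqF.
have iY : P.-integrable setT (EFin \o Y).
  apply/integrableP; split; first exact/measurable_EFinP.
  have m2 : measurable_fun setT (fun w => (Y w ^+ 2)%:E) by apply/measurable_EFinP; exact: measurable_funX.
  apply: (@le_lt_trans _ _ (\int[P]_w (1%:E + (Y w ^+ 2)%:E))%E).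
    apply: ge0_le_integral => //.
    - by apply: measurableT_comp => //; exact/measurable_EFinP.
    - by apply: emeasurable_funD.
    - move=> w _ /=; rewrite lee_fin -[Y w ^+ 2]real_normK ?num_real//.
      have := sqr_ge0 (`|Y w| - 1); have := normr_ge0 (Y w); nra.
  rewrite ge0_integralD//; last by move=> w _; rewrite lee_fin sqr_ge0.
  rewrite lte_add_pinfty//; last by apply: le_lt_trans I2 _; rewrite ltry.
  by rewrite integral_cst// mul1e (le_lt_trans (probability_le1 P _))// ltry.
split => //.
have L := integral_sin_quotient_cvg iY.
have L0 : \int[P]_w (n.+1%:R * sin (n.+1%:R^-1 * Y w)) @[n --> \oo] --> (0 : R).
  have H : `|A| * n.+1%:R^-1 @[n --> \oo] --> (`|A| * 0 : R).
    by apply: cvgM; [exact: cvg_cst|exact: cvg_harmonic].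
  rewrite mulr0 in H; apply/cvgrPdist_le => e e0; move/cvgr_le : H => /(_ e e0).
  apply: filterS => n; apply: le_trans; rewrite sub0r normrN.
  set z := n.+1%:R^-1.
  have n0 : n.+1%:R != 0 :> R by rewrite pnatr_eq0.
  have is' : P.-integrable setT (EFin \o (fun w => sin (z * Y w))).
    apply: (@bounded_integrable _ _ _ P _ _ 1) => //.
      apply: (measurableT_comp (f := @sin R)) => //.
      exact: (continuous_measurable_fun (@continuous_sin R)).
    by move=> w _; exact: norm_sin_le1.
  rewrite RintegralZl//.
  have -> : \int[P]_w sin (z * Y w) = expR (rho z) * sin (theta z).
    have := cf z (- (pi / 2)).
    have E x : cos (x - pi / 2) = sin x :> R by rewrite cosB cos_pihalf sin_pihalf; ring.
    by under eq_Rintegral do rewrite E; rewrite E.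
  have [r0 [_ t1]] := B z.
  rewrite normrM ger0_norm//.
  apply: (@le_trans _ _ (n.+1%:R * (`|A| * z ^+ 2))).
    rewrite ler_wpM2l// normrM ger0_norm ?expR_ge0//.
    apply: (@le_trans _ _ (1 * `|theta z|)).
      by rewrite ler_pM ?expR_ge0 ?ler_norm_sin// -expR0 ler_expR.
    rewrite mul1r; apply: le_trans t1 _.
    by rewrite ler_wpM2r ?sqr_ge0// ler_norm.
  by rewrite le_eqVlt; apply/orP; left; apply/eqP; rewrite /z; field.
exact: (cvg_unique _ L L0).
Qed.

End MomentsFromCf.

Section MeasurableBigops.
Context {R : realType} d (Omega : measurableType d) (I : finType) (Pr : pred I) (F : I -> Omega -> R).
Context (mF : forall i, measurable_fun setT (F i)).

Lemma measurable_sum_cond : measurable_fun setT (fun w => \sum_(i | Pr i) F i w).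
Proof.
under eq_fun do rewrite big_mkcond/=.
by apply: (@measurable_sum _ _ _ _ _ _ (fun i w => if Pr i then F i w else 0)) => i; case: (Pr i).
Qed.

Lemma measurable_prod_cond : measurable_fun setT (fun w => \prod_(i | Pr i) F i w).
Proof.
under eq_fun do rewrite big_mkcond/=.
elim: (index_enum I) => [|i s IH].
  by under eq_fun do rewrite big_nil; exact: measurable_cst.
under eq_fun do rewrite big_cons; apply: measurable_funM => //.
by case: (Pr i).
Qed.

End MeasurableBigops.

(** * Sums of independent variables *)

Section Independence.
Context {R : realType} d (Omega : measurableType d) (P : probability Omega R).
Context (m : nat) (Y : 'I_m -> Omega -> R) (z rho theta : 'I_m -> R).
Context (mY : forall i, measurable_fun setT (Y i : Omega -> measurableTypeR R))
  (indY : independent_family P Y)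
  (cfY : forall i, has_cf P (fun w => z i * Y i w) (rho i) (theta i)).

Let p i (C : set (measurableTypeR R)) := fine (P (Y i @^-1` C)).
Let S j w := \sum_(i < m | (i < j)%N) z i * Y i w.
Let tail j (C : 'I_m -> set (measurableTypeR R)) w : R := \prod_(i < m | (j <= i)%N) \1_(C i) (Y i w).

Let mtail j C : (forall i, measurable (C i)) -> measurable_fun setT (tail j C).
Proof.
move=> mC; apply: measurable_prod_cond => i.
by apply: (measurableT_comp (f := \1_(C i) : measurableTypeR R -> R)) => //; exact: measurable_indic.
Qed.

Let tail_le1 j C w : 0 <= tail j C w <= 1.
Proof.
rewrite prodr_ge0/=; last by move=> i _; rewrite indicE.
by apply: prodr_ile1 => i _; rewrite indicE; case: (_ \in _); rewrite ?lexx ?ler01.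
Qed.

Let mS j : measurable_fun setT (S j).
Proof. by apply: measurable_sum_cond => i; apply: measurable_funM => //; exact: mY. Qed.

Let mcosS j b : measurable_fun setT (fun w => cos (S j w + b)).
Proof. by apply: measurable_cos_shift; exact: mS. Qed.

Let claim0 C b : (forall i, measurable (C i)) ->
  \int[P]_w (cos (S 0 w + b) * tail 0 C w) = cos b * \prod_(i < m) p i (C i).
Proof.
move=> mC.
have tE : tail 0 C = \1_(\bigcap_i (Y i @^-1` C i)).
  apply/funext => w; rewrite /tail indicE.
  have [H|H] := boolP (w \in _).
    rewrite big1// => i _; rewrite indicE mem_set//.
    by move: H; rewrite inE => /(_ i I).
  have : exists i, ~ C i (Y i w).
    by apply: contrapT => /forallNP K; move/negP : H; apply; rewrite inE => i _; exact: contrapT (K i).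
  move=> [i Ci]; rewrite (bigD1 i)//= indicE memNset// mul0r//.
have mB : measurable (\bigcap_i (Y i @^-1` C i)).
  apply: fin_bigcap_measurable => // i _; rewrite -[X in measurable X]setTI; exact: mY.
transitivity (\int[P]_w (cos b * tail 0 C w)).
  by apply: eq_Rintegral => w _; rewrite /S big_pred0 ?add0r.
rewrite RintegralZl//; last first.
  apply: (@bounded_integrable _ _ _ P _ _ 1) => //; first exact: mtail.
  by move=> w _; have /andP[q0 q1] := tail_le1 0 C w; rewrite ger0_norm.
rewrite tE /Rintegral integral_indic// setIT /p; congr (_ * _).
transitivity (fine (\prod_(i < m) P (Y i @^-1` C i))%E); first by congr fine; exact: (indY mC).
suff -> : (\prod_(i < m) P (Y i @^-1` C i) = (\prod_(i < m) fine (P (Y i @^-1` C i)))%:E)%E by [].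
apply: (big_ind2 (fun x (y : R) => x = y%:E)) => // [x1 x2 y1 y2 -> ->|i _]; first by rewrite EFinM.
by rewrite fineK//; apply: fin_num_measure; rewrite -[X in measurable X]setTI; exact: mY.
Qed.

Let upd j (D : set (measurableTypeR R)) (C : 'I_m -> set (measurableTypeR R)) i := if i == j then D else C i.

(** Induction trades indicators for cosines one variable at a time: [S j] puts the first [j]
    variables into the cosine, [tail j] keeps the indicators of the others. The sets [C] stay
    arbitrary so that [integral_transfer] can be applied to the next variable. *)
Let claim j : (j <= m)%N -> forall C b, (forall i, measurable (C i)) ->
  \int[P]_w (cos (S j w + b) * tail j C w) =
  expR (\sum_(i < m | (i < j)%N) rho i) * cos (\sum_(i < m | (i < j)%N) theta i + b)
   * \prod_(i < m | (j <= i)%N) p i (C i).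
Proof.
elim: j => [|j IH] jm C b mC.
  have e0 (f : 'I_m -> R) : \sum_(i < m | (i < 0)%N) f i = 0 by rewrite big_pred0.
  by rewrite claim0// !e0 expR0 mul1r add0r.
pose k := Ordinal jm.
have sumS (f : 'I_m -> R) : \sum_(i < m | (i < j.+1)%N) f i = \sum_(i < m | (i < j)%N) f i + f k.
  rewrite (bigD1 k)//= addrC; congr (_ + _); apply: eq_bigl => i.
  by rewrite ltnS andbC ltn_neqAle -(inj_eq val_inj).
have prodS (f : 'I_m -> R) : \prod_(i < m | (j <= i)%N) f i = f k * \prod_(i < m | (j < i)%N) f i.
  rewrite (bigD1 k)//=; congr (_ * _); apply: eq_bigl => i.
  by rewrite andbC ltn_neqAle -(inj_eq val_inj) eq_sym.
have updk D : upd k D C k = D by rewrite /upd eqxx.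
have updT D (i : 'I_m) : (j < i)%N -> upd k D C i = C i.
  by move=> ji; rewrite /upd -(inj_eq val_inj)/= gtn_eqF.
have mupd D : measurable D -> forall i, measurable (upd k D C i).
  by move=> mD i; rewrite /upd; case: ifP.
have tailD D w : tail j (upd k D C) w = \1_D (Y k w) * tail j.+1 C w.
  rewrite /tail prodS updk; congr (_ * _); apply: eq_bigr => i ji; by rewrite updT.
set E := expR (\sum_(i < m | (i < j)%N) rho i).
set Th := \sum_(i < m | (i < j)%N) theta i.
set Pi := \prod_(i < m | (j < i)%N) p i (C i).
pose Z c w := cos (S j w + c) * tail j.+1 C w.
have ZD c D : measurable D -> \int[P]_w (Z c w * \1_D (Y k w)) = E * cos (Th + c) * Pi * p k D.
  move=> mD; have := IH (ltnW jm) (upd k D C) c (mupd D mD).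
  have -> : \prod_(i < m | (j <= i)%N) p i (upd k D C i) = p k D * Pi.
    by rewrite prodS updk; congr (_ * _); apply: eq_bigr => i ji; rewrite updT.
  rewrite -/E -/Th [p k D * _]mulrC mulrA => <-.
  by apply: eq_Rintegral => w _; rewrite tailD /Z -mulrA [\1_D _ * _]mulrC.
have mZ c : measurable_fun setT (Z c) by apply: measurable_funM; [exact: mcosS|exact: mtail].
have Zb c w : `|Z c w| <= 1.
  rewrite normrM -[leRHS]mulr1 ler_pM//; first exact: norm_cos_le1.
  by have /andP[q0 q1] := tail_le1 j.+1 C w; rewrite ger0_norm.
have iZ c : P.-integrable setT (EFin \o Z c).
  by apply: (@bounded_integrable _ _ _ P _ _ 1).
(* With [Z c] as a weight, both sides are linear in [h] along [Y k], and they agree on indicators by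
   the induction hypothesis in the form [ZD]. *)
have transfer c (h : R -> R) : measurable_fun setT (h : measurableTypeR R -> measurableTypeR R) ->
    (forall x, `|h x| <= 1) ->
    \int[P]_w (Z c w * h (Y k w)) = E * cos (Th + c) * Pi * \int[P]_w h (Y k w).
  move=> mh h1.
  have ih : P.-integrable setT (EFin \o (fun w => h (Y k w))).
    apply: (@bounded_integrable _ _ _ P _ _ 1) => //; exact: (measurableT_comp mh (mY k)).
  rewrite -RintegralZl//.
  apply: (integral_transfer (mY k) (mY k) (iZ c)) => //.
    apply: (@bounded_integrable _ _ _ P _ _ `|E * cos (Th + c) * Pi|) => // .
  move=> D mD; rewrite ZD// RintegralZl//; last first.
    apply: (@bounded_integrable _ _ _ P _ _ 1) => //.
      by apply: (measurableT_comp (f := \1_D : measurableTypeR R -> R)) => //; exact: measurable_indic.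
    by move=> w _; rewrite indicE; case: (_ \in _); rewrite ?normr1 ?normr0.
  congr (_ * _); rewrite /p.
  have mYD : measurable (Y k @^-1` D) by rewrite -[X in measurable X]setTI; exact: mY.
  have -> : (fun w => \1_D (Y k w)) = \1_(Y k @^-1` D) :> (Omega -> R).
    by apply/funext => w; rewrite !indicE; congr (_%:R); congr nat_of_bool; apply/idP/idP; rewrite !inE.
  by rewrite /Rintegral integral_indic// setIT.
have mc : measurable_fun setT ((fun x => cos (z k * x)) : measurableTypeR R -> measurableTypeR R).
  apply: (measurableT_comp (f := @cos R)); first exact: (continuous_measurable_fun (@continuous_cos R)).
  exact: measurable_funM.
have ms : measurable_fun setT ((fun x => sin (z k * x)) : measurableTypeR R -> measurableTypeR R).
  apply: (measurableT_comp (f := @sin R)); first exact: (continuous_measurable_fun (@continuous_sin R)).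
  exact: measurable_funM.
have Tc := transfer b _ mc (fun x => norm_cos_le1 _).
have Ts := transfer (b - pi / 2) _ ms (fun x => norm_sin_le1 _).
have cs x : cos (x - pi / 2) = sin x :> R by rewrite cosB cos_pihalf sin_pihalf; ring.
have cfc : \int[P]_w cos (z k * Y k w) = expR (rho k) * cos (theta k).
  by have := cfY k 0; under eq_Rintegral do rewrite addr0; rewrite addr0.
have cfs : \int[P]_w sin (z k * Y k w) = expR (rho k) * sin (theta k).
  by have := cfY k (- (pi / 2)); under eq_Rintegral do rewrite cs; rewrite cs.
rewrite !sumS expRD -/E -/Th -/Pi.
(* The sine of the sum over earlier variables is [Z] at phase [b - pi / 2], since
   [sin x = cos (x - pi / 2)]. *)
transitivity (\int[P]_w (Z b w * cos (z k * Y k w) - Z (b - pi / 2) w * sin (z k * Y k w))).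
  apply: eq_Rintegral => w _; rewrite /S sumS -/(S j w) /Z.
  have -> : S j w + z k * Y k w + b = (S j w + b) + z k * Y k w by ring.
  by rewrite (cosD (S j w + b)) addrA cs; ring.
have izc : P.-integrable setT (EFin \o (fun w => Z b w * cos (z k * Y k w))).
  by apply: (integrable_mul_bounded (M := 1) (iZ b)) => [|w]; [exact: (measurableT_comp mc (mY k))|exact: norm_cos_le1].
have izs : P.-integrable setT (EFin \o (fun w => Z (b - pi / 2) w * sin (z k * Y k w))).
  by apply: (integrable_mul_bounded (M := 1) (iZ _)) => [|w]; [exact: (measurableT_comp ms (mY k))|exact: norm_sin_le1].
rewrite RintegralB// Tc Ts cfc cfs addrA cs.
have -> : Th + theta k + b = (Th + b) + theta k by ring.
by rewrite (cosD (Th + b)); ring.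
Qed.

Lemma has_cf_sum_independent :
  has_cf P (fun w => \sum_i z i * Y i w) (\sum_i rho i) (\sum_i theta i).
Proof.
move=> b; have := claim (leqnn m) b (fun i => measurableT : measurable (setT : set (measurableTypeR R))).
have all (f : 'I_m -> R) : \sum_(i < m | (i < m)%N) f i = \sum_i f i.
  by apply: eq_bigl => i; rewrite ltn_ord.
have p0 (f : 'I_m -> R) : \prod_(i < m | (m <= i)%N) f i = 1.
  by rewrite big_pred0// => i; rewrite leqNgt ltn_ord.
rewrite !all p0 mulr1 => <-.
apply: eq_Rintegral => w _; by rewrite /S all /tail p0 mulr1.
Qed.

End Independence.

Section GaussianCf.
Context {R : realType} d (Omega : measurableType d) (P : probability Omega R).

(** Integrals are transferred from [P] with weight 1 to Lebesgue measure weighted by the density. *)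
Lemma normal_law_has_cf (Y : Omega -> R) (m s : R) : s != 0 ->
  measurable_fun setT (Y : Omega -> measurableTypeR R) ->
  (forall A : set (measurableTypeR R), measurable A -> P (Y @^-1` A) = normal_prob m s A) ->
  forall z, has_cf P (fun w => z * Y w) (- (s ^+ 2 * z ^+ 2) / 2) (z * m).
Proof.
move=> s0 mY law z b; rewrite -(normal_pdf_cos m s0).
pose pdf : measurableTypeR R -> R := normal_pdf m s.
have mh : measurable_fun setT ((fun x => cos (z * x + b)) : measurableTypeR R -> measurableTypeR R).
  apply: (measurableT_comp (f := @cos R)); first exact: (continuous_measurable_fun (@continuous_cos R)).
  by apply: measurable_funD => //; exact: measurable_funM.
transitivity (\int[P]_w (1 * cos (z * Y w + b))).
  by apply: eq_Rintegral => w _; rewrite mul1r.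
have i1 : P.-integrable setT (EFin \o (fun=> 1 : R)).
  by apply: (@bounded_integrable _ _ _ P _ _ 1) => // w _; rewrite normr1.
have i2 : (@lebesgue_measure R).-integrable setT (EFin \o pdf).
  exact: integrable_normal_pdf.
have mid : measurable_fun setT ((fun x => x) : measurableTypeR R -> measurableTypeR R).
  exact: measurable_id.
apply: (integral_transfer mY mid i1 i2 _ mh) => [C mC|x]; last exact: norm_cos_le1.
have mYC : measurable (Y @^-1` C) by rewrite -[X in measurable X]setTI; exact: mY.
transitivity (fine (P (Y @^-1` C))).
  rewrite (_ : (fun x => 1 * \1_C (Y x)) = \1_(Y @^-1` C) :> (Omega -> R)).
    by rewrite /Rintegral integral_indic// setIT.
  by apply/funext => w; rewrite mul1r !indicE; congr (_%:R); congr nat_of_bool; apply/idP/idP; rewrite !inE.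
rewrite law// /normal_prob.
transitivity (\int[@lebesgue_measure R]_(x in C) pdf x); first by [].
rewrite Rintegral_mkcond; apply: eq_Rintegral => x _.
by rewrite patchE indicE; case: (x \in C); rewrite ?mulr1 ?mulr0.
Qed.

(** The parameters hidden in [gaussian] are identified by comparing the explicit characteristic
    function near 0 with the mean and second moment of [Y]. Dirac laws are treated apart. *)
Lemma gaussian_has_cf (Y : Omega -> R) :
  measurable_fun setT (Y : Omega -> measurableTypeR R) -> gaussian P Y ->
  P.-integrable setT (EFin \o Y) -> P.-integrable setT (EFin \o (fun w => Y w ^+ 2)) ->
  \int[P]_w Y w = 0 -> has_cf P Y (- (\int[P]_w (Y w ^+ 2)) / 2) 0.
Proof.
move=> mY G iY iY2 Y0.
have mzY (z : R) : measurable_fun setT (fun w => z * Y w) by exact: measurable_funM.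
case: G => [[m [s [s0 law]]]|[m law]]; last first.
  have Ym : {ae P, forall w, Y w = m}.
    exists (Y @^-1` ~` [set m]); split.
    - rewrite -[X in measurable X]setTI; apply: mY => //.
      by apply: measurableC; exact: measurable_set1.
    - apply: eq_trans (law _ _) _; first by apply: measurableC; exact: measurable_set1.
      by rewrite diracE memNset//; apply.
    - by move=> w /=.
  have m0 : m = 0.
    rewrite -Y0 -[LHS](Rintegral_probability_cst P); rewrite /Rintegral; congr fine.
    apply: ae_eq_integral => //; first by case/integrableP: iY.
    by apply: filterS Ym => w /= ->.
  have -> : \int[P]_w (Y w ^+ 2) = 0.
    rewrite -[RHS](Rintegral_probability_cst P); rewrite /Rintegral; congr fine.
    apply: ae_eq_integral => //; first by case/integrableP: iY2.
    by apply: filterS Ym => w /= ->; rewrite m0 expr0n.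
  rewrite oppr0 mul0r; apply: (@ae_has_cf _ _ _ _ (fun=> 0)) => //.
    by apply: filterS Ym => w /= ->.
  exact: has_cf_cst.
have cf := normal_law_has_cf s0 mY law.
have L1 := integral_sin_quotient_cvg iY.
have L2 := integral_cos_quotient_cvg mY iY2.
have hz : (n.+1%:R^-1 : R) @[n --> \oo] --> (0 : R) by exact: cvg_harmonic.
have hE : expR (- (s ^+ 2 * n.+1%:R^-1 ^+ 2) / 2) @[n --> \oo] --> (1 : R).
  have hx : - (s ^+ 2 * n.+1%:R^-1 ^+ 2) / 2 @[n --> \oo] --> (- (s ^+ 2 * (0 * 0)) / 2 : R).
    apply: cvgM; last exact: cvg_cst.
    apply: cvgN; apply: cvgM; first exact: cvg_cst.
    by under eq_fun do rewrite expr2; exact: cvgM.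
  have := cvg_comp _ _ hx (@continuous_expR R _).
  by rewrite mul0r mulr0 oppr0 mul0r expR0.
have Es (z : R) : \int[P]_w sin (z * Y w) = expR (- (s ^+ 2 * z ^+ 2) / 2) * sin (z * m).
  have cs x : cos (x - pi / 2) = sin x :> R by rewrite cosB cos_pihalf sin_pihalf; ring.
  by have := cf z (- (pi / 2)); under eq_Rintegral do rewrite cs; rewrite cs.
have Ec (z : R) : \int[P]_w cos (z * Y w) = expR (- (s ^+ 2 * z ^+ 2) / 2) * cos (z * m).
  by have := cf z 0; under eq_Rintegral do rewrite addr0; rewrite addr0.
have isin (z : R) : P.-integrable setT (EFin \o (fun w => sin (z * Y w))).
  apply: (@bounded_integrable _ _ _ P _ _ 1) => //.
    apply: (measurableT_comp (f := @sin R)) => //.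
    exact: (continuous_measurable_fun (@continuous_sin R)).
  by move=> w _; exact: norm_sin_le1.
have icos (z : R) : P.-integrable setT (EFin \o (fun w => cos (z * Y w))).
  by have := integrable_cos_shift P 0 (mzY z); under eq_fun do rewrite /= addr0.
have m0 : m = 0.
  have H : expR (- (s ^+ 2 * n.+1%:R^-1 ^+ 2) / 2) * (n.+1%:R * sin (n.+1%:R^-1 * m)) @[n --> \oo] --> 1 * m.
    by apply: cvgM => //; exact: sin_quotient_cvg.
  have E n : \int[P]_w (n.+1%:R * sin (n.+1%:R^-1 * Y w)) =
      expR (- (s ^+ 2 * n.+1%:R^-1 ^+ 2) / 2) * (n.+1%:R * sin (n.+1%:R^-1 * m)).
    by rewrite RintegralZl// Es mulrCA.
  move: L1; under eq_fun do rewrite E; rewrite mul1r in H.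
  by move=> L1; rewrite -Y0; exact: (cvg_unique _ H L1).
have -> : \int[P]_w (Y w ^+ 2) = s ^+ 2.
  have E n : \int[P]_w (2 * n.+1%:R ^+ 2 * (1 - cos (n.+1%:R^-1 * Y w))) =
      2 * n.+1%:R ^+ 2 * (1 - expR (- (s ^+ 2 * n.+1%:R^-1 ^+ 2) / 2)).
    have i1 : P.-integrable setT (EFin \o (fun=> 1 : R)).
      by apply: (@bounded_integrable _ _ _ P _ _ 1) => // w _; rewrite normr1.
    rewrite RintegralZl//; last by have := integrableB measurableT i1 (icos n.+1%:R^-1).
    by rewrite RintegralB// Rintegral_probability_cst Ec m0 mulr0 cos0 mulr1.
  move: L2; under eq_fun do rewrite E; move=> L2.
  suff L3 : 2 * n.+1%:R ^+ 2 * (1 - expR (- (s ^+ 2 * n.+1%:R^-1 ^+ 2) / 2)) @[n --> \oo] --> s ^+ 2.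
    exact: (cvg_unique _ L2 L3).
  have s2 : 0 <= s ^+ 2 by exact: sqr_ge0.
  apply: (@squeeze_cvgr _ _ _ _ (fun n : nat => s ^+ 2 * expR (- (s ^+ 2 * n.+1%:R^-1 ^+ 2) / 2)) (fun=> s ^+ 2)); last 2 first.
  - by rewrite -[X in _ --> X]mulr1; apply: cvgM => //; exact: cvg_cst.
  - exact: cvg_cst.
  near=> n.
  have n0 : 0 < n.+1%:R :> R by rewrite ltr0n.
  set x := s ^+ 2 * n.+1%:R^-1 ^+ 2 / 2.
  have xE : - (s ^+ 2 * n.+1%:R^-1 ^+ 2) / 2 = - x by rewrite /x mulNr.
  have sE : s ^+ 2 = 2 * n.+1%:R ^+ 2 * x by rewrite /x; field; rewrite gt_eqF.
  rewrite xE; move: sE; move: x {xE} => x ->; rewrite -mulrA.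
  have c0 : 0 <= 2 * n.+1%:R ^+ 2 :> R by apply: mulr_ge0.
  have H := expR_ge1Dx x; have H' := expR_ge1Dx (- x).
  have Ex : expR (- x) * expR x = 1 by rewrite -expRD addNr expR0.
  have E0 := expR_gt0 (- x).
  by rewrite !ler_wpM2l//; move: H H' Ex E0; move: (expR x) (expR (- x)) => u v; nra.
have := cf 1; under eq_fun do rewrite mul1r.
by rewrite m0 mulr0 expr1n mulr1.
Unshelve. all: by end_near. Qed.

End GaussianCf.

(** * The Levy exponent *)

Section CharFun.
Context {R : realType} d (Omega : measurableType d) (P : probability Omega R).

Lemma char_fun_has_cf (Y : Omega -> R) (z r t : R) :
  measurable_fun setT (Y : Omega -> measurableTypeR R) ->
  char_fun P Y z = cexp (Complex r t) -> has_cf P (fun w => z * Y w) r t.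
Proof.
move=> mY; rewrite /char_fun /cintegral /cexp/= => -[ec es].
apply: has_cfP; first exact: measurable_funM.
  by rewrite -ec; apply: eq_Rintegral => w _; rewrite expR0 mul1r.
by rewrite -es; apply: eq_Rintegral => w _; rewrite expR0 mul1r.
Qed.

End CharFun.

Section NormIntegral.
Context {R : realType} d (T : measurableType d) (mu : {measure set T -> \bar R}) (D : set T).

Lemma Rintegral_norm_le (f g : T -> R) : measurable D ->
  mu.-integrable D (EFin \o f) -> mu.-integrable D (EFin \o g) ->
  (forall x, D x -> `|f x| <= g x) -> `|\int[mu]_(x in D) f x| <= \int[mu]_(x in D) g x.
Proof.
move=> mD fi gi fg; apply: le_trans (le_normr_Rintegral mD fi) _.
apply: le_Rintegral => //.
have -> : EFin \o (fun x => `|f x|) = (fun x => `|(EFin \o f) x|)%E by [].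
exact: integrable_abse.
Qed.

End NormIntegral.

Section LevyExponent.
Context {R : realType} (gamma b : R) (nu : {measure set (measurableTypeR R) -> \bar R}).
Context (nuL : levy_measure nu).
Notation D := ([set x | x != 0] : set (measurableTypeR R)).

(** All jumps are compensated here, not only those in [[-1, 1]]; the difference goes into
    [levy_mean], the mean of the seed. Once [nu] has a second moment, both jump parts are O(z ^
    2). *)
Definition jump_re (z : R) : R := \int[nu]_(x in D) (cos (z * x) - 1).
Definition jump_im (z : R) : R := \int[nu]_(x in D) (sin (z * x) - z * x).
Definition levy_mean : R := gamma + \int[nu]_(x in D) (x - x * \1_`[-1, 1]%classic x).

Let mD : measurable D.
Proof.
rewrite (_ : D = ~` [set 0]); last by apply/seteqP; split => x /=; [move/eqP|move/eqP].
by apply: measurableC; exact: measurable_set1.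
Qed.

Let mid : measurable_fun D ((fun x => x) : measurableTypeR R -> measurableTypeR R).
Proof. exact: measurable_id. Qed.

Let mcos (z : R) : measurable_fun D (fun x : measurableTypeR R => cos (z * x)).
Proof.
apply: (measurableT_comp (f := @cos R)); last exact: measurable_funM.
exact: (continuous_measurable_fun (@continuous_cos R)).
Qed.

Let msin (z : R) : measurable_fun D (fun x : measurableTypeR R => sin (z * x)).
Proof.
apply: (measurableT_comp (f := @sin R)); last exact: measurable_funM.
exact: (continuous_measurable_fun (@continuous_sin R)).
Qed.

Let imin : nu.-integrable D (EFin \o (fun x : measurableTypeR R => Num.min 1 (x ^+ 2))).
Proof.
have mm : measurable_fun setT (fun x : measurableTypeR R => Num.min 1 (x ^+ 2)).
  by apply: measurable_minr => //; exact: measurable_funX.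
apply: (integrableS measurableT mD) => //.
apply/integrableP; split; first exact/measurable_EFinP.
have [_ H] := nuL.
by under eq_integral do rewrite /= ger0_norm ?le_min ?ler01 ?sqr_ge0//.
Qed.

Let icos (z : R) : nu.-integrable D (EFin \o (fun x : measurableTypeR R => cos (z * x) - 1)).
Proof.
have := integrableZl mD (2 + z ^+ 2) imin; apply: le_integrable => //.
  by apply/measurable_EFinP; exact: measurable_funB.
move=> x _ /=; rewrite lee_fin.
have z2 := sqr_ge0 z; have x2 := sqr_ge0 x.
rewrite [leRHS]ger0_norm; last by rewrite mulr_ge0 ?addr_ge0// le_min ler01.
have /andP[q0 q1] := one_sub_cos_le (z * x).
rewrite -normrN opprB ger0_norm//.
have c1 := cos_geN1 (z * x).
rewrite exprMn in q1; rewrite /Num.min; case: ifPn => _; last by nra.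
by nra.
Qed.

(** The bound on [jump_re] is available only for [z ^ 2 * M <= 1]. The Fatou argument is therefore
    run for [c * x], with [c] so small that every [z = c / n] qualifies. *)
Let sqr_integrable (M : R) : 0 <= M ->
  (forall z, z ^+ 2 * M <= 1 -> - jump_re z <= z ^+ 2 * M) ->
  nu.-integrable D (EFin \o (fun x : measurableTypeR R => x ^+ 2)).
Proof.
move=> M0 HM; pose c := (1 + M)^-1.
have c0 : 0 < c by rewrite invr_gt0; lra.
have cM : c ^+ 2 * M <= 1.
  rewrite /c exprVn mulrC ler_pdivrMr; last by rewrite exprn_gt0//; lra.
  by rewrite mul1r; nra.
have H : (\int[nu]_(x in D) ((c * x) ^+ 2)%:E <= (2 * c ^+ 2 * M)%:E)%E.
  apply: (@sqr_integral_le _ _ _ nu D mD (fun x : measurableTypeR R => c * x)).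
    exact: measurable_funM.
  move=> n; have n0 : 0 < n.+1%:R :> R by rewrite ltr0n.
  set z := n.+1%:R^-1 * c.
  have zn : z ^+ 2 = c ^+ 2 / n.+1%:R ^+ 2 by rewrite /z; field; rewrite gt_eqF.
  have zM : z ^+ 2 * M <= 1.
    apply: le_trans cM; rewrite ler_wpM2r// zn ler_pdivrMr ?exprn_gt0//.
    by rewrite ler_peMr ?sqr_ge0// expr_ge1// ler1n.
  have i2 : nu.-integrable D (EFin \o (fun x : measurableTypeR R => - (cos (z * x) - 1))).
    by have := integrableZl mD (-1) (icos z); apply: eq_integrable => // x _; rewrite /= -EFinM mulN1r.
  have -> : (\int[nu]_(x in D) (2 * n.+1%:R ^+ 2 * (1 - cos (n.+1%:R^-1 * (c * x))))%:E)%E =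
    (\int[nu]_(x in D) (2 * n.+1%:R ^+ 2 * (- (cos (z * x) - 1)))%:E)%E.
    by apply: eq_integral => x _; rewrite mulrA opprB.
  have i3 := integrableZl mD (2 * n.+1%:R ^+ 2) i2.
  rewrite -[leLHS]fineK; last exact: (integrable_fin_num _ i3).
  rewrite lee_fin -/(Rintegral nu D (fun x => 2 * n.+1%:R ^+ 2 * (- (cos (z * x) - 1)))).
  rewrite RintegralZl//.
  have -> : \int[nu]_(x in D) (- (cos (z * x) - 1)) = - jump_re z.
    by rewrite -[RHS]mulN1r /jump_re -RintegralZl//; apply: eq_Rintegral => x _; rewrite mulN1r.
  apply: (@le_trans _ _ (2 * n.+1%:R ^+ 2 * (z ^+ 2 * M))).
    by rewrite ler_wpM2l ?HM// mulr_ge0.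
  by rewrite zn le_eqVlt; apply/orP; left; apply/eqP; field; rewrite gt_eqF.
have i1 : nu.-integrable D (EFin \o (fun x : measurableTypeR R => (c * x) ^+ 2)).
  apply/integrableP; split.
    by apply/measurable_EFinP; apply: measurable_funX; exact: measurable_funM.
  under eq_integral do rewrite /= ger0_norm ?sqr_ge0//.
  by apply: le_lt_trans H _; rewrite ltry.
have := integrableZl mD (c ^+ 2)^-1 i1; apply: eq_integrable => // x _ /=.
by rewrite -EFinM exprMn mulrA mulVf ?mul1r// expf_neq0// gt_eqF.
Qed.

(** To be read with [u = exp U] and [v = exp (- U)]: on [[0, 1]],
    [exp (- U) <= 1 / (1 + U) <= 1 - U / 2]. *)
Let exp_lower (u v U : R) : 1 + U <= u -> v * u = 1 -> 0 < v -> U <= 1 -> 0 <= U -> v <= 1 - U / 2.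
Proof. by move=> *; nra. Qed.

Lemma levy_exponent_re (z : R) : complex.Re (levy_exponent gamma b nu z) =
  - (b ^+ 2 * z ^+ 2) / 2 + jump_re z.
Proof.
rewrite /levy_exponent /cintegral /=; congr (_ + _).
by apply: eq_Rintegral => x _ /=; rewrite expR0 mul1r subr0.
Qed.

(** Square integrability bounds [E cos (z * Y)] below by [1 - z ^ 2 * M / 2], and it is at most the
    modulus [exp (Re psi)]. Taking logarithms bounds [- jump_re] by a multiple of [z ^ 2], the
    Gaussian part having the same sign. *)
Lemma levy_seed_sqr_integrable d (Omega : measurableType d) (P : probability Omega R)
    (Y : Omega -> R) :
  measurable_fun setT (Y : Omega -> measurableTypeR R) ->
  (forall z, char_fun P Y z = cexp (levy_exponent gamma b nu z)) ->
  P.-integrable setT (EFin \o (fun w => Y w ^+ 2)) ->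
  nu.-integrable D (EFin \o (fun x : measurableTypeR R => x ^+ 2)).
Proof.
move=> mY cf iY2; pose M := \int[P]_w (Y w ^+ 2).
have M0 : 0 <= M by apply: Rintegral_ge0 => w _; exact: sqr_ge0.
apply: (sqr_integrable M0) => z zM.
set psi := levy_exponent gamma b nu z in cf *.
have H : has_cf P (fun w => z * Y w) (complex.Re psi) (complex.Im psi).
  apply: char_fun_has_cf => //; rewrite cf -/psi; by case: psi.
have rE := levy_exponent_re z; rewrite -/psi in rE.
have mzY : measurable_fun setT (fun w => z * Y w) by exact: measurable_funM.
have ic : P.-integrable setT (EFin \o (fun w => cos (z * Y w))).
  by have := integrable_cos_shift P 0 mzY; under eq_fun do rewrite /= addr0.
have i1 : P.-integrable setT (EFin \o (fun=> 1 : R)).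
  by apply: (@bounded_integrable _ _ _ P _ _ 1) => // w _; rewrite normr1.
have i2 : P.-integrable setT (EFin \o (fun w => z ^+ 2 / 2 * Y w ^+ 2)).
  by have := integrableZl measurableT (z ^+ 2 / 2) iY2.
have L : 1 - z ^+ 2 / 2 * M <= \int[P]_w cos (z * Y w).
  rewrite -[X in X - _](Rintegral_probability_cst P) -RintegralZl// -RintegralB//.
  apply: le_Rintegral => //; first by have := integrableB measurableT i1 i2.
  move=> w _; have /andP[_ q1] := one_sub_cos_le (z * Y w).
  by rewrite exprMn in q1; lra.
have E : \int[P]_w cos (z * Y w) = expR (complex.Re psi) * cos (complex.Im psi).
  by have := H 0; under eq_Rintegral do rewrite addr0; rewrite addr0.
have L2 : 1 - z ^+ 2 / 2 * M <= expR (complex.Re psi).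
  apply: le_trans L _; rewrite E -[leRHS]mulr1 ler_wpM2l ?expR_ge0//; exact: cos_le1.
have bz : 0 <= b ^+ 2 * z ^+ 2 by rewrite mulr_ge0 ?sqr_ge0.
have : - (z ^+ 2 * M) <= complex.Re psi; last by rewrite rE; lra.
rewrite -ler_expR; apply: le_trans L2.
have U0 : 0 <= z ^+ 2 * M by rewrite mulr_ge0 ?sqr_ge0.
set U := z ^+ 2 * M in zM U0 *.
have -> : z ^+ 2 / 2 * M = U / 2 by rewrite /U; field.
have e1 := expR_ge1Dx U; have e2 : expR (- U) * expR U = 1 by rewrite -expRD addNr expR0.
have e3 := expR_gt0 (- U).
by move: e1 e2 e3 zM U0; exact: exp_lower.
Qed.

Context (ix2 : nu.-integrable D (EFin \o (fun x : measurableTypeR R => x ^+ 2))).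
Let V : R := \int[nu]_(x in D) (x ^+ 2).

Let isin (z : R) : nu.-integrable D (EFin \o (fun x : measurableTypeR R => sin (z * x) - z * x)).
Proof.
have := integrableZl mD (z ^+ 2) ix2; apply: le_integrable => //.
  by apply/measurable_EFinP; apply: measurable_funB => //; exact: measurable_funM.
move=> x _ /=; rewrite lee_fin [leRHS]ger0_norm; last by apply: mulr_ge0; exact: sqr_ge0.
by rewrite -normrN opprB -exprMn; exact: norm_subr_sin_le.
Qed.

Let ibig : nu.-integrable D (EFin \o (fun x : measurableTypeR R => x - x * \1_`[-1, 1]%classic x)).
Proof.
have := ix2; apply: le_integrable => //.
  apply/measurable_EFinP; apply: measurable_funB => //; apply: measurable_funM => //.
move=> x _ /=; rewrite lee_fin [leRHS]ger0_norm ?sqr_ge0// indicE.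
have [_|] := boolP (x \in _); first by rewrite mulr1 subrr normr0 sqr_ge0.
rewrite notin_setE/= in_itv/= => /negP; rewrite -ler_norml -ltNge mulr0 subr0 => x1.
by rewrite -[leRHS]real_normK ?num_real// expr2 ler_peMr// ltW.
Qed.

Lemma levy_exponent_im (z : R) : complex.Im (levy_exponent gamma b nu z) =
  levy_mean * z + jump_im z.
Proof.
rewrite /levy_exponent /cintegral /= /levy_mean mulrDl -addrA; congr (_ + _).
rewrite mulrC -RintegralZl//.
have iz : nu.-integrable D (EFin \o (fun x : measurableTypeR R => z * (x - x * \1_`[-1, 1]%classic x))).
  by have := integrableZl mD z ibig.
rewrite -RintegralD//.
  by apply: eq_Rintegral => x _ /=; rewrite expR0 mul1r subr0; ring.
Qed.

Lemma jump_re_le0 (z : R) : jump_re z <= 0.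
Proof.
rewrite -oppr_ge0 -mulN1r -RintegralZl//; apply: Rintegral_ge0 => x _.
by rewrite mulN1r opprB subr_ge0 cos_le1.
Qed.

Lemma jump_re_ge (z : R) : - jump_re z <= V * z ^+ 2.
Proof.
rewrite -mulN1r -RintegralZl// mulrC -RintegralZl//; apply: le_Rintegral => //.
- by have := integrableZl mD (-1) (icos z).
- by have := integrableZl mD (z ^+ 2) ix2.
- move=> x _; have /andP[_ q1] := one_sub_cos_le (z * x).
  rewrite mulN1r opprB -exprMn; apply: le_trans q1 _.
  by have := sqr_ge0 (z * x); lra.
Qed.

Let norm_int_le (f : R -> R) (c : R) : nu.-integrable D (EFin \o (f : measurableTypeR R -> R)) ->
  (forall x, `|f x| <= c * x ^+ 2) -> `|\int[nu]_(x in D) f x| <= c * V.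
Proof.
move=> fi fc; have ig := integrableZl mD c ix2.
rewrite -RintegralZl//; exact: Rintegral_norm_le.
Qed.

Lemma jump_im_le (z : R) : `|jump_im z| <= V * z ^+ 2.
Proof.
rewrite mulrC; apply: (norm_int_le (isin z)) => x.
by rewrite -normrN opprB -exprMn; exact: norm_subr_sin_le.
Qed.

(** The defect of additivity has integrand [(1 - cos yx) (1 - cos zx) - sin yx sin zx], where every
    factor is at most linear in [y x] or [z x]. The exponent is thus additive up to overlaps of the
    two weight families. *)
Lemma jump_re_cross (y z : R) :
  `|jump_re (y + z) - jump_re y - jump_re z| <= 2 * (`|y| * `|z|) * V.
Proof.
rewrite /jump_re -!RintegralB//; last by have := integrableB mD (icos (y + z)) (icos y).
apply: norm_int_le.
  by have := integrableB mD (integrableB mD (icos (y + z)) (icos y)) (icos z).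
move=> x; rewrite mulrDl cosD.
have -> : cos (y * x) * cos (z * x) - sin (y * x) * sin (z * x) - 1 - (cos (y * x) - 1) -
  (cos (z * x) - 1) = (1 - cos (y * x)) * (1 - cos (z * x)) - sin (y * x) * sin (z * x) by ring.
have -> : 2 * (`|y| * `|z|) * x ^+ 2 = `|y * x| * `|z * x| + `|y * x| * `|z * x|.
  by rewrite -[x ^+ 2]real_normK ?num_real// !normrM; ring.
apply: le_trans (ler_normB _ _) _; rewrite !normrM !lerD// ler_pM ?ler_norm_1Bcos ?ler_norm_sin//.
all: by rewrite -normrM ?ler_norm_1Bcos ?ler_norm_sin.
Qed.

Lemma jump_im_cross (y z : R) :
  `|jump_im (y + z) - jump_im y - jump_im z| <= 2 * (`|y| * `|z|) * V.
Proof.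
rewrite /jump_im -!RintegralB//; last by have := integrableB mD (isin (y + z)) (isin y).
apply: norm_int_le.
  by have := integrableB mD (integrableB mD (isin (y + z)) (isin y)) (isin z).
move=> x; rewrite mulrDl sinD.
have -> : sin (y * x) * cos (z * x) + cos (y * x) * sin (z * x) - (y * x + z * x) -
  (sin (y * x) - y * x) - (sin (z * x) - z * x) =
  - (sin (y * x) * (1 - cos (z * x))) - (1 - cos (y * x)) * sin (z * x) by ring.
have -> : 2 * (`|y| * `|z|) * x ^+ 2 = `|y * x| * `|z * x| + `|y * x| * `|z * x|.
  by rewrite -[x ^+ 2]real_normK ?num_real// !normrM; ring.
apply: le_trans (ler_normB _ _) _; rewrite normrN [X in X + _]normrM [X in _ + X]normrM.
by rewrite lerD// ler_pM ?ler_norm_1Bcos ?ler_norm_sin.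
Qed.

(** For [w >= n] both integrands are at most [w ^ 2] times the minimum of [x ^ 2] and [2 * |x| / n],
    whose integral tends to 0 by domination. The bound uses [w >= |z|] because on an atom only an
    upper bound of the argument is known. *)
Lemma jump_subquadratic (eta : R) : 0 < eta -> exists2 Z : R, 0 < Z &
  forall z w, `|z| <= w -> Z <= w ->
  `|jump_re z| <= eta * w ^+ 2 /\ `|jump_im z| <= eta * w ^+ 2.
Proof.
move=> eta0.
pose g n (x : R) := Num.min (x ^+ 2) (2 * `|x| * n.+1%:R^-1).
have g0 n x : 0 <= g n x by rewrite le_min sqr_ge0/= !mulr_ge0.
have mg n : measurable_fun D (g n : measurableTypeR R -> R).
  apply: measurable_minr; first exact: measurable_funX.
  apply: measurable_funM => //; apply: measurable_funM => //.
have glim (x : R) : g n x @[n --> \oo] --> (0 : R).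
  apply: (@squeeze_cvgr _ _ _ _ (fun=> 0) (fun n => 2 * `|x| * n.+1%:R^-1)).
  - by near=> n; rewrite g0/= ge_min lexx orbT.
  - exact: cvg_cst.
  - rewrite -[X in _ --> X](mulr0 (2 * `|x|)); apply: cvgM; [exact: cvg_cst|exact: cvg_harmonic].
have L : \int[nu]_(x in D) g n x @[n --> \oo] --> \int[nu]_(x in D) (0 : R).
  apply: (@Rdominated_cvg _ _ _ nu D g (fun=> 0) (fun x => x ^+ 2)) => //.
  move=> n x _; rewrite ger0_norm//; by rewrite ge_min lexx.
rewrite Rintegral_cst// mul0r in L.
have /cvgr_le/(_ eta eta0) := L => -[N _ /(_ N (leqnn N)) /= HN].
have ig : nu.-integrable D (EFin \o (g N : measurableTypeR R -> R)).
  have := ix2; apply: le_integrable => //; first exact/measurable_EFinP.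
  by move=> x _ /=; rewrite lee_fin !ger0_norm ?sqr_ge0// ge_min lexx.
exists N.+1%:R; first by rewrite ltr0n.
move=> z w zw Nw.
have w0 : 0 <= w by exact: le_trans zw.
have K (f : R -> R) : nu.-integrable D (EFin \o (f : measurableTypeR R -> R)) ->
    (forall x, `|f x| <= (z * x) ^+ 2) -> (forall x, `|f x| <= 2 * `|z * x|) ->
    `|\int[nu]_(x in D) f x| <= eta * w ^+ 2.
  move=> fi f1 f2.
  apply: (@le_trans _ _ (w ^+ 2 * \int[nu]_(x in D) g N x)); last first.
    by rewrite mulrC ler_wpM2r ?sqr_ge0.
  rewrite -RintegralZl//; apply: Rintegral_norm_le => //.
    by have := integrableZl mD (w ^+ 2) ig.
  move=> x _; rewrite /g minr_pMr ?sqr_ge0// le_min; apply/andP; split.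
    apply: le_trans (f1 x) _; rewrite exprMn ler_wpM2r ?sqr_ge0//.
    by rewrite -[leLHS]real_normK ?num_real// ler_sqr ?nnegrE.
  apply: le_trans (f2 x) _; rewrite normrM.
  have -> : w ^+ 2 * (2 * `|x| * N.+1%:R^-1) = 2 * ((w / N.+1%:R * w) * `|x|) by field.
  rewrite ler_wpM2l// ler_wpM2r//; apply: le_trans zw _.
  by rewrite ler_peMl// ler_pdivlMr ?ltr0n// mul1r.
split; apply: K => //.
- move=> x; have /andP[q0 q1] := one_sub_cos_le (z * x).
  by rewrite -normrN opprB ger0_norm//; have := sqr_ge0 (z * x); lra.
- move=> x; rewrite -normrN opprB; apply: le_trans (ler_norm_1Bcos _) _.
  by rewrite ler_peMl// ler1n.
- by move=> x; rewrite -normrN opprB; exact: norm_subr_sin_le.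
- move=> x; apply: le_trans (ler_normB _ _) _.
  by have := ler_norm_sin (z * x); lra.
Unshelve. all: by end_near. Qed.

End LevyExponent.

(** * Atoms of a finite family of sets *)

Section Atoms.
Context {J : finType} {T : Type} (F : J -> set T).

(** An empty [I] is given the empty set, because the points outside every [F j] may have infinite
    measure. *)
Definition atom (I : {set J}) : set T :=
  [set p | I != finset.set0 /\ forall j, F j p <-> j \in I].

Lemma trivIset_atom : trivIset setT atom.
Proof.
apply/trivIsetP => I I' _ _ II'; apply/seteqP; split => // p [[_ H] [_ H']].
move/negP: II'; apply; apply/eqP/finset.setP => j.
by apply/idP/idP => [/H/H'|/H'/H].
Qed.

Lemma bigcup_atom (C : {set J} -> bool) : ~~ C finset.set0 ->
  \bigcup_(I in [set I | C I]) atom I = [set p | C (finset (fun j : J => `[< F j p >]))].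
Proof.
move=> C0; apply/seteqP; split => [p [I /= CI [I0 H]]|p /= Cp].
  rewrite (_ : finset _ = I)//; apply/setP => j; rewrite inE.
  by apply/asboolP/idP => /H.
exists (finset (fun j : J => `[< F j p >])) => //; split.
  by apply: contraNneq C0 => <-.
by move=> j; rewrite inE; split => [/asboolP|/asboolP].
Qed.

Lemma atom_pair (j k : J) :
  \bigcup_(I in [set I : {set J} | (j \in I) && (k \in I)]) atom I = F j `&` F k.
Proof.
rewrite (bigcup_atom (C := fun I : {set J} => (j \in I) && (k \in I))) ?inE//.
by apply/seteqP; split => p /=; rewrite !inE;
  [move=> /andP[/asboolP ? /asboolP ?]|move=> [? ?]; apply/andP; split; apply/asboolP].
Qed.

End Atoms.

Section AtomMeasure.
Context {R : realType} d (T : measurableType d) (mu : {measure set T -> \bar R}).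
Context (J : finType) (F : J -> set T).
Context (mF : forall j, measurable (F j)) (fF : forall j, (mu (F j) < +oo)%E).

Lemma measurable_atom I : measurable (atom F I).
Proof.
have [->|I0] := eqVneq I finset.set0.
  by rewrite (_ : atom F _ = set0)//; apply/seteqP; split => // p [] /eqP.
have -> : atom F I = \bigcap_j (if j \in I then F j else ~` F j).
  apply/seteqP; split => [p [_ H] j _|p H].
    by case: ifPn => jI; [exact/H|move=> /H; rewrite (negbTE jI)].
  split => // j; have := H j Logic.I; case: ifPn => jI //.
apply: fin_bigcap_measurable => // j _; case: ifP => _ //; exact: measurableC.
Qed.

Lemma atom_finite I : (mu (atom F I) < +oo)%E.
Proof.
have [->|[j jI]] := finset.set_0Vmem I.
  rewrite (_ : atom F _ = set0); first by rewrite measure0 ltry.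
  by apply/seteqP; split => // p [] /eqP.
apply: le_lt_trans (fF j); apply: le_measure; rewrite ?inE//; first exact: measurable_atom.
by move=> p [_ H]; exact/H.
Qed.

Definition atom_mass I : R := fine (mu (atom F I)).

Lemma atom_mass_ge0 I : 0 <= atom_mass I.
Proof. by rewrite fine_ge0. Qed.

Lemma atom_mass_pair (j k : J) :
  fine (mu (F j `&` F k)) = \sum_(I : {set J} | (j \in I) && (k \in I)) atom_mass I.
Proof.
rewrite -atom_pair measure_fin_bigcup//; last 3 first.
- exact: finite_finset.
- by apply: sub_trivIset (@trivIset_atom _ _ F).
- by move=> I _; exact: measurable_atom.
rewrite -(@bigfs _ _ _ _ (index_enum {set J}) (fun I : {set J} => (j \in I) && (k \in I)))//; last 2 first.
- exact: index_enum_uniq.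
- by move=> I _; rewrite mem_index_enum.
rewrite -sum_fine// => I _; rewrite ge0_fin_numE//; exact: atom_finite.
Qed.

(** A pair [j], [k] collects all atoms inside both [F j] and [F k]. Pairwise intersections are the
    areas that can be computed, so sums over atoms are brought to this form. *)
Lemma atom_mass_sum (f : J -> J -> R) :
  \sum_(I : {set J}) atom_mass I * (\sum_(j in I) \sum_(k in I) f j k) =
  \sum_j \sum_k f j k * fine (mu (F j `&` F k)).
Proof.
transitivity (\sum_(I : {set J}) \sum_j \sum_k (if (j \in I) && (k \in I) then f j k * atom_mass I else 0)).
  apply: eq_bigr => I _; rewrite mulr_sumr [LHS]big_mkcond/=; apply: eq_bigr => j _.
  case: ifP => jI /=; last by rewrite big1.
  rewrite mulr_sumr big_mkcond/=; apply: eq_bigr => k _; by case: ifP => // _; rewrite mulrC.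
rewrite exchange_big/=; apply: eq_bigr => j _; rewrite exchange_big/=; apply: eq_bigr => k _.
by rewrite atom_mass_pair mulr_sumr -big_mkcond.
Qed.

Lemma atom_mass_single (f : J -> R) :
  \sum_(I : {set J}) atom_mass I * (\sum_(j in I) f j) = \sum_j f j * fine (mu (F j)).
Proof.
pose g j k : R := if j == k then f j else 0.
have gE (Q : pred J) j : Q j -> \sum_(k | Q k) g j k = f j.
  move=> Qj; rewrite (bigD1 j)//= /g eqxx big1 ?addr0// => k /andP[_ kj].
  by rewrite eq_sym (negbTE kj).
transitivity (\sum_(I : {set J}) atom_mass I * (\sum_(j in I) \sum_(k in I) g j k)).
  by apply: eq_bigr => I _; congr (_ * _); apply: eq_bigr => j jI; rewrite gE.
rewrite atom_mass_sum; apply: eq_bigr => j _.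
rewrite (bigD1 j)//= /g eqxx setIid big1 ?addr0// => k kj.
by rewrite eq_sym (negbTE kj) mul0r.
Qed.

Lemma atom_mass_sqr (theta : J -> R) :
  \sum_(I : {set J}) atom_mass I * (\sum_(j in I) theta j) ^+ 2 =
  \sum_j \sum_k theta j * theta k * fine (mu (F j `&` F k)).
Proof.
rewrite -(atom_mass_sum (fun j k => theta j * theta k)); apply: eq_bigr => I _; congr (_ * _).
by rewrite expr2 mulr_suml; apply: eq_bigr => j _; rewrite mulr_sumr.
Qed.

End AtomMeasure.

Section LevyBasisSums.
Context {R : realType} d (Omega : measurableType d) (P : probability Omega R).
Context (gamma b : R) (nu : {measure set (measurableTypeR R) -> \bar R}).
Context (L : set (measurableTypeR R * measurableTypeR R) -> Omega -> R)
  (LB : levy_basis P gamma b nu L).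
Context (ix2 : nu.-integrable [set x | x != 0] (EFin \o (fun x : measurableTypeR R => x ^+ 2))).
Notation m := (levy_mean gamma nu).

Let fb0 : finite_borel2 (set0 : set (measurableTypeR R * measurableTypeR R)).
Proof. by split => //; rewrite measure0 ltry. Qed.

(** Additivity over a sequence of empty sets makes the partial sums converge, so their constant
    increment [L set0] is 0. *)
Lemma levy_basis_set0 : {ae P, forall w, L set0 w = 0}.
Proof.
have := lb_sigma_additive LB (F := fun=> set0) (fun=> measurable0) _ _.
rewrite (_ : \bigcup_(_ : nat) set0 = set0); last by apply/seteqP; split => // p [].
move=> /(_ _ _)/wrap[]; first by apply/trivIsetP => *; rewrite set0I.
  by rewrite measure0 ltry.
apply: filterS => w H.
have H1 : (\sum_(0 <= k < n.+1) L set0 w) @[n --> \oo] --> L set0 w.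
  by move: H; rewrite -(cvg_shiftS (fun n => \sum_(0 <= k < n) L set0 w)).
have D : (\sum_(0 <= k < n.+1) L set0 w - \sum_(0 <= k < n) L set0 w) @[n --> \oo] --> L set0 w - L set0 w.
  exact: cvgB.
have E : (fun n => \sum_(0 <= k < n.+1) L set0 w - \sum_(0 <= k < n) L set0 w) = (fun=> L set0 w).
  by apply/funext => n; rewrite big_nat_recr//= addrAC subrr add0r.
rewrite subrr E in D.
exact: (cvg_unique _ (cvg_cst (L set0 w)) D).
Qed.

Lemma levy_basis_additive (I : finType) (G : I -> set (measurableTypeR R * measurableTypeR R)) :
  (forall i, measurable (G i)) -> trivIset setT G -> (leb2 (\bigcup_i G i) < +oo)%E ->
  {ae P, forall w, L (\bigcup_i G i) w = \sum_i L (G i) w}.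
Proof.
move=> mG tG fG.
(* The finite family is padded with empty sets to a sequence, to which sigma-additivity applies. *)
pose H (k : nat) := if insub k : option 'I_#|I| is Some o then G (enum_val o) else set0.
have HE (o : 'I_#|I|) : H o = G (enum_val o) by rewrite /H valK.
have HU : \bigcup_k H k = \bigcup_i G i.
  apply/seteqP; split => [p [k _]|p [i _ Gi]].
    by rewrite /H; case: insubP => // o _ _ Gp; exists (enum_val o).
  by exists (enum_rank i) => //; rewrite HE enum_rankK.
have mH k : measurable (H k) by rewrite /H; case: insubP.
have tH : trivIset setT H.
  apply/trivIsetP => k k' _ _ kk'; rewrite /H.
  case: insubP => [x _ xk|_]; last by rewrite set0I.
  case: insubP => [x' _ xk'|_]; last by rewrite setI0.
  move/trivIsetP : tG; apply => //; apply: contra kk' => /eqP/enum_val_inj xx'.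
  by rewrite -xk -xk' xx'.
have := lb_sigma_additive LB mH tH; rewrite HU => /(_ fG) A.
have := levy_basis_set0; move: A; apply: filterS2 => w A L0.
have E n : (#|I| <= n)%N -> \sum_(0 <= k < n) L (H k) w = \sum_i L (G i) w.
  move=> In; rewrite (big_cat_nat (leq0n _) In)//= [X in _ + X]big1_seq ?addr0; last first.
    move=> k /=; rewrite mem_index_iota => /andP[k1 _].
    by rewrite /H insubF// ltnNge k1.
  rewrite big_mkord (eq_bigr (fun i : 'I_#|I| => L (G (enum_val i)) w)) => [|i _]; last by rewrite HE.
  by rewrite -(big_enum_val (A := I) (fun i => L (G i) w)).
have C : (\sum_(0 <= k < n) L (H k) w) @[n --> \oo] --> \sum_i L (G i) w.
  apply: cvg_near_cst; near=> n; rewrite E//; near: n; exact: nbhs_infty_ge.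
exact: (cvg_unique _ A C).
Unshelve. all: by end_near. Qed.

Context (J : finType) (F : J -> set (measurableTypeR R * measurableTypeR R)) (fF : forall j, finite_borel2 (F j)).
Let mF j : measurable (F j). Proof. by case: (fF j). Qed.
Let ltF j : (leb2 (F j) < +oo)%E. Proof. by case: (fF j). Qed.
Notation v := (atom_mass (@leb2 R) F).

Let fA I : finite_borel2 (atom F I).
Proof. by split; [exact: measurable_atom|exact: atom_finite]. Qed.

Lemma levy_basis_atoms : {ae P, forall w, forall j, L (F j) w = \sum_(I : {set J} | j \in I) L (atom F I) w}.
Proof.
apply: filter_forall => j.
pose G (I : {set J}) := if j \in I then atom F I else set0.
have UG : \bigcup_I G I = F j.
  rewrite -[RHS]setIid -atom_pair; apply/seteqP; split => [p [I _]|p [I /= jI Ip]].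
    by rewrite /G; case: ifP => // jI Ip; exists I => //=; rewrite jI.
  by exists I => //; rewrite /G; case/andP: jI => ->.
have := @levy_basis_additive _ G; rewrite UG => A.
have A1 : {ae P, forall w, L (F j) w = \sum_I L (G I) w}.
  apply: A => //.
    by move=> I; rewrite /G; case: ifP => // _; exact: measurable_atom.
  apply/trivIsetP => I I' _ _ II'; rewrite /G.
  case: ifP => _; last by rewrite set0I.
  case: ifP => _; last by rewrite setI0.
  by have /trivIsetP := @trivIset_atom _ _ F; apply.
have := levy_basis_set0; move: A1; apply: filterS2 => w -> L0.
rewrite [RHS]big_mkcond/=; apply: eq_bigr => I _.
by rewrite /G; case: ifP.
Qed.

Let mL A : finite_borel2 A -> measurable_fun setT (L A : Omega -> measurableTypeR R).
Proof. exact: (lb_measurable LB). Qed.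

Let L_cf A z : finite_borel2 A -> has_cf P (fun w => z * L A w)
  (fine (leb2 A) * (- (b ^+ 2 * z ^+ 2) / 2 + jump_re nu z)) (fine (leb2 A) * (m * z + jump_im nu z)).
Proof.
move=> fbA; apply: char_fun_has_cf; first exact: mL.
rewrite (lb_char LB)// -(levy_exponent_re gamma) -(levy_exponent_im gamma b ix2).
by case: (levy_exponent _ _ _ _) => r i; congr cexp; rewrite /=; congr Complex; rewrite ?mul0r ?subr0 ?addr0.
Qed.

Definition levy_centered w j : R := L (F j) w - m * fine (leb2 (F j)).

Lemma measurable_levy_sum (theta : J -> R) :
  measurable_fun setT (fun w => \sum_j theta j * levy_centered w j).
Proof.
apply: (@measurable_sum_cond _ _ _ J predT (fun j w => theta j * levy_centered w j)) => j.
apply: measurable_funM => //; apply: measurable_funB => //; exact: (mL (fF j)).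
Qed.

(** The values on the atoms are independent, with coefficients [\sum_(j in I) theta j]. The linear
    parts of their exponents add up to the mean of the combination, which the centring cancels; only
    [jump_im] remains in the angle. *)
Lemma levy_sum_has_cf (theta : J -> R) :
  has_cf P (fun w => \sum_j theta j * levy_centered w j)
   (\sum_(I : {set J}) v I * (- (b ^+ 2 * (\sum_(j in I) theta j) ^+ 2) / 2 + jump_re nu (\sum_(j in I) theta j)))
   (\sum_(I : {set J}) v I * jump_im nu (\sum_(j in I) theta j)).
Proof.
pose tot (I : {set J}) := \sum_(j in I) theta j.
pose Y (i : 'I_#|{set J}|) := L (atom F (enum_val i)).
have ind : independent_family P Y.
  apply: (lb_independent LB (F := fun i => atom F (enum_val i))) => //.
  apply/trivIsetP => i i' _ _ ii'.
  have /trivIsetP := @trivIset_atom _ _ F; apply => //.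
  by apply: contra ii' => /eqP/enum_val_inj ->.
have cfY (i : 'I_#|{set J}|) := L_cf (tot (enum_val i)) (fA (enum_val i)).
have mY i : measurable_fun setT (Y i : Omega -> measurableTypeR R) by exact: mL.
have S (f : {set J} -> R) : \sum_(i < #|{set J}|) f (enum_val i) = \sum_I f I.
  by rewrite -(big_enum_val (A := {set J}) f).
have := has_cf_sum_independent mY ind cfY.
rewrite (S (fun I => fine (leb2 (atom F I)) * (- (b ^+ 2 * tot I ^+ 2) / 2 + jump_re nu (tot I)))).
rewrite (S (fun I => fine (leb2 (atom F I)) * (m * tot I + jump_im nu (tot I)))).
move=> /(has_cf_shift (- (\sum_j theta j * (m * fine (leb2 (F j))))))/ae_has_cf.
rewrite -[X in has_cf _ _ _ X](_ : \sum_I fine (leb2 (atom F I)) * (m * tot I + jump_im nu (tot I)) -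
  (\sum_j theta j * (m * fine (leb2 (F j)))) = _); last first.
  under eq_bigr do rewrite mulrDr.
  rewrite big_split/= addrAC.
  have -> : \sum_I fine (leb2 (atom F I)) * (m * tot I) = m * \sum_I v I * tot I.
    by rewrite mulr_sumr; apply: eq_bigr => I _; rewrite /atom_mass; ring.
  rewrite (atom_mass_single mF ltF) mulr_sumr.
  rewrite (_ : \sum_j theta j * (m * fine (leb2 (F j))) = \sum_i m * (theta i * fine (leb2 (F i)))).
    by rewrite subrr add0r.
  by apply: eq_bigr => j _; ring.
apply.
- apply: measurable_funD => //.
  apply: (@measurable_sum_cond _ _ _ _ predT (fun i w => tot (enum_val i) * Y i w)) => i.
  by apply: measurable_funM => //; exact: (mY i).
- exact: measurable_levy_sum.
- have := levy_basis_atoms; apply: filterS => w E.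
  rewrite (S (fun I => tot I * L (atom F I) w)).
  under eq_bigr => I _ do rewrite /tot mulr_suml big_mkcond/=.
  rewrite exchange_big/= -sumrB; apply: eq_bigr => j _.
  by rewrite /levy_centered E mulrBr; congr (_ - _); rewrite mulr_sumr [RHS]big_mkcond.
Qed.

Let V : R := \int[nu]_(x in [set x | x != 0]) (x ^+ 2).

(** The exponent at [z] is bounded by [z ^ 2] times the quadratic form of overlaps, so [cf_moments]
    applies and supplies the factor 4. *)
Lemma levy_sum_moments (theta : J -> R) :
  let Y w := \sum_j theta j * levy_centered w j in
  [/\ (\int[P]_w (Y w ^+ 2)%:E <=
        (4 * ((b ^+ 2 + V) * \sum_j \sum_k theta j * theta k * fine (leb2 (F j `&` F k))))%:E)%E,
      P.-integrable setT (EFin \o Y) & \int[P]_w Y w = 0].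
Proof.
move=> Y.
pose S z (I : {set J}) := \sum_(j in I) z * theta j.
have SE z I : S z I = z * \sum_(j in I) theta j by rewrite /S mulr_sumr.
have v0 I := atom_mass_ge0 (@leb2 R) F I.
have nuL := lb_levy_measure LB.
have V0 : 0 <= V by apply: Rintegral_ge0 => x _; exact: sqr_ge0.
apply: (cf_moments (rho := fun z => \sum_(I : {set J}) v I * (- (b ^+ 2 * S z I ^+ 2) / 2 + jump_re nu (S z I)))
  (theta := fun z => \sum_(I : {set J}) v I * jump_im nu (S z I))).
- exact: measurable_levy_sum.
- move=> z; have := levy_sum_has_cf (fun j => z * theta j).
  rewrite (_ : (fun w => \sum_j z * theta j * levy_centered w j) = (fun w => z * Y w))//.
  by apply/funext => w; rewrite /Y mulr_sumr; apply: eq_bigr => j _; rewrite mulrA.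
- move=> z; rewrite -(atom_mass_sqr mF ltF).
  have E : (b ^+ 2 + V) * (\sum_I v I * (\sum_(j in I) theta j) ^+ 2) * z ^+ 2 =
      \sum_I v I * ((b ^+ 2 + V) * S z I ^+ 2).
    by rewrite mulr_sumr mulr_suml; apply: eq_bigr => I _; rewrite SE; ring.
  rewrite E; split; [|split].
  + apply: sumr_le0 => I _; rewrite mulr_ge0_le0//.
    have := jump_re_le0 nuL (S z I); have : 0 <= b ^+ 2 * S z I ^+ 2 by rewrite mulr_ge0 ?sqr_ge0.
    lra.
  + rewrite -sumrN; apply: ler_sum => I _; rewrite -mulrN ler_wpM2l//.
    have := jump_re_ge nuL ix2 (S z I); have : 0 <= b ^+ 2 * S z I ^+ 2 by rewrite mulr_ge0 ?sqr_ge0.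
    by rewrite -/V mulrDl; lra.
  + apply: le_trans (ler_norm_sum _ _ _) _; apply: ler_sum => I _; rewrite normrM ger0_norm// ler_wpM2l//.
    apply: le_trans (jump_im_le ix2 (S z I)) _.
    by rewrite -/V mulrDl lerDr mulr_ge0 ?sqr_ge0.
Qed.

End LevyBasisSums.

(** * Trawl sets *)

Section TrawlSets.
Context {R : realType} (a : R -> R) (a_trawl : trawl_function a).
Notation mu := (@lebesgue_measure R).

(** Continuous extension to the whole line by the constant [a 0], as nothing is known of [a] at
    negative arguments. *)
Let ext (x : R) : R := a (Num.max 0 x).

Let ext_ge0 x : 0 <= ext x.
Proof. by apply: (trawl_ge0 a_trawl); rewrite le_max lexx. Qed.

Let extE x : 0 <= x -> ext x = a x.
Proof. by move=> x0; rewrite /ext max_r. Qed.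

Let ext_continuous : continuous ext.
Proof.
move=> x; apply/cvgrPdist_le => e e0.
have /subspace_continuousP/(_ (Num.max 0 x)) := trawl_continuous a_trawl.
rewrite /= in_itv/= andbT le_max lexx => /(_ isT)/cvgrPdist_le/(_ e e0) H.
have M : Num.max 0 y @[y --> x] --> Num.max 0 x.
  by apply: (@continuous_max _ _ (fun=> 0) id) => //; exact: cst_continuous.
have H' : \forall y \near x, (`[0, +oo[%classic : set R) (Num.max 0 y) -> `|ext x - ext y| <= e := M _ H.
move: H'; apply: filterS => y /=; apply.
by rewrite in_itv/= andbT le_max lexx.
Qed.

Lemma trawl_setE t : trawl_set a t = [set p | p.1 <= t /\ 0 <= p.2 <= a (t - p.1)].
Proof.
apply/seteqP; split => [p [[x y]/= [x0 y0] <-]/=|[x y]/= [xt y0]].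
  split; first lra.
  by rewrite (_ : t - (x + t) = - x)//; ring.
exists (x - t, y); last by rewrite subrK.
by split => /=; [lra|rewrite opprB].
Qed.

(** The times whose trawl set contains a given point form an interval, because [a] is
    non-increasing; an atom therefore picks consecutive indices of a sampling grid. *)
Lemma trawl_set_between s1 s2 s3 p : s1 <= s2 -> s2 <= s3 ->
  trawl_set a s1 p -> trawl_set a s3 p -> trawl_set a s2 p.
Proof.
move=> s12 s23; rewrite !trawl_setE/= => -[p1 /andP[q0 q1]] [p2 /andP[q2 q3]].
split; first exact: le_trans s12.
rewrite q0/=; apply: le_trans q3 _; apply: (trawl_nonincreasing a_trawl); lra.
Qed.

Lemma measurable_trawl_set t : measurable (trawl_set a t).
Proof.
have -> : trawl_set a t = [set p | p.1 <= t] `&` ([set p | 0 <= p.2] `&` [set p | p.2 <= ext (t - p.1)]).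
  rewrite trawl_setE; apply/seteqP; split => [p/= [pt /andP[p0 p1]]|p /= [pt [p0 p1]]].
    by split => //; split => //; rewrite extE// subr_ge0.
  by split => //; rewrite p0/= -extE// subr_ge0.
have me : measurable_fun setT (ext : measurableTypeR R -> measurableTypeR R).
  exact: (continuous_measurable_fun ext_continuous).
have m1 : measurable_fun setT (fst : measurableTypeR R * measurableTypeR R -> measurableTypeR R) by exact: measurable_fst.
have m2 : measurable_fun setT (snd : measurableTypeR R * measurableTypeR R -> measurableTypeR R) by exact: measurable_snd.
apply: measurableI; [|apply: measurableI].
- by rewrite -[X in measurable X]setTI; apply: measurable_fun_le => //.
- by rewrite -[X in measurable X]setTI; apply: measurable_fun_le => //.
- rewrite -[X in measurable X]setTI; apply: measurable_fun_le => //.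
  by apply: (measurableT_comp me); exact: measurable_funB.
Qed.

(** The intersection is the part of the later trawl set to the left of [s], and the substitution
    [x |-> t - x] turns its area into a tail integral of [a]. *)
Let inter_le s t : s <= t -> leb2 (trawl_set a s `&` trawl_set a t) = (overlap a (t - s))%:E.
Proof.
move=> st.
have -> : trawl_set a s `&` trawl_set a t = [set p | p.1 <= s /\ 0 <= p.2 <= ext (t - p.1)].
  rewrite !trawl_setE; apply/seteqP; split => p /=.
    by move=> [[ps /andP[q0 q1]] [pt q2]]; split => //; rewrite extE ?subr_ge0.
  move=> [ps /andP[q0]]; rewrite extE; last by rewrite subr_ge0; lra.
  move=> q1; split; split => //; [|lra|by rewrite q0].
  by rewrite q0/=; apply: le_trans q1 _; apply: (trawl_nonincreasing a_trawl); lra.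
rewrite /leb2 /product_measure1/=.
transitivity (\int[mu]_(x in `]-oo, s]) (ext (t - x))%:E)%E.
  rewrite [RHS]integral_mkcond; apply: eq_integral => x _ /=.
  rewrite patchE; case: ifPn => xs.
    rewrite (_ : xsection _ _ = `[0, ext (t - x)]%classic); last first.
      apply/seteqP; split => y; rewrite /xsection/= inE/= in_itv/=; first by case.
      by move=> ?; split => //; move: xs; rewrite inE/= in_itv.
    rewrite lebesgue_measure_itv/= lte_fin; case: ifPn => [_|]; first by rewrite sube0.
    by rewrite -leNgt => e0; congr EFin; apply/le_anti; rewrite e0 ext_ge0.
  rewrite (_ : xsection _ _ = set0) ?measure0//.
  apply/seteqP; split => y //; rewrite /xsection/= inE/= => -[xs' _].
  by move/negP: xs; apply; rewrite inE/= in_itv.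
have -> : s = (fun x => t - x) (t - s) by rewrite /=; ring.
have D : derive1 (fun x : R => t - x) = cst (-1).
  apply/funext => x; rewrite derive1E deriveB// derive_cst derive_id sub0r//.
rewrite (@decreasing_ge0_integration_by_substitutiony _ (fun x => t - x) (fun x => ext (t - x)) (t - s)).
- rewrite /overlap.
  have E x : x \in (`[t - (t - (t - s)), +oo[%classic : set R) ->
      (((fun x0 : R => ext (t - x0)) \o (fun x0 : R => t - x0)) * (fun x0 => - derive1 (fun x0 : R => t - x0) x0)) x = a x.
    rewrite inE/= in_itv/= andbT => xs.
    rewrite D !fctE /= opprK mulr1 (_ : t - (t - x) = x); last ring.
    by rewrite extE//; lra.
  rewrite (_ : t - (t - (t - s)) = t - s) in E; last ring.
  transitivity (\int[mu]_(x in `[(t - s)%R, +oo[) (a x)%:E)%E.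
    by apply: eq_integral => x xs; rewrite -(E x xs).
  rewrite (_ : t - (t - (t - s)) = t - s); last ring.
  rewrite /Rintegral fineK//; apply: integrable_fin_num => //.
  apply: integrableS (trawl_integrable a_trawl) => //.
  by apply: subset_itvr; rewrite bnd_simp; lra.
- by move=> x y _ _; rewrite ltrD2l ltrN2.
- by rewrite D => ? _; exact: cst_continuous.
- by rewrite D; exact: is_cvg_cst.
- by rewrite D; exact: is_cvg_cst.
- split => [x _|]; first exact: derivableB.
  by apply: cvg_at_right_filter; apply: cvgB; [exact: cvg_cst|exact: cvg_id].
- apply/cvgrNyPle => M; near=> x; have : t - M <= x by near: x; apply: nbhs_pinfty_ge; rewrite num_real.
  lra.
- apply: continuous_subspaceT => x; apply: continuous_comp; last exact: ext_continuous.
  by apply: cvgB; [exact: cvg_cst|exact: cvg_id].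
- by [].
Unshelve. all: by end_near. Qed.

Lemma leb2_trawl_setI s t : leb2 (trawl_set a s `&` trawl_set a t) = (overlap a `|t - s|)%:E.
Proof.
have [st|/ltW ts] := leP s t; first by rewrite inter_le// ger0_norm// subr_ge0.
by rewrite setIC inter_le// distrC ger0_norm// subr_ge0.
Qed.

Lemma finite_borel2_trawl_set t : finite_borel2 (trawl_set a t).
Proof.
split; first exact: measurable_trawl_set.
by rewrite -[X in leb2 X]setIid leb2_trawl_setI ltry.
Qed.

Lemma leb2_trawl_set t : fine (leb2 (trawl_set a t)) = overlap a 0.
Proof. by rewrite -[X in leb2 X]setIid leb2_trawl_setI subrr normr0. Qed.

End TrawlSets.

(** * Characteristic functions of sums of trawl values *)

Section ExponentBounds.
Context {R : realType} d (T : measurableType d) (mu : {measure set T -> \bar R}).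
Context (J : finType) (F : J -> set T).
Context (mF : forall j, measurable (F j)) (ltF : forall j, (mu (F j) < +oo)%E).
Notation v := (atom_mass mu F).
Notation area j k := (fine (mu (F j `&` F k))).

(** On each atom the defect is bounded by the product of the two total weights, and such products
    are sums over pairs of sets. *)
Lemma atom_sum_cross (f : R -> R) (c : R) (alpha beta : J -> R) : 0 <= c ->
  (forall y z, `|f (y + z) - f y - f z| <= c * (`|y| * `|z|)) ->
  `|\sum_(I : {set J}) v I * f (\sum_(j in I) (alpha j + beta j))
    - \sum_(I : {set J}) v I * f (\sum_(j in I) alpha j)
    - \sum_(I : {set J}) v I * f (\sum_(j in I) beta j)|
  <= c * \sum_j \sum_k `|alpha j| * `|beta k| * area j k.
Proof.
move=> c0 fc; rewrite -!sumrB -(atom_mass_sum mF ltF (fun j k => `|alpha j| * `|beta k|)) mulr_sumr.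
apply: le_trans (ler_norm_sum _ _ _) _; apply: ler_sum => I _.
rewrite -!mulrBr normrM ger0_norm ?atom_mass_ge0// mulrCA ler_wpM2l ?atom_mass_ge0//.
rewrite big_split/=; apply: le_trans (fc _ _) _; rewrite ler_wpM2l//.
apply: le_trans (ler_pM (normr_ge0 _) (normr_ge0 _) (ler_norm_sum _ _ _) (ler_norm_sum _ _ _)) _.
by rewrite mulr_suml le_eqVlt; apply/orP; left; apply/eqP; apply: eq_bigr => j _; rewrite mulr_sumr.
Qed.

(* The atoms meeting many of the sets [F j] with [S j] see [f] in its subquadratic range;
   the other ones only meet sets at positions close to each other. *)
Lemma atom_sum_small (f : R -> R) (V eta Z h : R) (theta : J -> R) (S : pred J) (pos : J -> nat) (M : nat) :
  0 <= V -> 0 <= eta -> 0 < h ->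
  (forall z, `|f z| <= V * z ^+ 2) ->
  (forall z w, `|z| <= w -> Z <= w -> `|f z| <= eta * w ^+ 2) ->
  (forall j, `|theta j| <= if S j then h else 0) ->
  (forall I, atom F I !=set0 -> forall j k, j \in I -> k \in I -> S j -> S k ->
     (pos j < pos k + #|[set i in I | S i]%SET|)%N) ->
  Z <= M%:R * h ->
  `|\sum_(I : {set J}) v I * f (\sum_(j in I) theta j)| <=
  h ^+ 2 * (eta * (\sum_(j | S j) \sum_(k | S k) area j k) +
    V * (\sum_(j | S j) \sum_(k | S k && ((pos j < pos k + M)%N && (pos k < pos j + M)%N)) area j k)).
Proof.
move=> V0 eta0 h0 fV feta thetaS HI ZM.
have cond (A : R) (b : bool) : (if b then A else 0) = b%:R * A by case: b; rewrite ?mul1r ?mul0r.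
pose g j k : R := (S j && S k)%:R.
pose g' j k : R := (S j && (S k && ((pos j < pos k + M)%N && (pos k < pos j + M)%N)))%:R.
have -> : \sum_(j | S j) \sum_(k | S k) area j k = \sum_j \sum_k g j k * area j k.
  rewrite big_mkcond; apply: eq_bigr => j _; rewrite /g; case: (S j) => /=.
    by rewrite big_mkcond; apply: eq_bigr => k _; rewrite cond.
  by rewrite big1// => k _; rewrite mul0r.
have -> : \sum_(j | S j) \sum_(k | S k && ((pos j < pos k + M)%N && (pos k < pos j + M)%N)) area j k =
    \sum_j \sum_k g' j k * area j k.
  rewrite big_mkcond; apply: eq_bigr => j _; rewrite /g'; case: (S j) => /=.
    by rewrite big_mkcond; apply: eq_bigr => k _; rewrite cond.
  by rewrite big1// => k _; rewrite mul0r.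
rewrite -!(atom_mass_sum mF ltF) !mulr_sumr -big_split/= mulr_sumr.
apply: le_trans (ler_norm_sum _ _ _) _; apply: ler_sum => I _.
rewrite normrM ger0_norm ?atom_mass_ge0//.
have -> : h ^+ 2 * (eta * (v I * (\sum_(j in I) \sum_(k in I) g j k)) + V * (v I * (\sum_(j in I) \sum_(k in I) g' j k)))
  = v I * (h ^+ 2 * (eta * (\sum_(j in I) \sum_(k in I) g j k) + V * (\sum_(j in I) \sum_(k in I) g' j k))) by ring.
(* The counting hypothesis speaks of nonempty atoms only; an empty one has no mass. *)
have [I0|/set0P I0] := eqVneq (atom F I) set0.
  by rewrite /atom_mass I0 measure0 !mul0r.
rewrite ler_wpM2l ?atom_mass_ge0//.
pose c := #|[set i in I | S i]%SET|.
have cE : \sum_(j in I) (S j)%:R = c%:R :> R.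
  rewrite /c -sum1_card natr_sum big_mkcond [RHS]big_mkcond; apply: eq_bigr => j _.
  by rewrite !inE; case: (j \in I); case: (S j).
have gE : \sum_(j in I) \sum_(k in I) g j k = c%:R ^+ 2.
  rewrite expr2 -cE mulr_suml; apply: eq_bigr => j _; rewrite mulr_sumr; apply: eq_bigr => k _.
  by rewrite /g -natrM mulnb.
have g'0 : 0 <= \sum_(j in I) \sum_(k in I) g' j k.
  by apply: sumr_ge0 => j _; apply: sumr_ge0 => k _; rewrite /g'.
have tot : `|\sum_(j in I) theta j| <= h * c%:R.
  apply: le_trans (ler_norm_sum _ _ _) _; rewrite -cE mulr_sumr; apply: ler_sum => j _.
  by apply: le_trans (thetaS j) _; case: (S j); rewrite ?mulr1 ?mulr0.
(* Either the bound [h * c] on the argument reaches [Z], and the subquadratic estimate is paid by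
   all [c ^ 2] pairs, or [c < M] and all these pairs lie in the band. *)
have [Zc|cZ] := leP Z (h * c%:R).
  apply: le_trans (feta _ _ tot Zc) _; rewrite gE exprMn mulrCA ler_wpM2l ?sqr_ge0//.
  by rewrite lerDl mulr_ge0.
have cM : (c < M)%N.
  by rewrite -(ltr_nat R) -(ltr_pM2r h0) mulrC; apply: lt_le_trans cZ ZM.
have g'E : \sum_(j in I) \sum_(k in I) g' j k = c%:R ^+ 2.
  rewrite -gE; apply: eq_bigr => j jI; apply: eq_bigr => k kI; rewrite /g /g'.
  have [Sj|//] := boolP (S j); have [Sk|//] := boolP (S k).
  by rewrite (ltn_trans (HI _ I0 _ _ jI kI Sj Sk)) ?ltn_add2l// (ltn_trans (HI _ I0 _ _ kI jI Sk Sj)) ?ltn_add2l.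
rewrite gE g'E.
apply: (@le_trans _ _ (V * (h * c%:R) ^+ 2)).
  apply: le_trans (fV _) _; rewrite ler_wpM2l// -[leLHS]real_normK ?num_real//.
  by rewrite ler_sqr ?nnegrE// mulr_ge0// ltW.
rewrite exprMn mulrCA ler_wpM2l ?sqr_ge0// lerDr mulr_ge0// sqr_ge0//.
Qed.

End ExponentBounds.

Lemma cvg_finsum (R : realType) (I : Type) (s : seq I) (f : I -> nat -> R) (l : I -> R) :
  (forall i, f i n @[n --> \oo] --> l i) -> \sum_(i <- s) f i n @[n --> \oo] --> \sum_(i <- s) l i.
Proof.
move=> fl; elim: s => [|i s IH].
  by rewrite big_nil; under eq_fun do rewrite big_nil; exact: cvg_cst.
rewrite big_cons; under eq_fun do rewrite big_cons.
by apply: cvgD; [exact: fl|exact: IH].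
Qed.

(** * Covariances of rescaled sums *)

Section OverlapSums.
Context {R : realType} (a a' : R -> R) (k : R).
Notation mu := (@lebesgue_measure R).
Context (a_trawl : trawl_function a) (k2 : 2 < k) (k3 : k < 3)
  (a'0 : forall y, 0 <= y -> 0 < a' y) (a'c : {within `[0, +oo[, continuous a'})
  (a'RV : regularly_varying k a')
  (aE : forall s, 0 <= s -> (a s)%:E = (\int[mu]_(y in `[s, +oo[) (a' y)%:E)%E).
Notation r := (overlap a).

Let r_ge0 (s : R) : 0 <= s -> 0 <= r s.
Proof. exact: (overlap_ge0 a_trawl a'0 a'c aE). Qed.

Section FixedStep.
Context (D : R) (D0 : 0 < D).
Notation G := (overlap_double_sum a D).
Notation S := (overlap_sum a D).

Definition overlap_rect (N N' : nat) : R := \sum_(i < N) \sum_(j < N') r `|i%:R * D - j%:R * D|.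

Lemma overlap_rectC N N' : overlap_rect N N' = overlap_rect N' N.
Proof.
rewrite /overlap_rect exchange_big/=; apply: eq_bigr => i _; apply: eq_bigr => j _.
by rewrite distrC.
Qed.

Let rect_addn N M : 2 * overlap_rect N (N + M) = G N + G (N + M) - G M.
Proof.
elim: M => [|M IH].
  by rewrite addn0 /overlap_double_sum big_ord0 subr0 /overlap_rect; ring.
have -> : overlap_rect N (N + M.+1) = overlap_rect N (N + M) + (S (N + M) - S M).
  rewrite addnS /overlap_rect; under eq_bigr do rewrite big_ord_recr/=.
  rewrite big_split/=; congr (_ + _).
  rewrite addnC /overlap_sum big_split_ord/= addrAC subrr add0r.
  rewrite (reindex_inj rev_ord_inj)/=; apply: eq_bigr => i _.
  have iN := ltn_ord i.
  have -> : (M + N)%:R * D = (N - i.+1)%:R * D + (M + i).+1%:R * D.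
    by rewrite -mulrDl -natrD; congr (_%:R * _); lia.
  by rewrite opprD addrA subrr add0r normrN ger0_norm// mulr_ge0// ltW.
have GS n : G n.+1 = G n + 2 * S n + r 0 by exact: overlap_double_sumS.
by rewrite addnS !GS mulrDr IH; ring.
Qed.

(** Polarisation for a stationary sequence: twice the covariance of two partial sums is the sum of
    their variances minus the variance of their difference. With truncated subtraction,
    [(N - N') + (N' - N)] is the distance of [N] and [N']. *)
Lemma overlap_rect_polar N N' :
  overlap_rect N N' = (G N + G N' - G ((N - N') + (N' - N))%N) / 2.
Proof.
have [NN'|/ltnW NN'] := leqP N N'.
  have -> : ((N - N') + (N' - N) = N' - N)%N by lia.
  by have := rect_addn N (N' - N); rewrite subnKC// => <-; field.
have -> : ((N - N') + (N' - N) = N - N')%N by lia.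
by have := rect_addn N' (N - N'); rewrite subnKC// overlap_rectC [G N + _]addrC => <-; field.
Qed.

(** In each row a lag [l < M] occurs at most twice, once on either side of the diagonal. *)
Lemma overlap_band_le (n M : nat) :
  \sum_(i < n) \sum_(j < n | (i < j + M)%N && (j < i + M)%N) r `|i%:R * D - j%:R * D| <=
  n%:R * (2 * (r 0 + S M)).
Proof.
have r0 (i : nat) : 0 <= r (i%:R * D) by rewrite r_ge0// mulr_ge0// ltW.
have SM : \sum_(l < M) r (l%:R * D) <= r 0 + S M.
  case: M => [|M]; first by rewrite big_ord0 addr_ge0 ?r_ge0// /overlap_sum big_ord0.
  rewrite big_ord_recl/= mul0r lerD2l /overlap_sum big_ord_recr/= lerDl r0//.
rewrite -[X in X%:R]card_ord -sum1_card natr_sum mulr_suml; apply: ler_sum => i _.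
rewrite mul1r; apply: (@le_trans _ _ (2 * \sum_(l < M) r (l%:R * D))); last by rewrite ler_pM2l.
pose e (j l : nat) : R := (j == i + l)%N%:R + (i == (j + l)%N :> nat)%:R.
apply: (@le_trans _ _ (\sum_(j < n) \sum_(l < M) e j l * r (l%:R * D))).
  rewrite big_mkcond/=; apply: ler_sum => j _.
  have pos (l : 'I_M) : 0 <= e j l * r (l%:R * D) by rewrite mulr_ge0// addr_ge0.
  case: ifPn => [/andP[ij ji]|_]; last by apply: sumr_ge0 => l _; exact: pos.
  have lM : ((i - j) + (j - i) < M)%N by lia.
  rewrite (bigD1 (Ordinal lM))//=.
  have rE : r `|i%:R * D - j%:R * D| = r (((i - j) + (j - i))%N%:R * D).
    congr r; have [h|/ltnW h] := leqP i j.
      rewrite (_ : ((i - j) + (j - i) = j - i)%N); last lia.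
      by rewrite distrC -mulrBl normrM (gtr0_norm D0) -natrB// normr_nat.
    rewrite (_ : ((i - j) + (j - i) = i - j)%N); last lia.
    by rewrite -mulrBl normrM (gtr0_norm D0) -natrB// normr_nat.
  rewrite rE; apply: (@le_trans _ _ (e j ((i - j) + (j - i))%N * r (((i - j) + (j - i))%N%:R * D))).
    rewrite ler_peMl// /e; have [h|/ltnW h] := leqP i j.
      have -> : (nat_of_ord j == i + ((i - j) + (j - i)))%N by apply/eqP; lia.
      by rewrite lerDl.
    have -> : (nat_of_ord i == j + ((i - j) + (j - i)))%N by apply/eqP; lia.
    by rewrite lerDr.
  by rewrite lerDl sumr_ge0// => l _; exact: pos.
rewrite exchange_big/= mulr_sumr; apply: ler_sum => l _.
rewrite -mulr_suml ler_wpM2r// /e big_split/= (_ : 2 = 1 + 1)//.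
have one (Q : pred 'I_n) : (forall j j' : 'I_n, Q j -> Q j' -> j = j') -> \sum_(j < n) (Q j)%:R <= 1 :> R.
  move=> QQ; have [j Qj|Q0] := pickP Q.
    rewrite (bigD1 j)//= Qj big1 ?addr0// => j' jj'.
    by case: (boolP (Q j')) => // /(QQ _ _ Qj) jE; rewrite jE eqxx in jj'.
  by rewrite big1// => j _; rewrite Q0.
apply: lerD; apply: one => j j' /eqP h /eqP h'; apply: val_inj => /=; lia.
Qed.

End FixedStep.

Context (Delta : nat -> R) (Delta_gt0 : forall n, (0 < n)%N -> 0 < Delta n)
  (Delta_cvg0 : Delta n @[n --> \oo] --> 0) (horizon_cvgy : (n%:R * Delta n) @[n --> \oo] --> +oo).
Notation sc := (scaling a Delta).

Lemma truncn_ratio_cvg (t : R) : 0 <= t -> (Num.truncn (n%:R * t))%:R / n%:R @[n --> \oo] --> t.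
Proof.
move=> t0; have H : t - n%:R^-1 @[n --> \oo] --> t - 0.
  apply: cvgB; first exact: cvg_cst.
  apply/cvgrPdist_le => e e0; near=> n.
  have ne : e^-1 <= n%:R by near: n; exact: nbhs_infty_ger.
  have n0 : 0 < n%:R :> R by apply: lt_le_trans ne; rewrite invr_gt0.
  rewrite sub0r normrN ger0_norm ?invr_ge0// -[leRHS]invrK lef_pV2//.
  by rewrite posrE invr_gt0.
rewrite subr0 in H; apply: (squeeze_cvgr _ H (cvg_cst t)); near=> n.
have n0 : 0 < n%:R :> R by rewrite ltr0n; near: n; exact: nbhs_infty_gt.
have nt : 0 <= n%:R * t by rewrite mulr_ge0// ltW.
have /andP[q0 q1] := truncn_itv nt.
rewrite ler_pdivlMr// ler_pdivrMr//; apply/andP; split; last by rewrite [t * _]mulrC.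
rewrite mulrBl mulVf ?gt_eqF// lerBlDr natr1 mulrC; exact: ltW.
Unshelve. all: by end_near. Qed.

Let cvg_norm_diff (N N' : nat -> nat) (t t' : R) : (N n)%:R / n%:R @[n --> \oo] --> t ->
  (N' n)%:R / n%:R @[n --> \oo] --> t' ->
  ((N n - N' n) + (N' n - N n))%N%:R / n%:R @[n --> \oo] --> `|t - t'|.
Proof.
move=> Nt Nt'; have : `|(N n)%:R / n%:R - (N' n)%:R / n%:R| @[n --> \oo] --> `|t - t'|.
  by apply: cvg_norm; exact: cvgB.
apply: cvg_trans; apply: near_eq_cvg; near=> n.
rewrite -mulrBl normrM [X in _ * X]ger0_norm ?invr_ge0//; congr (_ * _).
have [h|/ltnW h] := leqP (N n) (N' n).
  rewrite (_ : ((N n - N' n) + (N' n - N n) = N' n - N n)%N); last lia.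
  by rewrite distrC -natrB// normr_nat.
rewrite (_ : ((N n - N' n) + (N' n - N n) = N n - N' n)%N); last lia.
by rewrite -natrB// normr_nat.
Unshelve. all: by end_near. Qed.

Lemma overlap_rect_cvg (N N' : nat -> nat) (t t' : R) : (N n)%:R / n%:R @[n --> \oo] --> t ->
  (N' n)%:R / n%:R @[n --> \oo] --> t' ->
  overlap_rect (Delta n) (N n) (N' n) / sc n ^+ 2 @[n --> \oo] -->
    limit_const k * (t `^ (4 - k) + t' `^ (4 - k) - `|t - t'| `^ (4 - k)).
Proof.
move=> Nt Nt'.
have C M (x : R) := overlap_double_sum_cvg a_trawl k2 k3 a'0 a'c a'RV aE Delta_gt0 Delta_cvg0 horizon_cvgy (N := M) (t := x).
have L : (overlap_double_sum a (Delta n) (N n) / sc n ^+ 2 + overlap_double_sum a (Delta n) (N' n) / sc n ^+ 2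
    - overlap_double_sum a (Delta n) ((N n - N' n) + (N' n - N n))%N / sc n ^+ 2) / 2 @[n --> \oo] -->
    (2 * (t `^ (4 - k) * limit_const k) + 2 * (t' `^ (4 - k) * limit_const k) - 2 * (`|t - t'| `^ (4 - k) * limit_const k)) / 2.
  apply: cvgM; last exact: cvg_cst.
  apply: cvgB; last by apply: C; exact: cvg_norm_diff.
  by apply: cvgD; exact: C.
rewrite (_ : limit_const k * _ = (2 * (t `^ (4 - k) * limit_const k) + 2 * (t' `^ (4 - k) * limit_const k) - 2 * (`|t - t'| `^ (4 - k) * limit_const k)) / 2); last by field.
apply: cvg_trans L; apply: near_eq_cvg; near=> n.
have n0 : (0 < n)%N by near: n; exact: nbhs_infty_gt.
rewrite overlap_rect_polar; last exact: Delta_gt0.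
by rewrite /=; ring.
Unshelve. all: by end_near. Qed.

Section LinearCombination.
Context (p : nat) (t : 'I_p -> R) (t01 : forall j, 0 <= t j <= 1) (u : 'I_p -> R).

(** The coefficient of the [i]-th sample in a combination, with coefficients [u], of the rescaled
    sums at the times [t j]. *)
Definition grid_weight (n i : nat) : R := (\sum_j u j * (i < Num.truncn (n%:R * t j))%N%:R) / sc n.

Let N n j : nat := Num.truncn (n%:R * t j).

Lemma truncn_grid_le n j : (Num.truncn (n%:R * t j) <= n)%N.
Proof.
have /andP[q0 q1] := t01 j; rewrite truncn_le_nat.
have n0 : 0 <= n%:R :> R by [].
by apply: (@le_lt_trans _ _ n%:R); [rewrite ler_piMr|rewrite ltr_nat].
Qed.

Lemma grid_sum n (x : nat -> R) :
  \sum_(i < n) grid_weight n i * x i = \sum_j u j * ((\sum_(0 <= i < Num.truncn (n%:R * t j)) x i) / sc n).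
Proof.
under eq_bigr do rewrite /grid_weight mulrAC mulr_suml mulr_suml.
rewrite exchange_big/=; apply: eq_bigr => j _.
rewrite big_mkord (big_ord_widen n x (truncn_grid_le n j)) mulr_suml mulr_sumr.
rewrite [RHS]big_mkcond; apply: eq_bigr => i _.
by case: ifP => _; rewrite ?mulr1 ?mulr0 ?mul0r//; ring.
Qed.

Lemma norm_grid_weight n i : `|grid_weight n i| <= (\sum_j `|u j|) / `|sc n|.
Proof.
rewrite /grid_weight normrM normfV ler_wpM2r ?invr_ge0//.
apply: le_trans (ler_norm_sum _ _ _) _; apply: ler_sum => j _.
by rewrite normrM -[leRHS]mulr1 ler_wpM2l//; case: (_ < _)%N; rewrite ?normr1 ?normr0.
Qed.

Lemma grid_quadratic_cvg :
  \sum_(i < n) \sum_(l < n) grid_weight n i * grid_weight n l * r `|i%:R * Delta n - l%:R * Delta n| @[n --> \oo] -->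
  \sum_j \sum_l u j * u l * (limit_const k * (t j `^ (4 - k) + t l `^ (4 - k) - `|t j - t l| `^ (4 - k))).
Proof.
have E n : \sum_(i < n) \sum_(l < n) grid_weight n i * grid_weight n l * r `|i%:R * Delta n - l%:R * Delta n| =
    \sum_j \sum_l u j * u l * (overlap_rect (Delta n) (N n j) (N n l) / sc n ^+ 2).
  pose rr i l := r `|i%:R * Delta n - l%:R * Delta n|.
  pose h i := \sum_l u l * ((\sum_(0 <= j < N n l) rr i j) / sc n).
  transitivity (\sum_(i < n) grid_weight n i * h i).
    apply: eq_bigr => i _; rewrite /h -(grid_sum n (rr i)) mulr_sumr.
    by apply: eq_bigr => l _; rewrite mulrA.
  rewrite grid_sum; apply: eq_bigr => j _.
  rewrite /h exchange_big/= mulr_suml mulr_sumr; apply: eq_bigr => l _.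
  rewrite -mulr_sumr -mulr_suml big_mkord.
  have -> : \sum_(i < N n j) \sum_(0 <= i' < N n l) rr i i' = overlap_rect (Delta n) (N n j) (N n l).
    by apply: eq_bigr => i _; rewrite big_mkord.
  by move: (sc n) => x; rewrite expr2 invfM; ring.
under eq_fun do rewrite E.
apply: cvg_finsum => j; apply: cvg_finsum => l.
apply: cvgM; first exact: cvg_cst.
have /andP[j0 _] := t01 j; have /andP[l0 _] := t01 l.
by apply: overlap_rect_cvg; exact: truncn_ratio_cvg.
Qed.

End LinearCombination.

End OverlapSums.

(** The exponents [rho n] and [theta n] of the fixed part may vary with [n], as the atoms do; only
    its characteristic function is constant. The sign of [rho n] keeps [exp (rho n)] at most 1 in
    the comparison. *)
Lemma cf_perturbation_cvg (R : realType) (rho theta delta eps : R^nat) (dl C beta : R) :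
  (forall n, rho n <= 0) -> (forall n, expR (rho n) * cos (theta n + beta) = C) ->
  delta n @[n --> \oo] --> dl -> eps n @[n --> \oo] --> 0 ->
  expR (rho n + delta n) * cos (theta n + eps n + beta) @[n --> \oo] --> expR dl * C.
Proof.
move=> r0 HC dd e0.
have ed : expR (delta n) @[n --> \oo] --> expR dl.
  exact: (cvg_comp _ _ dd (@continuous_expR R _)).
have B : `|expR (delta n) - expR dl| + expR dl * `|eps n| @[n --> \oo] --> `|expR dl - expR dl| + expR dl * `|0 : R|.
  apply: cvgD; first by apply: cvg_norm; apply: cvgB => //; exact: cvg_cst.
  by apply: cvgM; [exact: cvg_cst|exact: cvg_norm].
rewrite subrr normr0 mulr0 addr0 in B.
apply/cvgrPdist_le => e e1; have /cvgr_le/(_ e e1) B' := B; move: B'; apply: filterS => n; apply: le_trans.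
rewrite distrC -(HC n) expRD.
set E := expR (rho n); set c := cos (_ + eps n + _); set c' := cos (theta n + beta).
have -> : E * expR (delta n) * c - expR dl * (E * c') = E * ((expR (delta n) - expR dl) * c + expR dl * (c - c')) by ring.
have E1 : E <= 1 by rewrite /E -expR0 ler_expR.
rewrite normrM (ger0_norm (expR_ge0 _)); apply: le_trans (ler_piMl (normr_ge0 _) E1) _.
apply: le_trans (ler_normD _ _) _; rewrite !normrM; apply: lerD.
  by rewrite -[leRHS]mulr1 ler_wpM2l// norm_cos_le1.
rewrite (ger0_norm (expR_ge0 _)) ler_wpM2l ?expR_ge0//.
apply: le_trans (cos_lipschitz _ _) _.
by rewrite (_ : _ - _ = eps n)//; ring.
Qed.

(** * Joint characteristic function of trawl values and rescaled sums *)

Section JointConvergence.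
Context {R : realType} d (Omega : measurableType d) (P : probability Omega R).
Context (gamma b : R) (nu : {measure set (measurableTypeR R) -> \bar R}).
Context (L : set (measurableTypeR R * measurableTypeR R) -> Omega -> R)
  (LB : levy_basis P gamma b nu L).
Context (ix2 : nu.-integrable [set x | x != 0] (EFin \o (fun x : measurableTypeR R => x ^+ 2))).
Context (a a' : R -> R) (k : R).
Context (a_trawl : trawl_function a) (k2 : 2 < k) (k3 : k < 3)
  (a'0 : forall y, 0 <= y -> 0 < a' y) (a'c : {within `[0, +oo[, continuous a'})
  (a'RV : regularly_varying k a')
  (aE : forall s, 0 <= s -> (a s)%:E = (\int[@lebesgue_measure R]_(y in `[s, +oo[) (a' y)%:E)%E).
Context (Delta : nat -> R) (Delta_gt0 : forall n, (0 < n)%N -> 0 < Delta n)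
  (Delta_cvg0 : Delta n @[n --> \oo] --> 0) (horizon_cvgy : (n%:R * Delta n) @[n --> \oo] --> +oo).
Notation r := (overlap a).
Notation sc := (scaling a Delta).
Notation m := (levy_mean gamma nu).
Let V : R := \int[nu]_(x in [set x | x != 0]) (x ^+ 2).

Let V0 : 0 <= V. Proof. by apply: Rintegral_ge0 => x _; exact: sqr_ge0. Qed.

Let nuL : levy_measure nu := lb_levy_measure LB.

Definition trawl_centered (s : R) (w : Omega) : R := trawl_process L a s w - m * r 0.
Notation xc := trawl_centered.

Definition levy_re (z : R) : R := - (b ^+ 2 * z ^+ 2) / 2 + jump_re nu z.

Let sc_gt0 n : (0 < n)%N -> 0 < sc n.
Proof. exact: (scaling_gt0 a'0 a'c aE). Qed.

Lemma measurable_trawl_centered s : measurable_fun setT (xc s).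
Proof.
apply: measurable_funB => //.
exact: (lb_measurable LB (finite_borel2_trawl_set a_trawl s)).
Qed.

Section FiniteFamily.
Context (J : finType) (s : J -> R).
Let F j := trawl_set a (s j).
Let fF j : finite_borel2 (F j) := finite_borel2_trawl_set a_trawl (s j).
Let mF j : measurable (F j). Proof. by case: (fF j). Qed.
Let ltF j : (leb2 (F j) < +oo)%E. Proof. by case: (fF j). Qed.

Let areaE j l : fine (leb2 (F j `&` F l)) = r `|s l - s j|.
Proof. by rewrite leb2_trawl_setI. Qed.

Let sumE (c : J -> J -> R) :
  \sum_j \sum_l c j l * fine (leb2 (F j `&` F l)) = \sum_j \sum_l c j l * r `|s l - s j|.
Proof. by apply: eq_bigr => j _; apply: eq_bigr => l _; rewrite areaE. Qed.

Let centeredE w j : levy_centered gamma nu L F w j = xc (s j) w.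
Proof. by rewrite /levy_centered (leb2_trawl_set a_trawl). Qed.

Definition trawl_cf (f : R -> R) (theta : J -> R) : R :=
  \sum_(I : {set J}) atom_mass (@leb2 R) F I * f (\sum_(j in I) theta j).

Lemma trawl_sum_has_cf (theta : J -> R) :
  has_cf P (fun w => \sum_j theta j * xc (s j) w)
   (trawl_cf levy_re theta) (trawl_cf (jump_im nu) theta).
Proof.
have := levy_sum_has_cf LB ix2 fF theta.
by under eq_fun => w do under eq_bigr do rewrite centeredE.
Qed.

Lemma trawl_sum_moments (theta : J -> R) :
  let Y w := \sum_j theta j * xc (s j) w in
  [/\ (\int[P]_w (Y w ^+ 2)%:E <= (4 * (b ^+ 2 + V) * \sum_j \sum_l theta j * theta l * r `|s l - s j|)%:E)%E,
      P.-integrable setT (EFin \o Y) & \int[P]_w Y w = 0].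
Proof.
move=> Y.
have -> : Y = (fun w => \sum_j theta j * levy_centered gamma nu L F w j).
  by apply/funext => w; apply: eq_bigr => j _; rewrite centeredE.
rewrite -(sumE (fun j l => theta j * theta l)) -mulrA.
exact: (levy_sum_moments LB ix2 fF theta).
Qed.

Lemma trawl_cf_re_le0 theta : trawl_cf levy_re theta <= 0.
Proof.
apply: sumr_le0 => I _; rewrite mulr_ge0_le0 ?atom_mass_ge0//.
have := jump_re_le0 nuL (\sum_(j in I) theta j).
have : 0 <= b ^+ 2 * (\sum_(j in I) theta j) ^+ 2 by rewrite mulr_ge0 ?sqr_ge0.
by rewrite /levy_re; lra.
Qed.

Lemma trawl_cf_re_split theta : trawl_cf levy_re theta =
  - (b ^+ 2 / 2) * (\sum_j \sum_l theta j * theta l * r `|s l - s j|) + trawl_cf (jump_re nu) theta.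
Proof.
rewrite -(sumE (fun j l => theta j * theta l)) -(atom_mass_sqr mF ltF).
rewrite mulr_sumr /trawl_cf -big_split/=; apply: eq_bigr => I _.
by rewrite /levy_re; field.
Qed.

Lemma trawl_cf_re_cross alpha beta :
  `|trawl_cf levy_re (fun j => alpha j + beta j) - trawl_cf levy_re alpha - trawl_cf levy_re beta| <=
   (b ^+ 2 + 2 * V) * \sum_j \sum_l `|alpha j| * `|beta l| * r `|s l - s j|.
Proof.
have c0 : 0 <= b ^+ 2 + 2 * V by rewrite addr_ge0 ?sqr_ge0// mulr_ge0.
have := atom_sum_cross mF ltF alpha beta c0 (f := levy_re).
rewrite sumE; apply => y z; rewrite /levy_re.
have -> : - (b ^+ 2 * (y + z) ^+ 2) / 2 + jump_re nu (y + z) - (- (b ^+ 2 * y ^+ 2) / 2 + jump_re nu y)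
    - (- (b ^+ 2 * z ^+ 2) / 2 + jump_re nu z) =
   - (b ^+ 2 * (y * z)) + (jump_re nu (y + z) - jump_re nu y - jump_re nu z) by field.
apply: le_trans (ler_normD _ _) _; rewrite normrN mulrDl; apply: lerD.
  by rewrite normrM ger0_norm ?sqr_ge0// normrM.
apply: le_trans (jump_re_cross nuL ix2 y z) _.
by rewrite -/V mulrAC.
Qed.

Lemma trawl_cf_im_cross alpha beta :
  `|trawl_cf (jump_im nu) (fun j => alpha j + beta j) - trawl_cf (jump_im nu) alpha - trawl_cf (jump_im nu) beta| <=
   (2 * V) * \sum_j \sum_l `|alpha j| * `|beta l| * r `|s l - s j|.
Proof.
have c0 : 0 <= 2 * V by rewrite mulr_ge0.
have := atom_sum_cross mF ltF alpha beta c0 (f := jump_im nu).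
rewrite sumE; apply => y z; apply: le_trans (jump_im_cross ix2 y z) _.
by rewrite -/V mulrAC.
Qed.

End FiniteFamily.

Section Joint.
Context (q : nat) (s : 'I_q -> R) (s0 : forall i, 0 <= s i) (sigma : 'I_q -> R).
Context (p : nat) (t : 'I_p -> R) (t01 : forall j, 0 <= t j <= 1) (u : 'I_p -> R).

(** Left indices are the fixed times, right ones the sampling grid. The weights [alpha] and [beta]
    are both defined on the union, so that they share one family of atoms. *)
Let time n (j : 'I_q + 'I_n) : R := match j with inl i => s i | inr l => l%:R * Delta n end.
Let alpha n (j : 'I_q + 'I_n) : R := if j is inl i then sigma i else 0.
Let beta n (j : 'I_q + 'I_n) : R := if j is inr l then grid_weight a Delta t u n l else 0.
(** The summand 1 keeps [U], and with it [h], positive when all coefficients vanish. *)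
Let U : R := 1 + \sum_j `|u j|.
Let h n : R := U / sc n.

Let U0 : 0 < U. Proof. by rewrite ltr_wpDr// sumr_ge0. Qed.

Let h0 n : (0 < n)%N -> 0 < h n.
Proof. by move=> n0; rewrite divr_gt0// sc_gt0. Qed.

Let beta_le n l : (0 < n)%N -> `|grid_weight a Delta t u n l| <= h n.
Proof.
move=> n0; apply: le_trans (norm_grid_weight _ _ _ _ _ _) _.
have sc0 := sc_gt0 n0.
rewrite gtr0_norm//; apply: ler_wpM2r; first by rewrite invr_ge0 ltW.
by rewrite /U lerDr.
Qed.

Let cross n : R := \sum_j \sum_l `|@alpha n j| * `|@beta n l| * r `|time l - time j|.

(** Only pairs of a fixed time and a grid time contribute. The grid weights are at most [U / sc n],
    and [overlap_point_sum] bounds the overlaps of one fixed time with the whole grid. *)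
Let cross_cvg0 : cross n @[n --> \oo] --> (0 : R).
Proof.
have H i := overlap_cross_cvg0 a_trawl k2 k3 a'0 a'c a'RV aE Delta_gt0 Delta_cvg0 horizon_cvgy (s0 i).
have B : \sum_i `|sigma i| * (U * ((sc n)^-1 * ((s i / Delta n + 2) * r 0 + overlap1 a (n%:R * Delta n) / Delta n)))
    @[n --> \oo] --> \sum_i `|sigma i| * (U * 0).
  by apply: cvg_finsum => i; apply: cvgM; [exact: cvg_cst|apply: cvgM; [exact: cvg_cst|exact: H]].
rewrite (_ : \sum_i `|sigma i| * (U * 0) = 0) in B; last by rewrite big1// => i _; rewrite !mulr0.
apply: (squeeze_cvgr _ (cvg_cst 0) B); near=> n.
have n0 : (0 < n)%N by near: n; exact: nbhs_infty_gt.
have D0 := Delta_gt0 n0.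
have r0 x : 0 <= r `|x| by apply: (overlap_ge0 a_trawl a'0 a'c aE).
rewrite /cross; apply/andP; split.
  by apply: sumr_ge0 => j _; apply: sumr_ge0 => l _; rewrite !mulr_ge0.
rewrite big_sumType/= [X in _ + X]big1 ?addr0; last first.
  by move=> i _; rewrite big1// => j _; rewrite normr0 !mul0r.
apply: ler_sum => i _; rewrite big_sumType/= [X in X + _]big1 ?add0r; last first.
  by move=> j _; rewrite normr0 mulr0 mul0r.
under eq_bigr do rewrite -mulrA.
rewrite -mulr_sumr ler_wpM2l//.
apply: (@le_trans _ _ (\sum_(l < n) h n * r `|l%:R * Delta n - s i|)).
  by apply: ler_sum => l _; rewrite ler_wpM2r// beta_le.
have sc0 := sc_gt0 n0.
rewrite -mulr_sumr /h -mulrA; apply: ler_wpM2l; first exact: ltW.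
apply: ler_wpM2l; first by rewrite invr_ge0 ltW.
exact: (overlap_point_sum a_trawl a'0 a'c aE D0 n (s0 i)).
Unshelve. all: by end_near. Qed.

Let quad n : R := \sum_j \sum_l @beta n j * @beta n l * r `|time l - time j|.

Definition joint_variance : R :=
  \sum_j \sum_l u j * u l * (limit_const k * (t j `^ (4 - k) + t l `^ (4 - k) - `|t j - t l| `^ (4 - k))).

Let quad_cvg : quad n @[n --> \oo] --> joint_variance.
Proof.
have E n : quad n = \sum_(i < n) \sum_(l < n) grid_weight a Delta t u n i * grid_weight a Delta t u n l *
    r `|i%:R * Delta n - l%:R * Delta n|.
  rewrite /quad big_sumType/= [X in X + _]big1 ?add0r; last first.
    by move=> i _; rewrite big1// => j _; rewrite !mul0r.
  apply: eq_bigr => i _; rewrite big_sumType/= [X in X + _]big1 ?add0r; last first.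
    by move=> j _; rewrite mulr0 mul0r.
  by apply: eq_bigr => l _; rewrite distrC.
under eq_fun do rewrite E.
by apply: (grid_quadratic_cvg (a' := a')).
Qed.

(** A point of the trawl sets at [l'] and [l] lies in all those in between, so its atom has at least
    [l - l' + 1] grid indices. *)
Let atom_interval n (I : {set 'I_q + 'I_n}) : atom (fun j => trawl_set a (@time n j)) I !=set0 ->
  forall l l' : 'I_n, inr l \in I -> inr l' \in I -> (l < l' + #|[set i in I | (if i is inr _ then true else false)]%SET|)%N.
Proof.
move=> [x [_ xI]] l l' lI l'I.
have [ll'|l'l] := ltnP l l'; first by rewrite ltn_addr.
have n0 : (0 < n)%N by exact: leq_ltn_trans (ltn_ord l).
have D0 := Delta_gt0 n0.
have lt (z : 'I_(l - l').+1) : (l' + z < n)%N.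
  by apply: leq_ltn_trans (ltn_ord l); have := ltn_ord z; rewrite ltnS; lia.
pose g (z : 'I_(l - l').+1) : 'I_q + 'I_n := inr (Ordinal (lt z)).
have gi : injective g by move=> z z' [] /addnI/val_inj.
have sub : [set g z | z in 'I_(l - l').+1]%SET \subset [set i in I | (if i is inr _ then true else false)]%SET.
  apply/fintype.subsetP => i /imsetP[z _ ->]; rewrite inE andbT; apply/xI => /=.
  apply: (trawl_set_between a_trawl (s1 := l'%:R * Delta n) (s3 := l%:R * Delta n)).
  - by rewrite ler_pM2r// ler_nat leq_addr.
  - by rewrite ler_pM2r// ler_nat; have := ltn_ord z; rewrite ltnS; lia.
  - exact: (xI (inr l')).2.
  - exact: (xI (inr l)).2.
have := subset_leq_card sub; rewrite card_imset// card_ord => H.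
by rewrite -{1}(subnKC l'l) ltn_add2l.
Qed.

Let small (f : R -> R) : (forall z, `|f z| <= V * z ^+ 2) ->
  (forall eta, 0 < eta -> exists2 Z, 0 < Z & forall z w, `|z| <= w -> Z <= w -> `|f z| <= eta * w ^+ 2) ->
  trawl_cf (@time n) f (@beta n) @[n --> \oo] --> (0 : R).
Proof.
move=> fV fsub; apply/cvgrPdist_le => e e0.
pose G1 : R := 2 * (1 `^ (4 - k) * limit_const k) + 1.
have lc0 : 0 < limit_const k by exact: limit_const_gt0.
have G10 : 0 < G1 by rewrite addr_gt0// mulr_gt0// mulr_gt0// powR_gt0.
have U2 : 0 < U ^+ 2 by rewrite exprn_gt0.
(* [eta] and [e'] make the two terms of [atom_sum_small] at most [e / 2] each: [G1] bounds the
   rescaled sum of all overlaps, and [V + 1] avoids a zero denominator. *)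
pose eta := e / (2 * U ^+ 2 * G1).
have eta0 : 0 < eta by rewrite divr_gt0// !mulr_gt0.
have [Z Z0 HZ] := fsub _ eta0.
pose e' := e / (2 * U ^+ 2 * (V + 1)).
have e'0 : 0 < e' by rewrite divr_gt0// mulr_gt0 ?mulr_gt0// ltr_wpDl.
have ZU : 0 < Z / U by rewrite divr_gt0.
have Hb := overlap_band_small a_trawl k2 k3 a'0 a'c a'RV aE Delta_gt0 Delta_cvg0 horizon_cvgy ZU e'0.
have HG : overlap_double_sum a (Delta n) n / sc n ^+ 2 @[n --> \oo] --> 2 * (1 `^ (4 - k) * limit_const k).
  apply: (overlap_double_sum_cvg a_trawl k2 k3 a'0 a'c a'RV aE Delta_gt0 Delta_cvg0 horizon_cvgy (N := id)).
  apply: cvg_near_cst; near=> n.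
  by rewrite divff// pnatr_eq0 -lt0n; near: n; exact: nbhs_infty_gt.
near=> n; rewrite sub0r normrN.
have n0 : (0 < n)%N by near: n; exact: nbhs_infty_gt.
have D0 := Delta_gt0 n0.
have sc0 := sc_gt0 n0.
(* The least count guaranteed to give [M * h n >= Z]; it exceeds [Z / U * sc n] by at most 1, the
   form expected by [overlap_band_small]. *)
pose M := (Num.truncn (Z / U * sc n)).+1.
have x0 : 0 <= Z / U * sc n by rewrite mulr_ge0 ?ltW.
have /andP[M1 M2] := truncn_itv x0.
pose S (j : 'I_q + 'I_n) := if j is inr _ then true else false.
pose pos (j : 'I_q + 'I_n) : nat := if j is inr l then l else 0%N.
have HI I : atom (fun j => trawl_set a (@time n j)) I !=set0 -> forall j j', j \in I -> j' \in I -> S j -> S j' ->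
   (pos j < pos j' + #|[set i in I | S i]%SET|)%N.
  by move=> I0 [//|l] [//|l'] lI l'I _ _ /=; exact: atom_interval.
have ZM : Z <= M%:R * h n.
  apply: (@le_trans _ _ (Z / U * sc n * h n)).
    by rewrite /h le_eqVlt; apply/orP; left; apply/eqP; field; rewrite !gt_eqF.
  by rewrite ler_wpM2r ?ltW ?h0.
have bS j : `|@beta n j| <= if S j then h n else 0.
  by case: j => [i|l] /=; [rewrite normr0|exact: beta_le].
have := @atom_sum_small _ _ _ (@leb2 R) _ (fun j => trawl_set a (@time n j))
  (fun j => measurable_trawl_set a_trawl _) (fun j => (finite_borel2_trawl_set a_trawl _).2)
  f V eta Z (h n) (@beta n) S pos M V0 (ltW eta0) (h0 n0) fV HZ bS HI ZM.
move=> /le_trans; apply.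
have -> : \sum_(j | S j) \sum_(j' | S j') fine (leb2 (trawl_set a (time j) `&` trawl_set a (time j'))) =
    overlap_double_sum a (Delta n) n.
  rewrite big_sumType/= big_pred0_eq add0r; apply: eq_bigr => l _.
  rewrite big_sumType/= big_pred0_eq add0r; apply: eq_bigr => l' _.
  by rewrite leb2_trawl_setI// distrC.
have -> : \sum_(j | S j) \sum_(j' | S j' && ((pos j < pos j' + M)%N && (pos j' < pos j + M)%N))
     fine (leb2 (trawl_set a (time j) `&` trawl_set a (time j'))) =
   \sum_(i < n) \sum_(j < n | (i < j + M)%N && (j < i + M)%N) r `|i%:R * Delta n - j%:R * Delta n|.
  rewrite big_sumType/= big_pred0_eq add0r; apply: eq_bigr => l _.
  rewrite big_sumType/= big_pred0_eq add0r; apply: eq_bigr => l' _.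
  by rewrite leb2_trawl_setI// distrC.
have B : \sum_(i < n) \sum_(j < n | (i < j + M)%N && (j < i + M)%N) r `|i%:R * Delta n - j%:R * Delta n| <=
    n%:R * (2 * (r 0 + overlap_sum a (Delta n) M)) by exact: (overlap_band_le a_trawl k2 k3 a'0 a'c aE).
have HGn : overlap_double_sum a (Delta n) n / sc n ^+ 2 <= G1.
  by near: n; move/cvgr_le : HG; apply; rewrite /G1 ltrDl.
have HBn : n%:R * (2 * (r 0 + overlap_sum a (Delta n) M)) / sc n ^+ 2 <= e'.
  have := near Hb n; apply => //.
  by rewrite /M -natr1 lerD2r.
set G := overlap_double_sum _ _ _ in HGn *; set B1 := \sum_(i < n) _ in B *.
have -> : h n ^+ 2 * (eta * G + V * B1) = U ^+ 2 * (eta * (G / sc n ^+ 2)) + U ^+ 2 * (V * (B1 / sc n ^+ 2)).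
  by rewrite /h; field; rewrite gt_eqF.
have -> : e = U ^+ 2 * (eta * G1) + U ^+ 2 * ((V + 1) * e').
  by rewrite /eta /e'; field; rewrite !gt_eqF// ltr_wpDl.
apply: lerD; rewrite ler_pM2l//; first by rewrite ler_pM2l.
have B2 : B1 / sc n ^+ 2 <= e' by apply: le_trans HBn; rewrite ler_wpM2r ?invr_ge0 ?sqr_ge0.
apply: (@le_trans _ _ (V * e')); first by rewrite ler_wpM2l.
by apply: ler_wpM2r; [exact: ltW|rewrite lerDl].
Unshelve. all: by end_near. Qed.

Definition rescaled_sum n (x : R) w : R := (\sum_(0 <= i < Num.truncn (n%:R * x)) xc (i%:R * Delta n) w) / sc n.

(** The exponent of the joint combination is the sum of the two exponents up to a multiple of
    [cross]. Of the rescaled sums only the quadratic form survives, so the characteristic function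
    splits into a Gaussian factor and that of the fixed part. *)
Lemma joint_cos_cvg (c : R) :
  \int[P]_w cos (\sum_i sigma i * xc (s i) w + \sum_j u j * rescaled_sum n (t j) w + c) @[n --> \oo] -->
  expR (- (b ^+ 2 / 2) * joint_variance) * \int[P]_w cos (\sum_i sigma i * xc (s i) w + c).
Proof.
pose rho n := trawl_cf (@time n) levy_re (@alpha n).
pose theta n := trawl_cf (@time n) (jump_im nu) (@alpha n).
pose ab n j := @alpha n j + @beta n j.
pose delta n := trawl_cf (@time n) levy_re (@ab n) - rho n.
pose eps n := trawl_cf (@time n) (jump_im nu) (@ab n) - theta n.
have cfa n : \int[P]_w cos (\sum_i sigma i * xc (s i) w + c) = expR (rho n) * cos (theta n + c).
  rewrite -(trawl_sum_has_cf (@time n) (@alpha n) c); apply: eq_Rintegral => w _.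
  congr (cos (_ + _)); rewrite big_sumType/= [X in _ = _ + X]big1 ?addr0// => l _.
  by rewrite mul0r.
have cfab n : \int[P]_w cos (\sum_i sigma i * xc (s i) w + \sum_j u j * rescaled_sum n (t j) w + c) =
    expR (rho n + delta n) * cos (theta n + eps n + c).
  have -> : rho n + delta n = trawl_cf (@time n) levy_re (@ab n) by rewrite /delta addrC subrK.
  have -> : theta n + eps n = trawl_cf (@time n) (jump_im nu) (@ab n) by rewrite /eps addrC subrK.
  rewrite -(trawl_sum_has_cf (@time n) (@ab n) c); apply: eq_Rintegral => w _.
  congr (cos (_ + _)); rewrite big_sumType/=; congr (_ + _).
    by apply: eq_bigr => i _; rewrite /ab addr0.
  rewrite -(grid_sum a Delta t01 u n (fun l => xc (l%:R * Delta n) w)).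
  by apply: eq_bigr => l _; rewrite /ab add0r.
have jre : trawl_cf (@time n) (jump_re nu) (@beta n) @[n --> \oo] --> (0 : R).
  apply: small => [z|eta eta0].
    by rewrite ler0_norm ?jump_re_le0//; exact: jump_re_ge.
  by have [Z Z0 H] := jump_subquadratic nuL ix2 eta0; exists Z => // z w zw Zw; have [] := H _ _ zw Zw.
have jim : trawl_cf (@time n) (jump_im nu) (@beta n) @[n --> \oo] --> (0 : R).
  apply: small => [z|eta eta0]; first exact: jump_im_le.
  by have [Z Z0 H] := jump_subquadratic nuL ix2 eta0; exists Z => // z w zw Zw; have [] := H _ _ zw Zw.
have squeeze0 (x y : R^nat) : (forall n, `|x n| <= y n) -> y n @[n --> \oo] --> (0 : R) -> x n @[n --> \oo] --> (0 : R).
  move=> xy y0; apply/cvgrPdist_le => e e0; move/cvgr_le : y0 => /(_ e e0).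
  by apply: filterS => n; rewrite sub0r normrN; exact: le_trans.
have scale (C : R) : C * cross n @[n --> \oo] --> (0 : R).
  by rewrite -[X in _ --> X](mulr0 C); apply: cvgM => //; exact: cvg_cst.
under eq_fun do rewrite cfab.
apply: cf_perturbation_cvg => [n|n||].
- exact: trawl_cf_re_le0.
- by rewrite -cfa.
- have D1 : delta n - trawl_cf (@time n) levy_re (@beta n) @[n --> \oo] --> (0 : R).
    by apply: squeeze0 (scale _) => n; exact: trawl_cf_re_cross.
  have D2 : - (b ^+ 2 / 2) * quad n + trawl_cf (@time n) (jump_re nu) (@beta n) @[n --> \oo] -->
      - (b ^+ 2 / 2) * joint_variance + 0.
    by apply: cvgD => //; apply: cvgM => //; exact: cvg_cst.
  have D3 : delta n - trawl_cf (@time n) levy_re (@beta n) + (- (b ^+ 2 / 2) * quad n + trawl_cf (@time n) (jump_re nu) (@beta n))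
      @[n --> \oo] --> 0 + (- (b ^+ 2 / 2) * joint_variance + 0) by exact: cvgD.
  rewrite add0r addr0 in D3; apply: cvg_trans D3; apply: near_eq_cvg; near=> n.
  by rewrite -trawl_cf_re_split subrK.
- have D1 : eps n - trawl_cf (@time n) (jump_im nu) (@beta n) @[n --> \oo] --> (0 : R).
    by apply: squeeze0 (scale _) => n; exact: trawl_cf_im_cross.
  have D3 : eps n - trawl_cf (@time n) (jump_im nu) (@beta n) + trawl_cf (@time n) (jump_im nu) (@beta n)
      @[n --> \oo] --> 0 + 0 by exact: cvgD.
  by rewrite addr0 in D3; move: D3; under eq_fun do rewrite subrK.
Unshelve. all: by end_near. Qed.

End Joint.

End JointConvergence.

(** * Asymptotic independence and stable convergence *)

Section AsymptoticIndependence.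
Context {R : realType} d (Omega : measurableType d) (P : probability Omega R).
Context (X : R -> Omega -> R) (mX : forall s, measurable_fun setT (X s : Omega -> measurableTypeR R)).
Context (C : R) (XC : forall s, (\int[P]_w (X s w ^+ 2)%:E <= C%:E)%E).
Context (om : nat -> Omega -> R) (W : R) (mom : forall n, measurable_fun setT (om n))
  (omW : forall n w, `|om n w| <= W).
Context (Hcos : forall q (s : 'I_q -> R), (forall i, 0 <= s i) -> forall (sigma : 'I_q -> R) (c : R),
  \int[P]_w (cos (\sum_i sigma i * X (s i) w + c) * om n w) @[n --> \oo] --> 0).

(** Finite intersections of events [x <= X s] with [s >= 0]: a system stable under intersection that
    generates the sigma-algebra of these variables. *)
Let rays : set (set Omega) :=
  [set B | exists2 l : seq (R * R), all (fun p => 0 <= p.1) l & B = [set w | all (fun p => p.2 <= X p.1 w) l]].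

Let W0 : 0 <= W.
Proof.
have [w _] : exists w : Omega, True.
  apply: contrapT => H; have : P setT = P set0.
    by congr (P _); apply/seteqP; split => // w _; apply: H; exists w.
  by rewrite measure0 probability_setT => /eqP; rewrite onee_eq0.
exact: le_trans (omW 0%N w).
Qed.

Let rays_setI : setI_closed rays.
Proof.
move=> _ _ [l l0 ->] [l' l'0 ->]; exists (l ++ l'); first by rewrite all_cat l0.
by apply/seteqP; split => w /=; rewrite all_cat; [move=> [-> ->]|move/andP].
Qed.

Let rays_measurable B : rays B -> measurable B.
Proof.
move=> [l _ ->]; elim: l => [|p l IH].
  by rewrite (_ : [set w | _] = setT)//; apply/seteqP; split.
have -> : [set w | all (fun p => p.2 <= X p.1 w) (p :: l)] =
    X p.1 @^-1` `[p.2, +oo[ `&` [set w | all (fun p => p.2 <= X p.1 w) l].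
  by apply/seteqP; split => w /=; rewrite in_itv/= andbT; [move/andP|move=> [-> ->]].
apply: measurableI => //; rewrite -[X in measurable X]setTI; apply: mX => //.
Qed.

Let iom n (f : Omega -> R) : measurable_fun setT f -> (forall w, `|f w| <= 1) ->
  P.-integrable setT (EFin \o (fun w => f w * om n w)).
Proof.
move=> mf f1; apply: (@bounded_integrable _ _ _ P _ _ W) => //; first exact: measurable_funM.
by move=> w _; rewrite normrM -[leRHS]mul1r ler_pM.
Qed.

(** Since [om] is bounded uniformly in [n], an approximation of [f] in mean is uniform in [n]
    too. *)
Let approx (f : Omega -> R) : measurable_fun setT f -> (forall w, `|f w| <= 1) ->
  (exists g : nat -> Omega -> R, [/\ forall l, measurable_fun setT (g l), forall l w, `|g l w| <= 1,
     forall w, g l w @[l --> \oo] --> f w &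
     forall l, \int[P]_w (g l w * om n w) @[n --> \oo] --> (0 : R)]) ->
  \int[P]_w (f w * om n w) @[n --> \oo] --> (0 : R).
Proof.
move=> mf f1 [g [mg g1 gf gom]].
have L : \int[P]_w `|g l w - f w| @[l --> \oo] --> \int[P]_w (0 : R).
  apply: (@Rdominated_cvg _ _ _ P setT (fun l w => `|g l w - f w|) (fun=> 0) (fun=> 2)) => //.
  - by move=> l; apply: measurableT_comp => //; exact: measurable_funB.
  - move=> w _; rewrite -(normr0 R) -(subrr (f w)); apply: cvg_norm; apply: cvgB => //; exact: cvg_cst.
  - by apply: (@bounded_integrable _ _ _ P _ _ 2) => // w _; rewrite ger0_norm.
  - move=> l w _; rewrite normr_id; apply: le_trans (ler_normB _ _) _.
    by have := g1 l w; have := f1 w; lra.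
rewrite Rintegral_cst// mul0r in L.
apply/cvgrPdist_le => e e0.
have e1 : 0 < e / (2 * (W + 1)) by rewrite divr_gt0// mulr_gt0// ltr_wpDl.
have /cvgr_le/(_ _ e1) [l _ /(_ l (leqnn l)) /= Hl] := L.
have e2 : 0 < e / 2 by rewrite divr_gt0.
have /cvgrPdist_le/(_ _ e2) := gom l; apply: filterS => n; rewrite !sub0r !normrN => Hn.
have mgf : measurable_fun setT (fun w => `|g l w - f w|).
  by apply: measurableT_comp => //; exact: measurable_funB.
have igf : P.-integrable setT (EFin \o (fun w => `|g l w - f w|)).
  apply: (@bounded_integrable _ _ _ P _ _ 2) => // w _; rewrite normr_id.
  by apply: le_trans (ler_normB _ _) _; have := g1 l w; have := f1 w; lra.
have : `|\int[P]_w (f w * om n w) - \int[P]_w (g l w * om n w)| <= e / 2.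
  rewrite -RintegralB//; [|exact: iom|exact: iom].
  apply: (@le_trans _ _ (\int[P]_w (W * `|g l w - f w|))).
    apply: Rintegral_le_norm.
    - by apply: measurable_funB; exact: measurable_funM.
    - by have := integrableZl measurableT W igf.
    - by move=> w; rewrite -mulrBl normrM mulrC distrC ler_wpM2r.
  rewrite RintegralZl//; apply: (@le_trans _ _ ((W + 1) * (e / (2 * (W + 1))))).
    apply: ler_pM => //; last by rewrite lerDl.
    by apply: Rintegral_ge0.
  by rewrite le_eqVlt; apply/orP; left; apply/eqP; field; rewrite gt_eqF// ltr_wpDl.
move: Hn; rewrite !ler_norml; set x := \int[P]_w _; set y := \int[P]_w _.
by move=> /andP[? ?] /andP[? ?]; apply/andP; split; lra.
Qed.

Let pos (x : R) : R := Num.max 0 x.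

Let pos_lip x y : `|pos x - pos y| <= `|x - y|.
Proof.
have A := ler_norm (x - y); have B := ler_norm (- (x - y)); rewrite normrN in B.
rewrite ler_norml /pos; case: (leP 0 x) => h1; case: (leP 0 y) => h2; apply/andP; split; lra.
Qed.

Let rays_cvg B : rays B -> \int[P]_w (\1_B w * om n w) @[n --> \oo] --> (0 : R).
Proof.
move=> RB; have mB := rays_measurable RB; move: RB mB => [l l0 ->] mB.
pose q := size l.
pose s (i : 'I_q) := (tnth (in_tuple l) i).1.
pose x (i : 'I_q) := (tnth (in_tuple l) i).2.
pose zeta (w : Omega) : 'rV[R]_q := \row_i X (s i) w.
(* Lipschitz functions that decrease, as [k] grows, to the indicator of the orthant
   [x i <= y 0 i]. *)
pose F (k : nat) (y : 'rV[R]_q) : R := pos (1 - k%:R * \sum_i pos (x i - y 0 i)).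
have mz (i : 'I_q) : measurable_fun setT (fun w => zeta w 0 i).
  by under eq_fun do rewrite mxE; exact: mX.
have FL k y y' : `|F k y - F k y'| <= k%:R * \sum_j `|y 0 j - y' 0 j|.
  apply: le_trans (pos_lip _ _) _.
  rewrite opprB addrC addrA subrK -mulrBr normrM normr_nat ler_wpM2l// -sumrB.
  apply: le_trans (ler_norm_sum _ _ _) _; apply: ler_sum => j _.
  apply: le_trans (pos_lip _ _) _; rewrite distrC.
  by rewrite opprB addrC addrA subrK distrC.
have S0 y : 0 <= \sum_i pos (x i - y 0 i) by apply: sumr_ge0 => i _; rewrite /pos le_max lexx.
have F01 k y : 0 <= F k y <= 1.
  rewrite /F /pos le_max lexx ge_max ler01/= lerBlDr lerDl mulr_ge0//.
have F1 k y : `|F k y| <= 1 by have /andP[q0 q1] := F01 k y; rewrite ger0_norm.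
have mF k := lipschitz_measurable mz (ler0n _ k) (FL k).
apply: approx.
- exact: measurable_indic.
- by move=> w; rewrite indicE; case: (_ \in _); rewrite ?normr1 ?normr0.
exists (fun k w => F k (zeta w)); split => //.
- move=> w; rewrite indicE; have [|] := boolP (w \in _).
    rewrite inE/= => /(all_tnthP (t := in_tuple l)) H.
    apply: cvg_near_cst; near=> k; rewrite /F big1 ?mulr0 ?subr0.
      by rewrite /pos max_r.
    by move=> i _; rewrite /zeta mxE /pos max_l// subr_le0; exact: H.
  rewrite notin_setE/= => H.
  have [i Hi] : exists i : 'I_q, X (s i) w < x i.
    apply: contrapT => /forallNP H'; apply: H; apply/(all_tnthP (t := in_tuple l)) => i.
    by rewrite leNgt; apply/negP; exact: (H' i).
  have Sp : 0 < \sum_i pos (x i - zeta w 0 i).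
    rewrite (bigD1 i)//= ltr_wpDr//; first by apply: sumr_ge0 => j _; rewrite /pos le_max lexx.
    by rewrite /zeta mxE /pos lt_max subr_gt0 Hi orbT.
  apply: cvg_near_cst; near=> k; rewrite /F /pos max_l// subr_le0 -ler_pdivrMr// mul1r.
  by near: k; exact: nbhs_infty_ger.
- move=> k.
  (* Applied to a vector that does not depend on [n] and with limit constant 0, so that the limit
     variable can be anything; [zeta] itself is taken. *)
  have := @lipschitz_cvg R q _ _ P _ _ P (fun=> zeta) om zeta 0 W C (fun=> mz) mz mom omW _ _ _
     (F k) k%:R 1 (ler0n _ k) (F1 k) (FL k).
  rewrite mul0r; apply.
  + by move=> n i; under eq_integral do rewrite mxE; exact: XC.
  + by move=> i; under eq_integral do rewrite mxE; exact: XC.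
  + move=> u b; rewrite mul0r.
    have s0 i : 0 <= s i by move/(all_tnthP (t := in_tuple l)) : l0; exact.
    have := Hcos s0 (fun j => u 0 j) b.
    rewrite (_ : (fun n => \int[P]_w (cos (\sum_j u 0 j * zeta w 0 j + b) * om n w)) =
      (fun n => \int[P]_w (cos (\sum_i u 0 i * X (s i) w + b) * om n w)))//.
    apply/funext => n; apply: eq_Rintegral => w _; congr (cos (_ + _) * _).
    by apply: eq_bigr => j _; rewrite /zeta mxE.
Unshelve. all: by end_near. Qed.

Let generated_measurable : <<s rays >> `<=` measurable.
Proof. by apply: smallest_sub; [exact: sigma_algebra_measurable|exact: rays_measurable]. Qed.

(** Dynkin induction: complements are taken against the whole space, and a countable disjoint union
    is the limit of the finite ones. *)
Let generated_cvg B : <<s rays >> B -> \int[P]_w (\1_B w * om n w) @[n --> \oo] --> (0 : R).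
Proof.
have oneT : \int[P]_w om n w @[n --> \oo] --> (0 : R).
  have : rays setT by exists [::] => //; apply/seteqP; split.
  move=> /rays_cvg; apply: cvg_trans; apply: near_eq_cvg; near=> n.
  by apply: eq_Rintegral => w _; rewrite indicT mul1r.
apply: (@dynkin_induction _ (g_sigma_algebraType rays) rays
  (fun B => \int[P]_w (\1_B w * om n w) @[n --> \oo] --> (0 : R))) => //.
- rewrite (_ : (fun n => \int[P]_w (\1_[set: g_sigma_algebraType rays] w * om n w)) = (fun n => \int[P]_w om n w))//.
  by apply/funext => n; apply: eq_Rintegral => w _; rewrite indicT mul1r.
- move=> S mS HS; have mS' : measurable (S : set Omega) by exact: generated_measurable.
  have : \int[P]_w om n w - \int[P]_w (\1_S w * om n w) @[n --> \oo] --> 0 - (0 : R) by exact: cvgB.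
  rewrite subrr; apply: cvg_trans; apply: near_eq_cvg; near=> n.
  rewrite -RintegralB//; last 2 first.
  + by apply: (@bounded_integrable _ _ _ P _ _ W).
  + apply: iom; first exact: measurable_indic.
    by move=> w; rewrite indicE; case: (_ \in _); rewrite ?normr1 ?normr0.
  by apply: eq_Rintegral => w _; rewrite !indicE in_setC; case: (w \in S); rewrite /= ?mul1r ?mul0r ?subrr ?subr0.
- move=> F mF tF HF.
  have mF' i : measurable (F i : set Omega) by apply: generated_measurable; exact: mF.
  have mU : measurable (\bigcup_i (F i : set Omega)) by exact: bigcupT_measurable.
  have ind1 (A : set Omega) w : `|\1_A w| <= 1 :> R.
    by rewrite indicE; case: (_ \in _); rewrite ?normr1 ?normr0.
  have sumE l w : \sum_(i < l) \1_(F i) w = \1_(\bigcup_(i in `I_l) F i) w :> R.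
    rewrite indicE; have [|] := boolP (w \in _).
      rewrite inE => -[i /= il Fi]; rewrite (bigD1 (Ordinal il))//= big1 ?addr0.
        by rewrite indicE mem_set.
      move=> j ji; rewrite indicE memNset// => Fj.
      have ij : i != j :> nat by move: ji; rewrite eq_sym -(inj_eq val_inj).
      have /trivIsetP/(_ i j Logic.I Logic.I ij)/seteqP[/(_ w) + _] := tF.
      exact.
    rewrite notin_setE/= => H; rewrite big1// => i _; rewrite indicE memNset// => Fi.
    by apply: H; exists i => /=.
  apply: approx; [exact: measurable_indic|exact: ind1|].
  exists (fun l w => \sum_(i < l) \1_(F i) w); split.
  + by move=> l; apply: measurable_sum => i; exact: measurable_indic.
  + by move=> l w; rewrite sumE.
  + move=> w; rewrite indicE; have [|] := boolP (w \in _).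
      rewrite inE => -[i _ Fi]; apply: cvg_near_cst; near=> l.
      rewrite sumE indicE mem_set//; exists i => //=.
      by near: l; exact: nbhs_infty_gt.
    rewrite notin_setE/= => H; apply: cvg_near_cst; near=> l.
    by rewrite sumE indicE memNset// => -[i _ Fi]; apply: H; exists i.
  + move=> l; have : \sum_(i < l) \int[P]_w (\1_(F i) w * om n w) @[n --> \oo] --> \sum_(i < l) (0 : R).
      elim: l => [|l IH].
        by rewrite big_ord0; under eq_fun do rewrite big_ord0; exact: cvg_cst.
      by rewrite big_ord_recr/=; under eq_fun do rewrite big_ord_recr/=; exact: cvgD.
    rewrite big1//; apply: cvg_trans; apply: near_eq_cvg; near=> n.
    have i1 (i : 'I_l) : P.-integrable setT (EFin \o (fun w => \1_(F i) w * om n w)).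
      by apply: iom; [exact: measurable_indic|exact: ind1].
    have [_ <-] := Rintegral_sum (index_enum 'I_l) i1.
    by apply: eq_Rintegral => w _; rewrite mulr_suml.
Unshelve. all: by end_near. Qed.

(** For [om n] the deviation of a test function from its limiting mean, the conclusion is stable
    convergence: in the limit, [om] is orthogonal to every event generated by [X]. *)
Lemma asymptotic_independence (G : set (set Omega)) :
  (forall A, G A -> exists s B, [/\ 0 <= s, measurable (B : set (measurableTypeR R)) & A = X s @^-1` B]) ->
  forall B, <<s G >> B -> measurable B /\ \int[P]_w (\1_B w * om n w) @[n --> \oo] --> (0 : R).
Proof.
move=> GX B GB; suff : <<s rays >> B.
  by move=> RB; split; [exact: generated_measurable|exact: generated_cvg].
move: B GB; apply: smallest_sub; first exact: smallest_sigma_algebra.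
move=> _ /GX[s [C' [s0 mC ->]]].
have mXs : @measurable_fun _ _ (g_sigma_algebraType rays) (measurableTypeR R) setT (X s).
  apply: (@measurability _ _ (g_sigma_algebraType rays) (measurableTypeR R) setT (X s) _ (RGenCInfty.measurableE R)) => _ [_ [x ->] <-].
  rewrite setTI; apply: sub_gen_smallest; exists [:: (s, x)]; first by rewrite /= s0.
  by apply/seteqP; split => w /=; rewrite in_itv/= !andbT.
by rewrite -[X s @^-1` C']setTI; exact: mXs.
Qed.

End AsymptoticIndependence.

(** * Linear combinations of fractional Brownian motion *)

Section FbmCombinations.
Context {R : realType} d (Omega : measurableType d) (P : probability Omega R).
Context (H v : R) (B : R -> Omega -> R) (FB : fbm P H v B).

Definition fbm_covariance (s t : R) : R := v / 2 * (s `^ (2 * H) + t `^ (2 * H) - `|t - s| `^ (2 * H)).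

Let mB t : 0 <= t -> measurable_fun setT (B t : Omega -> measurableTypeR R).
Proof. exact: (fbm_measurable FB). Qed.

(** Integrability is contained in [fbm_cov] at [s = t], an equality of extended reals with a finite
    right-hand side. *)
Lemma fbm_sqr_integrable t : 0 <= t -> P.-integrable setT (EFin \o (fun w => B t w ^+ 2)).
Proof.
move=> t0; apply/integrableP; split.
  by apply/measurable_EFinP; apply: measurable_funX; exact: mB.
under eq_integral do rewrite /= ger0_norm ?sqr_ge0// expr2.
have := fbm_cov FB t0 t0; rewrite unlock => ->.
exact: ltry.
Qed.

Lemma fbm_integrable t : 0 <= t -> P.-integrable setT (EFin \o B t).
Proof.
move=> t0; have i1 : P.-integrable setT (EFin \o (fun=> 1 : R)).
  by apply: (@bounded_integrable _ _ _ P _ _ 1) => // w _; rewrite normr1.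
have := integrableD measurableT i1 (fbm_sqr_integrable t0); apply: le_integrable => //.
  by apply/measurable_EFinP; exact: mB.
move=> w _ /=; rewrite lee_fin [leRHS]ger0_norm ?addr_ge0 ?sqr_ge0//.
rewrite -[_ ^+ 2]real_normK ?num_real//.
by have := sqr_ge0 (`|B t w| - 1); have := normr_ge0 (B t w); nra.
Qed.

Lemma fbm_mul_integrable s t : 0 <= s -> 0 <= t -> P.-integrable setT (EFin \o (fun w => B s w * B t w)).
Proof.
move=> s0 t0; have := integrableD measurableT (fbm_sqr_integrable s0) (fbm_sqr_integrable t0).
apply: le_integrable => //; first by apply/measurable_EFinP; apply: measurable_funM; exact: mB.
move=> w _ /=; rewrite lee_fin [leRHS]ger0_norm ?addr_ge0 ?sqr_ge0// normrM.
rewrite -[B s w ^+ 2]real_normK ?num_real// -[B t w ^+ 2]real_normK ?num_real//.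
by have := sqr_ge0 (`|B s w| - `|B t w|); have := normr_ge0 (B t w); have := normr_ge0 (B s w); nra.
Qed.

Lemma fbm_covE s t : 0 <= s -> 0 <= t -> \int[P]_w (B s w * B t w) = fbm_covariance s t.
Proof. by move=> s0 t0; have := fbm_cov FB s0 t0; rewrite unlock /Rintegral => ->. Qed.

Lemma fbm_meanE t : 0 <= t -> \int[P]_w B t w = 0.
Proof. by move=> t0; have := fbm_mean FB t0; rewrite unlock /Rintegral => ->. Qed.

Context (m : nat) (c t : 'I_m -> R) (t0 : forall i, 0 <= t i).

Lemma fbm_combination_has_cf : has_cf P (fun w => \sum_(i < m) c i * B (t i) w)
  (- (\sum_i \sum_j c i * c j * fbm_covariance (t i) (t j)) / 2) 0.
Proof.
pose Y w := \sum_(i < m) c i * B (t i) w.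
have iB i : P.-integrable setT (EFin \o (fun w => c i * B (t i) w)).
  by have := integrableZl measurableT (c i) (fbm_integrable (t0 i)).
have iBB i j : P.-integrable setT (EFin \o (fun w => c i * c j * (B (t i) w * B (t j) w))).
  by have := integrableZl measurableT (c i * c j) (fbm_mul_integrable (t0 i) (t0 j)).
have mY : measurable_fun setT (Y : Omega -> measurableTypeR R).
  apply: (@measurable_sum_cond _ _ _ _ predT (fun i w => c i * B (t i) w)) => i.
  by apply: measurable_funM => //; exact: mB.
have Y2 w : Y w ^+ 2 = \sum_(ij <- enum [set: 'I_m * 'I_m]%SET) c ij.1 * c ij.2 * (B (t ij.1) w * B (t ij.2) w).
  transitivity (\sum_i \sum_j (c i * B (t i) w) * (c j * B (t j) w)).
    by rewrite expr2 /Y mulr_suml; apply: eq_bigr => i _; rewrite mulr_sumr.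
  rewrite big_enum/= pair_big/=; apply: eq_big => [ij|ij _]; first by rewrite inE.
  by ring.
have [i2 E2] := Rintegral_sum (enum [set: 'I_m * 'I_m]%SET) (fun ij => iBB ij.1 ij.2).
have [i1 E1] := Rintegral_sum (index_enum 'I_m) iB.
have EY : \int[P]_w Y w = 0.
  rewrite E1 big1// => i _; rewrite RintegralZl//; last exact: fbm_integrable.
  by rewrite fbm_meanE// mulr0.
have EY2 : \int[P]_w (Y w ^+ 2) = \sum_i \sum_j c i * c j * fbm_covariance (t i) (t j).
  under eq_Rintegral do rewrite Y2.
  rewrite E2 big_enum/= pair_big/=; apply: eq_big => [ij|ij _]; first by rewrite inE.
  by rewrite RintegralZl ?fbm_covE//; exact: fbm_mul_integrable.
rewrite -EY2; apply: gaussian_has_cf => //.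
- exact: (fbm_gaussian FB).
- by move: i2; apply: eq_integrable => // w _; rewrite /= Y2.
Qed.

End FbmCombinations.

(** * Stable convergence of the finite-dimensional distributions *)

Section StableLimit.
Context {R : realType} d (Omega : measurableType d) (P : probability Omega R).
Context (gamma b : R) (nu : {measure set (measurableTypeR R) -> \bar R}).
Context (L : set (measurableTypeR R * measurableTypeR R) -> Omega -> R)
  (LB : levy_basis P gamma b nu L).
Context (ix2 : nu.-integrable [set x | x != 0] (EFin \o (fun x : measurableTypeR R => x ^+ 2))).
Context (a a' : R -> R) (k : R).
Context (a_trawl : trawl_function a) (k2 : 2 < k) (k3 : k < 3)
  (a'0 : forall y, 0 <= y -> 0 < a' y) (a'c : {within `[0, +oo[, continuous a'})
  (a'RV : regularly_varying k a')
  (aE : forall s, 0 <= s -> (a s)%:E = (\int[@lebesgue_measure R]_(y in `[s, +oo[) (a' y)%:E)%E).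
Context (Delta : nat -> R) (Delta_gt0 : forall n, (0 < n)%N -> 0 < Delta n)
  (Delta_cvg0 : Delta n @[n --> \oo] --> 0) (horizon_cvgy : (n%:R * Delta n) @[n --> \oo] --> +oo).
Context d' (Omega' : measurableType d') (P' : probability Omega' R) (BH : R -> Omega' -> R)
  (BH_fbm : fbm P' (2 - k / 2) 2 BH).
Notation sc := (scaling a Delta).
Notation xc := (trawl_centered gamma nu L a).
Notation W := (rescaled_sum gamma nu L a Delta).
Notation X := (trawl_process L a).
Let V : R := \int[nu]_(x in [set x | x != 0]) (x ^+ 2).

Definition limit_scale : R := Num.sqrt (b ^+ 2 / ((k - 2) * (3 - k) * (4 - k))).
Definition moment_const : R := 4 * (b ^+ 2 + V).

Let mxc s : measurable_fun setT (xc s : Omega -> measurableTypeR R).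
Proof. exact: (measurable_trawl_centered LB a_trawl). Qed.

Lemma measurable_rescaled_sum n t : measurable_fun setT (W n t : Omega -> measurableTypeR R).
Proof.
apply: measurable_funM => //; rewrite /=; under eq_fun do rewrite big_mkord.
apply: (@measurable_sum_cond _ _ _ _ predT (fun (i : 'I_(Num.truncn (n%:R * t))) w => xc (i%:R * Delta n) w)) => i.
exact: mxc.
Qed.

(** Only differences of times enter the quadratic form, so the shift by [N] cancels. *)
Lemma block_moment n N M :
  (\int[P]_w (((\sum_(0 <= i < M) xc ((N + i)%:R * Delta n) w) / sc n) ^+ 2)%:E <=
   (moment_const * (overlap_double_sum a (Delta n) M / sc n ^+ 2))%:E)%E.
Proof.
have [+ _ _] := trawl_sum_moments LB ix2 a_trawl (fun i : 'I_M => (N + i)%:R * Delta n) (fun=> (sc n)^-1).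
rewrite -/V -/moment_const.
have -> : \sum_(j < M) \sum_(l < M) (sc n)^-1 * (sc n)^-1 * overlap a `|(N + l)%:R * Delta n - (N + j)%:R * Delta n| =
    overlap_double_sum a (Delta n) M / sc n ^+ 2.
  rewrite /overlap_double_sum mulr_suml; apply: eq_bigr => i _; rewrite mulr_suml; apply: eq_bigr => j _.
  move: (sc n) => x; rewrite expr2 invfM mulrC; congr (overlap a _ * _).
  by rewrite distrC -!mulrBl !natrD; congr (`|_ * _|); ring.
congr (_ <= _)%E; apply: eq_integral => w _; congr ((_ ^+ 2)%:E).
by rewrite big_mkord mulr_suml; apply: eq_bigr => i _; rewrite mulrC.
Qed.

Lemma rescaled_moment t : 0 <= t -> exists C : R, forall n, (\int[P]_w (W n t w ^+ 2)%:E <= C%:E)%E.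
Proof.
move=> t0; have := overlap_double_sum_cvg a_trawl k2 k3 a'0 a'c a'RV aE Delta_gt0 Delta_cvg0 horizon_cvgy (truncn_ratio_cvg t0).
move=> /cvgP/cvg_seq_bounded[M [_ HM]].
exists (moment_const * (M + 1)) => n.
apply: (@le_trans _ _ (moment_const * (overlap_double_sum a (Delta n) (Num.truncn (n%:R * t)) / sc n ^+ 2))%:E).
  by have := block_moment n 0 (Num.truncn (n%:R * t)).
rewrite lee_fin ler_wpM2l//.
  by rewrite /moment_const mulr_ge0// addr_ge0 ?sqr_ge0//; apply: Rintegral_ge0 => x _; exact: sqr_ge0.
apply: le_trans (ler_norm _) _; apply: (HM (M + 1)) => //.
by rewrite ltrDl.
Qed.

Lemma trawl_centered_moment s : (\int[P]_w (xc s w ^+ 2)%:E <= (moment_const * overlap a 0)%:E)%E.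
Proof.
have [+ _ _] := trawl_sum_moments LB ix2 a_trawl (fun i : 'I_1 => s) (fun=> 1).
rewrite !big_ord1 subrr normr0 !mul1r; congr (_ <= _)%E.
by apply: eq_integral => w _; rewrite big_ord1 mul1r.
Qed.

(** The centred values have mean 0, so centring by [levy_mean] times the area is centring by the
    expectation. *)
Lemma trawl_expectation s : fine 'E_P[X s] = levy_mean gamma nu * overlap a 0.
Proof.
have [_ i1 E1] := trawl_sum_moments LB ix2 a_trawl (fun i : 'I_1 => s) (fun=> 1).
have XE w : \sum_(j < 1) 1 * xc s w = xc s w by rewrite big_ord1 mul1r.
have ixc : P.-integrable setT (EFin \o xc s).
  by move: i1; apply: eq_integrable => // w _; rewrite /= XE.
have E : \int[P]_w xc s w = 0 by rewrite -E1; apply: eq_Rintegral => w _; rewrite XE.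
rewrite unlock -/(Rintegral P setT (X s)).
transitivity (\int[P]_w (xc s w + levy_mean gamma nu * overlap a 0)).
  by apply: eq_Rintegral => w _; rewrite /trawl_centered subrK.
rewrite RintegralD//; first by rewrite E add0r Rintegral_probability_cst.
by apply: (@bounded_integrable _ _ _ P _ _ `|levy_mean gamma nu * overlap a 0|).
Qed.

Section FiniteDimensional.
Context (p : nat) (t : 'I_p -> R) (t01 : forall i, 0 <= t i <= 1).
Let xi n w : 'rV[R]_p := \row_i W n (t i) w.
Let eta w : 'rV[R]_p := \row_i (limit_scale * BH (t i) w).

Let t0 i : 0 <= t i. Proof. by have /andP[] := t01 i. Qed.

Let factor (u : 'I_p -> R) := expR (- (b ^+ 2 / 2) * joint_variance k t u).

Let factorN u : factor (fun j => - u j) = factor u.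
Proof.
rewrite /factor /joint_variance; congr (expR (_ * _)).
by apply: eq_bigr => i _; apply: eq_bigr => j _; rewrite mulrNN.
Qed.

Let limit_cos (u : 'rV[R]_p) (c : R) :
  \int[P']_w cos (\sum_j u 0 j * eta w 0 j + c) = factor (fun j => u 0 j) * cos c.
Proof.
have := @fbm_combination_has_cf _ _ _ P' _ _ _ BH_fbm p (fun j => u 0 j * limit_scale) t t0 c.
move=> E; transitivity (\int[P']_w cos (\sum_(i < p) u 0 i * limit_scale * BH (t i) w + c)).
  apply: eq_Rintegral => w _; congr (cos (_ + _)); apply: eq_bigr => j _.
  by rewrite mxE mulrA.
rewrite E add0r /factor; congr (expR _ * _).
have s2 : limit_scale ^+ 2 = b ^+ 2 * limit_const k.
  by rewrite sqr_sqrtr// mulr_ge0 ?sqr_ge0// ltW// limit_const_gt0.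
have -> : \sum_i \sum_j u 0 i * limit_scale * (u 0 j * limit_scale) * fbm_covariance (2 - k / 2) 2 (t i) (t j) =
    b ^+ 2 * joint_variance k t (fun j => u 0 j).
  rewrite /joint_variance mulr_sumr; apply: eq_bigr => i _; rewrite mulr_sumr; apply: eq_bigr => j _.
  rewrite /fbm_covariance (_ : 2 * (2 - k / 2) = 4 - k); last by field.
  rewrite (_ : u 0 i * limit_scale * (u 0 j * limit_scale) = u 0 i * u 0 j * limit_scale ^+ 2); last by ring.
  by rewrite s2 distrC; field.
by field.
Qed.

Let mW n j : measurable_fun setT (fun w => xi n w 0 j).
Proof. by under eq_fun do rewrite mxE; exact: measurable_rescaled_sum. Qed.

Let mlin n (u : 'rV[R]_p) : measurable_fun setT (fun w => \sum_j u 0 j * xi n w 0 j).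
Proof.
apply: (@measurable_sum_cond _ _ _ _ predT (fun j w => u 0 j * xi n w 0 j)) => j.
by apply: measurable_funM => //; exact: mW.
Qed.

Let weight (u : 'rV[R]_p) (beta : R) n w : R :=
  cos (\sum_j u 0 j * xi n w 0 j + beta) - factor (fun j => u 0 j) * cos beta.

(** The product of cosines is half the sum of the cosines of [A + Y] and [A - Y], shifted. Both have
    the same Gaussian factor by [factorN], and their limits recombine into the product that [weight]
    subtracts. *)
Let weight_cvg (u : 'rV[R]_p) (beta : R) q (s : 'I_q -> R) : (forall i, 0 <= s i) -> forall (sigma : 'I_q -> R) (c : R),
  \int[P]_w (cos (\sum_i sigma i * xc (s i) w + c) * weight u beta n w) @[n --> \oo] --> (0 : R).
Proof.
move=> s0 sigma c.
pose A w := \sum_i sigma i * xc (s i) w.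
pose Y n w := \sum_j u 0 j * xi n w 0 j.
have J v c' := @joint_cos_cvg _ _ _ P _ _ _ _ LB ix2 _ _ _ a_trawl k2 k3 a'0 a'c a'RV aE _ Delta_gt0 Delta_cvg0 horizon_cvgy _ _ s0 sigma _ _ t01 v c'.
have J1 : \int[P]_w cos (A w + Y n w + (c + beta)) @[n --> \oo] --> factor (fun j => u 0 j) * \int[P]_w cos (A w + (c + beta)).
  have E1 n : \int[P]_w cos (A w + Y n w + (c + beta)) =
      \int[P]_w cos (\sum_i sigma i * xc (s i) w + \sum_j u 0 j * W n (t j) w + (c + beta)).
    by apply: eq_Rintegral => w _; congr (cos (_ + _ + _)); apply: eq_bigr => j _; rewrite mxE.
  by under eq_fun do rewrite E1; exact: J.
have J2 : \int[P]_w cos (A w - Y n w + (c - beta)) @[n --> \oo] --> factor (fun j => u 0 j) * \int[P]_w cos (A w + (c - beta)).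
  have E1 n : \int[P]_w cos (A w - Y n w + (c - beta)) =
      \int[P]_w cos (\sum_i sigma i * xc (s i) w + \sum_j (- u 0 j) * W n (t j) w + (c - beta)).
    by apply: eq_Rintegral => w _; congr (cos (_ + _ + _)); rewrite /Y -sumrN; apply: eq_bigr => j _; rewrite mxE mulNr.
  by under eq_fun do rewrite E1; rewrite -factorN; exact: J.
have mA : measurable_fun setT (A : Omega -> measurableTypeR R).
  apply: (@measurable_sum_cond _ _ _ _ predT (fun i w => sigma i * xc (s i) w)) => i.
  by apply: measurable_funM => //; exact: mxc.
have icA c' : P.-integrable setT (EFin \o (fun w => cos (A w + c'))) by exact: integrable_cos_shift.
have ic1 n c' : P.-integrable setT (EFin \o (fun w => cos (A w + Y n w + c'))).
  by apply: integrable_cos_shift; apply: measurable_funD => //; exact: mlin.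
have ic2 n c' : P.-integrable setT (EFin \o (fun w => cos (A w - Y n w + c'))).
  by apply: integrable_cos_shift; apply: measurable_funB => //; exact: mlin.
set E := factor _ in J1 J2.
have Lim : 1 / 2 * \int[P]_w cos (A w + Y n w + (c + beta)) + 1 / 2 * \int[P]_w cos (A w - Y n w + (c - beta))
    - E * cos beta * \int[P]_w cos (A w + c) @[n --> \oo] -->
   1 / 2 * (E * \int[P]_w cos (A w + (c + beta))) + 1 / 2 * (E * \int[P]_w cos (A w + (c - beta)))
    - E * cos beta * \int[P]_w cos (A w + c).
  by apply: cvgB; [apply: cvgD; apply: cvgM => //; exact: cvg_cst|exact: cvg_cst].
have Z : 1 / 2 * (E * \int[P]_w cos (A w + (c + beta))) + 1 / 2 * (E * \int[P]_w cos (A w + (c - beta)))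
    - E * cos beta * \int[P]_w cos (A w + c) = 0.
  have D : \int[P]_w cos (A w + (c + beta)) + \int[P]_w cos (A w + (c - beta)) = 2 * cos beta * \int[P]_w cos (A w + c).
    rewrite -RintegralD// -RintegralZl//; apply: eq_Rintegral => w _.
    by rewrite !addrA cosD cosB; ring.
  by rewrite -mulrDr -mulrDr D; field.
rewrite Z in Lim; apply: cvg_trans Lim; apply: near_eq_cvg; near=> n.
rewrite -!RintegralZl// -RintegralD//; last 2 first.
- by have := integrableZl measurableT (1 / 2) (ic1 n (c + beta)).
- by have := integrableZl measurableT (1 / 2) (ic2 n (c - beta)).
rewrite -RintegralB//; last 2 first.
- by have := integrableD measurableT (integrableZl measurableT (1 / 2) (ic1 n (c + beta))) (integrableZl measurableT (1 / 2) (ic2 n (c - beta))).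
- by have := integrableZl measurableT (E * cos beta) (icA c).
apply: eq_Rintegral => w _; rewrite /weight -/E -/(A w) -/(Y n w).
have -> : A w + Y n w + (c + beta) = (A w + c) + (Y n w + beta) by ring.
have -> : A w - Y n w + (c - beta) = (A w + c) - (Y n w + beta) by ring.
by rewrite cosD cosB; field.
Unshelve. all: by end_near. Qed.

(** Each generating event of [sampled_sigma] lies in the sigma-algebra of finitely many values of
    [X] at nonnegative times, to which asymptotic independence applies; the centring of [xc] is a
    mere translation. *)
Let sampled (B : set Omega) : sampled_sigma X Delta B -> forall u beta,
  measurable B /\ \int[P]_w (\1_B w * weight u beta n w) @[n --> \oo] --> (0 : R).
Proof.
move=> SB u beta.
apply: (@asymptotic_independence _ _ _ P xc mxc _ trawl_centered_moment (weight u beta)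
   (1 + `|factor (fun j => u 0 j) * cos beta|) _ _ _
   [set A | exists s B, [/\ 0 <= s, measurable (B : set (measurableTypeR R)) & A = xc s @^-1` B]]).
- move=> n; apply: measurable_funB => //; apply: measurable_cos_shift; exact: mlin.
- move=> n w; apply: le_trans (ler_normB _ _) _; rewrite lerD2r; exact: norm_cos_le1.
- by move=> q s s0 sigma c; exact: weight_cvg.
- by [].
move: B SB; apply: smallest_sub; first exact: smallest_sigma_algebra.
(* Of the intersection over [N >= j] only the member [N = j] is kept. *)
move=> B [j /= j1]; move=> /(_ j (leqnn j)); move: B.
apply: smallest_sub; first exact: smallest_sigma_algebra.
elim/big_ind : _ => [//|U V' HU HV A [/HU|/HV]//|i _ A [C mC <-]].
apply: sub_gen_smallest; exists (i%:R * Delta j), ((fun x => x + levy_mean gamma nu * overlap a 0) @^-1` C); split.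
- by rewrite mulr_ge0// ltW// Delta_gt0.
- rewrite -[X in measurable X]setTI.
  have : measurable_fun setT ((fun x => x + levy_mean gamma nu * overlap a 0) : measurableTypeR R -> measurableTypeR R).
    exact: measurable_funD.
  exact.
- by rewrite setTI; apply/seteqP; split => w /=; rewrite /trawl_centered subrK.
Qed.

(** Adding [P B] times the limiting mean to the integral of [weight] over [B] gives the limit for
    cosines; Lipschitz functions follow by trigonometric approximation. *)
Lemma stable_lipschitz_cvg (B : set Omega) (F : 'rV[R]_p -> R) (K M : R) : sampled_sigma X Delta B ->
  0 <= K -> (forall x, `|F x| <= M) ->
  (forall x y, `|F x - F y| <= K * \sum_j `|x 0 j - y 0 j|) ->
  [/\ measurable B, forall n, measurable_fun setT (F \o xi n), measurable_fun setT (F \o eta) &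
   \int[P]_w (F (xi n w) * \1_B w) @[n --> \oo] --> fine (P B) * \int[P']_w F (eta w)].
Proof.
move=> SB K0 FM FK.
have mB : measurable B by have [] := sampled SB 0 0.
have meta j : measurable_fun setT (fun w => eta w 0 j).
  by under eq_fun do rewrite mxE; apply: measurable_funM => //; exact: (fbm_measurable BH_fbm).
have [C1 HC1] : exists C : R, forall n j, (\int[P]_w ((xi n w 0 j) ^+ 2)%:E <= C%:E)%E.
  have [C HC] := choice (fun j => rescaled_moment (t0 j)).
  exists (\sum_j `|C j|) => n j; under eq_integral do rewrite mxE.
  apply: le_trans (HC j n) _; rewrite lee_fin (bigD1 j)//=; apply: le_trans (ler_norm _) _.
  by rewrite lerDl sumr_ge0.
have [C2 HC2] : exists C : R, forall j, (\int[P']_w ((eta w 0 j) ^+ 2)%:E <= C%:E)%E.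
  exists (\sum_j `|limit_scale ^+ 2 * fbm_covariance (2 - k / 2) 2 (t j) (t j)|) => j.
  have E : (\int[P']_w ((eta w 0 j) ^+ 2)%:E)%E = (limit_scale ^+ 2 * fbm_covariance (2 - k / 2) 2 (t j) (t j))%:E.
    under eq_integral do rewrite mxE exprMn EFinM.
    rewrite integralZl//; last exact: (fbm_sqr_integrable BH_fbm (t0 j)).
    have -> : (\int[P']_w (BH (t j) w ^+ 2)%:E)%E = (fbm_covariance (2 - k / 2) 2 (t j) (t j))%:E.
      rewrite -(fbm_covE BH_fbm (t0 j) (t0 j)) /Rintegral fineK; first by apply: eq_integral => w _; rewrite expr2.
      by apply: integrable_fin_num => //; exact: (fbm_mul_integrable BH_fbm).
    by rewrite -EFinM.
  rewrite E lee_fin (bigD1 j)//=; apply: le_trans (ler_norm _) _.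
  by rewrite lerDl sumr_ge0.
split => //.
- by move=> n; exact: (lipschitz_measurable (mW n) K0 FK).
- exact: (lipschitz_measurable meta K0 FK).
apply: (@lipschitz_cvg R p _ _ P _ _ P' xi (fun=> \1_B) eta (fine (P B)) 1 (Num.max C1 C2) mW meta _ _ _ _ _ F K M) => //.
- by move=> n w; rewrite indicE; case: (_ \in _); rewrite ?normr1 ?normr0.
- by move=> n j; apply: le_trans (HC1 n j) _; rewrite lee_fin le_max lexx.
- by move=> j; apply: le_trans (HC2 j) _; rewrite lee_fin le_max lexx orbT.
move=> u beta; rewrite limit_cos.
have [_ S] := sampled SB u beta.
have : \int[P]_w (\1_B w * weight u beta n w) + fine (P B) * (factor (fun j => u 0 j) * cos beta) @[n --> \oo] -->
   0 + fine (P B) * (factor (fun j => u 0 j) * cos beta) by apply: cvgD => //; exact: cvg_cst.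
rewrite add0r; apply: cvg_trans; apply: near_eq_cvg; near=> n.
have E1 : \int[P]_w \1_B w = fine (P B) by rewrite /Rintegral integral_indic// setIT.
have i1 : P.-integrable setT (EFin \o (\1_B : Omega -> R)).
  apply: (@bounded_integrable _ _ _ P _ _ 1) => // w _.
  by rewrite indicE; case: (_ \in _); rewrite ?normr1 ?normr0.
set cc := factor _ * cos _.
have -> : fine (P B) * cc = \int[P]_w (cc * \1_B w) by rewrite RintegralZl// E1 mulrC.
rewrite -RintegralD//; last 2 first.
- apply: (integrable_mul_bounded (M := 1 + `|cc|) i1).
    by apply: measurable_funB => //; apply: measurable_cos_shift; exact: mlin.
  by move=> w; apply: le_trans (ler_normB _ _) _; rewrite lerD2r; exact: norm_cos_le1.
- by have := integrableZl measurableT cc i1.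
by apply: eq_Rintegral => w _; rewrite /weight -/cc; ring.
Unshelve. all: by end_near. Qed.

Lemma stable_fidi : stable_cvg P P' (sampled_sigma X Delta) xi eta.
Proof.
move=> B SB PB f cf [M fM].
(* The supremum distance expresses continuity on row vectors; it is at most the sum of the
   coordinate differences, in which the Lipschitz result is stated. *)
pose close (e : R) (x y : 'rV[R]_p) := 0 <= e /\ forall j, `|x 0 j - y 0 j| <= e.
have cr x : setT x -> close 0 x x by split => // j; rewrite subrr normr0.
have cs e x y : close e x y -> close e y x by move=> [e0 H]; split => // j; rewrite distrC.
have ct e1 e2 x y z : close e1 x y -> close e2 y z -> close (e1 + e2) x z.
  move=> [e10 H1] [e20 H2]; split; first by rewrite addr_ge0.
  move=> j; rewrite (_ : x 0 j - z 0 j = (x 0 j - y 0 j) + (y 0 j - z 0 j)); last by ring.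
  by apply: le_trans (ler_normD _ _) _; exact: lerD.
have mB : measurable B by have [] := sampled SB 0 0.
have pB0 : 0 < fine (P B) by rewrite fine_gt0// PB/= (le_lt_trans (probability_le1 P mB))// ltry.
have Hlip F M' K : 0 <= K -> (forall x, setT x -> `|F x| <= M') -> close_lipschitz setT close F K ->
  [/\ forall n, measurable_fun setT (F \o xi n), measurable_fun setT (F \o eta) &
   \int[P]_w (F (xi n w) * \1_B w) @[n --> \oo] --> fine (P B) * \int[P']_w F (eta w)].
  move=> K0 FM FK.
  have FL x y : `|F x - F y| <= K * \sum_j `|x 0 j - y 0 j|.
    apply: FK => //; first exact: sumr_ge0.
    split; first exact: sumr_ge0.
    by move=> j; rewrite (bigD1 j)//= lerDl sumr_ge0.
  by have [] := stable_lipschitz_cvg SB K0 (fun x => FM x Logic.I) FL.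
have cc : close_continuous setT close f.
  move=> x _ e e0.
  have /cvgrPdist_le/(_ e e0)/nbhs_ballP[del /= del0 Hdel] := cf x.
  exists del => // y e' _ e'0 e'd [_ xy]; rewrite distrC; apply: Hdel.
  split => // i j; rewrite ord1; exact: le_lt_trans (xy j) e'd.
have om0 w : 0 <= (\1_B w : R) <= 1 by rewrite indicE; case: (_ \in _); rewrite ?lexx ?ler01.
have mom : measurable_fun setT (\1_B : Omega -> R) by exact: measurable_indic.
have C := @portmanteau _ _ _ P _ _ P' _ setT close cr cs ct xi eta \1_B (fine (P B)) (fun _ _ => Logic.I) (fun _ => Logic.I)
  om0 mom Hlip f M (fun x _ => fM x) cc.
have : (\int[P]_w (f (xi n w) * \1_B w)) / fine (P B) @[n --> \oo] --> fine (P B) * \int[P']_w f (eta w) / fine (P B).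
  by apply: cvgM => //; exact: cvg_cst.
rewrite mulrAC divff ?gt_eqF// mul1r; apply: cvg_trans; apply: near_eq_cvg; near=> n; congr (_ / _).
rewrite [RHS]Rintegral_mkcond; apply: eq_Rintegral => w _.
by rewrite patchE indicE; case: (w \in B); rewrite ?mulr1 ?mulr0.
Unshelve. all: by end_near. Qed.

End FiniteDimensional.

End StableLimit.

(** * Tightness and Skorokhod convergence *)

Section UniformDistance.
Context {R : realType}.
Implicit Types (x y z : R -> R) (e : R).

Definition uniform_close e x y := 0 <= e /\ forall t, 0 <= t <= 1 -> `|x t - y t| <= e.

Lemma uniform_close_refl x : uniform_close 0 x x.
Proof. by split => // t _; rewrite subrr normr0. Qed.

Lemma uniform_close_sym e x y : uniform_close e x y -> uniform_close e y x.
Proof. by move=> [e0 H]; split => // t t01; rewrite distrC; exact: H. Qed.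

Lemma uniform_close_trans e1 e2 x y z :
  uniform_close e1 x y -> uniform_close e2 y z -> uniform_close (e1 + e2) x z.
Proof.
move=> [e10 H1] [e20 H2]; split; first by rewrite addr_ge0.
move=> t t01; rewrite (_ : x t - z t = (x t - y t) + (y t - z t)); last by ring.
by apply: le_trans (ler_normD _ _) _; apply: lerD; [exact: H1|exact: H2].
Qed.

Lemma skorokhod_dist_le_uniform e x y : uniform_close e x y -> skorokhod_dist 1 x y <= e.
Proof.
move=> [e0 xy]; apply: ge_inf.
  (* Evaluation at time 0 shows that every admissible [e'] is nonnegative, so that the infimum is
     over a set bounded below. *)
  exists 0 => e' [lam _ H]; have /H[+ _] : (0 : R) \in `[0, 1] by rewrite in_itv/= lexx ler01.
  exact: le_trans.
exists id.
  split => //.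
  by apply: continuous_subspaceT => t; exact: cvg_id.
by move=> t; rewrite in_itv/= => t01; rewrite subrr normr0; split => //; exact: xy.
Qed.

Lemma skorokhod_close_continuous (f : (R -> R) -> R) :
  skorokhod_continuous 1 f -> close_continuous (cadlag 1) uniform_close f.
Proof.
move=> cf x Dx e e0; have [del del0 H] := cf x Dx e e0.
exists del => // y e' Dy _ e'd /uniform_close_sym/uniform_close_sym xy; apply: ltW; apply: H => //.
by apply: le_lt_trans e'd; exact: skorokhod_dist_le_uniform.
Qed.

Definition step_path (M : nat) (v : nat -> R) : R -> R := fun t => v (Num.truncn (M%:R * t)).

Lemma step_path_cadlag M v : cadlag 1 (step_path M v).
Proof.
(* For [M = 0] the path is constant; the case arises as the index 0 of the sequence of processes. *)
have [->|M0] := posnP M.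
  have E t : step_path 0 v t = v 0%N by rewrite /step_path mul0r truncn0.
  split=> t _; first by under eq_fun do rewrite E; rewrite E; exact: cvg_cst.
  by under eq_fun do rewrite E; exact: is_cvg_cst.
have Mp : 0 < M%:R :> R by rewrite ltr0n.
split=> [t /andP[t0 _]|t /andP[t0 _]].
  have Mt : 0 <= M%:R * t by rewrite mulr_ge0.
  have /andP[q0 q1] := truncn_itv Mt.
  apply: cvg_near_cst; near=> s.
  rewrite /step_path; congr v; apply: truncn_def; apply/andP; split.
    apply: le_trans q0 _; apply: ler_wpM2l; first exact: ltW.
    by near: s; exact: nbhs_right_ge.
  rewrite mulrC -ltr_pdivlMr//; near: s; apply: nbhs_right_lt.
  by rewrite ltr_pdivlMr// mulrC.
have Mt : 0 < M%:R * t by rewrite mulr_gt0.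
(* The left limit is [v j] for the largest integer [j] strictly below [M * t], the predecessor of
   [M * t] when that is an integer. *)
have [j /andP[j0 j1]] : exists j : nat, j%:R < M%:R * t <= j.+1%:R.
  have /andP[q0 q1] := truncn_itv (ltW Mt).
  move: q0; rewrite le_eqVlt => /predU1P[E|q0]; last by exists (Num.truncn (M%:R * t)); rewrite q0 ltW.
  exists (Num.truncn (M%:R * t)).-1; case: (Num.truncn _) E q1 => [|q] E q1.
    by move: Mt; rewrite -E ltxx.
  by rewrite -E/= lexx ltr_nat ltnSn.
apply/cvg_ex; exists (v j); apply: cvg_near_cst; near=> s.
rewrite /step_path; congr v; apply: truncn_def; apply/andP; split.
  rewrite mulrC -ler_pdivrMr//; apply: ltW; near: s; apply: nbhs_left_gt.
  by rewrite ltr_pdivrMr// mulrC.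
by apply: lt_le_trans j1; rewrite ltr_pM2l.
Unshelve. all: by end_near. Qed.

Lemma continuous_cadlag x : {within `[0, +oo[, continuous x} -> cadlag 1 x.
Proof.
move=> /continuous_within_itvcyP[cx c0]; split=> t.
  move=> /andP[t0 _]; move: t0; rewrite le_eqVlt => /predU1P[<-//|t0].
  apply: cvg_at_right_filter; apply: cx.
  by rewrite in_itv/= t0.
move=> /andP[t0 _]; apply/cvg_ex; exists (x t).
apply: cvg_at_left_filter; apply: cx.
by rewrite in_itv/= t0.
Qed.

Definition grid_point (M : nat) (t : R) : R := (Num.truncn (M%:R * t))%:R / M%:R.

Lemma grid_point_le (M : nat) (t : R) : 0 <= t -> (0 < M)%N ->
  0 <= grid_point M t <= t /\ t < grid_point M t + M%:R^-1.
Proof.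
rewrite /grid_point => t0 M0; have Mp : 0 < M%:R :> R by rewrite ltr0n.
have /andP[q0 q1] := truncn_itv (mulr_ge0 (ltW Mp) t0).
rewrite divr_ge0//= ler_pdivrMr// [t * _]mulrC q0; split => //.
by rewrite -[X in _ + X]mul1r -mulrDl ltr_pdivlMr// natr1 mulrC.
Qed.

(** Uniform continuity on the compact interval, phrased through near coverings; a grid point lies
    within [1 / M] of its time. *)
Lemma step_path_uniform_cvg x : {within `[0, +oo[, continuous x} -> forall e, 0 < e ->
  \forall M \near \oo, uniform_close e x (step_path M (fun j => x (j%:R / M%:R))).
Proof.
move=> /subspace_continuousP cx e e0.
have /compact_near_coveringP/near_covering_withinP NC : compact (`[0, 1]%classic : set R) by exact: segment_compact.
have H : \forall M \near \oo, `[0, 1]%classic `<=` (fun t : R => `|x t - step_path M (fun j => x (j%:R / M%:R)) t| <= e).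
  apply: NC => t; rewrite /= in_itv/= => /andP[t0 t1].
  have e2 : 0 < e / 2 by rewrite divr_gt0.
  have tI : `[0, +oo[%classic t by rewrite /= in_itv/= t0.
  have /cvgrPdist_le/(_ _ e2) := cx t tI.
  rewrite near_withinE => /nbhs_ballP[del /= del0 Hdel].
  have d2 : 0 < del / 2 by rewrite divr_gt0.
  exists (ball t (del / 2), [set M | (del / 2)^-1 < M%:R /\ (0 < M)%N]).
    split; first exact: nbhsx_ballx.
    apply: filterI; first exact: nbhs_infty_gtr.
    exact: nbhs_infty_gt.
  move=> [s M] /= [Bs [Md M0]]; rewrite in_itv/= => /andP[s0 s1].
  have Mp : 0 < M%:R :> R by rewrite ltr0n.
  have [/andP[g0 g1] g2] := grid_point_le s0 M0.
  have Mi : (M%:R : R)^-1 < del / 2.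
    by rewrite -[ltRHS]invrK ltf_pV2// posrE invr_gt0.
  rewrite /step_path -/(grid_point M s); set u := grid_point M s in g0 g1 g2 *.
  have H1 : `|x t - x s| <= e / 2.
    apply: Hdel; last by rewrite /= in_itv/= s0.
    by move: Bs; rewrite /ball/=; lra.
  have H2 : `|x t - x u| <= e / 2.
    apply: Hdel; last by rewrite /= in_itv/= g0.
    move: Bs; rewrite /ball/= !ltr_norml => /andP[? ?]; apply/andP; split; lra.
  rewrite (_ : x s - x u = (x t - x u) - (x t - x s)); last by ring.
  by apply: le_trans (ler_normB _ _) _; lra.
near=> M; split; first exact: ltW.
move=> t t01; have : `[0, 1]%classic `<=` (fun t : R => `|x t - step_path M (fun j => x (j%:R / M%:R)) t| <= e).
  by near: M.
by apply; rewrite /= in_itv.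
Unshelve. all: by end_near. Qed.

End UniformDistance.

(** * Dyadic maximal inequality from second moments *)

Section MaximalInequality.
Context {R : realType} d (T : measurableType d) (mu : {measure set T -> \bar R}).
Context (g : R) (g1 : 1 < g).

(** Chosen so that [2 + 2 * eta = 2 ^ g]; positive because [g > 1]. *)
Let eta : R := (2 `^ g - 2) / 2.

Let eta_gt0 : 0 < eta.
Proof.
rewrite divr_gt0// subr_gt0 -[ltLHS]powRr1//.
by rewrite /powR pnatr_eq0/= ltr_expR ltr_pM2r// ln_gt0// ltr1n.
Qed.

(** The first summand solves [K * (2 + eta) + (1 + eta^-1) = K * (2 + 2 * eta)], the balance of the
    doubling step; adding 1 makes the constant at least 1, as a block of length 1 requires. *)
Definition maximal_const : R := (1 + eta^-1) / eta + 1.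

Lemma maximal_const_ge1 : 1 <= maximal_const.
Proof.
have e0 := ltW eta_gt0.
by rewrite /maximal_const lerDr divr_ge0// addr_ge0// invr_ge0.
Qed.

Let ge0_integral_combination (f1 f2 f3 : T -> R) (c1 c2 : R) :
  measurable_fun setT f1 -> measurable_fun setT f2 -> measurable_fun setT f3 ->
  (forall w, 0 <= f1 w) -> (forall w, 0 <= f2 w) -> (forall w, 0 <= f3 w) -> 0 <= c1 -> 0 <= c2 ->
  (\int[mu]_w (f1 w + (c1 * f2 w + c2 * f3 w))%:E =
   \int[mu]_w (f1 w)%:E + (c1%:E * \int[mu]_w (f2 w)%:E + c2%:E * \int[mu]_w (f3 w)%:E))%E.
Proof.
move=> m1 m2 m3 f10 f20 f30 c10 c20.
have M (f : T -> R) : measurable_fun setT f -> measurable_fun setT (fun w => (f w)%:E).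
  by move=> mf; apply/measurable_EFinP.
have S2 w : 0 <= c1 * f2 w + c2 * f3 w by rewrite addr_ge0// mulr_ge0.
have mM (c : R) (f : T -> R) : measurable_fun setT f -> measurable_fun setT (fun w => c * f w).
  by move=> mf; exact: measurable_funM.
under eq_integral do rewrite EFinD.
rewrite ge0_integralD//; first last.
- by apply: M; apply: measurable_funD; exact: mM.
- by move=> w _; rewrite lee_fin.
- exact: M.
- by move=> w _; rewrite lee_fin.
congr (_ + _)%E; under eq_integral do rewrite EFinD.
rewrite ge0_integralD//; first last.
- by apply: M; exact: mM.
- by move=> w _; rewrite lee_fin mulr_ge0.
- by apply: M; exact: mM.
- by move=> w _; rewrite lee_fin mulr_ge0.
have Z (c : R) (f : T -> R) : measurable_fun setT f -> (forall w, 0 <= f w) -> 0 <= c ->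
    (\int[mu]_w (c * f w)%:E = c%:E * \int[mu]_w (f w)%:E)%E.
  move=> mf f0 c0; under eq_integral do rewrite EFinM.
  by rewrite ge0_integralZl//; [exact: M|move=> w _; rewrite lee_fin].
by rewrite !Z.
Qed.

(* Splitting a block in two halves costs the factor [2 + eta], which is less than [2 `^ g]. *)
Lemma dyadic_maximal_inequality (S : nat -> T -> R) (A : R) (N : nat) :
  (forall i, measurable_fun setT (S i : T -> measurableTypeR R)) -> 0 <= A ->
  (forall i m, (m <= N)%N -> (\int[mu]_w ((S (i + m)%N w - S i w) ^+ 2)%:E <= (A * m%:R `^ g)%:E)%E) ->
  forall J i, (2 ^ J <= N)%N -> exists V : T -> R,
    [/\ measurable_fun setT V, forall w, 0 <= V w,
      forall l w, (l <= 2 ^ J)%N -> (S (i + l)%N w - S i w) ^+ 2 <= V w &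
      (\int[mu]_w (V w)%:E <= (maximal_const * (A * (2 ^ J)%:R `^ g))%:E)%E].
Proof.
move=> mS A0 HS.
pose D i m w : R := (S (i + m)%N w - S i w) ^+ 2.
have mS' i : measurable_fun setT (S i) by exact: mS.
have mD i m : measurable_fun setT (D i m) by apply: measurable_funX; apply: measurable_funB.
elim=> [|J IH] i JN.
  exists (D i 1%N); split=> //.
  - by move=> w; exact: sqr_ge0.
  - move=> l w; rewrite expn0; case: l => [|[|//]] _; last exact: lexx.
    by rewrite addn0 subrr expr0n/= sqr_ge0.
  apply: le_trans (HS i 1%N JN) _.
  by rewrite expn0 lee_fin ler_peMl ?maximal_const_ge1// mulr_ge0// powR_ge0.
have JN' : (2 ^ J <= N)%N by apply: leq_trans JN; rewrite leq_exp2l.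
have [V1 [mV1 V10 HV1 IV1]] := IH i JN'.
have [V2 [mV2 V20 HV2 IV2]] := IH (i + 2 ^ J)%N JN'.
pose c1 := 1 + eta; pose c2 := 1 + eta^-1.
have c10 : 0 <= c1 by rewrite addr_ge0// ltW.
have c20 : 0 <= c2 by rewrite addr_ge0// invr_ge0 ltW.
pose V w := V1 w + (c1 * V2 w + c2 * D i (2 ^ J)%N w).
have D0 w : 0 <= D i (2 ^ J)%N w by exact: sqr_ge0.
exists V; split.
- by apply: measurable_funD => //; apply: measurable_funD; exact: measurable_funM.
- by move=> w; rewrite !addr_ge0// mulr_ge0.
- move=> l w lJ.
  have [l1|l1] := leqP l (2 ^ J)%N.
    by apply: le_trans (HV1 l w l1) _; rewrite lerDl addr_ge0// mulr_ge0.
  have l2 : (l - 2 ^ J <= 2 ^ J)%N by rewrite leq_subLR addnn -mul2n -expnS.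
  have := HV2 (l - 2 ^ J)%N w l2; rewrite -addnA subnKC ?(ltnW l1)// => H2.
  set x := S (i + l)%N w - S (i + 2 ^ J)%N w in H2.
  rewrite (_ : S (i + l)%N w - S i w = x + (S (i + 2 ^ J)%N w - S i w)); last by rewrite /x; ring.
  apply: (@le_trans _ _ (c1 * x ^+ 2 + c2 * D i (2 ^ J)%N w)).
    rewrite /D /c1 /c2; set y := S _ w - S _ w.
    have := sqr_ge0 (eta * x - y); have := eta_gt0 => e0.
    rewrite -(pmulr_rge0 _ (_ : 0 < eta^-1)) ?invr_gt0// => H.
    have E : eta^-1 * (eta * x - y) ^+ 2 = eta * x ^+ 2 - 2 * x * y + eta^-1 * y ^+ 2.
      by field; rewrite gt_eqF.
    by rewrite E in H; lra.
  by apply: ler_wpDl => //; rewrite lerD2r; apply: ler_wpM2l.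
rewrite /V ge0_integral_combination//.
pose B := A * (2 ^ J)%:R `^ g.
have B0 : 0 <= B by rewrite mulr_ge0// powR_ge0.
apply: (@le_trans _ _ ((maximal_const * B)%:E + (c1%:E * (maximal_const * B)%:E + c2%:E * B%:E))%E).
  apply: leeD => //; apply: leeD; first by rewrite lee_wpmul2l// lee_fin.
  by rewrite lee_wpmul2l ?lee_fin//; exact: HS.
rewrite -!EFinM -!EFinD lee_fin.
have -> : A * (2 ^ J.+1)%:R `^ g = (2 + 2 * eta) * B.
  rewrite expnS natrM powRM// /B mulrCA; congr (_ * _).
  by rewrite /eta; field.
have K : maximal_const * eta = c2 + eta.
  by rewrite /maximal_const mulrDl mulfVK ?gt_eqF// mul1r.
rewrite -subr_ge0 (_ : _ - _ = B * (maximal_const * eta) - B * c2); last by rewrite /c1; ring.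
by rewrite K mulrDr addrAC subrr add0r mulr_ge0// ltW.
Qed.

End MaximalInequality.

Section Oscillation.
Context {R : realType} d (Omega : measurableType d) (P : probability Omega R).
Context (g C : R) (g1 : 1 < g) (C0 : 0 <= C) (n : nat).
Context (S : nat -> Omega -> R) (mS : forall i, measurable_fun setT (S i : Omega -> measurableTypeR R)).
Context (HS : forall i m, (m <= n)%N ->
  (\int[P]_w ((S (i + m)%N w - S i w) ^+ 2)%:E <= (C * (m%:R / n%:R) `^ g)%:E)%E).

(** Sum of the maximal inequality over [M.+1] blocks, each of length at most [4 / M] relative to
    [n]. *)
Definition oscillation_bound (M : nat) : R := maximal_const g * C * (M.+1%:R * (4 / M%:R) `^ g).

Lemma step_path_oscillation M : (4 <= M <= n)%N -> exists U : Omega -> R,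
  [/\ measurable_fun setT U, forall w, 0 <= U w,
    forall w (t : R), 0 <= t <= 1 ->
      (S (Num.truncn (n%:R * t)) w - S (Num.truncn (n%:R * grid_point M t)) w) ^+ 2 <= U w &
    (\int[P]_w (U w)%:E <= (oscillation_bound M)%:E)%E].
Proof.
move=> /andP[M4 Mn].
have M0 : (0 < M)%N by apply: leq_trans M4.
have n0 : (0 < n)%N by apply: leq_trans Mn.
have Mp : 0 < M%:R :> R by rewrite ltr0n.
have np : 0 < n%:R :> R by rewrite ltr0n.
(* At most [m] samples separate a time from its grid point. Rounding up to a power of 2 at most
   doubles [m], and [2 * m * M <= 4 * n] because [M <= n]; with [4 <= M] the block length is then at
   most [n]. *)
pose m := (n %/ M).+1; pose J := up_log 2 m.
have mJ : (m <= 2 ^ J)%N by exact: up_logP.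
have J2 : (2 ^ J <= 2 * m)%N.
  have [m1|m1] := leqP m 1; first by rewrite /J (_ : m = 1%N) ?up_log1//; lia.
  have J0 : (0 < J)%N by rewrite /J up_log_gt0.
  by rewrite -(prednK J0) expnS leq_mul2l/= ltnW// up_log_gtn.
have nM : (n %/ M * M <= n)%N by rewrite leq_divM.
have JM : (2 ^ J * M <= 4 * n)%N.
  apply: (@leq_trans (2 * m * M)); first by rewrite leq_mul2r J2 orbT.
  by rewrite /m; lia.
have Jn : (2 ^ J <= n)%N.
  by rewrite -(leq_pmul2r M0); apply: leq_trans JM _; rewrite mulnC leq_mul2l M4 orbT.
have A0 : 0 <= C * n%:R^-1 `^ g by rewrite mulr_ge0// powR_ge0.
have HS' i l : (l <= n)%N -> (\int[P]_w ((S (i + l)%N w - S i w) ^+ 2)%:E <= (C * n%:R^-1 `^ g * l%:R `^ g)%:E)%E.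
  move=> ln; apply: le_trans (HS i ln) _.
  by rewrite lee_fin powRM ?invr_ge0// -mulrA [X in C * X]mulrC.
have D i := @dyadic_maximal_inequality _ _ _ P _ g1 S _ n mS A0 HS' J i Jn.
have [V HV] := choice D.
pose i0 (j : 'I_M.+1) := Num.truncn (n%:R * (j%:R / M%:R) : R).
exists (fun w => \sum_j V (i0 j) w); split.
- by apply: measurable_sum => j; have [] := HV (i0 j).
- by move=> w; apply: sumr_ge0 => j _; have [] := HV (i0 j).
- move=> w t /andP[t0 t1].
  have [/andP[u0 u1] u2] := grid_point_le t0 M0.
  have jM : (Num.truncn (M%:R * t) < M.+1)%N.
    rewrite ltnS truncn_le_nat; apply: (@le_lt_trans _ _ M%:R); last by rewrite ltr_nat.
    by rewrite ler_piMr// ltW.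
  rewrite (bigD1 (Ordinal jM))//=; apply: ler_wpDr.
    by apply: sumr_ge0 => j _; have [] := HV (i0 j).
  have [_ _ + _] := HV (i0 (Ordinal jM)); rewrite /i0/= -/(grid_point M t).
  set u := grid_point M t in u0 u1 u2 *; set q := Num.truncn (n%:R * u).
  have nu0 : 0 <= n%:R * u by rewrite mulr_ge0.
  have nt0 : 0 <= n%:R * t by rewrite mulr_ge0.
  have qt : (q <= Num.truncn (n%:R * t))%N by apply: le_truncn; apply: ler_wpM2l.
  have tq : (Num.truncn (n%:R * t) <= q + m)%N.
    rewrite truncn_le_nat; have /andP[_ q1] := truncn_itv nu0.
    have : n%:R * t < n%:R * u + n%:R / M%:R by rewrite -mulrDr ltr_pM2l.
    have : n%:R / M%:R < m%:R :> R.
      by rewrite ltr_pdivrMr// -natrM ltr_nat ltn_ceil.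
    have : n%:R * u < q%:R + 1 by rewrite natr1.
    by rewrite -[(q + m).+1%:R]natr1 natrD; lra.
  have := @leq_sub2r q _ _ tq; rewrite addKn => lm.
  by move=> /(_ (Num.truncn (n%:R * t) - q)%N w (leq_trans lm mJ)); rewrite subnKC.
under eq_integral do rewrite -sumEFin.
rewrite ge0_integral_sum//; last 2 first.
- by move=> j; apply/measurable_EFinP; have [] := HV (i0 j).
- by move=> j w _; rewrite lee_fin; have [] := HV (i0 j).
have B j : (\int[P]_w (V (i0 j) w)%:E <= (maximal_const g * C * (4 / M%:R) `^ g)%:E)%E.
  have [_ _ _ I] := HV (i0 j); apply: le_trans I _; rewrite lee_fin -mulrA -mulrA.
  apply: ler_wpM2l; first by apply: le_trans (maximal_const_ge1 g1).
  apply: ler_wpM2l => //; rewrite -powRM ?invr_ge0//.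
  have g0 : 0 <= g by apply: le_trans (ltW g1).
  apply: ge0_ler_powR => //; rewrite ?nnegrE ?mulr_ge0 ?invr_ge0//.
  by rewrite mulrC ler_pdivlMr// mulrAC ler_pdivrMr// -!natrM ler_nat.
apply: le_trans (lee_sum _ (fun j _ => B j)) _.
rewrite sumEFin lee_fin sumr_const card_ord /oscillation_bound -[X in X <= _]mulr_natl.
by rewrite mulrCA.
Qed.

End Oscillation.

(** The number of blocks grows like [M] while each contributes [M ^ (- g)]; the sum vanishes exactly
    because [g > 1]. *)
Lemma oscillation_bound_cvg0 {R : realType} (g C : R) : 1 < g -> oscillation_bound g C M @[M --> \oo] --> 0.
Proof.
move=> g1; have g0 : 0 < g - 1 by rewrite subr_gt0.
have H : (M.+1%:R^-1 : R) `^ (g - 1) @[M --> \oo] --> 0.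
  apply: (@cvg_comp _ _ _ (fun M => M.+1%:R^-1 : R) (fun x => x `^ (g - 1)) \oo (0^'+) (nbhs 0)); last exact: powR_cvg0.
  move=> U [e /= e0 HU]; have := @cvg_harmonic R; move=> /cvgrPdist_lt/(_ e e0); apply: filterS => M HM.
  by apply: HU; rewrite /= ?invr_gt0.
have H2 : maximal_const g * C * (4 `^ g * (M.+1%:R^-1 : R) `^ (g - 1)) * (1 + M.+1%:R^-1) @[M --> \oo] -->
    maximal_const g * C * (4 `^ g * 0) * (1 + 0).
  apply: cvgM; first by do 2 (apply: cvgM; first exact: cvg_cst).
  by apply: cvgD; [exact: cvg_cst|exact: cvg_harmonic].
rewrite !mulr0 mul0r in H2.
have E M : oscillation_bound g C M.+1 = maximal_const g * C * (4 `^ g * M.+1%:R^-1 `^ (g - 1)) * (1 + M.+1%:R^-1).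
  rewrite /oscillation_bound -[RHS]mulrA; congr (_ * _); rewrite powRM ?invr_ge0//.
  have G : g = 1 + (g - 1) by ring.
  rewrite [X in _ * (_ * _ `^ X)]G [in LHS]powRD; last by rewrite invr_eq0 pnatr_eq0 implybT.
  rewrite powRr1 ?invr_ge0// -[M.+2%:R]natr1; move: (_ `^ _) (_ `^ _) => x y.
  by field; rewrite nat1r pnatr_eq0.
rewrite -cvg_shiftS; under eq_fun do rewrite E; exact: H2.
Qed.

Section StepFunctionals.
Context {R : realType} (F : (R -> R) -> R) (K : R)
  (FK : close_lipschitz (cadlag 1) uniform_close F K).

Definition step_row (M : nat) (v : 'rV[R]_M.+1) : R -> R := step_path M (fun i => v 0 (inord i)).

(** For [t] in [[0, 1]] the index is at most [M], a value reached at [t = 1]; hence [M.+1]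
    entries. *)
Lemma step_row_uniform_close M (u : nat -> R) :
  uniform_close 0 (step_path M u) (step_row (\row_(i < M.+1) u i)).
Proof.
split=> // t /andP[t0 t1]; rewrite /step_row /step_path mxE inordK ?subrr ?normr0//.
rewrite ltnS truncn_le_nat; apply: (@le_lt_trans _ _ M%:R); last by rewrite ltr_nat.
by rewrite ler_piMr.
Qed.

(** Being Lipschitz at distance 0, the functional cannot see a path outside [[0, 1]]. *)
Lemma uniform_close0_eq x y : cadlag 1 x -> cadlag 1 y -> uniform_close 0 x y -> F x = F y.
Proof.
move=> Dx Dy xy; apply/eqP; rewrite -subr_eq0 -normr_le0 -(mulr0 K).
exact: FK.
Qed.

Lemma step_row_lipschitz M (v v' : 'rV[R]_M.+1) :
  `|F (step_row v) - F (step_row v')| <= K * \sum_j `|v 0 j - v' 0 j|.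
Proof.
apply: FK; [exact: sumr_ge0|exact: step_path_cadlag|exact: step_path_cadlag|].
split=> [|t _]; first exact: sumr_ge0.
by rewrite /step_row /step_path (bigD1 (inord (Num.truncn (M%:R * t))))//= lerDl sumr_ge0.
Qed.

End StepFunctionals.

Section SkorokhodCriterion.
Context {R : realType} d (Omega : measurableType d) (P : probability Omega R)
  d' (Omega' : measurableType d') (P' : probability Omega' R).
Context (S : nat -> nat -> Omega -> R) (Z : R -> Omega' -> R).
Context (mS : forall n i, measurable_fun setT (S n i : Omega -> measurableTypeR R))
  (mZ : forall t, 0 <= t -> measurable_fun setT (Z t : Omega' -> measurableTypeR R))
  (cZ : forall w, {within `[0, +oo[, continuous (Z ^~ w)}).
Context (g C : R) (g1 : 1 < g) (C0 : 0 <= C).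
Context (HS : \forall n \near \oo, forall i m, (m <= n)%N ->
  (\int[P]_w ((S n (i + m)%N w - S n i w) ^+ 2)%:E <= (C * (m%:R / n%:R) `^ g)%:E)%E).

Let W n (t : R) w : R := S n (Num.truncn (n%:R * t)) w.

Context (HF : forall p (t : 'I_p -> R), (forall i, 0 <= t i <= 1) ->
  forall (F : 'rV[R]_p -> R) (K M : R), 0 <= K -> (forall x, `|F x| <= M) ->
  (forall x y, `|F x - F y| <= K * \sum_j `|x 0 j - y 0 j|) ->
  \int[P]_w F (\row_i W n (t i) w) @[n --> \oo] --> \int[P']_w F (\row_i Z (t i) w)).

Section LipschitzFunctional.
Context (F : (R -> R) -> R) (M0 K : R) (K0 : 0 <= K)
  (FM : forall x, cadlag 1 x -> `|F x| <= M0)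
  (FK : close_lipschitz (cadlag 1) uniform_close F K).

Let W_cadlag n w : cadlag 1 (W n ^~ w).
Proof. exact: (step_path_cadlag n (fun i => S n i w)). Qed.

Let Z_cadlag w : cadlag 1 (Z ^~ w).
Proof. exact: continuous_cadlag. Qed.

Let grid M (x : R -> R) : 'rV[R]_M.+1 := \row_i x (i%:R / M%:R).

Let grid_cadlag M (v : 'rV[R]_M.+1) : cadlag 1 (step_row v).
Proof. exact: step_path_cadlag. Qed.

(** On step paths the functional is a Lipschitz function of finitely many measurable values, so no
    sigma-algebra on path space is involved. *)
Let mFW n : measurable_fun setT (fun w => F (W n ^~ w)).
Proof.
have E w : F (W n ^~ w) = F (step_row (\row_(i < n.+1) S n i w)).
  by apply: (uniform_close0_eq FK) => //; exact: (step_row_uniform_close n (fun i => S n i w)).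
under eq_fun do rewrite E.
apply: (@lipschitz_measurable _ _ _ _ (fun w => \row_(i < n.+1) S n i w) _ (fun v => F (step_row v)) K) => //.
  by move=> j; under eq_fun do rewrite mxE; exact: mS.
exact: step_row_lipschitz.
Qed.

Let mFZ_grid M : measurable_fun setT (fun w => F (step_row (grid M (Z ^~ w)))).
Proof.
apply: (@lipschitz_measurable _ _ _ _ (fun w => grid M (Z ^~ w)) _ (fun v => F (step_row v)) K) => //.
  by move=> j; under eq_fun do rewrite mxE; apply: mZ; rewrite divr_ge0.
exact: step_row_lipschitz.
Qed.

Let FZ_grid_cvg w : F (step_row (grid M (Z ^~ w))) @[M --> \oo] --> F (Z ^~ w).
Proof.
apply/cvgrPdist_le => e e0.
have K1 : 0 < K + 1 by rewrite ltr_wpDl.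
have := step_path_uniform_cvg (@cZ w) (divr_gt0 e0 K1); apply: filterS => M H.
have H' := uniform_close_trans H (step_row_uniform_close M (fun j => Z (j%:R / M%:R) w)).
rewrite addr0 in H'; have eK : 0 <= e / (K + 1) by rewrite divr_ge0// ltW.
apply: le_trans (FK eK _ _ H') _ => //.
by rewrite mulrC mulrAC ler_pdivrMr// ler_pM2l// lerDl.
Qed.

Let mFZ : measurable_fun setT (fun w => F (Z ^~ w)).
Proof. exact: (measurable_fun_lim mFZ_grid FZ_grid_cvg). Qed.

Let Z_grid_integral_cvg :
  \int[P']_w F (step_row (grid M (Z ^~ w))) @[M --> \oo] --> \int[P']_w F (Z ^~ w).
Proof.
apply: (@Rdominated_cvg _ _ _ P' setT (fun M w => F (step_row (grid M (Z ^~ w)))) (fun w => F (Z ^~ w)) (fun=> M0)) => //.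
- by apply: (@bounded_integrable _ _ _ P' _ _ `|M0|) => // x _.
- by move=> k w _; exact: FM.
Qed.

Let W_grid_integral n M eta : (4 <= M <= n)%N -> 0 < eta -> oscillation_bound g C M <= eta ^+ 2 ->
  (forall i m, (m <= n)%N ->
    (\int[P]_w ((S n (i + m)%N w - S n i w) ^+ 2)%:E <= (C * (m%:R / n%:R) `^ g)%:E)%E) ->
  `|\int[P]_w F (W n ^~ w) - \int[P]_w F (step_row (grid M (W n ^~ w)))| <= K * eta.
Proof.
move=> Mn eta0 Meta Hn.
have [U [mU U0 HU IU]] := step_path_oscillation g1 C0 (mS n) Hn Mn.
have mG : measurable_fun setT (fun w => F (step_row (grid M (W n ^~ w)))).
  apply: (@lipschitz_measurable _ _ _ _ (fun w => grid M (W n ^~ w)) _ (fun v => F (step_row v)) K) => //.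
    by move=> j; under eq_fun do rewrite mxE; exact: mS.
  exact: step_row_lipschitz.
have ib (f : Omega -> R) : measurable_fun setT f -> (forall w, `|f w| <= M0) -> P.-integrable setT (EFin \o f).
  by move=> mf fM; apply: (@bounded_integrable _ _ _ P _ _ M0).
have iU : P.-integrable setT (EFin \o U).
  apply/integrableP; split; first exact/measurable_EFinP.
  under eq_integral do rewrite /= ger0_norm//.
  by apply: le_lt_trans IU _; rewrite ltry.
have iU2 : P.-integrable setT (EFin \o (fun w => K / (2 * eta) * U w)) by have := integrableZl measurableT (K / (2 * eta)) iU.
have ic : P.-integrable setT (EFin \o (fun w : Omega => K * eta / 2)).
  by apply: (@bounded_integrable _ _ _ P _ _ `|K * eta / 2|).
rewrite -RintegralB//; last 2 first.
- by apply: ib => // w; exact: FM.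
- by apply: ib => // w; exact: FM.
apply: (@le_trans _ _ (\int[P]_w (K * eta / 2 + K / (2 * eta) * U w))).
  apply: Rintegral_le_norm; first exact: measurable_funB.
    by have := integrableD measurableT ic iU2.
  (* The distance [e] is random: [|x| <= eta / 2 + x ^ 2 / (2 * eta)] turns the bound [U w] on
     squared oscillations into one whose mean is at most [eta]. *)
  move=> w; pose e := eta / 2 + U w / (2 * eta).
  have e0 : 0 <= e by rewrite addr_ge0 ?divr_ge0 ?mulr_ge0// ltW.
  have H : uniform_close e (W n ^~ w) (step_path M (fun j => W n (j%:R / M%:R) w)).
    split=> // t t01; have := HU w t t01.
    rewrite -/(W n t w) -/(W n (grid_point M t) w) /step_path -/(grid_point M t).
    set x := _ - _ => xU; rewrite -real_normK ?num_real// in xU.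
    rewrite /e -(ler_pM2l (_ : 0 < 2 * eta)) ?mulr_gt0//.
    have -> : 2 * eta * (eta / 2 + U w / (2 * eta)) = eta ^+ 2 + U w by field; rewrite gt_eqF.
    by have := sqr_ge0 (`|x| - eta); nra.
  have H' := uniform_close_trans H (step_row_uniform_close M (fun j => W n (j%:R / M%:R) w)).
  rewrite addr0 in H'; apply: le_trans (FK e0 _ _ H') _ => //.
  by rewrite /e le_eqVlt; apply/orP; left; apply/eqP; field; rewrite gt_eqF.
rewrite RintegralD// Rintegral_probability_cst RintegralZl//.
have I : \int[P]_w U w <= eta ^+ 2.
  apply: le_trans Meta; rewrite /Rintegral -[leRHS]/(fine (oscillation_bound g C M)%:E).
  by apply: fine_le => //; exact: integrable_fin_num.
apply: (@le_trans _ _ (K * eta / 2 + K / (2 * eta) * eta ^+ 2)).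
  by rewrite lerD2l; apply: ler_wpM2l => //; rewrite divr_ge0// mulr_ge0// ltW.
by rewrite le_eqVlt; apply/orP; left; apply/eqP; field; rewrite gt_eqF.
Qed.

Lemma uniform_lipschitz_cvg :
  [/\ forall n, measurable_fun setT (fun w => F (W n ^~ w)), measurable_fun setT (fun w => F (Z ^~ w)) &
   \int[P]_w F (W n ^~ w) @[n --> \oo] --> \int[P']_w F (Z ^~ w)].
Proof.
split => //; apply/cvgrPdist_le => e e0.
pose eta := e / (3 * (K + 1)).
have K1 : 0 < K + 1 by rewrite ltr_wpDl.
have eta0 : 0 < eta by rewrite divr_gt0// mulr_gt0.
have e3 : 0 < e / 3 by rewrite divr_gt0.
have Keta : K * eta <= e / 3.
  rewrite /eta mulrA ler_pdivrMr ?mulr_gt0// (_ : e / 3 * (3 * (K + 1)) = K * e + e); last by field.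
  by rewrite lerDl ltW.
(* The grid size is fixed before [n] grows, which is possible since the oscillation bound does not
   depend on [n]. *)
have [M [M4 MO MZ]] : exists M, [/\ (4 <= M)%N, oscillation_bound g C M <= eta ^+ 2 &
    `|\int[P']_w F (Z ^~ w) - \int[P']_w F (step_row (grid M (Z ^~ w)))| <= e / 3].
  have : \forall M \near \oo, [/\ (4 <= M)%N, oscillation_bound g C M <= eta ^+ 2 &
    `|\int[P']_w F (Z ^~ w) - \int[P']_w F (step_row (grid M (Z ^~ w)))| <= e / 3].
    have eta2 : 0 < eta ^+ 2 by rewrite exprn_gt0.
    near=> M; split; first by near: M; exact: nbhs_infty_ge.
      near: M; have /cvgrPdist_le/(_ _ eta2) := oscillation_bound_cvg0 C g1.
      by apply: filterS => M; rewrite sub0r normrN; apply: le_trans; exact: ler_norm.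
    by near: M; move/cvgrPdist_le : Z_grid_integral_cvg; exact.
  by move=> [M _ /(_ M (leqnn M))]; exists M.
have : \int[P]_w F (step_row (grid M (W n ^~ w))) @[n --> \oo] --> \int[P']_w F (step_row (grid M (Z ^~ w))).
  have t01 (i : 'I_M.+1) : 0 <= (i%:R / M%:R : R) <= 1.
    have Mp : 0 < M%:R :> R by rewrite ltr0n (leq_trans _ M4).
    by rewrite divr_ge0//= ler_pdivrMr// mul1r ler_nat -ltnS.
  apply: (HF t01 (F := fun v => F (step_row v)) K0 (M := M0)); first by move=> x; exact: FM.
  exact: step_row_lipschitz.
move=> /cvgrPdist_le/(_ _ e3) HW.
near=> n.
have Mn : (4 <= M <= n)%N by rewrite M4; near: n; exact: nbhs_infty_ge.
have H1 := W_grid_integral Mn eta0 MO.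
have {}H1 : `|\int[P]_w F (W n ^~ w) - \int[P]_w F (step_row (grid M (W n ^~ w)))| <= K * eta.
  by apply: H1; near: n.
have H2 : `|\int[P']_w F (step_row (grid M (Z ^~ w))) - \int[P]_w F (step_row (grid M (W n ^~ w)))| <= e / 3 by near: n.
move: MZ H1 H2 Keta; rewrite !ler_norml => /andP[? ?] /andP[? ?] /andP[? ?] ?; apply/andP; split; lra.
Unshelve. all: by end_near. Qed.

End LipschitzFunctional.

Lemma skorokhod_cvg_of_increments : skorokhod_cvg P P' 1 W Z.
Proof.
move=> f cf [M fM].
have om0 (w : Omega) : 0 <= (1 : R) <= 1 by rewrite ler01 lexx.
have C1 := @portmanteau _ _ _ P _ _ P' _ (cadlag 1) uniform_close (fun x _ => uniform_close_refl x)
  uniform_close_sym uniform_close_trans (fun n w => W n ^~ w) (fun w => Z ^~ w) (fun=> 1) 1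
  (fun n w => step_path_cadlag n (fun i => S n i w)) (fun w => continuous_cadlag (@cZ w)) om0 (measurable_cst _).
have Hlip F M' K : 0 <= K -> (forall x, cadlag 1 x -> `|F x| <= M') -> close_lipschitz (cadlag 1) uniform_close F K ->
  [/\ forall n, measurable_fun setT (fun w => F (W n ^~ w)), measurable_fun setT (fun w => F (Z ^~ w)) &
   \int[P]_w (F (W n ^~ w) * 1) @[n --> \oo] --> 1 * \int[P']_w F (Z ^~ w)].
  move=> K0 FM FK; have [m1 m2 L] := uniform_lipschitz_cvg K0 FM FK; split => //.
  rewrite mul1r; have E n : \int[P]_w (F (W n ^~ w) * 1) = \int[P]_w F (W n ^~ w).
    by apply: eq_Rintegral => w _; rewrite mulr1.
  by under eq_fun do rewrite E.
have := C1 Hlip f M fM (skorokhod_close_continuous cf).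
rewrite mul1r; have E n : \int[P]_w (f (W n ^~ w) * 1) = \int[P]_w f (W n ^~ w).
  by apply: eq_Rintegral => w _; rewrite mulr1.
by under eq_fun do rewrite E.
Qed.

End SkorokhodCriterion.

Theorem theorem3 (R : realType)
  (d : measure_display) (Omega : measurableType d) (P : probability Omega R)
  (P_complete : measure_is_complete P)
  (gamma b : R) (nu : {measure set (measurableTypeR R) -> \bar R})
  (L : set (measurableTypeR R * measurableTypeR R) -> Omega -> R)
  (L_basis : levy_basis P gamma b nu L)
  (L' : {RV P >-> measurableTypeR R}) (L'_seed : levy_seed gamma b nu L')
  (a : R -> R) (a_trawl : trawl_function a)
  (L'_int : ('E_P[fun w => `|L' w|%R] < +oo)%E)
  (kappa : R) (kappa_gt2 : 2 < kappa) (kappa_lt3 : kappa < 3)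
  (a' : R -> R)
  (a'_gt0 : forall y, 0 <= y -> 0 < a' y)
  (a'_cont : {within `[0, +oo[, continuous a'})
  (a'_RV : regularly_varying kappa a')
  (a_tail : forall s, 0 <= s ->
     (a s)%:E = (\int[@lebesgue_measure R]_(y in `[s, +oo[) (a' y)%:E)%E)
  (b_gt0 : 0 < b)
  (L'_sqint : ('E_P[fun w => (`|L' w| ^+ 2)%R] < +oo)%E)
  (Delta : nat -> R)
  (Delta_gt0 : forall n, (0 < n)%N -> 0 < Delta n)
  (Delta_cvg0 : Delta n @[n --> \oo] --> 0)
  (nDelta_cvgoo : (n%:R * Delta n) @[n --> \oo] --> +oo)
  (d' : measure_display) (Omega' : measurableType d')
  (P' : probability Omega' R) (BH : R -> Omega' -> R)
  (BH_fbm : fbm P' (2 - kappa / 2) 2 BH) :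
  let X := trawl_process L a in
  let S := partial_sum P X Delta in
  let sigma_kappa :=
    Num.sqrt (b ^+ 2 / ((kappa - 2) * (3 - kappa) * (4 - kappa))) in
  1 / 2 < 2 - kappa / 2 /\
  stable_skorokhod_cvg P P' (sampled_sigma X Delta) 1
    (fun n t w =>
       1 / (n%:R * Num.sqrt (a (n%:R * Delta n) * (n%:R * Delta n))) * S n t w)
    (fun t w => sigma_kappa * BH t w).
Proof.
move=> X S sigma_kappa; split; first by lra.
(* The seed passes its second moment on to the jump measure; every moment bound on the basis rests
   on this. *)
have ix2 : nu.-integrable [set x | x != 0] (EFin \o (fun x : measurableTypeR R => x ^+ 2)).
  have mL' : measurable_fun setT (L' : Omega -> measurableTypeR R) by exact: measurable_funP.
  apply: (levy_seed_sqr_integrable (lb_levy_measure L_basis) mL' L'_seed).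
  apply/integrableP; split; first by apply/measurable_EFinP; exact: measurable_funX.
  move: L'_sqint; rewrite unlock; apply: le_lt_trans; apply: ge0_le_integral => //.
  - by apply/measurable_EFinP; apply: measurableT_comp => //; exact: measurable_funX.
  - by apply/measurable_EFinP; apply: measurable_funX; exact: measurableT_comp.
  - by move=> w _ /=; rewrite lee_fin normrX.
(* Partial sums indexed by an integer, free of the truncation of [n * t], so that their increments
   are blocks. *)
pose Sn n i w : R := (\sum_(0 <= j < i) trawl_centered gamma nu L a (j%:R * Delta n) w) / scaling a Delta n.
have WE : (fun n t w => 1 / (n%:R * Num.sqrt (a (n%:R * Delta n) * (n%:R * Delta n))) * S n t w) =
    rescaled_sum gamma nu L a Delta.
  apply/funext => n; apply/funext => t; apply/funext => w.
  rewrite /rescaled_sum -/(scaling a Delta n) mul1r mulrC; congr (_ / _).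
  by apply: eq_bigr => j _; rewrite (trawl_expectation L_basis ix2 a_trawl).
rewrite WE /sigma_kappa -/(limit_scale b kappa); split; last first.
  by move=> m t t01; exact: (stable_fidi L_basis ix2 a_trawl kappa_gt2 kappa_lt3 a'_gt0 a'_cont a'_RV a_tail Delta_gt0 Delta_cvg0 nDelta_cvgoo BH_fbm).
have mS n i : measurable_fun setT (Sn n i : Omega -> measurableTypeR R).
  apply: measurable_funM => //; under eq_fun do rewrite big_mkord.
  apply: (@measurable_sum_cond _ _ _ _ predT (fun (j : 'I_i) w => trawl_centered gamma nu L a (j%:R * Delta n) w)) => j.
  exact: (measurable_trawl_centered L_basis a_trawl).
have mZ t : 0 <= t -> measurable_fun setT ((fun w => limit_scale b kappa * BH t w) : Omega' -> measurableTypeR R).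
  by move=> t0; apply: measurable_funM => //; exact: (fbm_measurable BH_fbm).
have cZ w : {within `[0, +oo[, continuous (fun t => limit_scale b kappa * BH t w)}.
  have [_ _ _ _ /(_ w)/continuous_within_itvcyP[c1 c2]] := BH_fbm.
  apply/continuous_within_itvcyP; split; last by apply: cvgM => //; exact: cvg_cst.
  by move=> t t0; apply: cvgM; [exact: cvg_cst|exact: c1].
have [g [C [/andP[g1 g2] C0 HC]]] := overlap_double_sum_holder a_trawl kappa_gt2 kappa_lt3 a'_gt0 a'_cont a'_RV a_tail Delta_gt0 Delta_cvg0 nDelta_cvgoo.
pose K := moment_const b nu.
have K0 : 0 <= K.
  by rewrite /K /moment_const mulr_ge0// addr_ge0 ?sqr_ge0//; apply: Rintegral_ge0 => x _; exact: sqr_ge0.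
apply: (@skorokhod_cvg_of_increments _ _ _ P _ _ P' Sn _ mS mZ cZ g (K * C) g1); first by rewrite mulr_ge0// ltW.
- near=> n; move=> i m mn.
  have Hn : forall N, (N <= n)%N -> overlap_double_sum a (Delta n) N <= C * scaling a Delta n ^+ 2 * (N%:R / n%:R) `^ g by near: n.
  have n0 : (0 < n)%N by near: n; exact: nbhs_infty_gt.
  have s0 : 0 < scaling a Delta n by exact: (scaling_gt0 a'_gt0 a'_cont a_tail Delta_gt0).
  have E w : Sn n (i + m)%N w - Sn n i w = (\sum_(0 <= j < m) trawl_centered gamma nu L a ((i + j)%:R * Delta n) w) / scaling a Delta n.
    rewrite /Sn -mulrBl; congr (_ / _).
    rewrite (@big_cat_nat _ _ _ i 0%N (i + m)%N)//=; last exact: leq_addr.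
    rewrite addrAC subrr add0r -[X in index_iota X]add0n big_addn addKn.
    by apply: eq_bigr => j _; rewrite addnC.
  under eq_integral do rewrite E.
  apply: le_trans (block_moment L_basis ix2 a_trawl Delta n i m) _.
  rewrite lee_fin -/K -mulrA; apply: ler_wpM2l => //.
  rewrite ler_pdivrMr ?exprn_gt0// mulrAC.
  exact: Hn.
- move=> p t t01 F K' M K'0 FM FK.
  (* Conditioning on the whole space gives the ordinary convergence that the Skorokhod criterion
     needs. *)
  have T : sampled_sigma X Delta setT.
    rewrite /sampled_sigma; set G := \bigcup_(_ in _) _.
    by have [H0 /(_ _ H0) + _] := @smallest_sigma_algebra _ setT G; rewrite setD0.
  have [_ _ _] := stable_lipschitz_cvg L_basis ix2 a_trawl kappa_gt2 kappa_lt3 a'_gt0 a'_cont a'_RV a_tail Delta_gt0 Delta_cvg0 nDelta_cvgoo BH_fbm t01 T K'0 FM FK.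
  rewrite probability_setT /= mul1r.
  have EF n : \int[P]_w (F (\row_i rescaled_sum gamma nu L a Delta n (t i) w) * \1_setT w) =
      \int[P]_w F (\row_i Sn n (Num.truncn (n%:R * t i)) w).
    by apply: eq_Rintegral => w _; rewrite indicT mulr1.
  by under eq_fun do rewrite EF.
Unshelve. all: by end_near. Qed.
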